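(* Let $D$ be a homogeneous Siegel domain of type II, with all notation as in the context. Let $p_1,q_1,q_2\in\,]0,\infty]$, $\mathbf s_1,\mathbf s_2\in\mathbb R^r$, $\mathbf s'\in\mathbb N_{\Omega'}$ and $g\in\operatorname{Hol}(D)$. Assume that $\mathbf s_1\in\frac1{2q_1}\mathbf m+(\mathbb R_+^* )^r$ (resp. $\mathbf s_1\in\frac1{2q_1}\mathbf m+(\mathbb R_+^* )^r$ if $q_1<\infty$ and $\mathbf s_1\in\mathbb R_+^r$ if $q_1=\infty$). Define $\mathbf s_3:=\mathbf s_2-\mathbf s_1+\big(\frac1{p_1}-\frac1{q_2}\big)(\mathbf b+\mathbf d)$. If $\mathcal C_{g,\mathbf s'}$ induces a continuous linear mapping $A^{p_1,q_1}_{\mathbf s_1,0}(D)\to\breve A^{q_2,q_2}_{\mathbf s_2,\mathbf s',0}(D)$ (resp. $A^{p_1,q_1}_{\mathbf s_1}(D)\to\breve A^{q_2,q_2}_{\mathbf s_2,\mathbf s'}(D)$), then $g\in\breve A^{\infty,\infty}_{\mathbf s_3,\mathbf s'}(D)$. If, in addition, $\mathbf s_1\in(\mathbb R_+^* )^r$ when $p_1=q_1=\infty$, and $\mathcal C_{g,\mathbf s'}$ induces a compact linear mapping $A^{p_1,q_1}_{\mathbf s_1,0}(D)\to\breve A^{q_2,q_2}_{\mathbf s_2,\mathbf s',0}(D)$ (resp. $A^{p_1,q_1}_{\mathbf s_1}(D)\to\breve A^{q_2,q_2}_{\mathbf s_2,\mathbf s'}(D)$), then $g\in\breve A^{\infty,\infty}_{\mathbf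 s_3,\mathbf s',0}(D)$.
   Context: **Siegel domain.** $\mathbb R_+=[0,\infty)$, $\mathbb R_+^*=(0,\infty)$, $\mathbb R_-=-\mathbb R_+$, $\mathbb R_-^*=-\mathbb R_+^*$. $E$ is a complex Hilbert space of finite dimension $n$, $F$ a real Hilbert space of finite dimension $m>0$, $F_{\mathbb C}$ its complexification, $\Omega\subseteq F$ an open convex cone containing no affine line, and $\Phi\colon E\times E\to F_{\mathbb C}$ a hermitian map (linear in the first variable) with $\Phi(\zeta):=\Phi(\zeta,\zeta)\in\overline\Omega\setminus\{0\}$ for $\zeta\neq0$. Put $\rho(\zeta,z):=\operatorname{Im}z-\Phi(\zeta)$ and $D:=\{(\zeta,z)\in E\times F_{\mathbb C}:\rho(\zeta,z)\in\Omega\}$. $D$ is assumed homogeneous (its biholomorphisms act transitively); equivalently there is a Lie group $T_+$, which we fix, acting linearly and simply transitively on $\Omega$ (on the left) such that for every $t\in T_+$ there is $g\in GL(E)$ with $t\cdot\Phi=\Phi(g\times g)$. $T_+$ acts by transposition (on the right, simply transitively) on the dual cone $\Omega'=\{\lambda\in F':\langle\lambda,h\rangle>0\ \forall h\in\overline\Omega\setminus\{0\}\}$. $T_+/[T_+,T_+]\cong(\mathbb R_+^* )^r$, where $r$ is the rank of $\Omega$. Fix base points $e_\Omega\in\Omega$, $e_{\Omega'}\in\Omega'$ and a surjective analytic strict morphism $\Delta\colon T_+\to(\mathbb R_+^* )^r$; put $\Delta^{\mathbf s}=\prod_j\Delta_j^{s_j}$ and $\Delta_\Omega^{\mathbf s}(t\cdot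 e_\Omega)=\Delta_{\Omega'}^{\mathbf s}(e_{\Omega'}\cdot t)=\Delta^{\mathbf s}(t)$. $\Delta$ is chosen so that there are $\mathbf d\in(\mathbb R_-^* )^r$, $\mathbf b\in\mathbb R_-^r$, $\mathbf m,\mathbf m'\in\mathbb N^r$ with: $\nu_\Omega:=\Delta_\Omega^{\mathbf d}\cdot\mathcal H^m$ and $\nu_{\Omega'}:=\Delta_{\Omega'}^{\mathbf d}\cdot\mathcal H^m$ are invariant under the linear automorphisms of $\Omega$, $\Omega'$ ($\mathcal H^k$ is $k$-dimensional Hausdorff measure); the Laplace transform of $\Delta_\Omega^{\mathbf s}\nu_\Omega$ (resp. $\Delta_{\Omega'}^{\mathbf s}\nu_{\Omega'}$) has non-empty domain iff $\operatorname{Re}\mathbf s\in\frac12\mathbf m+(\mathbb R_+^* )^r$ (resp. $\frac12\mathbf m'+(\mathbb R_+^* )^r$), and then is a constant multiple of $\Delta_{\Omega'}^{-\mathbf s}$ on $\Omega'$ (resp. $\Delta_\Omega^{-\mathbf s}$ on $\Omega$); and $\Delta^{-\mathbf b}(t)=\det_{\mathbb R}(g)$ whenever $t\cdot\Phi=\Phi(g\times g)$. **Function spaces.** $\mathcal N=E\times F$ with Haar (Lebesgue) measure $\mathcal H^{2n+m}$. For $f$ on $D$ and $h\in\Omega$, $f_h(\zeta,x):=f(\zeta,x+i\Phi(\zeta)+ih)$, a function on $\mathcal N$. For $p,q\in]0,\infty]$, $\mathbf s\in\mathbb R^r$, $L^{p,q}_{\mathbf s}(D)$ is the space of measurable $f$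 on $D$ with $h\mapsto\Delta_\Omega^{\mathbf s}(h)\|f_h\|_{L^p(\mathcal N)}$ in $L^q(\nu_\Omega)$, with the corresponding quasi-norm; $L^{p,q}_{\mathbf s,0}(D)$ is the closure of $C_c(D)$ in it; $A^{p,q}_{\mathbf s}(D)=L^{p,q}_{\mathbf s}(D)\cap\operatorname{Hol}(D)$, $A^{p,q}_{\mathbf s,0}(D)=L^{p,q}_{\mathbf s,0}(D)\cap\operatorname{Hol}(D)$. Convention: $1/\infty=0$. **Riemann–Liouville operators.** $\mathbb N_{\Omega'}$ is the set of $\mathbf s'\in\mathbb R^r$ such that $\Delta_{\Omega'}^{\mathbf s'}$ is the restriction to $\Omega'$ of a polynomial on $F'$. For $\mathbf s'\in\mathbb N_{\Omega'}$ and $f\in\operatorname{Hol}(D)$, $f*I^{-\mathbf s'}_\Omega$ denotes $\Delta_{\Omega'}^{\mathbf s'}(\partial)f$, where $\Delta_{\Omega'}^{\mathbf s'}(\partial)$ is the constant-coefficient holomorphic differential operator in the variable $z\in F_{\mathbb C}$ with $\Delta_{\Omega'}^{\mathbf s'}(\partial)e^{\langle\lambda_{\mathbb C},z\rangle}=\Delta_{\Omega'}^{\mathbf s'}(\lambda)e^{\langle\lambda_{\mathbb C},z\rangle}$. **Spaces $\breve A$ and Cesàro-type operators.** $\breve A^{p,q}_{\mathbf s,\mathbf s'}(D)$ (resp. $\breve A^{p,q}_{\mathbf s,\mathbf s',0}(D)$) is the Hausdorff space associated with $\{f\in\operatorname{Hol}(D):f*I^{-\mathbf s'}_\Omega\in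 A^{p,q}_{\mathbf s+\mathbf s'}(D)\}$ (resp. with $A^{p,q}_{\mathbf s+\mathbf s',0}(D)$) with the quasi-norm $\|f*I_\Omega^{-\mathbf s'}\|_{A^{p,q}_{\mathbf s+\mathbf s'}(D)}$, i.e. its quotient by $\ker(\,\cdot\,*I^{-\mathbf s'}_\Omega)$; a function $g\in\operatorname{Hol}(D)$ is said to belong to it if its class does. For $g\in\operatorname{Hol}(D)$, $\mathcal C_{g,\mathbf s'}\colon\operatorname{Hol}(D)\to\operatorname{Hol}(D)/\ker(\,\cdot\,*I_\Omega^{-\mathbf s'})$ is defined by $\mathcal C_{g,\mathbf s'}(f)*I_\Omega^{-\mathbf s'}=f\,(g*I_\Omega^{-\mathbf s'})$. *)

(* Defs.v *)
From HB Require Import structures.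
From mathcomp Require Import all_boot all_order all_algebra.
From mathcomp Require Import -(notations) mpoly.
From mathcomp Require Import all_classical all_reals all_analysis.
From mathcomp Require Import measurable_realfun ess_sup_inf.
From mathcomp Require Import complex.

Set Implicit Arguments.
Unset Strict Implicit.
Unset Printing Implicit Defensive.

Import Order.TTheory GRing.Theory Num.Theory.
Import numFieldNormedType.Exports.

Local Open Scope classical_set_scope.
Local Open Scope ring_scope.

(* Conventions.  E = C^n and F = R^m (column vectors) with the standard
   scalar products, so F_C = C^m; the dual F' is identified with R^m through
   the scalar product of F, and t in GL(F) acts on F' by its transpose.  The
   Hausdorff measures H^m on F and H^{2n+m} on E x F are Lebesgue measures. *)

(* R[i] as a normed module over itself: over this scalar field, the library's
   [differentiable] and ['D_v f] are complex differentiability and the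
   holomorphic directional derivative. *)
HB.instance Definition _ (R : realType) := NormedModule.copy R[i] R[i]^o.

Definition coord_display : measure_display -> measure_display.
Proof. exact. Qed.

(* Vectors carry the sigma-algebra generated by the coordinates, which is the
   Borel one. *)
Section measurable_cV.
Context (R : realType) (k : nat).

Let coords : 'I_k -> 'cV[R]_k -> measurableTypeR R := fun i x => x i ord0.
Let cV0 : g_sigma_preimage coords set0.
Proof. exact: sigma_algebra0. Qed.
Let cVC A : g_sigma_preimage coords A -> g_sigma_preimage coords (~` A).
Proof. exact: sigma_algebraC. Qed.
Let cVU (F : (set 'cV[R]_k)^nat) : (forall i, g_sigma_preimage coords (F i)) ->
  g_sigma_preimage coords (\bigcup_i (F i)).
Proof. exact: sigma_algebra_bigcup. Qed.
HB.instance Definition _ := @isMeasurable.Build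
  (coord_display default_measure_display) 'cV[R]_k
  (g_sigma_preimage coords) cV0 cVC cVU.

End measurable_cV.

Section push.
Context d d' (T : measurableType d) (T' : measurableType d') (R : realType).
Variables (mu : {measure set T -> \bar R}) (f : T -> T') (g : T' -> T).
Hypotheses (mf : measurable_fun setT f) (mg : measurable_fun setT g)
  (fK : cancel f g)
  (smu : sigma_finite setT mu).

Let mpre A : measurable A -> measurable (f @^-1` A).
Proof. by move=> mA; rewrite -[X in measurable X]setTI; exact: mf. Qed.

Definition push_iso (_ : measurable_fun setT f) (_ : measurable_fun setT g)
  (_ : cancel f g) (_ : sigma_finite setT mu) : set T' -> \bar R :=
  pushforward mu f.

Let push0 : push_iso mf mg fK smu set0 = 0%E.
Proof. by rewrite /push_iso /pushforward preimage_set0 measure0. Qed.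

Let push_ge0 A : (0 <= push_iso mf mg fK smu A)%E.
Proof. exact: measure_ge0. Qed.

Let push_sigma_additive : semi_sigma_additive (push_iso mf mg fK smu).
Proof.
move=> F mF tF mUF; rewrite /push_iso /pushforward preimage_bigcup.
apply: measure_semi_sigma_additive.
- by move=> n; exact: mpre.
- apply/trivIsetP => /= i j _ _ ij; rewrite -preimage_setI.
  by move/trivIsetP : tF => /(_ _ _ _ _ ij) ->//; rewrite preimage_set0.
- by rewrite -preimage_bigcup; exact: mpre.
Qed.

HB.instance Definition _ := isMeasure.Build _ _ _ (push_iso mf mg fK smu)
  push0 push_ge0 push_sigma_additive.

Let push_sigma_finite : sigma_finite setT (push_iso mf mg fK smu).
Proof.
have [F FT Foo] := smu.
exists (fun n => g @^-1` F n); first by rewrite -preimage_bigcup -FT.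
move=> n; have [mFn Fnoo] := Foo n; split.
  by rewrite -[X in measurable X]setTI; exact: mg.
rewrite /push_iso /pushforward (_ : f @^-1` (g @^-1` F n) = F n)//.
by apply/seteqP; split=> x /=; rewrite fK.
Qed.

HB.instance Definition _ := Measure_isSigmaFinite.Build _ _ _
  (push_iso mf mg fK smu) push_sigma_finite.

End push.

Lemma product_sigma_finite d1 d2 (T1 : measurableType d1)
    (T2 : measurableType d2) (R : realType)
    (m1 : {sigma_finite_measure set T1 -> \bar R})
    (m2 : {sigma_finite_measure set T2 -> \bar R}) :
  sigma_finite setT (m1 \x m2)%E.
Proof.
have /sigma_finiteP[F [TF ndF Foo]] := sigma_finiteT m1.
have /sigma_finiteP[G [TG ndG Goo]] := sigma_finiteT m2.
exists (fun n => F n `*` G n).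
  rewrite -setXTT TF TG predeqE => -[x y]; split.
    move=> [/= [i _ Fix] [k _ Gky]]; exists (maxn i k) => //; split.
    - by move: x Fix; exact/subsetPset/ndF/leq_maxl.
    - by move: y Gky; exact/subsetPset/ndG/leq_maxr.
  by move=> [i _ []/= ? ?]; split; exists i.
move=> k; have [? ?] := Foo k; have [? ?] := Goo k.
split; first exact: measurableX.
by rewrite product_measure1E// lte_mul_pinfty// ge0_fin_numE.
Qed.

Section lebesgue_cV.
Context {R : realType}.
Local Notation RT k := (k.-tuple (measurableTypeR R)).

Let tcons k (p : measurableTypeR R * RT k) : RT k.+1 :=
  [tuple of p.1 :: p.2].
Let tuncons k (t : RT k.+1) :=
  (thead t, [tuple of behead t]).

Let mtcons k : measurable_fun setT (@tcons k).
Proof. by apply: measurable_cons. Qed.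

Let mtuncons k : measurable_fun setT (@tuncons k).
Proof.
apply: measurable_fun_pair; first exact: measurable_tnth.
exact: measurable_behead.
Qed.

Let tconsK k : cancel (@tcons k) (@tuncons k).
Proof. by move=> [x t]; congr pair; apply: val_inj. Qed.

Fixpoint lebesgue_tuple k :
    {sigma_finite_measure set (RT k) -> \bar R} :=
  if k is k'.+1 then
    push_iso (@mtcons k') (@mtuncons k') (@tconsK k')
      (product_sigma_finite (@lebesgue_measure R) (lebesgue_tuple k'))
  else dirac [tuple].

Let ctuple k (t : RT k) : 'cV[R]_k := \col_i tnth t i.
Let tuplec k (x : 'cV[R]_k) : RT k := [tuple x i ord0 | i < k].

Let mctuple k : measurable_fun setT (@ctuple k).
Proof.
have E := @g_sigma_preimage_comp _ (measurableTypeR R) k _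
  (fun i (x : 'cV[R]_k) => x i ord0) _ (@ctuple k).
have {}E : preimage_set_system setT (@ctuple k) measurable
    = (measurable : set (set (RT k))).
  rewrite -E; congr g_sigma_preimage.
  by apply/funext => i; apply/funext => t /=; rewrite mxE.
by move=> _ A mA; rewrite -E; exists A.
Qed.

Let mtuplec k : measurable_fun setT (@tuplec k).
Proof.
have E := @g_sigma_preimage_comp _ (measurableTypeR R) k _
  (fun i (t : RT k) => tnth t i) _ (@tuplec k).
have {}E : preimage_set_system setT (@tuplec k) measurable
    = (measurable : set (set 'cV[R]_k)).
  rewrite -E; congr g_sigma_preimage.
  by apply/funext => i; apply/funext => t /=; rewrite tnth_mktuple.
by move=> _ A mA; rewrite -E; exists A.
Qed.

Let ctupleK k : cancel (@ctuple k) (@tuplec k).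
Proof. by move=> t; apply: eq_from_tnth => i; rewrite tnth_mktuple mxE. Qed.

Definition lebesgue_cV k : {sigma_finite_measure set 'cV[R]_k -> \bar R} :=
  push_iso (@mctuple k) (@mtuplec k) (@ctupleK k)
    (sigma_finiteT (lebesgue_tuple k)).

End lebesgue_cV.

(* [d] may satisfy the triangle inequality only up to a constant, in which case
   its balls need not be open; the topology is therefore given by its open
   sets. *)
Definition qspace (R : realType) (T : Type) (d : T -> T -> \bar R) : Type := T.

Section qspace_topology.
Context (R : realType) (T : Type) (d : T -> T -> \bar R).

Definition qopen (U : set (qspace d)) : Prop :=
  forall x, U x -> exists2 e : R, 0 < e & forall y, (d x y < e%:E)%E -> U y.

HB.instance Definition _ := gen_eqMixin (qspace d).
HB.instance Definition _ := gen_choiceMixin (qspace d).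

Let qopenT : qopen setT.
Proof. by move=> x _; exists 1. Qed.

Let qopenI : setI_closed qopen.
Proof.
move=> U V oU oV x [/oU[e e0 eU] /oV[e' e'0 e'V]].
exists (Num.min e e'); first by rewrite lt_min e0 e'0.
move=> y xy; split; [apply: eU|apply: e'V]; apply: (lt_le_trans xy);
  by rewrite lee_fin ge_min lexx ?orbT.
Qed.

Let qopen_bigU (I : Type) (f : I -> set (qspace d)) :
  (forall i, qopen (f i)) -> qopen (\bigcup_i f i).
Proof.
move=> of_ x [i _ /(of_ i)[e e0 ef]]; exists e => // y xy.
by exists i => //; exact: ef.
Qed.

HB.instance Definition _ :=
  isOpenTopological.Build (qspace d) qopenT qopenI qopen_bigU.

End qspace_topology.

Section powers.
Context {R : realType} {r : nat}.

Definition rpow (x s : 'rV[R]_r) : R :=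
  \prod_(j < r) x ord0 j `^ s ord0 j.

Definition cexp (z : R[i]) : R[i] :=
  (expR (complex.Re z))%:C%C * (cos (complex.Im z) +i* sin (complex.Im z))%C.

Definition cpow (x : 'rV[R]_r) (s : 'rV[R[i]]_r) : R[i] :=
  cexp (\sum_(j < r) s ord0 j * (ln (x ord0 j))%:C%C).

Definition pos_orthant : set 'rV[R]_r := [set x | forall j, 0 < x ord0 j].

End powers.

Section cone_notions.
Context {R : realType} {m : nat}.
Implicit Types (T : set 'M[R]_m) (Om : set 'cV[R]_m).

Definition pairing (l h : 'cV[R]_m) : R := \sum_(i < m) l i ord0 * h i ord0.

Definition dual_cone Om : set 'cV[R]_m :=
  [set l | forall h, closure Om h -> h != 0 -> 0 < pairing l h].

Definition simply_transitive (G : Type) (T : set G) (V : Type)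
    (act : G -> V -> V) (A : set V) : Prop :=
  (forall t h, T t -> A h -> A (act t h)) /\
  (forall h k, A h -> A k -> exists! t, T t /\ act t h = k).

(* A Lie group acting linearly and simply transitively on an open cone acts
   faithfully and its image in GL_m(R) is closed; conversely closed subgroups
   of GL_m(R) are Lie groups. *)
Definition closed_linear_group T : Prop :=
  [/\ T `<=` [set t | t \in unitmx],
      T 1%:M,
      (forall s t, T s -> T t -> T (s *m t)),
      (forall t, T t -> T (invmx t)) &
      (forall t, t \in unitmx -> closure T t -> T t)].

(* Surjective morphisms onto (R_+^* )^r which are strict, i.e. open onto their
   image.  Analyticity is automatic: continuous morphisms of Lie groups are
   analytic. *)
Definition strict_character r T (D : 'M[R]_m -> 'rV[R]_r) : Prop :=
  [/\ D @` T = pos_orthant,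
      (forall s t, T s -> T t ->
        forall j, D (s *m t) ord0 j = D s ord0 j * D t ord0 j),
      {within T, continuous D} &
      (forall U, open U -> open (D @` (T `&` U)))].

Definition derived_subgroup T : set 'M[R]_m :=
  [set t | forall H : set 'M[R]_m,
    (forall x y, T x -> T y -> H (x *m y *m invmx x *m invmx y)) ->
    (forall x y, H x -> H y -> H (x *m y)) ->
    (forall x, H x -> H (invmx x)) -> H 1%:M -> H t].

End cone_notions.

Record homogeneous_cone (R : realType) (m r : nat) := HomogeneousCone {
  cone_dim_gt0 : (0 < m)%N ;
  Om : set 'cV[R]_m ;
  Om_open : open Om ;
  Om_convex : convex_set (Om : set (convex_lmodType 'cV[R]_m)) ;
  Om_cone : forall (a : R) h, 0 < a -> Om h -> Om (a *: h) ;
  Om_no_line : forall h v, v != 0 -> ~ (forall a : R, Om (h + a *: v)) ;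
  Tplus : set 'M[R]_m ;
  Tplus_group : closed_linear_group Tplus ;
  Tplus_Om : simply_transitive Tplus (fun t h => t *m h) Om ;
  Tplus_Om' :
    simply_transitive Tplus (fun t l => t^T *m l) (dual_cone Om) ;
  (* r is the rank of Om: T_+ / [T_+, T_+] is isomorphic to (R_+^* )^r *)
  rank_Om : exists2 chi : 'M[R]_m -> 'rV[R]_r, strict_character Tplus chi &
    forall t, Tplus t -> (chi t = const_mx 1 <-> derived_subgroup Tplus t) ;
  eOm : 'cV[R]_m ;
  eOm_in : Om eOm ;
  eOm' : 'cV[R]_m ;
  eOm'_in : dual_cone Om eOm' ;
  Delta : 'M[R]_m -> 'rV[R]_r ;
  Delta_char : strict_character Tplus Delta }.

Section cone_powers.
Context {R : realType} {m r : nat} (K : homogeneous_cone R m r).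

Definition Om' : set 'cV[R]_m := dual_cone (Om K).

Definition orbit_elt (h : 'cV[R]_m) : 'M[R]_m :=
  xget 1%:M [set t | Tplus K t /\ t *m eOm K = h].

Definition orbit_elt' (l : 'cV[R]_m) : 'M[R]_m :=
  xget 1%:M [set t | Tplus K t /\ t^T *m eOm' K = l].

Definition DeltaOm (s : 'rV[R]_r) (h : 'cV[R]_m) : R :=
  rpow (Delta K (orbit_elt h)) s.
Definition DeltaOm' (s : 'rV[R]_r) (l : 'cV[R]_m) : R :=
  rpow (Delta K (orbit_elt' l)) s.
Definition cDeltaOm (s : 'rV[R[i]]_r) (h : 'cV[R]_m) : R[i] :=
  cpow (Delta K (orbit_elt h)) s.
Definition cDeltaOm' (s : 'rV[R[i]]_r) (l : 'cV[R]_m) : R[i] :=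
  cpow (Delta K (orbit_elt' l)) s.

End cone_powers.

Section laplace.
Context {R : realType} {m : nat}.
Implicit Types (mu : {measure set 'cV[R]_m -> \bar R}) (A : set 'cV[R]_m)
  (phi : 'cV[R]_m -> R[i]) (l : 'cV[R]_m).

Definition laplace_integrand phi l (h : 'cV[R]_m) : R[i] :=
  (expR (- pairing l h))%:C%C * phi h.

Definition laplace_domain mu A phi : set 'cV[R]_m :=
  [set l |
    mu.-integrable A (fun h => (complex.Re (laplace_integrand phi l h))%:E) /\
    mu.-integrable A (fun h => (complex.Im (laplace_integrand phi l h))%:E)].

Definition laplace mu A phi l : R[i] :=
  (\int[mu]_(h in A) complex.Re (laplace_integrand phi l h) +i*
   \int[mu]_(h in A) complex.Im (laplace_integrand phi l h))%C.

Definition laplace_property r mu A A'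
    (Del Del' : 'rV[R[i]]_r -> 'cV[R]_m -> R[i]) (mm : 'I_r -> nat) : Prop :=
  (forall s : 'rV[R[i]]_r,
    laplace_domain mu A (Del s) !=set0 <->
    forall j, (mm j)%:R / 2 < complex.Re (s ord0 j)) /\
  (forall s : 'rV[R[i]]_r,
    (forall j, (mm j)%:R / 2 < complex.Re (s ord0 j)) ->
    exists c : R[i], forall l, A' l -> laplace_domain mu A (Del s) l /\
      laplace mu A (Del s) l = c * Del' (- s) l).

End laplace.

Section complex_matrices.
Context {R : realType}.

Definition cplx p q (A B : 'M[R]_(p, q)) : 'M[R[i]]_(p, q) :=
  \matrix_(i, j) (A i j +i* B i j)%C.
Definition re_mx p q (A : 'M[R[i]]_(p, q)) : 'M[R]_(p, q) :=
  map_mx (@complex.Re R) A.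
Definition im_mx p q (A : 'M[R[i]]_(p, q)) : 'M[R]_(p, q) :=
  map_mx (@complex.Im R) A.

Definition detR n (g : 'M[R[i]]_n) : R :=
  \det (block_mx (re_mx g) (- im_mx g) (im_mx g) (re_mx g)).

Definition intertwines m n (Phi : 'cV[R[i]]_n -> 'cV[R[i]]_n -> 'cV[R[i]]_m)
    (t : 'M[R]_m) (g : 'M[R[i]]_n) : Prop :=
  forall z w, cplx t 0 *m Phi z w = Phi (g *m z) (g *m w).

Definition linear_automorphism m (A : set 'cV[R]_m) (a : 'M[R]_m) : Prop :=
  a \in unitmx /\ [set a *m h | h in A] = A.

End complex_matrices.

Record siegel_domain (R : realType) (n m r : nat) := SiegelDomain {
  cone_of :> homogeneous_cone R m r ;
  Phi : 'cV[R[i]]_n -> 'cV[R[i]]_n -> 'cV[R[i]]_m ;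
  Phi_linear : forall w, linear (Phi^~ w) ;
  Phi_hermitian : forall z w, Phi w z = map_mx (@conjc R) (Phi z w) ;
  Phi_pos : forall z, z != 0 ->
    closure (Om cone_of) (re_mx (Phi z z)) /\ Phi z z != 0 ;
  (* given T_+, this is equivalent to the transitivity of the group of
     biholomorphisms of the domain *)
  Phi_homogeneous : forall t, Tplus cone_of t ->
    exists2 g : 'M[R[i]]_n, g \in unitmx & intertwines Phi t g ;
  dvec : 'rV[R]_r ;
  dvec_lt0 : forall j, dvec ord0 j < 0 ;
  bvec : 'rV[R]_r ;
  bvec_le0 : forall j, bvec ord0 j <= 0 ;
  mvec : 'I_r -> nat ;
  mvec' : 'I_r -> nat ;
  nuOm : {measure set 'cV[R]_m -> \bar R} ;
  nuOmE : forall A, measurable A -> nuOm A =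
    (\int[lebesgue_cV m]_(h in A `&` Om cone_of)
      (DeltaOm cone_of dvec h)%:E)%E ;
  nuOm' : {measure set 'cV[R]_m -> \bar R} ;
  nuOm'E : forall A, measurable A -> nuOm' A =
    (\int[lebesgue_cV m]_(l in A `&` Om' cone_of)
      (DeltaOm' cone_of dvec l)%:E)%E ;
  nuOm_invariant : forall a, linear_automorphism (Om cone_of) a ->
    forall A, measurable A -> nuOm [set h | A (a *m h)] = nuOm A ;
  nuOm'_invariant : forall a, linear_automorphism (Om' cone_of) a ->
    forall A, measurable A -> nuOm' [set l | A (a *m l)] = nuOm' A ;
  laplace_Om : laplace_property nuOm (Om cone_of) (Om' cone_of)
    (cDeltaOm cone_of) (cDeltaOm' cone_of) mvec ;
  laplace_Om' : laplace_property nuOm' (Om' cone_of) (Om cone_of)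
    (cDeltaOm' cone_of) (cDeltaOm cone_of) mvec' ;
  Delta_bvec : forall t (g : 'M[R[i]]_n), Tplus cone_of t -> g \in unitmx ->
    intertwines Phi t g -> rpow (Delta cone_of t) (- bvec) = detR g }.

Section spaces.
Context {R : realType} {n m r : nat} (S : siegel_domain R n m r).
Local Notation C := R[i].
Local Notation point := ('cV[C]_n * 'cV[C]_m)%type.
Local Notation fn := ('cV[C]_n * 'cV[C]_m -> C).

Definition domain : set point :=
  [set w | Om S (im_mx w.2 - re_mx (Phi S w.1 w.1))].

(* A function on the domain D is represented by its extension by 0 to
   E x F_C, so that equality on D is equality. *)
Definition on_domain (f : fn) : Prop := forall w, ~ domain w -> f w = 0.

Definition Hol : set fn :=
  [set f | on_domain f /\ forall w, domain w -> differentiable f w].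

(* f_h(zeta, x) = f(zeta, x + i Phi(zeta) + i h), with zeta = a + i b *)
Definition slice (f : fn) (h : 'cV[R]_m)
    (v : 'cV[R]_n * 'cV[R]_n * 'cV[R]_m) : C :=
  let zeta := cplx v.1.1 v.1.2 in
  f (zeta, cplx v.2 (re_mx (Phi S zeta zeta) + h)).

Definition haarN : {measure set ('cV[R]_n * 'cV[R]_n * 'cV[R]_m)%type -> \bar R}
  := (lebesgue_cV n \x lebesgue_cV n \x lebesgue_cV m)%E.

Definition sliceN (p : \bar R) (f : fn) (h : 'cV[R]_m) : \bar R :=
  Lnorm haarN p (fun v => (Normc.normc (slice f h v))%:E).

Definition weighted_slices (p : \bar R) (s : 'rV[R]_r) (f : fn)
    (h : 'cV[R]_m) : \bar R := ((DeltaOm S s h)%:E * sliceN p f h)%E.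

Definition Lpq_norm (p q : \bar R) (s : 'rV[R]_r) (f : fn) : \bar R :=
  Lnorm (nuOm S) q (weighted_slices p s f).

Definition real_point
    (v : ('cV[R]_n * 'cV[R]_n) * ('cV[R]_m * 'cV[R]_m)) : point :=
  (cplx v.1.1 v.1.2, cplx v.2.1 v.2.2).

Definition measurable_on_domain (f : fn) : Prop :=
  measurable_fun (real_point @^-1` domain)
    (fun v => complex.Re (f (real_point v))) /\
  measurable_fun (real_point @^-1` domain)
    (fun v => complex.Im (f (real_point v))).

Definition Lpq (p q : \bar R) (s : 'rV[R]_r) : set fn :=
  [set f | [/\ on_domain f, measurable_on_domain f,
    measurable_fun (Om S) (weighted_slices p s f) &
    (Lpq_norm p q s f < +oo)%E]].

Definition Cc : set fn :=
  [set f | continuous f /\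
    exists2 A : set point, compact A /\ A `<=` domain &
      forall w, ~ A w -> f w = 0].

Definition Lpq0 (p q : \bar R) (s : 'rV[R]_r) : set fn :=
  [set f | Lpq p q s f /\ forall e : R, 0 < e ->
    exists2 phi, Cc phi &
      (Lpq_norm p q s (fun w => f w - phi w)%R < e%:E)%E].

Definition Apq p q s : set fn := Lpq p q s `&` Hol.
Definition Apq0 p q s : set fn := Lpq0 p q s `&` Hol.

Definition dz (j : 'I_m) (f : fn) : fn :=
  fun w => 'D_((0, delta_mx j ord0) : point) f w.

Definition dz_mon (al : multinom m) (f : fn) : fn :=
  foldr (fun j g => iter (al j) (dz j) g) f (enum 'I_m).

Definition diff_op (P : mpoly m R) (f : fn) : fn :=
  fun w => \sum_(al <- msupp P) (mcoeff al P)%:C%C * dz_mon al f w.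

Definition symbol (s' : 'rV[R]_r) : set (mpoly m R) :=
  [set P | forall l, Om' S l -> DeltaOm' S s' l = meval (fun j => l j ord0) P].

Definition NOm' : set 'rV[R]_r := [set s' | symbol s' !=set0].

(* f * I_Omega^{-s'}, meaningful for s' in N_{Omega'}; the polynomial is unique
   since Omega' is open and non-empty *)
Definition RL (s' : 'rV[R]_r) (f : fn) : fn :=
  fun w => if w \in domain then diff_op (xget 0 (symbol s')) f w else 0.

Definition RL_class (s' : 'rV[R]_r) (f : fn) : set fn :=
  [set h | Hol h /\ RL s' h = RL s' f].

(* For a space X of functions on D: the f in Hol(D) with f * I^{-s'} in X,
   and the elements of the associated Hausdorff space, i.e. the cosets of such
   f modulo the kernel of ( * I^{-s'}). *)
Definition breve (s' : 'rV[R]_r) (X : set fn) : set fn :=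
  [set f | Hol f /\ X (RL s' f)].
Definition breve_class (s' : 'rV[R]_r) (X : set fn) : set (set fn) :=
  [set c | exists2 f, breve s' X f & c = RL_class s' f].

(* C_{g,s'}(f) as a coset of the kernel of ( * I^{-s'}) in Hol(D) *)
Definition cesaro (g : fn) (s' : 'rV[R]_r) (f : fn) : set fn :=
  [set h | Hol h /\ RL s' h = (fun w => f w * RL s' g w)].

Section operators.
Variables (X1 : set fn) (N1 : fn -> \bar R).
Variables (s' : 'rV[R]_r) (X2 : set fn) (N2 : fn -> \bar R).

Definition src_dist (x y : {f | X1 f}) : \bar R :=
  N1 (fun w => sval x w - sval y w).
Definition src_space : topologicalType := qspace src_dist.

(* the infimum is over a singleton *)
Definition tgt_dist (x y : {c | breve_class s' X2 c}) : \bar R :=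
  ereal_inf [set e | exists h1 h2,
    [/\ sval x h1, sval y h2 & e = N2 (RL s' (fun w => h1 w - h2 w))]].
Definition tgt_space : topologicalType := qspace tgt_dist.

Definition src_val (x : src_space) : fn := sval (x : {f | X1 f}).
Definition tgt_val (y : tgt_space) : set fn :=
  sval (y : {c | breve_class s' X2 c}).

Definition linear_on_classes (T : src_space -> tgt_space) : Prop :=
  forall (a : C) x y z, src_val z = (fun w => a * src_val x w + src_val y w) ->
  forall h1 h2, tgt_val (T x) h1 -> tgt_val (T y) h2 ->
    tgt_val (T z) (fun w => a * h1 w + h2 w).

Definition induced_by (g : fn) (T : src_space -> tgt_space) : Prop :=
  (forall x, tgt_val (T x) = cesaro g s' (src_val x)) /\ linear_on_classes T.

Definition bounded_in (B : set src_space) : Prop :=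
  exists M : R, forall x, B x -> (N1 (src_val x) <= M%:E)%E.

Definition compact_operator (T : src_space -> tgt_space) : Prop :=
  forall B, bounded_in B -> precompact (T @` B).

Definition induces_continuous (g : fn) : Prop :=
  exists2 T, induced_by g T & continuous T.

Definition induces_compact (g : fn) : Prop :=
  exists2 T, induced_by g T & compact_operator T.

End operators.

End spaces.

(* Main.v *)
(* C_{g,s'} f has Riemann-Liouville derivative f G, with G the one of g, so only
   G matters.  Fix a holomorphic f0 without zeros on D, namely e^{i <e', z>} times
   a negative power of linear factors: it decays fast enough to lie in every
   source space.  The affine automorphisms of D given by N and T_+ act
   transitively and change the norms by explicit powers of Delta, so f0 yields,
   for every w in D, a test function f_w of norm at most 1 which takes at w the
   value f0(base) Delta_Omega(rho(w))^{-s1 + (b + d) / p1} up to a constant.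
   Point evaluation at w on the target space has norm at most a constant times
   Delta_Omega(rho(w))^{-s + (b + d) / q2} by submean inequality at the base
   point and the same automorphisms.  Applied to f_w G this bounds G(w), which
   is the first assertion.  If w leaves every compact subset of D, then f_w tends
   to 0 pointwise; hence for a compact operator every cluster point of the images
   of such f_w is 0, and the bound for G tends to 0 at the boundary. *)

Require Import Defs.
From HB Require Import structures.
From mathcomp Require Import all_boot all_order all_algebra.
From mathcomp Require Import -(notations) mpoly.
From mathcomp Require Import all_classical all_reals all_analysis.
From mathcomp Require Import measurable_realfun ess_sup_inf.
From mathcomp Require Import complex ring lra.
Set Implicit Arguments.
Unset Strict Implicit.
Unset Printing Implicit Defensive.
Import Order.TTheory GRing.Theory Num.Theory.
Import numFieldNormedType.Exports.
Local Open Scope classical_set_scope.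
Local Open Scope ring_scope.

(** At a fixed point [w] the normalised test function attached to [w0] is the value of [f0] at an
    automorphic image of [w], divided by [orbit_scale t]. The powers of Delta(t) cancel exactly when
    [f0] is compared with Delta^{-tau} for tau = s1 - (b + d) / p1, so pointwise convergence to 0
    asks that [f0] be o(Delta^{-tau}) at the boundary and at infinity. This holds once all entries
    of tau are positive; as b <= 0 and d < 0, the extra condition for p1 = q1 = oo is what secures
    it in the remaining case. Measurability, monotonicity and decay of the powers of Delta are all
    extracted from the Laplace formulas that fix m and m', together with the invariance of nu under
    T_+. Point evaluation must be bounded for every finite q2 > 0, and below 1 convexity is lost:
    there the submean inequality comes from a weighted supremum. Balls of the target need not be
    open, so continuity and compactness are exploited through explicit open sets, given by a
    weighted uniform bound on the difference with a fixed function. *)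

(** * Open sets and the sigma-algebra generated by the coordinates *)

Definition open_base d (M : measurableType d) (op : set (set M)) :=
  exists B : nat -> set M, (forall n, measurable (B n)) /\
    forall U x, op U -> U x -> exists n, B n x /\ B n `<=` U.

(** Only countably many base sets exist, so the union of those contained in [U] is measurable
    whatever the number of points of [U]. *)
Lemma open_base_measurable d (M : measurableType d) (op : set (set M)) U :
  open_base op -> op U -> measurable U.
Proof.
move=> [B [mB hB]] oU.
rewrite (_ : U = \bigcup_(n in [set n | B n `<=` U]) B n).
  by apply: bigcup_measurable => n _; exact: mB.
apply/seteqP; split=> [x Ux|x [n /= BU] /BU//].
by have [n [? ?]] := hB _ _ oU Ux; exists n.
Qed.

Lemma open_base_pickle d (M : measurableType d) (op : set (set M))
    (I : countType) (B : I -> set M) : (forall i, measurable (B i)) ->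
  (forall U x, op U -> U x -> exists i, B i x /\ B i `<=` U) -> open_base op.
Proof.
move=> mB hB.
exists (fun n => if unpickle n is Some i then B i else set0); split.
  by move=> n; case: (unpickle n) => [i|]; [exact: mB|exact: measurable0].
move=> U x oU Ux; have [i Bi] := hB U x oU Ux.
by exists (pickle i); rewrite pickleK.
Qed.

Lemma measurable_coord (R : realType) k (i : 'I_k) :
  measurable_fun setT (fun x : 'cV[R]_k => x i ord0 : measurableTypeR R).
Proof.
move=> _ A mA; rewrite setTI; apply: sub_sigma_algebra => /=.
rewrite -bigcup_seq/=; exists i => /=; first by rewrite mem_index_enum.
by exists A => //; rewrite setTI.
Qed.

Lemma measurable_cVP (R : realType) k d (T : measurableType d)
    (f : T -> 'cV[R]_k) :
  (forall i, measurable_fun setT (fun x => f x i ord0 : measurableTypeR R)) ->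
  measurable_fun setT f.
Proof.
move=> mf.
suff H : g_sigma_preimage (fun i x => f x i ord0 : measurableTypeR R)
    `<=` measurable.
  move=> _ A mA; apply: H.
  have E := @g_sigma_preimage_comp _ (measurableTypeR R) k _
    (fun i (x : 'cV[R]_k) => x i ord0) _ f.
  by rewrite (_ : (fun i x => f x i ord0) =
    (fun i => (fun x : 'cV[R]_k => x i ord0) \o f))// E; exists A.
apply: smallest_sub; first exact: sigma_algebra_measurable.
rewrite -bigcup_seq; apply: bigcup_sub => i _ A [B mB <-].
exact: mf.
Qed.

Lemma rat_approx (R : realType) (x e : R) : 0 < e ->
  exists q : rat, `|x - ratr q| < e.
Proof.
move=> e0; have xe : x - e < x + e by rewrite ltrBlDr -addrA ltrDl addr_gt0.
have [q /[!in_itv]/= /andP[q1 q2]] := rat_in_itvoo xe.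
by exists q; rewrite distrC ltr_distl q1.
Qed.

Lemma open_base_cV (R : realType) k :
  @open_base _ ('cV[R]_k : measurableType _) (@open 'cV[R]_k).
Proof.
apply: (@open_base_pickle _ _ _ ('cV[rat]_k * rat)%type
  (fun q => \big[setI/setT]_(i < k)
    [set x : 'cV[R]_k | `|x i ord0 - ratr (q.1 i ord0)| < ratr q.2])).
  move=> q; apply: bigsetI_measurable => i _.
  have := @measurable_coord R k i measurableT _
    (measurable_ball (ratr (q.1 i ord0)) (ratr q.2)).
  rewrite setTI; congr measurable; apply/seteqP.
  by split=> x /=; rewrite /ball/= distrC.
move=> U x oU Ux.
have [e /= e0 eU] := (nbhs_ballP _ _).1 (open_nbhs_nbhs (conj oU Ux)).
have e20 : 0 < e / 2 by rewrite divr_gt0.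
(* A rational radius below e / 2: a cube of that radius containing [x] has all its points within e
   of [x]. *)
have [r /[!in_itv]/= /andP[r0 re]] := rat_in_itvoo e20.
have /choice[c xc] : forall i, exists q : rat, `|x i ord0 - ratr q| < ratr r.
  by move=> i; exact: rat_approx.
exists (\col_i c i, r); split.
  by rewrite -bigcap_seq => i ik /=; rewrite mxE xc.
move=> y; rewrite -bigcap_seq/= => cy; apply: eU; rewrite /= (splitr e).
split; first by rewrite -splitr.
move=> i j; rewrite !ord1; have := cy i.
rewrite /= mem_index_enum mxE => /(_ isT) yi; rewrite /ball/=.
rewrite -(subrKA (ratr (c i))); apply: (le_lt_trans (ler_normD _ _)).
by rewrite ltrD// ?(lt_trans (xc i))// distrC (lt_trans yi).
Qed.

Lemma open_base_prod d1 d2 (M1 : measurableType d1) (M2 : measurableType d2)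
    (op1 : set (set M1)) (op2 : set (set M2)) (op : set (set (M1 * M2))) :
  open_base op1 -> open_base op2 ->
  (forall U x, op U -> U x -> exists V W, [/\ op1 V, op2 W, V x.1, W x.2 &
    V `*` W `<=` U]) -> open_base op.
Proof.
move=> [B1 [mB1 h1]] [B2 [mB2 h2]] h.
apply: (@open_base_pickle _ _ _ (nat * nat)%type
  (fun q => B1 q.1 `*` B2 q.2)).
  by move=> q; exact: measurableX.
move=> U x /h/[apply] -[V [W [/h1 oV /h2 oW /oV[i [? iV]] /oW[j [? jW]] VW]]].
exists (i, j); split => // y [y1 y2]; apply: VW.
by split; [exact: iV|exact: jW].
Qed.

Lemma open_prod_rect (X Y : topologicalType) (U : set (X * Y)) x :
  open U -> U x -> exists V W, [/\ open V, open W, V x.1, W x.2 &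
    V `*` W `<=` U].
Proof.
move=> oU Ux; have [[A B] /= [+ +] AB] := open_nbhs_nbhs (conj oU Ux).
rewrite !nbhsE => -[V [oV Vx] VA] [W [oW Wx] WB].
exists V, W; split => // y [y1 y2]; apply: AB.
by split; [exact: VA|exact: WB].
Qed.

Section open_measurable.
Context {R : realType}.
Local Notation E n := ('cV[R]_n * 'cV[R]_n)%type.
Local Notation N n m := ('cV[R]_n * 'cV[R]_n * 'cV[R]_m)%type.

Lemma open_base_E n : @open_base _ (E n : measurableType _) (@open (E n)).
Proof.
apply: open_base_prod; [exact: open_base_cV|exact: open_base_cV|].
exact: open_prod_rect.
Qed.

Lemma open_base_N n m :
  @open_base _ (N n m : measurableType _) (@open (N n m)).
Proof.
apply: open_base_prod; [exact: open_base_E|exact: open_base_cV|].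
exact: open_prod_rect.
Qed.

Lemma open_base_NV n m : @open_base _
  (N n m * 'cV[R]_m : measurableType _)%type (@open (N n m * 'cV[R]_m)%type).
Proof.
apply: open_base_prod; [exact: open_base_N|exact: open_base_cV|].
exact: open_prod_rect.
Qed.

Lemma open_base_P n m : @open_base _
  (E n * E m : measurableType _)%type (@open (E n * E m)%type).
Proof.
apply: open_base_prod; [exact: open_base_E|exact: open_base_E|].
exact: open_prod_rect.
Qed.

Definition open_measurable_cV k U :=
  @open_base_measurable _ _ _ U (@open_base_cV R k).
Definition open_measurable_E n U :=
  @open_base_measurable _ _ _ U (@open_base_E n).
Definition open_measurable_N n m U :=
  @open_base_measurable _ _ _ U (@open_base_N n m).
Definition open_measurable_NV n m U :=
  @open_base_measurable _ _ _ U (@open_base_NV n m).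
Definition open_measurable_P n m U :=
  @open_base_measurable _ _ _ U (@open_base_P n m).

Lemma preimage_measurable_fun d (M : measurableType d) (D : set M)
    (f : M -> R) : measurable D ->
  (forall U : set R, open U -> measurable (D `&` f @^-1` U)) ->
  measurable_fun D (f : M -> measurableTypeR R).
Proof.
move=> mD h; apply: (measurability _ (@RGenOpens.measurableE R)).
by move=> _ [_ [a [b ->]] <-]; apply: h; exact: interval_open.
Qed.

End open_measurable.

(** * Product measures under skew maps *)

Section product_maps.
Local Open Scope ereal_scope.
Context d1 d2 (X : measurableType d1) (Y : measurableType d2) (R : realType).
Variables (m1 : {sigma_finite_measure set X -> \bar R})
  (m2 : {sigma_finite_measure set Y -> \bar R}).

(** Both sides are measures in [B] that agree on rectangles. The exchange allows a shear to act
    along either factor. *)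
Lemma product_measure_swap B : measurable B ->
  (m1 \x m2) B = (m2 \x m1) ((fun z => (z.2, z.1)) @^-1` B).
Proof.
move=> mB; pose sw (z : Y * X) := (z.2, z.1).
have ms : measurable_fun setT sw by exact: measurable_fun_pair.
rewrite -[RHS]/(pushforward (m2 \x m1)%E sw B).
apply: (@product_measure_unique _ _ _ _ _ m1 m2
  (pushforward (m2 \x m1) sw)) => // A C mA mC.
rewrite /= /pushforward (_ : _ @^-1` _ = C `*` A); last first.
  by apply/seteqP; split=> -[x y] [].
by rewrite product_measure1E// muleC.
Qed.

Lemma ge0_integral_scaled (mu : {measure set X -> \bar R}) (phi : X -> X)
    (c : {nonneg R}) (f : X -> \bar R) :
  measurable_fun setT phi ->
  (forall A, measurable A -> mu (phi @^-1` A) = c%:num%:E * mu A) ->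
  measurable_fun setT f -> (forall x, 0 <= f x) ->
  \int[mu]_x f (phi x) = c%:num%:E * \int[mu]_x f x.
Proof.
move=> mphi hphi mf f0.
rewrite -[LHS]/(\int[mu]_(x in phi @^-1` setT) (f \o phi) x).
rewrite -ge0_integral_pushforward//.
rewrite -ge0_integral_mscale//; apply: eq_measure_integral => //= A mA _.
by rewrite /pushforward hphi.
Qed.

(** By sections: the inner integral produces [c2] and the change of variable under [phi] produces
    [c1]. Triangular matrices, translations and the affine automorphisms of the domain all have this
    skew form. *)
Lemma product_measure_shear (phi : X -> X) (psi : X -> Y -> Y)
    (c1 c2 : {nonneg R}) B :
  measurable_fun setT phi ->
  measurable_fun setT (fun z : X * Y => psi z.1 z.2) ->
  (forall A, measurable A -> m1 (phi @^-1` A) = c1%:num%:E * m1 A) ->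
  (forall x A, measurable A -> m2 (psi x @^-1` A) = c2%:num%:E * m2 A) ->
  measurable B ->
  (m1 \x m2) ((fun z => (phi z.1, psi z.1 z.2)) @^-1` B) =
    (c1%:num * c2%:num)%:E * (m1 \x m2) B.
Proof.
move=> mphi mpsi h1 h2 mB; rewrite /= /product_measure1.
transitivity (\int[m1]_x (c2%:num%:E * m2 (xsection B (phi x)))).
  apply: eq_integral => x _ /=; rewrite -(h2 x); last exact: measurable_xsection.
  congr (m2 _); apply/seteqP; split=> y /=; rewrite /xsection /= !inE//.
have mx : measurable_fun setT (m2 \o xsection B).
  exact: measurable_fun_xsection.
rewrite ge0_integralZl//; last 1 first.
- exact: (measurableT_comp mx).
rewrite (ge0_integral_scaled (f := m2 \o xsection B) mphi h1)//.
by rewrite muleA -EFinM mulrC.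
Qed.

End product_maps.

(** * Lebesgue measure under affine maps of the line *)

Section lebesgue_affine1.
Context {R : realType}.
Local Notation mu := (@lebesgue_measure R).

Let lebesgue_affine_gt0 (a b : R) (B : set (measurableTypeR R)) : 0 < a ->
  measurable B ->
  mu ((fun x : R => a * x + b) @^-1` B) = (a^-1%:E * mu B)%E.
Proof.
move=> a0 mB; have an : a != 0 by rewrite gt_eqF.
have mf : measurable_fun setT
    (fun x : measurableTypeR R => a * x + b : measurableTypeR R).
  by apply: measurable_funD => //; exact: measurable_funM.
have a0' : 0 <= a by exact: ltW.
(* The push-forward multiplied by [a] agrees with Lebesgue measure on half-open intervals, which
   characterises that measure. *)
have := @lebesgue_measure_unique R (mscale (NngNum a0')
  (pushforward mu (fun x : measurableTypeR R => a * x + b : measurableTypeR R))).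
move=> /(_ mf) H; rewrite (H _ B mB).
  change (mu ((fun x => (a * x + b)%R) @^-1` B) =
    a^-1%:E * (a%:E * mu ((fun x => (a * x + b)%R) @^-1` B)))%E.
  rewrite muleA -EFinM mulVf// mul1e//.
move=> _ [[c d]] _ <-.
change (mu `]c, d] = a%:E * mu ((fun x => (a * x + b)%R) @^-1` `]c, d]))%E.
rewrite [X in (_ * mu X)%E](_ : _ = `](c - b) / a, (d - b) / a]%classic); last first.
  apply/seteqP; split=> x /=; rewrite !in_itv/=;
  by rewrite ltr_pdivrMr// ler_pdivlMr// ltrBlDr lerBrDr [x * a]mulrC.
rewrite !lebesgue_measure_itv/= !lte_fin ltr_pM2r ?invr_gt0// ltrD2r.
case: ifP => _; last by rewrite mule0.
rewrite -!EFinB -EFinM; congr EFin; field; exact: an.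
Qed.

Lemma lebesgue_affine (a b : R) (B : set (measurableTypeR R)) : a != 0 ->
  measurable B ->
  mu ((fun x : R => a * x + b) @^-1` B) = (`|a|^-1%:E * mu B)%E.
Proof.
move=> an mB; have [a0|a0|/eqP] := ltgtP a 0; last by rewrite (negbTE an).
- have mN : measurable_fun setT (-%R : measurableTypeR R -> measurableTypeR R).
    exact: oppr_measurable.
  have na0 : 0 < - a by rewrite oppr_gt0.
  rewrite ltr0_norm// -(lebesgue_affine_gt0 b na0 mB).
  have mf : measurable_fun setT
      (fun x : measurableTypeR R => - a * x + b : measurableTypeR R).
    by apply: measurable_funD => //; exact: measurable_funM.
  rewrite -[RHS]lebesgue_measureN; last by rewrite -[X in measurable X]setTI; exact: mf.
  rewrite /pushforward; congr (mu _); apply/seteqP.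
  by split=> x /=; rewrite mulrNN.
- by rewrite gtr0_norm// lebesgue_affine_gt0.
Qed.

End lebesgue_affine1.

(** * The determinant formula for linear maps of R^k *)

Section lebesgue_cV_linear.
Context {R : realType}.
Local Notation RT k := (k.-tuple (measurableTypeR R)).
Local Notation lam := (@lebesgue_cV R).
Local Open Scope ereal_scope.

Definition consv k (z : measurableTypeR R * 'cV[R]_k) : 'cV[R]_k.+1 :=
  col_mx (const_mx z.1 : 'cV_1) z.2.

Lemma consvE0 k (z : measurableTypeR R * 'cV[R]_k) : consv z ord0 ord0 = z.1.
Proof.
transitivity (consv z (lshift k (ord0 : 'I_1)) ord0).
  by congr (consv z _ _); exact: val_inj.
exact: etrans (col_mxEu (const_mx z.1 : 'cV_1) z.2 ord0 ord0) (mxE _ _ _ _).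
Qed.

Lemma consvES k (z : measurableTypeR R * 'cV[R]_k) i :
  consv z (lift ord0 i) ord0 = z.2 i ord0.
Proof.
transitivity (consv z (rshift 1 i) ord0).
  by congr (consv z _ _); exact: val_inj.
exact: (col_mxEd (const_mx z.1 : 'cV_1) z.2 i ord0).
Qed.

Lemma measurable_consv k : measurable_fun setT (@consv k).
Proof.
apply: measurable_cVP => i.
case: (unliftP ord0 i) => [j ->|->].
  under eq_fun do rewrite consvES.
  exact: (measurableT_comp (measurable_coord j)).
by under eq_fun do rewrite consvE0; exact: measurable_fst.
Qed.

Lemma lebesgue_cVE k (A : set 'cV[R]_k) :
  lam k A = lebesgue_tuple k [set t : RT k | A (\col_i tnth t i)].
Proof. by []. Qed.

(** The measure on columns is defined through tuples; this recursion replaces that definition in the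
    inductions on the dimension. *)
Lemma lebesgue_cVS k (B : set 'cV[R]_k.+1) : measurable B ->
  lam k.+1 B = (@lebesgue_measure R \x lam k) (@consv k @^-1` B).
Proof.
move=> mB; rewrite lebesgue_cVE /= /push_iso /pushforward /=.
rewrite /product_measure1; apply: eq_integral => x _ /=.
rewrite [RHS]lebesgue_cVE; congr (lebesgue_tuple k _); apply/seteqP.
have E (t : RT k) : \col_i tnth [tuple of x :: t] i =
    consv (x, \col_i tnth t i) :> 'cV[R]_k.+1.
  apply/matrixP => i j; rewrite !ord1.
  case: (unliftP ord0 i) => [j' ->|->]; rewrite ?consvES ?consvE0 !mxE ?tnthS ?tnth0//.
by split=> t; rewrite /xsection/= !inE /= E.
Qed.

Lemma measurable_affine_cV k (A : 'M[R]_k) (b : 'cV[R]_k) :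
  measurable_fun setT (fun x : 'cV[R]_k => (A *m x + b)%R).
Proof.
apply: measurable_cVP => i; under eq_fun do rewrite !mxE.
apply: measurable_funD => //; apply: measurable_sum => j.
by apply: measurable_funM => //; exact: measurable_coord.
Qed.

Let measurable_lin k (A : 'M[R]_k) :
  measurable_fun setT (fun x : 'cV[R]_k => A *m x).
Proof.
by have := @measurable_affine_cV k A 0; under eq_fun do rewrite addr0.
Qed.

Let measurable_pre d1 d2 (X : measurableType d1) (Y : measurableType d2)
  (f : X -> Y) B : measurable_fun setT f -> measurable B ->
  measurable (f @^-1` B).
Proof. by move=> mf mB; rewrite -[X in measurable X]setTI; exact: mf. Qed.

Lemma consv_shear k (a : R) (b : R) (psi : R -> 'cV[R]_k -> 'cV[R]_k)
    (c2 : {nonneg R}) (B : set 'cV[R]_k.+1) : a != 0%R ->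
  measurable_fun setT (fun z : measurableTypeR R * 'cV[R]_k => psi z.1 z.2) ->
  (forall x A, measurable A -> lam k (psi x @^-1` A) = c2%:num%:E * lam k A) ->
  measurable B ->
  (@lebesgue_measure R \x lam k)
    ((fun z => consv ((a * z.1 + b)%R : measurableTypeR R, psi z.1 z.2)) @^-1` B) =
  (`|a|^-1 * c2%:num)%:E * lam k.+1 B.
Proof.
move=> a0 mpsi hpsi mB.
have h : (0 <= `|a|^-1)%R by rewrite invr_ge0.
rewrite (lebesgue_cVS mB) -[(`|a|^-1)%R]/((NngNum h)%:num).
apply: (@product_measure_shear _ _ _ _ R (@lebesgue_measure R) (lam k)
  (fun x => a * x + b)%R psi (NngNum h) c2 (@consv k @^-1` B)) => //.
- by apply: measurable_funD => //; exact: measurable_funM.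
- by move=> A mA; exact: lebesgue_affine.
- by apply: measurable_pre => //; exact: measurable_consv.
Qed.

Lemma lebesgue_cV_translate k (b : 'cV[R]_k) B : measurable B ->
  lam k ((fun x => (x + b)%R) @^-1` B) = lam k B.
Proof.
elim: k b B => [|k IH] b B mB.
  by congr (lam 0 _); apply/seteqP; split=> x /=; rewrite (flatmx0 (x + b)%R) (flatmx0 x).
rewrite lebesgue_cVS; last first.
  apply: measurable_pre => //.
  have := @measurable_affine_cV k.+1 1%:M b.
  by under eq_fun do rewrite mul1mx.
pose b' : 'cV[R]_k := \col_i b (lift ord0 i) ord0.
have m1 : measurable_fun setT (fun z : measurableTypeR R * 'cV[R]_k => (z.2 + b')%R).
  have := @measurable_affine_cV k 1%:M b'; under eq_fun do rewrite mul1mx.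
  by move=> mb; exact: (measurableT_comp mb).
have hs (x : R) A : measurable A -> lam k ((fun y => (y + b')%R) @^-1` A) =
    (NngNum (@ler01 R))%:num%:E * lam k A by move=> mA; rewrite mul1e IH.
have := @consv_shear k 1 (b ord0 ord0) (fun _ y => y + b')%R (NngNum (@ler01 R)) B (oner_neq0 R) m1 hs mB.
rewrite normr1 invr1 /= mulr1 mul1e => <-.
have E z : consv ((1 * z.1 + b ord0 ord0)%R : measurableTypeR R, (z.2 + b')%R) =
    (consv z + b)%R.
  apply/matrixP => i j; rewrite !ord1 [RHS]mxE mul1r.
  by case: (unliftP ord0 i) => [j' ->|->]; rewrite ?consvES ?consvE0 ?mxE.
by congr (_ _); apply/seteqP; split=> z /=; rewrite E.
Qed.

(** The determinant is inverted because preimages, not images, are measured. *)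
Definition scales k (A : 'M[R]_k) := forall B, measurable B ->
  lam k ((fun x => A *m x) @^-1` B) = `|\det A|^-1%:E * lam k B.

Lemma scales_mul k (A B : 'M[R]_k) : scales A -> scales B -> scales (A *m B).
Proof.
move=> hA hB C mC.
rewrite (_ : _ @^-1` _ = (fun x => B *m x) @^-1` ((fun x => A *m x) @^-1` C)).
  rewrite hB; last exact: (measurable_pre (@measurable_lin _ A)).
  by rewrite hA// muleA -EFinM det_mulmx normrM invfM mulrC.
by apply/seteqP; split=> x /=; rewrite mulmxA.
Qed.

Lemma mul_block_consv k (a : R) (l : 'rV[R]_k) (c : 'cV[R]_k) (D : 'M[R]_k)
    (z : measurableTypeR R * 'cV[R]_k) :
  (block_mx a%:M l c D : 'M[R]_(1 + k)%N) *m consv z =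
  consv ((a * z.1 + (l *m z.2) ord0 ord0)%R : measurableTypeR R,
    z.1 *: c + D *m z.2)%R.
Proof.
rewrite /consv mul_block_col; congr col_mx.
  by apply/matrixP => i j; rewrite !ord1 mul_scalar_mx !mxE.
congr (_ + _)%R; apply/matrixP => i j.
by rewrite !ord1 !mxE big_ord1 !mxE mulrC.
Qed.

Let measurable_blocklin k (A : 'M[R]_k.+1) B : measurable B ->
  measurable ((fun x => A *m x) @^-1` B).
Proof. by move=> mB; apply: (measurable_pre (@measurable_lin _ A)). Qed.

(** In an upper triangular block the first coordinate depends on the others, so the product is
    swapped, sheared and swapped back. *)
Lemma scales_ublock k (a : R) (l : 'rV[R]_k) (D : 'M[R]_k) :
  a != 0%R -> scales D -> scales (block_mx a%:M l 0 D : 'M[R]_(1 + k)%N).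
Proof.
move=> a0 hD B mB.
rewrite lebesgue_cVS; last exact: measurable_blocklin.
have h : (0 <= `|\det D|^-1)%R by rewrite invr_ge0.
have h' : (0 <= `|a|^-1)%R by rewrite invr_ge0.
rewrite det_ublock det_scalar1 normrM invfM.
rewrite product_measure_swap; last first.
  by apply: measurable_pre; [exact: measurable_consv|exact: measurable_blocklin].
rewrite lebesgue_cVS// (product_measure_swap _ _ (B := consv (k:=k) @^-1` B)); last first.
  by apply: measurable_pre => //; exact: measurable_consv.
rewrite mulrC -[(`|a|^-1)%R]/((NngNum h')%:num).
rewrite -[(`|\det D|^-1)%R]/((NngNum h)%:num) -(@product_measure_shear _ _ _ _ R (lam k) (@lebesgue_measure R) (fun y => D *m y)
  (fun (y : 'cV[R]_k) (x : measurableTypeR R) =>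
     (a * x + (l *m y) ord0 ord0)%R : measurableTypeR R) (NngNum h) (NngNum h'))//.
- congr (_ _); apply/seteqP; split=> z /=; rewrite mul_block_consv/=;
  by rewrite scaler0 add0r.
- exact: measurable_lin.
- apply: measurable_funD => //.
    by apply: measurable_funM => //; exact: measurable_snd.
  under eq_fun do rewrite mxE.
  apply: measurable_sum => j; apply: measurable_funM => //.
  exact: (measurableT_comp (measurable_coord j)).
- by move=> y A mA; exact: lebesgue_affine.
- apply: measurable_pre; first exact: measurable_fun_pair.
  by apply: measurable_pre => //; exact: measurable_consv.
Qed.

Lemma scales_lblock k (c : 'cV[R]_k) :
  scales (block_mx 1%:M 0 c 1%:M : 'M[R]_(1 + k)%N).
Proof.
move=> B mB; rewrite lebesgue_cVS; last exact: measurable_blocklin.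
rewrite det_lblock !det1 mulr1.
have m1 : measurable_fun setT
    (fun z : measurableTypeR R * 'cV[R]_k => (z.2 + z.1 *: c)%R).
  apply: measurable_cVP => i; under eq_fun do rewrite !mxE.
  apply: measurable_funD; last by apply: measurable_funM => //; exact: measurable_fst.
  exact: (measurableT_comp (measurable_coord i)).
have hs (x : R) A : measurable A -> lam k ((fun y => (y + x *: c)%R) @^-1` A) =
    (NngNum (@ler01 R))%:num%:E * lam k A.
  by move=> mA; rewrite mul1e lebesgue_cV_translate.
have := @consv_shear k 1 0 (fun x y => y + x *: c)%R (NngNum (@ler01 R)) B (oner_neq0 R) m1 hs mB.
rewrite normr1 invr1 /= mulr1 => <-.
congr (_ _); apply/seteqP; split=> z /=; rewrite mul_block_consv/=;
  by rewrite mul1r mul0mx mxE addr0 mul1mx addrC.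
Qed.

Lemma scales1 k : scales (1%:M : 'M[R]_k).
Proof.
move=> B mB; rewrite det1 normr1 invr1 mul1e; congr (_ _).
by apply/seteqP; split=> x /=; rewrite mul1mx.
Qed.

(** Gaussian elimination by induction on [k]: a nonzero top left entry gives a block LU
    factorisation, and otherwise adding a lower row to the first one creates such an entry. *)
Theorem lebesgue_cV_linear k (A : 'M[R]_k) : A \in unitmx -> scales A.
Proof.
elim: k A => [|k IH] A uA.
  move=> B mB; rewrite det_mx00 normr1 invr1 mul1e; congr (lam 0 _).
  by apply/seteqP; split=> x /=; rewrite (flatmx0 (A *m x)) (flatmx0 x).
have pivot (C : 'M[R]_(1 + k)%N) : C \in unitmx -> C ord0 ord0 != 0%R -> scales C.
  move=> uC c0; pose a := C ord0 ord0.
  rewrite -(submxK C).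
  have -> : ulsubmx C = a%:M.
    apply/matrixP => i j; rewrite !ord1 !mxE eqxx mulr1n.
    by congr (C _ _); apply: val_inj.
  set l := ursubmx C; set c := dlsubmx C; set D := drsubmx C.
  (* The Schur complement of the pivot [a], invertible because the determinant of the whole matrix
     is [a] times its own. *)
  pose D' : 'M[R]_k := (D - (a^-1 *: c) *m l)%R.
  have E : block_mx a%:M l c D = (block_mx 1%:M 0 (a^-1 *: c) 1%:M : 'M[R]_(1 + k)%N)
      *m (block_mx a%:M l 0 D' : 'M[R]_(1 + k)%N).
    rewrite mulmx_block !mul1mx !mul0mx ?mulmx0 !addr0; congr block_mx.
      by rewrite mul_mx_scalar scalerA divff// scale1r.
    by rewrite /D' addrC subrK.
  rewrite E; apply: scales_mul; first exact: scales_lblock.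
  apply: scales_ublock => //; apply: IH.
  move: uC; rewrite -(submxK C) !unitmxE -/l -/c -/D.
  have -> : ulsubmx C = a%:M.
    apply/matrixP => i j; rewrite !ord1 !mxE eqxx mulr1n.
    by congr (C _ _); apply: val_inj.
  by rewrite E det_mulmx det_lblock !det1 !mul1r det_ublock unitrM => /andP[].
have [a0|a0] := eqVneq (A ord0 ord0) 0%R; last exact: pivot.
have [i ci] : exists i : 'I_k, A (lift ord0 i) ord0 != 0%R.
  apply/existsP; apply: contraTT uA; rewrite negb_exists => /forallP h.
  rewrite unitmxE (expand_det_col _ ord0) big1 ?unitr0// => i _.
  case: (unliftP ord0 i) => [j ->|->]; last by rewrite a0 mul0r.
  by have := h j; rewrite negbK => /eqP ->; rewrite mul0r.
(* Left multiplication by [E s] adds [s] times the row of the nonzero entry to row 0, and [E (-1)]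
   undoes [E 1]. *)
pose E (s : R) : 'M[R]_(1 + k)%N := block_mx 1%:M (s *: delta_mx ord0 i)%R 0 1%:M.
have sE s : scales (E s) by apply: scales_ublock; [exact: oner_neq0|exact: scales1].
have uE s : E s \in unitmx by rewrite unitmxE det_ublock !det1 mulr1 unitr1.
have EE : E (-1)%R *m E 1%R = 1%:M.
  rewrite /E mulmx_block !mul1mx !mulmx1 !mul0mx ?mulmx0 !addr0 add0r.
  by rewrite scaleN1r scale1r subrr -scalar_mx_block.
rewrite -[A]mul1mx -EE -mulmxA; apply: scales_mul => //.
apply: pivot; first by rewrite unitmx_mul uE.
pose A' : 'M[R]_(1 + k)%N := A.
suff: (E 1%R *m A') (lshift k ord0) (lshift k ord0) != 0%R.
  by rewrite (_ : lshift k ord0 = ord0)//; exact: val_inj.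
rewrite -(submxK A') /E mulmx_block block_mxEul mul1mx scale1r mxE -rowE !mxE.
rewrite (_ : lshift k ord0 = ord0); last exact: val_inj.
rewrite (_ : rshift 1 i = lift ord0 i); last exact: val_inj.
by rewrite /A' a0 add0r.
Qed.

End lebesgue_cV_linear.

(** * Lebesgue measure on products, cubes and open sets *)

(** Keeps sigma-finiteness in the type, so that products can be iterated. *)
Definition product_sf d1 d2 (X : measurableType d1) (Y : measurableType d2)
    (R : realType) (m1 : {sigma_finite_measure set X -> \bar R})
    (m2 : {sigma_finite_measure set Y -> \bar R}) :
    {sigma_finite_measure set (X * Y)%type -> \bar R} :=
  HB.pack (product_measure1 m1 m2)
    (Measure_isSigmaFinite.Build _ _ _ (product_measure1 m1 m2)
      (product_sigma_finite m1 m2)).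

Section lebesgue_more.
Context {R : realType}.
Local Notation lam := (@lebesgue_cV R).
Local Open Scope ereal_scope.

Definition lebE n :
    {sigma_finite_measure set ('cV[R]_n * 'cV[R]_n)%type -> \bar R} :=
  product_sf (lam n) (lam n).
Definition lebN n m :
    {sigma_finite_measure set ('cV[R]_n * 'cV[R]_n * 'cV[R]_m)%type -> \bar R} :=
  product_sf (lebE n) (lam m).
Definition lebP n m : {sigma_finite_measure
    set (('cV[R]_n * 'cV[R]_n) * ('cV[R]_m * 'cV[R]_m))%type -> \bar R} :=
  product_sf (lebE n) (lebE m).

Let measurable_pre d1 d2 (X : measurableType d1) (Y : measurableType d2)
  (f : X -> Y) B : measurable_fun setT f -> measurable B ->
  measurable (f @^-1` B).
Proof. by move=> mf mB; rewrite -[X in measurable X]setTI; exact: mf. Qed.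

Lemma lebesgue_cV0T : lam 0 setT = 1.
Proof. by rewrite lebesgue_cVE /= /dirac indicE mem_set. Qed.

Definition colpair p q (z : 'cV[R]_p * 'cV[R]_q) : 'cV[R]_(p + q) :=
  col_mx z.1 z.2.

Lemma measurable_colpair p q : measurable_fun setT (@colpair p q).
Proof.
apply: measurable_cVP => i.
case: (fintype.splitP i) => j ij.
  have -> : i = lshift q j by exact: val_inj.
  under eq_fun do rewrite col_mxEu.
  by apply: (measurableT_comp (measurable_coord j)); exact: measurable_fst.
have -> : i = rshift p j by exact: val_inj.
under eq_fun do rewrite col_mxEd.
by apply: (measurableT_comp (measurable_coord j)); exact: measurable_snd.
Qed.

Lemma consv_colpair p q (x : measurableTypeR R) (y : 'cV[R]_p) (z : 'cV[R]_q) :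
  colpair (consv (x, y), z) = consv (x, colpair (y, z)) :> 'cV[R]_(p + q).+1.
Proof.
apply/matrixP => i j; rewrite !ord1.
case: (unliftP ord0 i) => [i' ->|->].
  rewrite consvES /=.
  case: (fintype.splitP i') => l il.
    transitivity (col_mx (consv (x, y)) z (lshift q (lift ord0 l)) ord0).
      by congr (col_mx _ _ _ _); apply: val_inj; rewrite /= il.
    rewrite col_mxEu consvES /colpair/=.
    by rewrite (_ : i' = lshift q l) ?col_mxEu//; exact: val_inj.
  transitivity (col_mx (consv (x, y)) z (rshift p.+1 l) ord0).
    by congr (col_mx _ _ _ _); apply: val_inj; rewrite /= il.
  rewrite col_mxEd /colpair/=.
  by rewrite (_ : i' = rshift p l) ?col_mxEd//; exact: val_inj.
rewrite consvE0/=.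
transitivity (col_mx (consv (x, y)) z (lshift q ord0) ord0).
  by congr (col_mx _ _ _ _); exact: val_inj.
by rewrite col_mxEu consvE0.
Qed.

(** Induction on [p] by Tonelli, one coordinate of the first block being moved across [colpair] at a
    time. *)
Lemma lebesgue_cV_pair p q (B : set 'cV[R]_(p + q)) : measurable B ->
  lam (p + q) B = (lam p \x lam q) (@colpair p q @^-1` B).
Proof.
elim: p B => [|p IH] B mB.
  rewrite /= /product_measure1.
  rewrite (eq_integral (fun=> lam q B)); last first.
    move=> x _ /=; congr (lam q _); apply/seteqP.
    have E (z : 'cV[R]_q) : colpair (x, z) = z.
      apply/matrixP => i j.
      have := @col_mxEd _ 0 q 1 x z i j.
      by rewrite (_ : rshift 0 i = i)//; exact: val_inj.
    by split=> z; rewrite /xsection/= !inE /= E.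
  by rewrite integral_cst// (_ : _ setT = 1) ?mule1//; exact: lebesgue_cV0T.
rewrite lebesgue_cVS//.
have mC : measurable (@consv R (p + q) @^-1` B).
  by apply: measurable_pre => //; exact: measurable_consv.
have mD : measurable (@colpair p.+1 q @^-1` B).
  by apply: measurable_pre => //; exact: measurable_colpair.
transitivity (\int[lebesgue_measure]_x \int[lam p]_y
    lam q (xsection (@colpair p.+1 q @^-1` B) (consv (x, y)))).
  rewrite /= /product_measure1; apply: eq_integral => x _ /=.
  apply: (etrans (IH _ (@measurable_xsection _ _ _ _ _ x mC))).
  rewrite /= /product_measure1; apply: eq_integral => y _ /=.
  congr (lam q _); apply/seteqP.
  by split=> z; rewrite /xsection/= !inE /= consv_colpair !inE.
have mF : measurable_fun setT (lam q \o xsection (@colpair p.+1 q @^-1` B)).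
  exact: measurable_fun_xsection.
rewrite -(@fubini_tonelli1 _ _ _ _ R lebesgue_measure (lam p)
  (fun z => lam q (xsection (@colpair p.+1 q @^-1` B) (consv z))))//; last first.
  by apply: (measurableT_comp mF); exact: measurable_consv.
rewrite [RHS]/= /product_measure1.
have := @ge0_integral_pushforward _ _ _ _ R (@consv R p) (@measurable_consv R p)
  (lebesgue_measure \x lam p)%E setT _ measurableT mF.
rewrite preimage_setT => <-//.
apply: eq_measure_integral; first exact: measurable_consv.
by move=> mc A mA _; exact/esym/(lebesgue_cVS mA).
Qed.

(** Transfers the determinant formula from R^{n+n} to R^n x R^n, the form in which C^n carries its
    measure. *)
Lemma pair_block n (A B C D : 'M[R]_n) :
  \det (block_mx A B C D) != 0%R ->
  forall U : set ('cV[R]_n * 'cV[R]_n), measurable U ->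
  lebE n ((fun z => (A *m z.1 + B *m z.2, C *m z.1 + D *m z.2)%R) @^-1` U)
  = `|\det (block_mx A B C D)|^-1%:E * lebE n U.
Proof.
move=> d0 U mU.
pose split_ (x : 'cV[R]_(n + n)) := (usubmx x, dsubmx x).
have ms : measurable_fun setT split_.
  apply: measurable_fun_pair; apply: measurable_cVP => i;
    by under eq_fun do rewrite mxE; exact: measurable_coord.
have mV : measurable (split_ @^-1` U) by exact: measurable_pre.
have := lebesgue_cV_linear (A := block_mx A B C D) _ mV.
rewrite unitmxE unitfE => /(_ d0).
rewrite !lebesgue_cV_pair//; last first.
  apply: measurable_pre mV => //.
  have := @measurable_affine_cV R _ (block_mx A B C D) 0.
  by under eq_fun do rewrite addr0.
have -> : colpair (q:=n) @^-1` (split_ @^-1` U) = U.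
  by apply/seteqP; split=> -[a b] /=; rewrite /split_ /colpair col_mxKu col_mxKd.
move=> <-; congr (_ _); apply/seteqP.
split=> -[a b] /=; rewrite /split_ /colpair/= mul_block_col col_mxKu col_mxKd//.
Qed.

Definition cube k (c : 'cV[R]_k) (e : R) : set 'cV[R]_k :=
  [set x | forall i, (`|x i ord0 - c i ord0| < e)%R].

Lemma open_cube k (c : 'cV[R]_k) e : open (cube c e).
Proof.
rewrite openE => x cx; apply/nbhs_ballP.
case: k c x cx => [|k] c x cx.
  by exists 1%R => //= y _ i; case: i.
(* The margin left by the worst coordinate; coordinate 0 seeds the maximum, so dimension 0 is
   treated apart. *)
pose d := (e - \big[Num.max/`|x ord0 ord0 - c ord0 ord0|]_i `|x i ord0 - c i ord0|)%R.
have d0 : (0 < d)%R.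
  by rewrite subr_gt0; apply/bigmax_ltP; split.
exists d => // y [_ /= xy] i.
have := xy i ord0; rewrite /ball/= => xyi.
have hi : (`|x i ord0 - c i ord0| <= e - d)%R.
  by rewrite /d opprB addrCA subrr addr0; exact: le_bigmax.
rewrite -(subrKA (x i ord0)) (le_lt_trans (ler_normD _ _))//.
by rewrite -(subrK d e) addrC ler_ltD// distrC.
Qed.

Lemma measurable_cube k (c : 'cV[R]_k) e : measurable (cube c e).
Proof. by apply: open_measurable_cV; exact: open_cube. Qed.

Lemma lebesgue_cube k (c : 'cV[R]_k) e : (0 < e)%R ->
  lam k (cube c e) = ((2 * e) ^+ k)%:E.
Proof.
move=> e0; elim: k c => [|k IH] c.
  rewrite (_ : cube c e = setT) ?lebesgue_cV0T//.
  by apply/seteqP; split=> // x _ [].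
rewrite lebesgue_cVS; last exact: measurable_cube.
pose c' : 'cV[R]_k := \col_i c (lift ord0 i) ord0.
rewrite (_ : _ @^-1` _ = (ball (c ord0 ord0) e : set (measurableTypeR R)) `*` cube c' e).
  rewrite product_measure1E//; [|exact: measurable_ball|exact: measurable_cube].
  rewrite exprS EFinM; congr (_ * _); last exact: IH.
  rewrite -[LHS]/(lebesgue_measure (ball (c ord0 ord0) e)).
  by rewrite lebesgue_measure_ball ?ltW// mulr_natl.
apply/seteqP; split=> -[x y] /=.
  move=> h; split=> [|i]; first by have := h ord0; rewrite consvE0 /ball/= distrC.
  by have := h (lift ord0 i); rewrite consvES mxE.
move=> [hx hy] i; case: (unliftP ord0 i) => [j ->|->].
  by rewrite consvES; have := hy j; rewrite mxE.
by rewrite consvE0 distrC.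
Qed.

Lemma lebesgue_cV_open_gt0 k (U : set 'cV[R]_k) x :
  open U -> U x -> 0 < lam k U.
Proof.
move=> oU Ux; have [e /= e0 eU] := (nbhs_ballP _ _).1 (open_nbhs_nbhs (conj oU Ux)).
apply: (@lt_le_trans _ _ (lam k (cube x e))).
  by rewrite lebesgue_cube// lte_fin exprn_gt0// mulr_gt0.
apply: le_measure; rewrite ?inE; [exact: measurable_cube|exact: open_measurable_cV|].
move=> y xy; apply: eU; split=> // i j; rewrite ord1 /ball/= distrC; exact: xy.
Qed.

Lemma product_open_gt0 d1 d2 (X : measurableType d1) (Y : measurableType d2)
    (m1 : {sigma_finite_measure set X -> \bar R})
    (m2 : {sigma_finite_measure set Y -> \bar R})
    (op1 : set (set X)) (op2 : set (set Y)) U x :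
  (forall V x, op1 V -> V x -> measurable V /\ 0 < m1 V) ->
  (forall V x, op2 V -> V x -> measurable V /\ 0 < m2 V) ->
  measurable U ->
  (exists V W, [/\ op1 V, op2 W, V x.1, W x.2 & V `*` W `<=` U]) ->
  0 < (m1 \x m2) U.
Proof.
move=> h1 h2 mU [V [W [oV oW Vx Wx VW]]].
have [mV V0] := h1 _ _ oV Vx; have [mW W0] := h2 _ _ oW Wx.
apply: (@lt_le_trans _ _ ((m1 \x m2) (V `*` W))).
  by rewrite product_measure1E// mule_gt0.
by apply: le_measure; rewrite ?inE//; exact: measurableX.
Qed.

Lemma lebesgue_E_open_gt0 n (U : set ('cV[R]_n * 'cV[R]_n)) x :
  open U -> U x -> 0 < lebE n U.
Proof.
move=> oU Ux; apply: (@product_open_gt0 _ _ _ _ (lam n) (lam n) open open U x).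
- by move=> V y oV Vy; split; [exact: open_measurable_cV|exact: (lebesgue_cV_open_gt0 oV Vy)].
- by move=> V y oV Vy; split; [exact: open_measurable_cV|exact: (lebesgue_cV_open_gt0 oV Vy)].
- exact: open_measurable_E.
- exact: (open_prod_rect oU Ux).
Qed.

Lemma lebesgue_N_open_gt0 n m (U : set ('cV[R]_n * 'cV[R]_n * 'cV[R]_m)) x :
  open U -> U x -> 0 < lebN n m U.
Proof.
move=> oU Ux.
apply: (@product_open_gt0 _ _ _ _ (lebE n) (lam m) open open U x).
- by move=> V y oV Vy; split; [exact: open_measurable_E|exact: (lebesgue_E_open_gt0 oV Vy)].
- by move=> V y oV Vy; split; [exact: open_measurable_cV|exact: (lebesgue_cV_open_gt0 oV Vy)].
- exact: open_measurable_N.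
- exact: (open_prod_rect oU Ux).
Qed.

End lebesgue_more.

(** * The modulus of a complex number as a real number *)

Section complex_norm.
Context {R : realType}.
Local Notation C := R[i].
Local Notation nc := (@Normc.normc R).
Implicit Types z w : C.

Lemma normc_ge0 z : 0 <= nc z.
Proof. by case: z => a b; exact: sqrtr_ge0. Qed.

Lemma normc_real (x : R) : nc x%:C%C = `|x|.
Proof. by rewrite /= expr0n/= addr0 sqrtr_sqr. Qed.

Lemma normc_pure (x : R) : nc (0 +i* x)%C = `|x|.
Proof. by rewrite /= expr0n/= add0r sqrtr_sqr. Qed.

Lemma normcB z w : nc (z - w) = nc (w - z).
Proof. by rewrite -normcN opprB. Qed.

Lemma normc_triB z w x : nc (z - w) <= nc (z - x) + nc (x - w).
Proof. by rewrite -[z - w](subrKA x) le_normcD. Qed.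

Lemma absRe_le_normc z : `|complex.Re z| <= nc z.
Proof.
by case: z => a b /=; rewrite -[leLHS]sqrtr_sqr ler_sqrt ?lerDl ?addr_ge0 ?sqr_ge0.
Qed.

Lemma absIm_le_normc z : `|complex.Im z| <= nc z.
Proof.
by case: z => a b /=; rewrite -[leLHS]sqrtr_sqr ler_sqrt ?lerDr ?addr_ge0 ?sqr_ge0.
Qed.

Lemma normc_le_ReIm z : nc z <= `|complex.Re z| + `|complex.Im z|.
Proof.
case: z => a b.
have -> : (a +i* b)%C = a%:C%C + (0 +i* b)%C.
  by rewrite /GRing.add/= addr0 add0r.
by rewrite (le_trans (le_normcD _ _))// normc_real normc_pure/= addr0 add0r.
Qed.

Lemma normc_gt0 z : z != 0 -> 0 < nc z.
Proof.
move=> z0; rewrite lt_neqAle normc_ge0 andbT eq_sym.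
by apply: contra z0 => /eqP/Normc.eq0_normc ->.
Qed.

Lemma normc_norm z : `|z| = (nc z)%:C%C.
Proof. by rewrite normc_def; case: z. Qed.

Lemma normc_ReJ z : complex.Re (z^*%C * z) = nc z ^+ 2.
Proof.
by case: z => a b /=; rewrite sqr_sqrtr ?addr_ge0 ?sqr_ge0// !expr2 mulNr opprK.
Qed.

Lemma normc_conj z : nc (z^*%C) = nc z.
Proof. by case: z => a b /=; rewrite sqrrN. Qed.

Lemma Re_mul_real (x : R) z : complex.Re (x%:C%C * z) = x * complex.Re z.
Proof. by case: z => a b /=; rewrite mul0r subr0. Qed.

Lemma normc_prod (I : Type) (s : seq I) (P : pred I) (F : I -> C) :
  nc (\prod_(i <- s | P i) F i) = \prod_(i <- s | P i) nc (F i).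
Proof.
apply: (big_morph nc); first by move=> x y; exact: Normc.normcM.
exact: Normc.normc1.
Qed.

Lemma normcX z k : nc (z ^+ k) = nc z ^+ k.
Proof.
elim: k => [|k IH]; first by rewrite !expr0 Normc.normc1.
by rewrite !exprS Normc.normcM IH.
Qed.

Lemma normc_sum (I : Type) (s : seq I) (P : pred I) (F : I -> C) :
  nc (\sum_(i <- s | P i) F i) <= \sum_(i <- s | P i) nc (F i).
Proof.
elim/big_rec2: _ => [|i y x _ h]; first by rewrite Normc.normc0.
by rewrite (le_trans (le_normcD _ _))// lerD2l.
Qed.

End complex_norm.

(** * Integrals of complex functions over a segment *)

Section complex_integral.
Context {R : realType}.
Local Notation C := R[i].
Local Notation nc := (@Normc.normc R).
Local Notation mu := (@lebesgue_measure R).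
Local Notation Re := (@complex.Re R).
Local Notation Im := (@complex.Im R).
Implicit Types (h : R -> C) (a b : R).

(** Continuity relative to the segment, in epsilon form with real moduli: nothing is asked outside
    [a, b]. *)
Definition ccont a b h := forall x, a <= x <= b -> forall e, 0 < e ->
  exists2 d, 0 < d & forall y, a <= y <= b -> `|y - x| < d -> nc (h y - h x) < e.

Definition cint a b h : C :=
  ((\int[mu]_(x in `[a, b]) Re (h x)) +i* (\int[mu]_(x in `[a, b]) Im (h x)))%C.

Definition cintegrable a b h :=
  mu.-integrable `[a, b] (EFin \o (fun x => Re (h x))) /\
  mu.-integrable `[a, b] (EFin \o (fun x => Im (h x))).

(** Retraction onto [a, b]. Composing with it extends a function continuous on the segment to one
    continuous on the line. *)
Definition clamp a b (x : R) := if x <= a then a else if b <= x then b else x.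

Lemma clamp_itv a b x : a <= b -> a <= clamp a b x <= b.
Proof.
by rewrite /clamp => ab; case: (leP x a) => xa; [|case: (leP b x) => bx]; apply/andP; split; lra.
Qed.

Lemma clamp_id a b x : a <= x <= b -> clamp a b x = x.
Proof.
by rewrite /clamp => /andP[ax xb]; case: (leP x a) => xa; [|case: (leP b x) => bx]; lra.
Qed.

Lemma clamp_lip a b x y : a <= b -> `|clamp a b y - clamp a b x| <= `|y - x|.
Proof.
rewrite /clamp => ab; case: (leP x a) => xa; case: (leP y a) => ya;
  try case: (leP b x) => bx; try case: (leP b y) => by_;
  rewrite ler_norml; case: (ger0P (y - x)) => ?; apply/andP; split; lra.
Qed.

Lemma continuous_epsP (f : R -> R) :
  (forall x e, 0 < e -> exists2 d, 0 < d &
    forall y, `|y - x| < d -> `|f y - f x| < e) -> continuous f.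
Proof.
move=> hf x; apply/cvgrPdist_lt => e e0.
have [d d0 hd] := hf x e e0.
by exists d => // y /=; rewrite distrC => /hd; rewrite distrC.
Qed.

Lemma itv_continuous (f : R -> R) a b : a <= b ->
  (forall x, a <= x <= b -> forall e, 0 < e -> exists2 d, 0 < d &
    forall y, a <= y <= b -> `|y - x| < d -> `|f y - f x| < e) ->
  {within `[a, b], continuous f}.
Proof.
move=> ab hf; apply: (@subspace_eq_continuous _ _ _ (f \o clamp a b)).
  by move=> x /[!inE]/=; rewrite in_itv/= => /clamp_id ->.
apply: continuous_subspaceT; apply: continuous_epsP => x e e0.
have [d d0 hd] := hf _ (clamp_itv x ab) e e0.
exists d => // y yx; apply: hd; first exact: clamp_itv.
exact: le_lt_trans (clamp_lip _ _ ab) yx.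
Qed.

Lemma ccontD a b h1 h2 : ccont a b h1 -> ccont a b h2 ->
  ccont a b (fun x => h1 x + h2 x).
Proof.
move=> c1 c2 x xab e e0; have e20 : 0 < e / 2 by rewrite divr_gt0.
have [d1 d10 hd1] := c1 x xab _ e20; have [d2 d20 hd2] := c2 x xab _ e20.
exists (Num.min d1 d2); first by rewrite lt_min d10.
move=> y yab; rewrite lt_min => /andP[y1 y2].
rewrite opprD addrACA (le_lt_trans (le_normcD _ _))// (splitr e).
by rewrite ltrD ?hd1 ?hd2.
Qed.

Lemma ccontM a b h1 h2 : ccont a b h1 -> ccont a b h2 ->
  ccont a b (fun x => h1 x * h2 x).
Proof.
move=> c1 c2 x xab e e0.
pose A := nc (h1 x) + nc (h2 x) + 1.
have A0 : 0 < A by rewrite ltr_wpDl ?addr_ge0 ?normc_ge0.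
pose e' := Num.min 1 (e / (2 * A)).
have e'0 : 0 < e' by rewrite lt_min ltr01 divr_gt0// mulr_gt0.
have [d1 d10 hd1] := c1 x xab _ e'0; have [d2 d20 hd2] := c2 x xab _ e'0.
exists (Num.min d1 d2); first by rewrite lt_min d10.
move=> y yab; rewrite lt_min => /andP[y1 y2].
have := hd1 y yab y1; have := hd2 y yab y2.
set u := h1 y - h1 x; set v := h2 y - h2 x => hv hu.
have -> : h1 y * h2 y - h1 x * h2 x = h1 x * v + u * h2 x + u * v.
  by rewrite /u /v; ring.
apply: (@le_lt_trans _ _ (nc (h1 x) * e' + e' * nc (h2 x) + e' * 1)).
  rewrite (le_trans (le_normcD _ _))// lerD//; last first.
    rewrite Normc.normcM ler_pM ?normc_ge0 ?ltW//.
    by rewrite (lt_le_trans hv)// /e' ge_min lexx.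
  rewrite (le_trans (le_normcD _ _))// !Normc.normcM lerD//.
    by rewrite ler_wpM2l ?normc_ge0 ?ltW.
  by rewrite ler_wpM2r ?normc_ge0 ?ltW.
have -> : nc (h1 x) * e' + e' * nc (h2 x) + e' * 1 = e' * A by rewrite /A; ring.
apply: (@le_lt_trans _ _ (e / (2 * A) * A)).
  by apply: ler_wpM2r; [exact: ltW|rewrite /e' ge_min lexx orbT].
rewrite invfM mulrA divfK ?gt_eqF//.
by rewrite ltr_pdivrMr// ltr_pMr// ltr1n.
Qed.

Lemma ccont_cst a b k : ccont a b (fun=> k).
Proof. by move=> x xab e e0; exists 1 => // y _ _; rewrite subrr Normc.normc0. Qed.

Lemma ccont_integrable a b h : a <= b -> ccont a b h -> cintegrable a b h.
Proof.
move=> ab ch; split; apply: continuous_compact_integrable;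
  [exact: segment_compact| |exact: segment_compact|];
  apply: itv_continuous => // x xab e e0; have [d d0 hd] := ch x xab e e0;
  exists d => // y yab yx.
- apply: le_lt_trans (hd y yab yx).
  by rewrite (le_trans _ (absRe_le_normc _))// raddfB.
- apply: le_lt_trans (hd y yab yx).
  by rewrite (le_trans _ (absIm_le_normc _))// raddfB.
Qed.

Lemma ccont_normc a b h : a <= b -> ccont a b h ->
  mu.-integrable `[a, b] (EFin \o (fun x => nc (h x))).
Proof.
move=> ab ch; apply: continuous_compact_integrable; first exact: segment_compact.
apply: itv_continuous => // x xab e e0; have [d d0 hd] := ch x xab e e0.
exists d => // y yab yx; apply: le_lt_trans (hd y yab yx).
rewrite ler_norml lerBlDr -[X in _ && (_ <= X + _)]/(nc (h y - h x)).
rewrite lerNl opprB lerBlDr; apply/andP; split.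
  by rewrite normcB -{1}[h x](subrK (h y)) le_normcD.
by rewrite -{1}[h y](subrK (h x)) le_normcD.
Qed.

Lemma cintD a b h1 h2 : cintegrable a b h1 -> cintegrable a b h2 ->
  cint a b (fun x => h1 x + h2 x) = cint a b h1 + cint a b h2.
Proof.
move=> [r1 i1] [r2 i2]; rewrite /cint [RHS]/GRing.add/=; congr Complex.
  by rewrite -RintegralD//; apply: eq_Rintegral => x _; rewrite raddfD.
by rewrite -RintegralD//; apply: eq_Rintegral => x _; rewrite raddfD.
Qed.

Let mI a b : measurable (`[a, b]%classic : set (measurableTypeR R)).
Proof. exact: measurable_itv. Qed.

Let integrableZ a b (f : R -> R) k : mu.-integrable `[a, b] (EFin \o f) ->
  mu.-integrable `[a, b] (EFin \o (fun x => k * f x)).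
Proof.
move=> fi; have := @integrableZl _ _ _ mu _ (mI a b) k _ fi.
by apply: eq_integrable => // x _ /=; rewrite EFinM.
Qed.

Lemma cintegrableZ a b k h : cintegrable a b h -> cintegrable a b (fun x => k * h x).
Proof.
move=> [hr hi]; split.
  have := integrableB (mI a b) (integrableZ (Re k) hr) (integrableZ (Im k) hi).
  by apply: eq_integrable => // x _ /=; case: k (h x) => ? ? [].
have := integrableD (mI a b) (integrableZ (Re k) hi) (integrableZ (Im k) hr).
by apply: eq_integrable => // x _ /=; case: k (h x) => ? ? [].
Qed.

Lemma cintZ a b k h : cintegrable a b h ->
  cint a b (fun x => k * h x) = k * cint a b h.
Proof.
move=> [hr hi]; rewrite /cint; case: k => p q; rewrite [RHS]/GRing.mul/=.
congr Complex.
  rewrite -!RintegralZl// -RintegralB//; [|exact: integrableZ..].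
  by apply: eq_Rintegral => x _; case: (h x).
rewrite -!RintegralZl// -RintegralD//; [|exact: integrableZ..].
by apply: eq_Rintegral => x _; case: (h x).
Qed.

Lemma cintB a b h1 h2 : cintegrable a b h1 -> cintegrable a b h2 ->
  cint a b (fun x => h1 x - h2 x) = cint a b h1 - cint a b h2.
Proof.
move=> i1 i2; rewrite -mulN1r -cintZ// -cintD//; last exact: cintegrableZ.
by congr cint; apply/funext => x; rewrite mulN1r.
Qed.

Lemma cint_cst a b k : a <= b -> cint a b (fun=> k) = (b - a)%:C%C * k.
Proof.
move=> ab; rewrite /cint !Rintegral_cst//= lebesgue_measure_itv/= lte_fin.
have -> : fine (if (a < b)%R then b%:E - a%:E else 0)%E = b - a.
  case: ifPn => //; rewrite -leNgt => ba.
  by rewrite (@le_anti _ _ b a) ?ab ?ba// subrr.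
by case: k => p q; rewrite [RHS]/GRing.mul/= !mul0r subr0 addr0 mulrC [q * _]mulrC.
Qed.

Lemma cint_split a m b h : a <= m -> m <= b -> cintegrable a b h ->
  cint a b h = cint a m h + cint m b h.
Proof.
move=> am mb [hr hi]; rewrite /cint [RHS]/GRing.add/=.
have H (f : R -> R) : mu.-integrable `[a, b] (EFin \o f) ->
  \int[mu]_(x in `[a, b]) f x =
  \int[mu]_(x in `[a, m]) f x + \int[mu]_(x in `[m, b]) f x.
  move=> fi.
  have h1 : (BLeft a <= BRight m)%O by rewrite bnd_simp.
  have h2 : (BRight m <= BRight b)%O by rewrite bnd_simp.
  rewrite -(Rintegral_itv_obnd_cbnd (r := m)); last first.
    by apply: integrableS fi => //; apply: subset_itv.
  by rewrite -(Rintegral_itvB fi h1 h2) addrC subrK.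
by congr Complex; exact: H.
Qed.

(** Real and imaginary parts are bounded separately, whence the factor 2. Sharp constants are never
    at stake later. *)
Lemma normc_cint_le a b h M : a <= b -> cintegrable a b h ->
  (forall x, a <= x <= b -> nc (h x) <= M) ->
  nc (cint a b h) <= 2 * M * (b - a).
Proof.
move=> ab [hr hi] hM; rewrite (le_trans (normc_le_ReIm _))// /cint/=.
have H (f : R -> R) : mu.-integrable `[a, b] (EFin \o f) ->
  (forall x, a <= x <= b -> `|f x| <= M) -> `|\int[mu]_(x in `[a, b]) f x| <= M * (b - a).
  move=> fi fM; rewrite (le_trans (le_normr_Rintegral (mI a b) fi))//.
  have -> : M * (b - a) = \int[mu]_(x in `[a, b]) M.
    rewrite Rintegral_cst//= lebesgue_measure_itv/= lte_fin.
    case: ifPn => //; rewrite -leNgt => ba.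
    by rewrite (@le_anti _ _ b a) ?ab ?ba// subrr.
  apply: le_Rintegral => //.
  - exact: integrable_norm.
  - by apply: continuous_compact_integrable; [exact: segment_compact|move=> ?; exact: cvg_cst].
have -> : 2 * M * (b - a) = M * (b - a) + M * (b - a) by ring.
apply: lerD; apply: H => // x xab; rewrite (le_trans _ (hM x xab))//.
  exact: absRe_le_normc.
exact: absIm_le_normc.
Qed.

Lemma normc_cint_le_integral a b h : a <= b -> ccont a b h ->
  ((nc (cint a b h))%:E <= 2%:E * \int[mu]_(x in `[a, b]) (nc (h x))%:E)%E.
Proof.
move=> ab ch; have [hr hi] := ccont_integrable ab ch.
have hn := ccont_normc ab ch.
have H (f : R -> R) : mu.-integrable `[a, b] (EFin \o f) ->
  (forall x, `|f x| <= nc (h x)) ->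
  (`|\int[mu]_(x in `[a, b]) f x|%:E <= \int[mu]_(x in `[a, b]) (nc (h x))%:E)%E.
  move=> fi fM; rewrite EFin_normr_Rintegral//.
  have mf := measurable_int mu fi.
  rewrite (le_trans (le_abse_integral mu (mI a b) mf))//.
  apply: ge0_le_integral => //; [exact: measurableT_comp|exact: (measurable_int mu hn)|].
  by move=> x _; rewrite /= lee_fin.
apply: (@le_trans _ _ (`|Re (cint a b h)|%:E + `|Im (cint a b h)|%:E)%E).
  by rewrite -EFinD lee_fin normc_le_ReIm.
rewrite /cint/= (_ : 2%:E = 1 + 1)%E// ge0_muleDl// !mul1e leeD//; apply: H => // x.
  exact: absRe_le_normc.
exact: absIm_le_normc.
Qed.

End complex_integral.

(** * Bisection of a rectangle *)

Section bisection.
Context {R : realType}.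
Variables (J : R -> R -> R -> R -> R) (a b c d : R).
Hypotheses (ab : a <= b) (cd : c <= d).
Hypothesis J_ge0 : forall a' b' c' d', 0 <= J a' b' c' d'.
Hypothesis J_quarter : forall a' b' c' d', a <= a' -> a' <= b' -> b' <= b ->
  c <= c' -> c' <= d' -> d' <= d -> let m := (a' + b') / 2 in
  let k := (c' + d') / 2 in
  J a' b' c' d' <= J a' m c' k + J m b' c' k + J a' m k d' + J m b' k d'.
Hypothesis J_local : forall p q, a <= p <= b -> c <= q <= d ->
  forall e, 0 < e -> exists2 del, 0 < del & forall a' b' c' d',
    a <= a' -> a' <= p -> p <= b' -> b' <= b ->
    c <= c' -> c' <= q -> q <= d' -> d' <= d ->
    b' - a' < del -> d' - c' < del ->
    J a' b' c' d' <= e * ((b' - a') + (d' - c')) ^+ 2.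

Let rect := (R * R * (R * R))%type.
Let JJ (Q : rect) := J Q.1.1 Q.1.2 Q.2.1 Q.2.2.
(** The fourth quarter is taken by default: if the first three stay below a fourth of [J],
    subadditivity forces it to reach that fourth. *)
Let next (Q : rect) : rect :=
  let: ((a', b'), (c', d')) := Q in
  let m := (a' + b') / 2 in let k := (c' + d') / 2 in
  if JJ Q / 4 <= J a' m c' k then ((a', m), (c', k)) else
  if JJ Q / 4 <= J m b' c' k then ((m, b'), (c', k)) else
  if JJ Q / 4 <= J a' m k d' then ((a', m), (k, d')) else
  ((m, b'), (k, d')).

Let inside (Q : rect) := [/\ a <= Q.1.1, Q.1.1 <= Q.1.2 & Q.1.2 <= b] /\
  [/\ c <= Q.2.1, Q.2.1 <= Q.2.2 & Q.2.2 <= d].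

Let nextP Q : inside Q -> [/\ inside (next Q), JJ Q / 4 <= JJ (next Q),
  (next Q).1.2 - (next Q).1.1 = (Q.1.2 - Q.1.1) / 2,
  (next Q).2.2 - (next Q).2.1 = (Q.2.2 - Q.2.1) / 2 &
  (Q.1.1 <= (next Q).1.1 /\ (next Q).1.2 <= Q.1.2) /\
  (Q.2.1 <= (next Q).2.1 /\ (next Q).2.2 <= Q.2.2)].
Proof.
case: Q => -[a' b'] [c' d'] [/= [h1 h2 h3] [h4 h5 h6]].
have := J_quarter h1 h2 h3 h4 h5 h6; rewrite /next /inside /JJ /=.
set m := (a' + b') / 2; set k := (c' + d') / 2 => hq.
have mE : m = (a' + b') / 2 by []. have kE : k = (c' + d') / 2 by [].
case: (leP (J a' b' c' d' / 4) (J a' m c' k)) => j1 /=.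
  by split => //; try (split; split); lra.
case: (leP (J a' b' c' d' / 4) (J m b' c' k)) => j2 /=.
  by split => //; try (split; split); lra.
case: (leP (J a' b' c' d' / 4) (J a' m k d')) => j3 /=.
  by split => //; try (split; split); lra.
by split => //; try (split; split); lra.
Qed.

(** Goursat's argument in abstract form: some quarter always keeps a fourth of [J], while near the
    common point of the nested rectangles [J] is an arbitrarily small multiple of the squared size,
    and the latter also shrinks by four at each step. *)
Lemma bisection : J a b c d = 0.
Proof.
pose Q n := iter n next ((a, b), (c, d)).
have Qin n : inside (Q n).
  by elim: n => [|n IH]; [by []|have [] := nextP IH].
have QJ n : J a b c d / 4 ^+ n <= JJ (Q n).
  elim: n => [|n IH]; first by rewrite expr0 divr1.
  have [_ h _ _ _] := nextP (Qin n); apply: le_trans h.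
  by rewrite exprSr invfM mulrA ler_pM2r.
have Qw n : (Q n).1.2 - (Q n).1.1 = (b - a) / 2 ^+ n.
  elim: n => [|n IH]; first by rewrite expr0 divr1.
  by have [_ _ -> _ _] := nextP (Qin n); rewrite IH exprSr invfM mulrA.
have Qh n : (Q n).2.2 - (Q n).2.1 = (d - c) / 2 ^+ n.
  elim: n => [|n IH]; first by rewrite expr0 divr1.
  by have [_ _ _ -> _] := nextP (Qin n); rewrite IH exprSr invfM mulrA.
have mono n k : ((Q n).1.1 <= (Q (n + k)%N).1.1 /\ (Q (n + k)%N).1.2 <= (Q n).1.2) /\
    ((Q n).2.1 <= (Q (n + k)%N).2.1 /\ (Q (n + k)%N).2.2 <= (Q n).2.2).
  elim: k => [|k [[i1 i2] [i3 i4]]]; first by rewrite addn0.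
  rewrite addnS; have [_ _ _ _ [[j1 j2] [j3 j4]]] := nextP (Qin (n + k)%N).
  split; split; [exact: le_trans j1|exact: le_trans i2|exact: le_trans j3|exact: le_trans i4].
have crossx n k : (Q n).1.1 <= (Q k).1.2.
  have [[i1 _] _] := mono n k; have [[_ i2] _] := mono k n.
  have [[_ h _] _] := Qin (n + k)%N.
  by rewrite (le_trans i1)// (le_trans h)// addnC.
have crossy n k : (Q n).2.1 <= (Q k).2.2.
  have [_ [i1 _]] := mono n k; have [_ [_ i2]] := mono k n.
  have [_ [_ h _]] := Qin (n + k)%N.
  by rewrite (le_trans i1)// (le_trans h)// addnC.
(* The suprema of the left and of the lower ends give a point common to all the rectangles. *)
pose A := [set (Q n).1.1 | n in setT]; pose C := [set (Q n).2.1 | n in setT].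
have supA k : ubound A (Q k).1.2 by move=> _ [n _ <-]; exact: crossx.
have supC k : ubound C (Q k).2.2 by move=> _ [n _ <-]; exact: crossy.
have A0 : A !=set0 by exists (Q 0).1.1; exists 0%N.
have C0 : C !=set0 by exists (Q 0).2.1; exists 0%N.
have hsA : has_sup A by split => //; exists (Q 0).1.2.
have hsC : has_sup C by split => //; exists (Q 0).2.2.
have pl n : (Q n).1.1 <= sup A by apply: ub_le_sup; [exact: hsA.2|exists n].
have pu n : sup A <= (Q n).1.2 by exact: ge_sup.
have ql n : (Q n).2.1 <= sup C by apply: ub_le_sup; [exact: hsC.2|exists n].
have qu n : sup C <= (Q n).2.2 by exact: ge_sup.
apply/eqP; apply: contraT => J0.
have {}J0 : 0 < J a b c d by rewrite lt_neqAle eq_sym J0 J_ge0.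
(* The added 1 keeps [S] positive for a degenerate rectangle. With e = J / (2 S^2) the local bound
   yields J <= J / 2. *)
pose S := (b - a) + (d - c) + 1.
have S0 : 0 < S by rewrite ltr_wpDl// addr_ge0// subr_ge0.
have e0 : 0 < J a b c d / 2 / S ^+ 2 by rewrite !divr_gt0// exprn_gt0.
have pab : a <= sup A <= b by rewrite (pl 0%N) (pu 0%N).
have qcd : c <= sup C <= d by rewrite (ql 0%N) (qu 0%N).
have [del del0 hdel] := J_local pab qcd e0.
pose n := (Num.truncn (S / del)).+1.
have hn : S / 2 ^+ n < del.
  rewrite ltr_pdivrMr ?exprn_gt0// mulrC -ltr_pdivrMr//.
  apply: (lt_le_trans (truncnS_gt _)); rewrite -/n -natrX ler_nat.
  by rewrite ltnW// ltn_expl.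
have h2n : 0 < 2 ^+ n :> R by rewrite exprn_gt0.
have hw : (b - a) / 2 ^+ n <= S / 2 ^+ n by rewrite ler_pM2r ?invr_gt0// /S; lra.
have hh : (d - c) / 2 ^+ n <= S / 2 ^+ n by rewrite ler_pM2r ?invr_gt0// /S; lra.
have [[g1 g2 g3] [g4 g5 g6]] := Qin n.
have := hdel _ _ _ _ g1 (pl n) (pu n) g3 g4 (ql n) (qu n) g6.
rewrite Qw Qh => /(_ (le_lt_trans hw hn) (le_lt_trans hh hn)).
rewrite -mulrDl => h; have := le_trans (QJ n) h.
have h24 : 2 ^+ 2 = 4 :> R by rewrite expr2 -natrM.
rewrite expr_div_n -exprM mulnC exprM h24.
rewrite mulrA ler_pM2r ?invr_gt0 ?exprn_gt0// leNgt => /negP[].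
have hS : ((b - a) + (d - c)) ^+ 2 <= S ^+ 2.
  by rewrite ler_sqr ?nnegrE /S; lra.
apply: (@le_lt_trans _ _ (J a b c d / 2 / S ^+ 2 * S ^+ 2)).
  by rewrite ler_pM2l.
by rewrite divfK ?gt_eqF ?exprn_gt0//; lra.
Qed.

End bisection.

(** * Complex differentiability with explicit derivative *)

Section cdiff.
Context {R : realType}.
Local Notation C := R[i].
Local Notation nc := (@Normc.normc R).
Implicit Types (f : C -> C) (z l : C).

Definition cdiff f z l := forall e, 0 < e -> exists2 d, 0 < d &
  forall w, nc (w - z) < d -> nc (f w - f z - l * (w - z)) <= e * nc (w - z).

Definition ccont_at f z := forall e, 0 < e -> exists2 d, 0 < d &
  forall w, nc (w - z) < d -> nc (f w - f z) < e.

Lemma cdiff_cont f z l : cdiff f z l -> ccont_at f z.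
Proof.
move=> df e e0; have [d d0 hd] := df 1 ltr01.
have L0 : 0 < 1 + nc l by rewrite ltr_pwDl ?normc_ge0.
exists (Num.min d (e / (1 + nc l))); first by rewrite lt_min d0 divr_gt0.
move=> w; rewrite lt_min => /andP[wd]; rewrite ltr_pdivlMr// => we.
apply: le_lt_trans we.
rewrite -[f w - f z](subrK (l * (w - z))) (le_trans (le_normcD _ _))//.
rewrite Normc.normcM [leRHS]mulrDr mulr1 lerD//; last by rewrite mulrC.
by rewrite (le_trans (hd _ wd))// mul1r.
Qed.

Lemma ccont_comp f (g : R -> C) L a b : 0 <= L ->
  (forall x y, nc (g y - g x) <= L * `|y - x|) ->
  (forall x, a <= x <= b -> ccont_at f (g x)) -> ccont a b (f \o g).
Proof.
move=> L0 gL fc x xab e e0; have [d d0 hd] := fc x xab e e0.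
have L1 : 0 < L + 1 by rewrite ltr_wpDl.
exists (d / (L + 1)); first by rewrite divr_gt0.
move=> y _; rewrite ltr_pdivlMr// => yd; apply: hd; apply: (le_lt_trans (gL x y)).
by apply: le_lt_trans yd; rewrite mulrC ler_wpM2l// lerDl.
Qed.

Lemma ccont_lip a b (h : R -> C) L : 0 <= L ->
  (forall x y, a <= x <= b -> a <= y <= b -> nc (h y - h x) <= L * `|y - x|) ->
  ccont a b h.
Proof.
move=> L0 hL x xab e e0; have L1 : 0 < L + 1 by rewrite ltr_wpDl.
exists (e / (L + 1)); first by rewrite divr_gt0.
move=> y yab; rewrite ltr_pdivlMr// => ye; apply: (le_lt_trans (hL _ _ xab yab)).
by apply: le_lt_trans ye; rewrite mulrC ler_wpM2l// lerDl.
Qed.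

End cdiff.

(** * Goursat's theorem on a sector for the form dz / z *)

Section sector.
Context {R : realType}.
Local Notation C := R[i].
Local Notation nc := (@Normc.normc R).
Local Notation I := ('i%C : C).

(** The points r (1 + i y) with r > 0 and |y| <= 1 fill the sector |arg z| <= pi / 4, and the curves
    r = const are vertical segments. [kap] is the logarithmic derivative of [ray]. *)
Definition ray (y : R) : C := (1 +i* y)%C.
Definition sig (r y : R) : C := r%:C%C * ray y.
Definition kap (y : R) : C := I / ray y.

Lemma ray_ge1 y : 1 <= nc (ray y).
Proof.
rewrite /= -[leLHS]sqrtr1 expr1n ler_sqrt ?lerDl ?sqr_ge0//.
by rewrite addr_ge0 ?sqr_ge0.
Qed.

Lemma ray_le2 y : -1 <= y <= 1 -> nc (ray y) <= 2.
Proof.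
move=> /andP[y1 y2]; rewrite (le_trans (normc_le_ReIm _))//= normr1.
by rewrite (_ : 2 = 1 + 1)// lerD2l ler_norml y1.
Qed.

Lemma ray_neq0 y : ray y != 0.
Proof. by rewrite /ray eq_complex /= oner_eq0. Qed.

Lemma normcI : nc I = 1.
Proof. by rewrite normc_pure normr1. Qed.

Lemma rayB y y' : ray y' - ray y = (0 +i* (y' - y))%C.
Proof. by rewrite /ray /GRing.add/= subrr. Qed.

Lemma kap_lip x y : nc (kap y - kap x) <= `|y - x|.
Proof.
have -> : kap y - kap x = I * ((ray x - ray y) / (ray y * ray x)).
  by rewrite /kap; field; rewrite !ray_neq0.
rewrite !Normc.normcM normcI mul1r rayB normc_pure Normc.normcV Normc.normcM.
have h : 1 <= nc (ray y) * nc (ray x).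
  apply: (@le_trans _ _ (1 * 1)); first by rewrite mulr1.
  by apply: ler_pM; rewrite ?ray_ge1.
rewrite distrC ler_piMr// invf_le1//; exact: lt_le_trans h.
Qed.

Lemma kap_le1 y : nc (kap y) <= 1.
Proof.
rewrite Normc.normcM normcI mul1r Normc.normcV invf_le1 ?ray_ge1//.
by rewrite normc_gt0// ray_neq0.
Qed.

Lemma sig_lipy r x y : nc (sig r y - sig r x) <= `|r| * `|y - x|.
Proof. by rewrite /sig -mulrBr Normc.normcM normc_real rayB normc_pure. Qed.

Lemma sig_lipr y r s : nc (sig s y - sig r y) <= nc (ray y) * `|s - r|.
Proof. by rewrite /sig -mulrBl -rmorphB Normc.normcM normc_real mulrC. Qed.

Lemma real_inv_lip a r s : 0 < a -> a <= r -> a <= s ->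
  nc ((s^-1)%:C%C - (r^-1)%:C%C) <= a^-1 ^+ 2 * `|s - r|.
Proof.
move=> a0 ar as_; have r0 : 0 < r by exact: lt_le_trans ar.
have s0 : 0 < s by exact: lt_le_trans as_.
rewrite -rmorphB normc_real.
have -> : s^-1 - r^-1 = (s^-1 * r^-1) * (r - s).
  by field; rewrite !gt_eqF.
rewrite normrM distrC ler_wpM2r// ger0_norm; last first.
  by rewrite mulr_ge0// invr_ge0 ltW.
by rewrite expr2; apply: ler_pM; rewrite ?invr_ge0 ?(ltW r0) ?(ltW s0)// lef_pV2 ?posrE.
Qed.

(** The integral of f(z) dz / z over the boundary of the image of the rectangle: in the coordinates
    of [sig] the form dz / z is dr / r + kap(y) dy. *)
Definition Jsec (f : C -> C) a b c d : C :=
  cint c d (fun y => (f (sig b y) - f (sig a y)) * kap y) -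
  cint a b (fun r => (f (sig r d) - f (sig r c)) * (r^-1)%:C%C).

Definition Jok (f : C -> C) a b c d :=
  cintegrable c d (fun y => (f (sig b y) - f (sig a y)) * kap y) /\
  cintegrable a b (fun r => (f (sig r d) - f (sig r c)) * (r^-1)%:C%C).

Definition secin (a b c d : R) := [/\ 0 < a, a <= b & b <= 1] /\
  [/\ -1 <= c, c <= d & d <= (1 : R)].

Lemma Jok_cont f a b c d : secin a b c d ->
  (forall r y, a <= r <= b -> c <= y <= d -> ccont_at f (sig r y)) ->
  Jok f a b c d.
Proof.
move=> [[a0 ab b1] [c1 cd d1]] fc; split; apply: ccont_integrable => //.
- apply: ccontM; last by apply: (@ccont_lip _ _ _ _ 1) => // x y _ _; rewrite mul1r kap_lip.
  under eq_fun do rewrite -mulN1r.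
  apply: ccontD.
    apply: (ccont_comp (L := `|b|)) => //; first exact: sig_lipy.
    by move=> y ycd; apply: fc; rewrite // ab lexx.
  apply: ccontM; first exact: ccont_cst.
  apply: (ccont_comp (L := `|a|)) => //; first exact: sig_lipy.
  by move=> y ycd; apply: fc; rewrite // ab lexx.
- apply: ccontM; last first.
    apply: (@ccont_lip _ _ _ _ (a^-1 ^+ 2)); first by rewrite sqr_ge0.
    by move=> x y /andP[ax _] /andP[ay _]; exact: real_inv_lip.
  under eq_fun do rewrite -mulN1r.
  apply: ccontD.
    apply: (ccont_comp (g := fun r => sig r d) (L := nc (ray d))); first exact: normc_ge0.
      by move=> x y; exact: sig_lipr.
    by move=> y ycd; apply: fc; rewrite // cd lexx.
  apply: ccontM; first exact: ccont_cst.
  apply: (ccont_comp (g := fun r => sig r c) (L := nc (ray c))); first exact: normc_ge0.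
    by move=> x y; exact: sig_lipr.
  by move=> y ycd; apply: fc; rewrite // cd lexx.
Qed.

Lemma JsecB f g a b c d : Jok f a b c d -> Jok g a b c d ->
  Jsec (fun z => f z - g z) a b c d = Jsec f a b c d - Jsec g a b c d.
Proof.
move=> [f1 f2] [g1 g2]; rewrite /Jsec.
set u1 := cint c d _ in f1 *; set u2 := cint a b _ in f2 *.
set v1 := cint c d (fun y => (f _ - _) * _); set v2 := cint a b (fun r => (f _ - _) * _).
set w1 := cint c d (fun y => (g _ - _) * _); set w2 := cint a b (fun r => (g _ - _) * _).
have -> : u1 = v1 - w1.
  by rewrite /v1 /w1 -cintB//; congr cint; apply/funext => x; ring.
have -> : u2 = v2 - w2.
  by rewrite /v2 /w2 -cintB//; congr cint; apply/funext => x; ring.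
by ring.
Qed.

(** The constant cancels in each difference, and the linear term contributes be (b - a) (d - c) i to
    both integrals. *)
Lemma Jsec_affine al be a b c d : secin a b c d ->
  Jsec (fun z => al + be * z) a b c d = 0.
Proof.
move=> [[a0 ab b1] [c1 cd d1]]; rewrite /Jsec.
have -> : (fun y => (al + be * sig b y - (al + be * sig a y)) * kap y) =
   (fun=> be * (b - a)%:C%C * I).
  apply/funext => y; rewrite /sig /kap rmorphB; field; exact: ray_neq0.
have -> : cint a b (fun r => (al + be * sig r d - (al + be * sig r c)) * (r^-1)%:C%C) =
   cint a b (fun=> be * ((d - c)%:C%C * I)).
  have H r : a <= r <= b ->
      (al + be * sig r d - (al + be * sig r c)) * (r^-1)%:C%C = be * ((d - c)%:C%C * I).
    move=> /andP[ar _].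
    have r0 : r != 0 by rewrite gt_eqF// (lt_le_trans a0).
    have rc : (r%:C%C : C) != 0 by rewrite eq_complex/= negb_and r0.
    have -> : (r^-1)%:C%C = (r%:C%C)^-1 :> C by rewrite fmorphV.
    rewrite -[(d - c)%:C%C * I]/((d - c)%:C%C * I) -(_ : ray d - ray c = (d - c)%:C%C * I).
      by rewrite /sig; field.
    by rewrite rayB; apply/eqP; rewrite eq_complex/= ?mulr0 ?mul0r ?mulr1 ?subrr ?addr0 ?add0r !eqxx.
  rewrite /cint; congr Complex; apply: eq_Rintegral => r;
  by rewrite inE/= in_itv/= => /H ->.
rewrite !cint_cst//; ring.
Qed.

Lemma Jsec_bound E a b c d M : secin a b c d -> Jok E a b c d -> 0 <= M ->
  (forall r y, a <= r <= b -> c <= y <= d -> nc (E (sig r y)) <= M) ->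
  nc (Jsec E a b c d) <= 4 * M * ((d - c) + (b - a) / a).
Proof.
move=> [[a0 ab b1] [c1 cd d1]] [i1 i2] M0 hE.
rewrite /Jsec (le_trans (le_normcD _ _))// normcN mulrDr lerD//.
  apply: (le_trans (normc_cint_le (M := 2 * M) cd i1 _)); last first.
    by rewrite mulrA -natrM.
  move=> y ycd; rewrite Normc.normcM.
  apply: (@le_trans _ _ (2 * M * 1)); last by rewrite mulr1.
  rewrite ler_pM ?normc_ge0 ?kap_le1// (le_trans (le_normcD _ _))// normcN.
  by rewrite mulr2n mulrDl mul1r lerD// hE// ?ab ?lexx.
apply: (le_trans (normc_cint_le (M := 2 * M / a) ab i2 _)); last first.
  by rewrite le_eqVlt; apply/orP; left; apply/eqP; ring.
move=> r /andP[ar rb]; have r0 : 0 < r by exact: lt_le_trans ar.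
rewrite Normc.normcM normc_real ger0_norm; last by rewrite invr_ge0 ltW.
rewrite ler_pM ?normc_ge0 ?invr_ge0 ?(ltW r0)//; last by rewrite lef_pV2 ?posrE.
rewrite (le_trans (le_normcD _ _))// normcN.
by rewrite mulr2n mulrDl mul1r lerD// hE// ?ar ?rb ?cd ?lexx.
Qed.

Lemma sig_ge r y : 0 <= r -> r <= nc (sig r y).
Proof.
move=> r0; rewrite Normc.normcM normc_real ger0_norm//.
by rewrite -[leLHS]mulr1 ler_wpM2l ?ray_ge1.
Qed.

Lemma sig_le2 r y : 0 <= r -> -1 <= y <= 1 -> nc (sig r y) <= 2 * r.
Proof.
move=> r0 y1; rewrite Normc.normcM normc_real ger0_norm// mulrC.
by rewrite ler_wpM2r ?ray_le2.
Qed.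

Section goursat.
Variables (f : C -> C).
Hypothesis df : forall z, z != 0 -> nc z < 4 -> exists l, cdiff f z l.

Let sec_df a b c d r y : secin a b c d -> a <= r <= b -> c <= y <= d ->
  exists l, cdiff f (sig r y) l.
Proof.
move=> [[a0 ab b1] [c1 cd d1]] /andP[ar rb] /andP[cy yd].
have r0 : 0 < r by exact: lt_le_trans ar.
have y1 : -1 <= y <= 1 by rewrite (le_trans c1 cy) (le_trans yd d1).
apply: df.
  by apply/eqP => h; have := sig_ge y (ltW r0); rewrite h Normc.normc0 leNgt r0.
apply: (le_lt_trans (sig_le2 (ltW r0) y1)).
have : r <= 1 by exact: le_trans rb b1.
by lra.
Qed.

Let Jok_f a b c d : secin a b c d -> Jok f a b c d.
Proof.
move=> sQ; apply: Jok_cont => // r y rab ycd.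
by have [l] := sec_df sQ rab ycd; exact: cdiff_cont.
Qed.

Let Jok_affine al be a b c d : secin a b c d -> Jok (fun z => al + be * z) a b c d.
Proof.
move=> sQ; apply: Jok_cont => // r y rab ycd.
apply: (@cdiff_cont _ _ _ be) => e e0; exists 1 => // w _.
have -> : al + be * w - (al + be * sig r y) - be * (w - sig r y) = 0 by ring.
by rewrite Normc.normc0 mulr_ge0 ?normc_ge0 ?ltW.
Qed.

Lemma goursat_sector a b c d : secin a b c d -> Jsec f a b c d = 0.
Proof.
move=> sQ; have [[a0 ab b1] [c1 cd d1]] := sQ.
apply: Normc.eq0_normc.
apply: (@bisection _ (fun a b c d => nc (Jsec f a b c d)) a b c d ab cd).
- by move=> *; exact: normc_ge0.
- move=> a' b' c' d' aa ab' bb cc cd' dd; cbv zeta.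
  set m := (a' + b') / 2; set k := (c' + d') / 2.
  have am : a' <= m by rewrite /m; lra.
  have mb : m <= b' by rewrite /m; lra.
  have ck : c' <= k by rewrite /k; lra.
  have kd : k <= d' by rewrite /k; lra.
  have a'0 : 0 < a' by exact: lt_le_trans aa.
  have m0 : 0 < m by exact: lt_le_trans am.
  have b'1 : b' <= 1 by exact: le_trans b1.
  have c'1 : -1 <= c' by exact: le_trans cc.
  have d'1 : d' <= 1 by exact: le_trans d1.
  have m1 : m <= 1 by exact: le_trans b'1.
  have k1 : -1 <= k by exact: le_trans ck.
  have k1' : k <= 1 by exact: le_trans d'1.
  have s1 : secin a' m c' k by [].
  have s2 : secin m b' c' k by [].
  have s3 : secin a' m k d' by [].
  have s4 : secin m b' k d' by [].
  have s5 : secin a' b' c' d' by [].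
  have s6 : secin a' m c' d' by [].
  have s7 : secin m b' c' d' by [].
  have hx p q : -1 <= p -> p <= q -> q <= 1 ->
      Jsec f a' b' p q = Jsec f a' m p q + Jsec f m b' p q.
    move=> p1 pq q1.
    have t1 : secin a' m p q by [].
    have t2 : secin m b' p q by [].
    have t3 : secin a' b' p q by [].
    have [i1 i2] := Jok_f t1; have [i3 i4] := Jok_f t2; have [i5 i6] := Jok_f t3.
    rewrite /Jsec (cint_split am mb i6) addrACA -cintD// opprD.
    by congr (cint _ _ _ + _); apply/funext => y; ring.
  have hy p q : 0 < p -> p <= q -> q <= 1 ->
      Jsec f p q c' d' = Jsec f p q c' k + Jsec f p q k d'.
    move=> p1 pq q1.
    have t1 : secin p q c' k by [].
    have t2 : secin p q k d' by [].
    have t3 : secin p q c' d' by [].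
    have [i1 i2] := Jok_f t1; have [i3 i4] := Jok_f t2; have [i5 i6] := Jok_f t3.
    rewrite /Jsec (cint_split ck kd i5) addrACA -opprD -cintD//.
    by congr (_ - cint _ _ _); apply/funext => y; ring.
  rewrite hx// hy// (hy m)// (le_trans (le_normcD _ _))//.
  have := le_normcD (Jsec f a' m c' k) (Jsec f a' m k d').
  have := le_normcD (Jsec f m b' c' k) (Jsec f m b' k d').
  by lra.
move=> p q pab qcd e e0.
have [l dl] := sec_df sQ pab qcd.
(* The 8 absorbs the 4 of [Jsec_bound] and the 2 that relates |sig r y - sig p q| to the size [S];
   the factor [a] pays for the weight 1 / r. *)
have e'0 : 0 < e * a / 8 by rewrite !mulr_gt0 ?invr_gt0.
have [del del0 hdel] := dl _ e'0.
exists (del / 4); first by rewrite divr_gt0.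
move=> a' b' c' d' aa ap pb bb cc cq qd dd wb hb.
have a'0 : 0 < a' by exact: lt_le_trans aa.
have sQ' : secin a' b' c' d'.
  split; split => //; [exact: le_trans pb|exact: le_trans b1|exact: le_trans cc|
    exact: le_trans qd|exact: le_trans d1].
have [[_ ab' b'1] [c'1 cd' d'1]] := sQ'.
pose be := l; pose al := f (sig p q) - l * sig p q.
have -> : Jsec f a' b' c' d' = Jsec (fun z => f z - (al + be * z)) a' b' c' d'.
  by rewrite JsecB ?Jsec_affine ?subr0//; [exact: Jok_f|exact: Jok_affine].
set S := b' - a' + (d' - c').
have S0 : 0 <= S by rewrite addr_ge0// subr_ge0.
have hE r y : a' <= r <= b' -> c' <= y <= d' ->
    nc (f (sig r y) - (al + be * sig r y)) <= e * a / 8 * (2 * S).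
  move=> /andP[ar rb] /andP[cy yd].
  have hz : nc (sig r y - sig p q) <= 2 * S.
    rewrite (le_trans (normc_triB _ _ (sig p y)))//.
    have y1 : -1 <= y <= 1 by rewrite (le_trans c'1 cy) (le_trans yd d'1).
    have p0 : 0 < p by exact: lt_le_trans ap.
    have hr : `|r - p| <= b' - a' by rewrite ler_norml; apply/andP; split; lra.
    have hy : `|y - q| <= d' - c' by rewrite ler_norml; apply/andP; split; lra.
    have H1 : nc (sig r y - sig p y) <= 2 * (b' - a').
      by rewrite (le_trans (sig_lipr _ _ _))// ler_pM ?normc_ge0 ?ray_le2.
    have H2 : nc (sig p y - sig p q) <= d' - c'.
      rewrite (le_trans (sig_lipy _ _ _))//.
      apply: (@le_trans _ _ (1 * `|y - q|)); last by rewrite mul1r.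
      by rewrite ler_wpM2r// ger0_norm ?(ltW p0)// (le_trans pb).
    by rewrite /S; lra.
  have -> : f (sig r y) - (al + be * sig r y) =
      f (sig r y) - f (sig p q) - l * (sig r y - sig p q).
    by rewrite /al /be; ring.
  apply: (le_trans (hdel _ _)); last by rewrite ler_wpM2l// ltW.
  by apply: (le_lt_trans hz); rewrite /S; lra.
have okE : Jok (fun z => f z - (al + be * z)) a' b' c' d'.
  apply: Jok_cont => // r y rab ycd.
  have [l' dl'] := sec_df sQ' rab ycd.
  apply: (@cdiff_cont _ _ _ (l' - be)) => e1 e10.
  have [d1' d10 hd1] := dl' _ e10; exists d1' => // w wd.
  have -> : f w - (al + be * w) - (f (sig r y) - (al + be * sig r y)) -
     (l' - be) * (w - sig r y) = f w - f (sig r y) - l' * (w - sig r y) by ring.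
  exact: hd1.
have M0 : 0 <= e * a / 8 * (2 * S) by rewrite mulr_ge0 ?(ltW e'0)// mulr_ge0.
apply: (le_trans (Jsec_bound sQ' okE M0 hE)).
have h1 : (d' - c') + (b' - a') / a' <= S / a.
  rewrite /S [leRHS]mulrDl [leLHS]addrC; apply: lerD.
    by rewrite ler_wpM2l ?subr_ge0// lef_pV2 ?posrE.
  rewrite -[leLHS]mulr1 ler_wpM2l ?subr_ge0// invf_ge1//.
  by rewrite (le_trans ab b1).
apply: (@le_trans _ _ (4 * (e * a / 8 * (2 * S)) * (S / a))).
  by rewrite ler_wpM2l// mulr_ge0.
rewrite le_eqVlt; apply/orP; left; apply/eqP; rewrite -/S; field; exact: lt0r_neq0.
Qed.

End goursat.

End sector.

(** * Rules for complex derivatives *)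

Section cdiff_calculus.
Context {R : realType}.
Local Notation C := R[i].
Local Notation nc := (@Normc.normc R).
Implicit Types (f g : C -> C) (z l : C).

Lemma cdiff_cst (k z : C) : cdiff (fun=> k) z 0.
Proof.
move=> e e0; exists 1 => // w _.
by rewrite subrr mul0r subr0 Normc.normc0 mulr_ge0 ?normc_ge0 ?ltW.
Qed.

Lemma cdiffD f g z l m : cdiff f z l -> cdiff g z m ->
  cdiff (fun w => f w + g w) z (l + m).
Proof.
move=> df dg e e0; have e20 : 0 < e / 2 by rewrite divr_gt0.
have [d1 d10 h1] := df _ e20; have [d2 d20 h2] := dg _ e20.
exists (Num.min d1 d2); first by rewrite lt_min d10.
move=> w; rewrite lt_min => /andP[/h1 {}h1 /h2 {}h2].
have -> : f w + g w - (f z + g z) - (l + m) * (w - z) =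
  (f w - f z - l * (w - z)) + (g w - g z - m * (w - z)) by ring.
by rewrite (le_trans (le_normcD _ _))// [in leRHS](splitr e) mulrDl lerD.
Qed.

Lemma cdiffM f g z l m : cdiff f z l -> cdiff g z m ->
  cdiff (fun w => f w * g w) z (l * g z + f z * m).
Proof.
move=> df dg e e0.
pose A := nc (g z) + nc (f z) + nc l + 1.
have A0 : 0 < A by rewrite ltr_wpDl ?addr_ge0 ?normc_ge0.
pose e' := Num.min 1 (e / (2 * A)).
have e'0 : 0 < e' by rewrite lt_min ltr01 divr_gt0// mulr_gt0.
have e'1 : e' <= 1 by rewrite ge_min lexx.
have e'2 : e' * A * 2 <= e.
  have : e' <= e / (2 * A) by rewrite ge_min lexx orbT.
  by rewrite ler_pdivlMr ?mulr_gt0// (mulrC 2) mulrA.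
have [d1 d10 h1] := df _ e'0; have [d2 d20 h2] := dg _ e'0.
have [d3 d30 h3] := cdiff_cont dg e'0.
exists (Num.min d1 (Num.min d2 d3)); first by rewrite !lt_min d10 d20.
move=> w; rewrite !lt_min => /and3P[/h1 {}h1 /h2 {}h2 /h3 {}h3].
have -> : f w * g w - f z * g z - (l * g z + f z * m) * (w - z) =
  (f w - f z - l * (w - z)) * g z + f z * (g w - g z - m * (w - z)) +
  ((f w - f z - l * (w - z)) * (g w - g z) + l * (w - z) * (g w - g z)) by ring.
set D := nc (w - z) in h1 h2 *; have D0 : 0 <= D by exact: normc_ge0.
apply: (@le_trans _ _ (e' * D * nc (g z) + nc (f z) * (e' * D) +
   (e' * D * 1 + nc l * D * e'))).
  rewrite (le_trans (le_normcD _ _))// lerD//.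
    rewrite (le_trans (le_normcD _ _))// !Normc.normcM lerD//.
      by rewrite ler_wpM2r ?normc_ge0.
    by rewrite ler_wpM2l ?normc_ge0.
  rewrite (le_trans (le_normcD _ _))// !Normc.normcM lerD//.
    by rewrite ler_pM ?normc_ge0// (le_trans (ltW h3)).
  by rewrite ler_wpM2l ?mulr_ge0 ?normc_ge0// ltW.
have -> : e' * D * nc (g z) + nc (f z) * (e' * D) + (e' * D * 1 + nc l * D * e') =
   e' * A * D by rewrite /A; ring.
rewrite ler_wpM2r// (le_trans _ e'2)// ler_peMr ?ler1n//.
by rewrite mulr_ge0// ltW.
Qed.

Lemma cdiffZ f k z l : cdiff f z l -> cdiff (fun w => k * f w) z (k * l).
Proof. by move=> df; have := cdiffM (cdiff_cst k z) df; rewrite mul0r add0r. Qed.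

Lemma cdiffB f g z l m : cdiff f z l -> cdiff g z m ->
  cdiff (fun w => f w - g w) z (l - m).
Proof.
move=> df dg; have := cdiffD df (cdiffZ (-1) dg).
by rewrite mulN1r; under eq_fun do rewrite mulN1r.
Qed.

Lemma cdiff_affine f a b z l : cdiff f (a + b * z) l ->
  cdiff (fun w => f (a + b * w)) z (l * b).
Proof.
move=> df e e0.
have B0 : 0 < nc b + 1 by rewrite ltr_wpDl ?normc_ge0.
have [d d0 h] := df _ (divr_gt0 e0 B0).
exists (d / (nc b + 1)); first by rewrite divr_gt0.
move=> w; rewrite ltr_pdivlMr// => wd.
have E : a + b * w - (a + b * z) = b * (w - z) by ring.
have hb : nc (b * (w - z)) <= nc (w - z) * (nc b + 1).
  by rewrite Normc.normcM mulrC ler_wpM2l ?normc_ge0// lerDl.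
have := h (a + b * w); rewrite E => /(_ (le_lt_trans hb wd)).
rewrite -mulrA => /le_trans; apply.
rewrite -mulrA ler_wpM2l ?(ltW e0)// ler_pdivrMl//.
by rewrite [leRHS]mulrC.
Qed.

Lemma cdiff_inv z : z != 0 -> cdiff (fun w => w^-1) z (- z^-2).
Proof.
move=> z0 e e0; have nz0 := normc_gt0 z0.
exists (Num.min (nc z / 2) (e * nc z ^+ 3 / 2)).
  by rewrite lt_min !divr_gt0 ?mulr_gt0 ?exprn_gt0.
move=> w; rewrite lt_min => /andP[wz we].
have nw : nc z / 2 <= nc w.
  have : nc z <= nc (w - z) + nc w.
    by rewrite normcB -{1}(subrK w z) le_normcD.
  lra.
have nw0 : 0 < nc w by rewrite (lt_le_trans _ nw)// divr_gt0.
have w0 : w != 0 by apply/eqP => h; move: nw0; rewrite h Normc.normc0 ltxx.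
have -> : w^-1 - z^-1 - - z^-2 * (w - z) = (w - z) * (w - z) * (w * z ^+ 2)^-1.
  by field; rewrite w0 z0.
rewrite !Normc.normcM Normc.normcV Normc.normcM normcX -mulrA mulrC.
rewrite ler_wpM2r ?normc_ge0// ler_pdivrMr ?mulr_gt0 ?exprn_gt0//.
apply: (le_trans (ltW we)).
have -> : e * nc z ^+ 3 / 2 = e * ((nc z / 2) * nc z ^+ 2) by rewrite exprS; field.
by rewrite ler_wpM2l ?(ltW e0)// ler_wpM2r// sqr_ge0.
Qed.

Lemma eq_cdiff f g z l d : 0 < d -> (forall w, nc (w - z) < d -> f w = g w) ->
  cdiff f z l -> cdiff g z l.
Proof.
move=> d0 fg df e e0; have [d1 d10 h] := df e e0.
exists (Num.min d d1); first by rewrite lt_min d0.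
move=> w; rewrite lt_min => /andP[wd /h].
by rewrite !fg// subrr Normc.normc0.
Qed.

Lemma ccont_at_sum (s : seq nat) (F : nat -> C -> C) z :
  (forall k, ccont_at (F k) z) -> ccont_at (fun w => \sum_(k <- s) F k w) z.
Proof.
move=> cF; elim: s => [|k s IH].
  by move=> e e0; exists 1 => // w _; rewrite !big_nil subrr Normc.normc0.
move=> e e0; have e20 : 0 < e / 2 by rewrite divr_gt0.
have [d1 d10 h1] := cF k _ e20; have [d2 d20 h2] := IH _ e20.
exists (Num.min d1 d2); first by rewrite lt_min d10.
move=> w; rewrite lt_min => /andP[/h1 {}h1 /h2 {}h2].
rewrite !big_cons opprD addrACA (le_lt_trans (le_normcD _ _))// (splitr e).
exact: ltrD.
Qed.

Lemma cdiff_sum (s : seq nat) (F : nat -> C -> C) z :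
  (forall k, exists l, cdiff (F k) z l) ->
  exists l, cdiff (fun w => \sum_(k <- s) F k w) z l.
Proof.
move=> dF; elim: s => [|k s [m IH]].
  by exists 0; under eq_fun do rewrite big_nil; exact: cdiff_cst.
have [l dl] := dF k; exists (l + m).
by under eq_fun do rewrite big_cons; exact: cdiffD.
Qed.

End cdiff_calculus.

(** * A mean value inequality at the centre of a square *)

Section mean_value.
Context {R : realType}.
Local Notation C := R[i].
Local Notation nc := (@Normc.normc R).
Local Notation mu := (@lebesgue_measure R).
Local Notation I := ('i%C : C).

(** For k < 4 and |y| <= 1 these are the four sides of the square with vertices 1 + i, -1 + i, -1 -
    i and 1 - i. *)
Definition side (k : nat) (y : R) : C := I ^+ k * ray y.

Let normcIX k : nc (I ^+ k) = 1.
Proof. by rewrite normcX normcI expr1n. Qed.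

Lemma side_ge1 k y : 1 <= nc (side k y).
Proof. by rewrite Normc.normcM normcIX mul1r ray_ge1. Qed.

Lemma side_le2 k y : -1 <= y <= 1 -> nc (side k y) <= 2.
Proof. by move=> y1; rewrite Normc.normcM normcIX mul1r ray_le2. Qed.

Lemma side_lip k x y : nc (side k y - side k x) <= `|y - x|.
Proof.
by rewrite /side -mulrBr Normc.normcM normcIX mul1r rayB normc_pure.
Qed.

Let kap_cont : ccont (-1) 1 (@kap R).
Proof. by apply: (@ccont_lip _ _ _ _ 1) => // x y _ _; rewrite mul1r kap_lip. Qed.

(** The imaginary part of [kap] is 1 / (1 + y^2), at least 1 / 2 on a segment of length 2. *)
Let kap_mass : 1 <= nc (cint (-1) 1 (@kap R)).
Proof.
have N11 : -1 <= 1 :> R by lra.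
apply: (le_trans _ (absIm_le_normc _)); rewrite /cint/=.
apply: (le_trans _ (ler_norm _)).
have [_ hi] := ccont_integrable N11 kap_cont.
apply: (@le_trans _ _ (\int[mu]_(x in `[-1, 1]) (2^-1 : R))).
  rewrite Rintegral_cst//= lebesgue_measure_itv/= lte_fin ifT; last by lra.
  by rewrite /= opprK mulVf.
apply: le_Rintegral => //.
  by apply: continuous_compact_integrable; [exact: segment_compact|move=> ?; exact: cvg_cst].
move=> y hy; have /andP[y1 y2] : -1 <= y <= 1 by move: hy; rewrite /= in_itv.
rewrite mul0r add0r mul1r div1r expr1n lef_pV2 ?posrE ?ltr_wpDr ?sqr_ge0//.
by nra.
Qed.

(** Cauchy's formula on a square, kept as an inequality. Summing [f] over the rotations by i makes
    the integrals over the two radial sides cancel, so the integral over the side r = 1 equals the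
    one over r = a, and a is sent to 0. *)
Lemma mean_value_ineq (f : C -> C) :
  (forall z, z != 0 -> nc z < 4 -> exists l, cdiff f z l) -> ccont_at f 0 ->
  ((nc (f 0))%:E <=
    \int[mu]_(y in `[(-1)%R, 1%R]) (\sum_(k < 4) nc (f (side k y)))%R%:E)%E.
Proof.
move=> df f0; have N11 : -1 <= 1 :> R by lra.
pose F z := \sum_(k < 4) f (I ^+ k * z).
have FE z : F z = \sum_(k <- iota 0 4) f (I ^+ k * z).
  by rewrite /F -(big_mkord xpredT (fun k => f (I ^+ k * z))).
have FI z : F (I * z) = F z.
  rewrite /F !big_ord_recr !big_ord0/= !add0r !expr0 !expr1 !mul1r !mulrA -!exprSr.
  have -> : I ^+ 4 = 1 :> C by rewrite (exprM I 2 2) sqr_i sqrrN expr1n.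
  by rewrite mul1r -expr2; ring.
have dF z : z != 0 -> nc z < 4 -> exists l, cdiff F z l.
  move=> z0 z4; have -> : F = fun z => \sum_(k <- iota 0 4) f (I ^+ k * z).
    exact/funext.
  apply: cdiff_sum => k.
  have [||l dl] := df (I ^+ k * z).
  - by rewrite mulf_neq0// expf_neq0// eq_complex/= oner_eq0 andbF.
  - by rewrite Normc.normcM normcIX mul1r.
  exists (l * I ^+ k).
  have := @cdiff_affine _ f 0 (I ^+ k) z l; rewrite add0r => /(_ dl).
  by under eq_fun do rewrite add0r.
have F0 : ccont_at F 0.
  have -> : F = fun z => \sum_(k <- iota 0 4) f (I ^+ k * z) by exact/funext.
  apply: ccont_at_sum => k e e0; have [d d0 hd] := f0 e e0.
  exists d => // w; rewrite subr0 mulr0 => wd; apply: hd.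
  by rewrite subr0 Normc.normcM normcIX mul1r.
have F0E : F 0 = 4 * f 0.
  by rewrite /F; under eq_bigr do rewrite mulr0; rewrite sumr_const card_ord mulr_natl.
have secP (a : R) : 0 < a -> a <= 1 -> secin a 1 (-1) 1 by move=> a0 a1; split; split; lra.
have cFsig a : 0 < a -> a <= 1 -> ccont (-1) 1 (F \o sig a).
  move=> a0 a1; apply: (ccont_comp (L := `|a|)) => //; first exact: sig_lipy.
  move=> y y1; have [||l dl] := dF (sig a y).
  - by apply/eqP => h; have := sig_ge y (ltW a0); rewrite h Normc.normc0 leNgt a0.
  - by apply: (le_lt_trans (sig_le2 (ltW a0) y1)); lra.
  exact: (cdiff_cont dl).
have key a : 0 < a -> a <= 1 ->
    cint (-1) 1 (fun y => (F (sig 1 y) - F (sig a y)) * kap y) = 0.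
  move=> a0 a1; have := goursat_sector dF (secP a a0 a1); rewrite /Jsec.
  have -> : (fun r => (F (sig r 1) - F (sig r (-1))) * (r^-1)%:C%C) = fun=> 0.
    (* The upper ray of the sector is the lower one turned by a quarter, and [F] is invariant under
       that turn. *)
    apply/funext => r; have -> : sig r 1 = I * sig r (-1).
      by apply/eqP; rewrite eq_complex/=; apply/andP; split; apply/eqP; ring.
    by rewrite FI subrr mul0r.
  by rewrite cint_cst// mulr0 subr0.
have cm4 g : ccont (-1) 1 g -> ccont (-1) 1 (fun y => (g y - F 0) * kap y).
  move=> cg; apply: ccontM => //.
  by apply: ccontD => //; exact: ccont_cst.
have int1 : cint (-1) 1 (fun y => F (sig 1 y) * kap y) = F 0 * cint (-1) 1 (@kap R).
  apply/eqP; rewrite -subr_eq0; apply/eqP/Normc.eq0_normc/eqP.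
  rewrite eq_le normc_ge0 andbT; apply/ler_addgt0Pr => e e0; rewrite add0r.
  have e40 : 0 < e / 4 by rewrite divr_gt0.
  have [d d0 hd] := F0 _ e40.
  (* Points of the inner side have modulus at most 2 a <= d / 2, where [F] is within e / 4 of
     [F 0]. *)
  pose a := Num.min 1 (d / 4).
  have a0 : 0 < a by rewrite lt_min ltr01 divr_gt0.
  have a1 : a <= 1 by rewrite ge_min lexx.
  have ad : a <= d / 4 by rewrite ge_min lexx orbT.
  have kI := ccont_integrable N11 kap_cont.
  have c1 : ccont (-1) 1 (fun y => F (sig 1 y) * kap y).
    by apply: ccontM => //; exact: cFsig.
  have ca : ccont (-1) 1 (fun y => (F (sig a y) - F 0) * kap y).
    by apply: cm4; exact: cFsig.
  have -> : cint (-1) 1 (fun y => F (sig 1 y) * kap y) - F 0 * cint (-1) 1 (@kap R) =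
     cint (-1) 1 (fun y => (F (sig a y) - F 0) * kap y).
    rewrite -[RHS]addr0 -[X in _ = _ + X](key a a0 a1) -cintZ// -cintB//; last 2 first.
    - exact: ccont_integrable.
    - exact: (cintegrableZ _ kI).
    rewrite -cintD; last 2 first.
    - exact: ccont_integrable.
    - apply: ccont_integrable => //; apply: ccontM => //.
      under eq_fun do rewrite -mulN1r; apply: ccontD; first exact: cFsig.
      by apply: ccontM; [exact: ccont_cst|exact: cFsig].
    by congr cint; apply/funext => y; ring.
  have H y : -1 <= y <= 1 -> nc ((F (sig a y) - F 0) * kap y) <= e / 4.
    move=> y1; rewrite Normc.normcM; apply: (@le_trans _ _ (e / 4 * 1)); last by rewrite mulr1.
    rewrite ler_pM ?normc_ge0 ?kap_le1// ltW// hd// subr0.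
    by apply: (le_lt_trans (sig_le2 (ltW a0) y1)); lra.
  apply: (le_trans (normc_cint_le N11 (ccont_integrable N11 ca) H)); lra.
have cF1 : ccont (-1) 1 (fun y => F (sig 1 y) * kap y).
  by apply: ccontM => //; exact: cFsig.
have := normc_cint_le_integral N11 cF1; rewrite int1 F0E.
have n4 : nc (4 : C) = 4.
  by rewrite -[4 : C]/((4%:R)) -(rmorph_nat (real_complex R) 4) normc_real ger0_norm.
rewrite !Normc.normcM n4 => h.
have {}h : ((4 * nc (f 0))%:E <= 2%:E * \int[mu]_(y in `[(-1)%R, 1%R])
   (\sum_(k < 4) nc (f (side k y)))%R%:E)%E.
  apply: (@le_trans _ _ (4 * nc (f 0) * nc (cint (-1) 1 (@kap R)))%:E).
    by rewrite lee_fin ler_peMr// mulr_ge0 ?normc_ge0.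
  apply: (le_trans h); rewrite lee_pmul2l//.
  have cside k : ccont (-1) 1 (fun y => f (side k y)).
    apply: (ccont_comp (L := 1)) => //.
      by move=> x y; rewrite mul1r; exact: side_lip.
    move=> y y1; have [||l dl] := df (side k y).
    - by apply/eqP => hh; have := side_ge1 k y; rewrite hh Normc.normc0 ler10.
    - by apply: (le_lt_trans (side_le2 k y1)); lra.
    exact: (cdiff_cont dl).
  apply: ge0_le_integral => //.
  - by move=> y _; rewrite lee_fin normc_ge0.
  - exact: (measurable_int mu (ccont_normc N11 cF1)).
  - apply/measurable_EFinP; apply: measurable_sum => k; apply/measurable_EFinP.
    exact: (measurable_int mu (ccont_normc N11 (cside k))).
  - move=> y; rewrite /= => y1; rewrite lee_fin.
    rewrite Normc.normcM; apply: (@le_trans _ _ (nc (F (sig 1 y)) * 1)).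
      by rewrite ler_wpM2l ?normc_ge0 ?kap_le1.
    rewrite mulr1 (le_trans (normc_sum _ _ _))//; apply: ler_sum => k _.
    by rewrite /sig mul1r.
move: h; set X := (\int[mu]_(_ in _) _)%E => h.
have X0 : (0 <= X)%E by apply: integral_ge0 => y _; rewrite lee_fin sumr_ge0// => k _; exact: normc_ge0.
case: X X0 h => [x| |]//=; rewrite ?leey//.
by rewrite !lee_fin => x0 h; have := normc_ge0 (f 0); lra.
Qed.

End mean_value.

(** * Derivative bounds and difference quotients in one variable *)

Section one_variable_bounds.
Context {R : realType}.
Local Notation C := R[i].
Local Notation nc := (@Normc.normc R).
Local Notation mu := (@lebesgue_measure R).
Implicit Types (f : C -> C) (z l : C).

(** Cauchy's estimate: the mean value inequality applied to the difference quotient at 0, whose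
    value there is [l]. It is at most 2 M on each of the four sides of length 2, whence 16. *)
Lemma cdiff_bound f l M : 0 <= M ->
  (forall z, nc z < 4 -> exists m, cdiff f z m) -> cdiff f 0 l ->
  (forall z, nc z <= 2 -> nc (f z) <= M) -> nc l <= 16 * M.
Proof.
move=> M0 df dl fM.
pose q z := if z == 0 then l else (f z - f 0) * z^-1.
have qn z : z != 0 -> q z = (f z - f 0) * z^-1 by rewrite /q => /negbTE ->.
have dq z : z != 0 -> nc z < 4 -> exists m, cdiff q z m.
  move=> z0 /df[m dm].
  exists ((m - 0) * z^-1 + (f z - f 0) * (- z^-2)).
  apply: (@eq_cdiff _ (fun w => (f w - f 0) * w^-1) _ _ _ (nc z)); first exact: normc_gt0.
    move=> w wz; rewrite qn//; apply/eqP => w0; move: wz.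
    by rewrite w0 sub0r normcN ltxx.
  apply: cdiffM; last exact: cdiff_inv.
  by apply: cdiffB => //; exact: cdiff_cst.
have q0 : ccont_at q 0.
  move=> e e0; have e20 : 0 < e / 2 by rewrite divr_gt0.
  have [d d0 h] := dl _ e20; exists d => // w wd.
  have -> : q 0 = l by rewrite /q eqxx.
  have [->|w0] := eqVneq w 0; first by rewrite /q eqxx subrr Normc.normc0.
  rewrite qn//; have := h w wd; rewrite !subr0 => hw.
  have -> : (f w - f 0) * w^-1 - l = (f w - f 0 - l * w) * w^-1 by field.
  have nw := normc_gt0 w0.
  rewrite Normc.normcM Normc.normcV ltr_pdivrMr//.
  by apply: (le_lt_trans hw); rewrite ltr_pM2r//; lra.
have := mean_value_ineq dq q0; rewrite [q 0]/q eqxx => h.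
rewrite -lee_fin; apply: (le_trans h).
have HM y : -1 <= y <= 1 -> \sum_(k < 4) nc (q (side k y)) <= 8 * M.
  move=> y1; apply: (@le_trans _ _ (\sum_(k < 4) (2 * M))); last first.
    by rewrite sumr_const card_ord -[leLHS]mulr_natl mulrA -natrM.
  apply: ler_sum => k _; have s1 := side_ge1 k y; have s2 := side_le2 k y1.
  rewrite qn; last first.
    by apply/eqP => hh; move: s1; rewrite hh Normc.normc0 ler10.
  rewrite Normc.normcM Normc.normcV.
  apply: (@le_trans _ _ (2 * M * 1)); last by rewrite mulr1.
  rewrite ler_pM ?normc_ge0 ?invr_ge0 ?normc_ge0//; last first.
    by rewrite invf_le1//; exact: lt_le_trans s1.
  rewrite (le_trans (le_normcD _ _))// normcN mulr2n mulrDl mul1r lerD// fM//.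
  by rewrite Normc.normc0.
apply: (@le_trans _ _ (\int[mu]_(y in `[(-1)%R, 1%R]) (8 * M)%:E)%E); last first.
  rewrite integral_cst//= lebesgue_measure_itv/= lte_fin ifT; last by lra.
  by rewrite -EFinB -EFinM lee_fin; lra.
apply: ge0_le_integral => //.
- by move=> y _; rewrite lee_fin sumr_ge0// => k _; exact: normc_ge0.
- apply/measurable_EFinP; apply: measurable_sum => k; apply/measurable_EFinP.
  have N11 : -1 <= 1 :> R by lra.
  apply: (measurable_int mu); apply: (ccont_normc N11).
  apply: (ccont_comp (L := 1)) => //.
    by move=> x y; rewrite mul1r; exact: side_lip.
  move=> y y1; have [||m dm] := dq (side k y).
  - by apply/eqP => hh; have := side_ge1 k y; rewrite hh Normc.normc0 ler10.
  - by apply: (le_lt_trans (side_le2 k y1)); lra.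
  exact: (cdiff_cont dm).
Qed.

(** The real mean value theorem for the component of [f] in the direction of f(z1) - f(z0), whose
    increment is the squared modulus of that difference. *)
Lemma cdiff_mvt f z0 z1 L :
  (forall t : R, 0 <= t <= 1 -> exists2 m, cdiff f (z0 + t%:C%C * (z1 - z0)) m & nc m <= L) ->
  nc (f z1 - f z0) <= L * nc (z1 - z0).
Proof.
move=> df; set c := f z1 - f z0; set v := z1 - z0.
have L0 : 0 <= L.
  have [|m _ hm] := df 0; first by rewrite lexx ler01.
  by rewrite (le_trans _ hm)// normc_ge0.
have [->|c0] := eqVneq c 0; first by rewrite Normc.normc0 mulr_ge0 ?normc_ge0.
have nc0 := normc_gt0 c0.
pose phi (t : R) := complex.Re (c^*%C * f (z0 + t%:C%C * v)).
have dphi (t : R) : 0 <= t <= 1 -> exists2 m, nc m <= L &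
    is_derive t 1 phi (complex.Re (c^*%C * (m * v))).
  move=> /df[m dm mL]; exists m => //.
  have dg : cdiff (fun s => c^*%C * f (z0 + s * v)) t%:C%C (c^*%C * (m * v)).
    apply: cdiffZ.
    have := @cdiff_affine _ f z0 v t%:C%C m.
    rewrite (mulrC v) => /(_ dm).
    by under eq_fun do rewrite mulrC.
  have cv : (fun h : R => h^-1 *: ((phi \o shift t) (h *: 1) - phi t)) @ 0^' -->
      complex.Re (c^*%C * (m * v)).
    apply/cvgrPdist_le => e e0; have [d d0 hd] := dg e e0.
    exists d => // h; rewrite /= sub0r normrN => hd' h0.
    have h0' : 0 < `|h| by rewrite normr_gt0.
    have := hd (h + t)%:C%C.
    rewrite -[X in nc X < d](_ : h%:C%C = _); last by rewrite rmorphD addrK.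
    rewrite -[X in _ * nc X](_ : h%:C%C = _); last by rewrite rmorphD addrK.
    rewrite -[X in _ * (m * v) * X](_ : h%:C%C = _); last by rewrite rmorphD addrK.
    rewrite normc_real => /(_ hd') hh.
    rewrite /phi /= [h *: 1]mulr1 distrC.
    have -> : h^-1 *: (complex.Re (c^*%C * f (z0 + (h + t)%:C%C * v)) -
        complex.Re (c^*%C * f (z0 + t%:C%C * v))) - complex.Re (c^*%C * (m * v)) =
      h^-1 * complex.Re (c^*%C * f (z0 + (h + t)%:C%C * v) -
         c^*%C * f (z0 + t%:C%C * v) - c^*%C * (m * v) * h%:C%C).
      move: (c^*%C * f _) (c^*%C * f _) (c^*%C * (m * v)) => [x1 x2] [y1 y2] [u1 u2] /=.
      by rewrite /GRing.scale/=; field.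
    rewrite normrM normfV ler_pdivrMl// [leRHS]mulrC.
    by rewrite (le_trans (absRe_le_normc _)).
  by apply: DeriveDef; [exact: cvgP cv|exact: cvg_lim cv].
have [t0 t01 E] : exists2 t : R, t \in `]0, 1[%R & phi 1 - phi 0 = 'D_1 phi t * (1 - 0).
  apply: (@MVT _ phi (fun t => 'D_1 phi t)); first exact: ltr01.
    move=> t; rewrite in_itv/= => /andP[/ltW t0 /ltW t1].
    have [|m _ dm] := dphi t; first by rewrite t0 t1.
    by apply: DeriveDef => //; exact: ex_derive.
  apply: derivable_within_continuous => t; rewrite in_itv/= => t01.
  by have [m _ dm] := dphi t t01; exact: ex_derive.
have [|m mL dm] := dphi t0.
  by move: t01; rewrite in_itv/= => /andP[/ltW -> /ltW ->].
move: E; rewrite derive_val subr0 mulr1.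
have -> : phi 1 - phi 0 = nc c ^+ 2.
  have -> : phi 1 = complex.Re (c^*%C * f z1).
    by rewrite /phi rmorph1 mul1r /v addrC subrK.
  have -> : phi 0 = complex.Re (c^*%C * f z0).
    by rewrite /phi rmorph0 mul0r addr0.
  by rewrite -raddfB -mulrBr -/c; exact: normc_ReJ.
move=> E.
have : nc c ^+ 2 <= nc c * (L * nc v).
  rewrite E (le_trans (ler_norm _))// (le_trans (absRe_le_normc _))//.
  rewrite Normc.normcM normc_conj ler_wpM2l ?normc_ge0// Normc.normcM.
  by rewrite ler_wpM2r ?normc_ge0.
by rewrite expr2 ler_pM2l.
Qed.

(** For real [q] every q(s) - K |s| is at most every q(t) + K |t|, so the supremum of the former is
    the limit. The 2 comes from adding real and imaginary parts. *)
Lemma cauchy_rate_lim (Q : C -> C) K d : 0 < d -> 0 <= K ->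
  (forall s t, s != 0 -> t != 0 -> nc s < d -> nc t < d ->
    nc (Q s - Q t) <= K * (nc s + nc t)) ->
  exists l, forall s, s != 0 -> nc s < d -> nc (Q s - l) <= 2 * K * nc s.
Proof.
move=> d0 K0 hQ.
have d20 : 0 < d / 2 by rewrite divr_gt0.
have sdn : ((d / 2)%:C%C : C) != 0 by rewrite eq_complex/= negb_and gt_eqF.
have nd : nc ((d / 2)%:C%C : C) < d by rewrite normc_real gtr0_norm//; lra.
have real_case (q : C -> R) : (forall s t, s != 0 -> t != 0 -> nc s < d -> nc t < d ->
    `|q s - q t| <= K * (nc s + nc t)) ->
  exists x, forall s, s != 0 -> nc s < d -> `|q s - x| <= K * nc s.
  move=> hq; pose A := [set q s - K * nc s | s in [set s | s != 0 /\ nc s < d]].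
  have ubA t : t != 0 -> nc t < d -> ubound A (q t + K * nc t).
    move=> t0 td _ [s [s0 sd] <-]; have := hq s t s0 t0 sd td.
    by rewrite ler_norml => /andP[_]; lra.
  have A0 : A !=set0 by exists (q (d / 2)%:C%C - K * nc (d / 2)%:C%C), (d / 2)%:C%C.
  exists (sup A) => s s0 sd; rewrite ler_norml; apply/andP; split.
    by have := ge_sup A0 (ubA s s0 sd); lra.
  have : q s - K * nc s <= sup A.
    apply: ub_le_sup; last by exists s.
    by exists (q s + K * nc s); exact: ubA.
  by lra.
have [|x hx] := real_case (fun s => complex.Re (Q s)).
  move=> s t s0 t0 sd td; rewrite -raddfB (le_trans (absRe_le_normc _))//.
  exact: hQ.
have [|y hy] := real_case (fun s => complex.Im (Q s)).
  move=> s t s0 t0 sd td; rewrite -raddfB (le_trans (absIm_le_normc _))//.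
  exact: hQ.
exists (x +i* y)%C => s s0 sd; rewrite (le_trans (normc_le_ReIm _))// !raddfB/=.
by have := hx s s0 sd; have := hy s s0 sd; lra.
Qed.

End one_variable_bounds.

(** * Complex normed spaces with a real-valued norm *)

Section complex_normed.
Context {R : realType}.
Local Notation C := R[i].
Local Notation nc := (@Normc.normc R).
Variable V : normedModType R[i].
Implicit Types (F : V -> C) (v w : V) (D : set V).

(** Norms of a space over C take their values in C; the real part restores the total order. *)
Definition rnorm (v : V) : R := complex.Re `|v|.

Lemma rnormE v : `|v| = (rnorm v)%:C%C.
Proof. by rewrite /rnorm RRe_real. Qed.

Lemma rnorm_ge0 v : 0 <= rnorm v.
Proof. by rewrite -ler0c -rnormE; exact: normr_ge0. Qed.

Lemma rnormZ (s : C) v : rnorm (s *: v) = nc s * rnorm v.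
Proof.
have h : (rnorm (s *: v))%:C%C = (nc s * rnorm v)%:C%C :> C.
  by rewrite -rnormE normrZ normc_norm rnormE -rmorphM.
exact: complexI h.
Qed.

Lemma rnormD v w : rnorm (v + w) <= rnorm v + rnorm w.
Proof. have : (rnorm (v + w))%:C%C <= (rnorm v + rnorm w)%:C%C :> C.
  by rewrite (rmorphD (real_complex R)) /= -!rnormE; exact: ler_normD.
by rewrite lecR. Qed.

Lemma rnormN v : rnorm (- v) = rnorm v.
Proof. by rewrite /rnorm normrN. Qed.

Lemma rnormB v w : rnorm (v - w) = rnorm (w - v).
Proof. by rewrite -rnormN opprB. Qed.

Lemma rnorm0 : rnorm 0 = 0.
Proof. by rewrite /rnorm normr0. Qed.

Lemma rnorm_tri v w x : rnorm (v - w) <= rnorm (v - x) + rnorm (x - w).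
Proof. by rewrite -[v - w](subrKA x) rnormD. Qed.

Lemma posC (e : C) : 0 < e -> e = (complex.Re e)%:C%C /\ 0 < complex.Re e.
Proof.
case: e => a b; rewrite ltcE/= => /andP[/eqP b0 a0]; split => //.
by rewrite b0.
Qed.

Lemma nbhs_rnormP (w : V) (P : set V) : nbhs w P <->
  exists2 d, 0 < d & forall v, rnorm (v - w) < d -> P v.
Proof.
split=> [/nbhs_ballP[e /= /posC[-> e0] h]|[d d0 h]].
  exists (complex.Re e) => // v vw; apply: h.
  by rewrite -ball_normE/= distrC rnormE ltcR.
apply/nbhs_ballP; exists d%:C%C; first by rewrite /= ltcR.
by move=> v; rewrite -ball_normE/= distrC rnormE ltcR; exact: h.
Qed.

End complex_normed.

(** * Functions locally bounded and differentiable along lines *)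

Section complex_derivative.
Context {R : realType}.
Local Notation C := R[i].
Local Notation nc := (@Normc.normc R).
Variable V : normedModType R[i].
Implicit Types (F : V -> C) (v w : V) (D : set V).

Lemma rnorm_normc (z : C) : rnorm (z : (C : normedModType C)) = nc z.
Proof. by rewrite /rnorm normc_norm. Qed.

Lemma cdiff_derive F w v l :
  cdiff (fun s : C => F (w + s *: v)) 0 l <->
  (fun h : C => h^-1 *: ((F \o shift w) (h *: v) - F w)) @ 0^' --> l.
Proof.
split=> [dl|].
  apply/cvgrPdist_le => e /posC[-> e0].
  have [d d0 hd] := dl _ e0.
  apply/nbhs_rnormP; exists d => // h; rewrite subr0 rnorm_normc => hdl h0.
  have := hd h; rewrite subr0 => /(_ hdl).
  rewrite scale0r addr0 /= [h *: v + w]addrC => hh.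
  have nh := normc_gt0 h0.
  rewrite distrC normc_norm lecR.
  have -> : h^-1 *: (F (w + h *: v) - F w) - l =
      (F (w + h *: v) - F w - l * h) * h^-1.
    by rewrite [RHS]mulrBl mulfK// [h^-1 *: _]mulrC.
  by rewrite Normc.normcM Normc.normcV ler_pdivrMr.
move=> /cvgrPdist_le cl e e0.
have ec0 : (0 : C) < e%:C%C by rewrite ltcR.
have /nbhs_rnormP[d d0 hd] := cl _ ec0.
exists d => // h; rewrite subr0 => hdl.
have [->|h0] := eqVneq h 0.
  by rewrite scale0r addr0 subrr mulr0 subr0 Normc.normc0 mulr0.
have := hd h; rewrite subr0 rnorm_normc => /(_ hdl h0).
rewrite distrC normc_norm lecR scale0r addr0 /= [h *: v + w]addrC => hh.
have nh := normc_gt0 h0.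
rewrite -ler_pdivrMr// -Normc.normcV -Normc.normcM.
apply: le_trans hh; rewrite le_eqVlt; apply/orP; left; apply/eqP; congr nc.
by rewrite mulrBl mulfK// [h^-1 *: _]mulrC.
Qed.

Lemma derivable_cdiff F w v : derivable F w v ->
  cdiff (fun s : C => F (w + s *: v)) 0 ('D_v F w).
Proof. by move=> dF; apply/cdiff_derive. Qed.

Lemma cdiff_derivable F w v l : cdiff (fun s : C => F (w + s *: v)) 0 l ->
  derivable F w v /\ 'D_v F w = l.
Proof.
move=> /cdiff_derive dl; split; first exact: cvgP dl.
by apply: cvg_lim dl; exact: norm_hausdorff.
Qed.

Lemma derivable_cdiff_at F w v s : derivable F (w + s *: v) v ->
  cdiff (fun s : C => F (w + s *: v)) s ('D_v F (w + s *: v)).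
Proof.
move=> /derivable_cdiff h.
have := @cdiff_affine _ _ (- s) 1 s _; move=> /(_ (fun t => F (w + s *: v + t *: v))).
rewrite mul1r addNr => /(_ _ h); rewrite mulr1.
congr cdiff; apply/funext => t.
by rewrite mul1r -addrA -scalerDl addrA subrr add0r.
Qed.

(** Local boundedness with differentiability in every direction. This class is stable under
    directional derivatives by one-variable estimates alone, which is what iterating [dz]
    requires. *)
Definition bounded_hol D F := forall w, D w -> exists2 r, 0 < r &
  exists M, forall w', rnorm (w' - w) < r ->
    [/\ D w', nc (F w') <= M & forall v, derivable F w' v].

(** Cauchy's estimate on the complex line through [w], the parameter being scaled by [rho] so that
    the disc of radius 4 stays in the ball. *)
Lemma derive_bound F w v r M rho : 0 < r -> 0 <= M -> 0 < rho ->
  4 * rho * rnorm v <= r ->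
  (forall w', rnorm (w' - w) < r -> nc (F w') <= M /\ derivable F w' v) ->
  rho * nc ('D_v F w) <= 16 * M.
Proof.
move=> r0 M0 rho0 hr hF.
have inb (s : C) : nc s < 4 -> rnorm (w + s *: (rho%:C%C *: v) - w) < r.
  move=> s4; rewrite addrAC subrr add0r !rnormZ normc_real gtr0_norm//.
  have [v0|v0] := eqVneq (rnorm v) 0; first by rewrite v0 !mulr0.
  apply: lt_le_trans hr; rewrite -mulrA ltr_pM2r// mulr_gt0//.
  by rewrite lt_neqAle eq_sym v0 rnorm_ge0.
pose f (s : C) := F (w + s *: (rho%:C%C *: v)).
have df (s : C) : nc s < 4 ->
    cdiff f s ('D_v F (w + s *: (rho%:C%C *: v)) * rho%:C%C).
  move=> /inb/hF[_]; rewrite scalerA => /derivable_cdiff_at h.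
  have := @cdiff_affine _ (fun t => F (w + t *: v)) 0 rho%:C%C s.
  rewrite add0r mulrC => /(_ _ h); congr cdiff.
  by apply/funext => t; rewrite /f add0r scalerA mulrC.
rewrite -[rho]gtr0_norm// -normc_real -Normc.normcM mulrC.
have := @cdiff_bound _ f _ M M0 _ (df 0 _).
rewrite scale0r addr0; apply.
- by move=> z /df h; exists ('D_v F (w + z *: (rho%:C%C *: v)) * rho%:C%C).
- by rewrite Normc.normc0.
- move=> z z2; have z4 : nc z < 4 by apply: (le_lt_trans z2); lra.
  by have [] := hF _ (inb z z4).
Qed.

Lemma lipschitz_line F w1 w2 L :
  (forall t : R, 0 <= t <= 1 -> let w := w1 + t%:C%C *: (w2 - w1) in
    derivable F w (w2 - w1) /\ nc ('D_(w2 - w1) F w) <= L) ->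
  nc (F w2 - F w1) <= L.
Proof.
move=> h; have := @cdiff_mvt _ (fun s => F (w1 + s *: (w2 - w1))) 0 1 L.
have E : w1 + (w2 - w1) = w2 by rewrite addrC subrK.
rewrite scale1r scale0r addr0 E subr0 Normc.normc1 mulr1; apply.
move=> t /h[dF hL]; exists ('D_(w2 - w1) F (w1 + t%:C%C *: (w2 - w1))) => //.
by rewrite add0r mulr1; exact: derivable_cdiff_at.
Qed.

(** Each point of the segment is the centre of a ball of radius r / 2 inside the given one; taking
    rho = r / (8 |v|) in the derivative estimate gives 128. *)
Lemma lipschitz_ball F w r M : 0 < r -> 0 <= M ->
  (forall w', rnorm (w' - w) < r -> nc (F w') <= M /\ forall v, derivable F w' v) ->
  forall w1 w2, rnorm (w1 - w) < r / 2 -> rnorm (w2 - w) < r / 2 ->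
  nc (F w2 - F w1) <= 128 * M / r * rnorm (w2 - w1).
Proof.
move=> r0 M0 hF w1 w2 h1 h2; apply: lipschitz_line => t /andP[t0 t1] /=.
set wt := w1 + _; set v := w2 - w1.
have ht : rnorm (wt - w) < r / 2.
  have -> : wt - w = (1 - t)%:C%C *: (w1 - w) + t%:C%C *: (w2 - w).
    have Ev : w2 - w1 = (w2 - w) - (w1 - w) by rewrite opprB addrA subrK.
    rewrite /wt Ev [_ *: (_ - (w1 - w))]scalerBr rmorphB rmorph1 scalerBl scale1r.
    by rewrite addrAC [X in _ + X]addrC addrA.
  apply: (le_lt_trans (rnormD _ _)); rewrite !rnormZ !normc_real !ger0_norm ?subr_ge0//.
  have [->|tp] := eqVneq t 0; first by rewrite subr0 mul1r mul0r addr0.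
  have tp' : 0 < t by rewrite lt_neqAle eq_sym tp.
  have H2 : t * rnorm (w2 - w) < t * (r / 2) by rewrite ltr_pM2l.
  have H1 : (1 - t) * rnorm (w1 - w) <= (1 - t) * (r / 2).
    by rewrite ler_wpM2l ?subr_ge0// ltW.
  by lra.
have hF' w' : rnorm (w' - wt) < r / 2 -> nc (F w') <= M /\ forall v, derivable F w' v.
  move=> hw; apply: hF; apply: (le_lt_trans (rnorm_tri _ _ wt)); lra.
have [_ dF] : nc (F wt) <= M /\ forall v, derivable F wt v.
  by apply: hF'; rewrite subrr rnorm0 divr_gt0.
split => //.
have [v0|v0] := eqVneq (rnorm v) 0.
  have -> : v = 0.
    by apply/eqP; rewrite -normr_eq0 rnormE v0.
  have [_ ->] : derivable F wt 0 /\ 'D_0 F wt = 0.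
    apply: cdiff_derivable; under eq_fun do rewrite scaler0 addr0.
    exact: cdiff_cst.
  by rewrite Normc.normc0 rnorm0 mulr0.
have v0' : 0 < rnorm v by rewrite lt_neqAle eq_sym v0 rnorm_ge0.
have rho0 : 0 < r / (8 * rnorm v) by rewrite divr_gt0// mulr_gt0.
have := @derive_bound F wt v (r / 2) M _ _ M0 rho0.
have -> : 4 * (r / (8 * rnorm v)) * rnorm v = r / 2 by field; rewrite v0.
rewrite lexx divr_gt0// => /(_ isT isT) H.
have {}H : r / (8 * rnorm v) * nc ('D_v F wt) <= 16 * M.
  by apply: H => w' /hF'[? ?]; split.
rewrite -(ler_pM2l rho0) (le_trans H)// le_eqVlt; apply/orP; left; apply/eqP.
by field; rewrite v0 gt_eqF.
Qed.

End complex_derivative.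

(** * Stability under directional derivatives *)

Section derivative_closed.
Context {R : realType}.
Local Notation C := R[i].
Local Notation nc := (@Normc.normc R).
Variable V : normedModType R[i].
Implicit Types (F : V -> C) (v w : V) (D : set V).

Lemma derivableB_derive F G w v : derivable F w v -> derivable G w v ->
  derivable (fun x => F x - G x) w v /\
  'D_v (fun x => F x - G x) w = 'D_v F w - 'D_v G w.
Proof.
by move=> dF dG; apply: cdiff_derivable; apply: cdiffB; exact: derivable_cdiff.
Qed.

Lemma derivableZ_derive F k w v : derivable F w v ->
  derivable (fun x => k * F x) w v /\
  'D_v (fun x => k * F x) w = k * 'D_v F w.
Proof.
by move=> dF; apply: cdiff_derivable; apply: cdiffZ; exact: derivable_cdiff.
Qed.

Lemma derivable_shift_derive F d w v : derivable F (w + d) v ->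
  derivable (fun x => F (x + d)) w v /\
  'D_v (fun x => F (x + d)) w = 'D_v F (w + d).
Proof.
move=> /derivable_cdiff dF; apply: cdiff_derivable.
by move: dF; congr cdiff; apply/funext => s; rewrite addrAC.
Qed.

Section at_point.
Variables (F : V -> C) (w v : V) (r M : R).
Hypotheses (r0 : (0 : R) < r) (M0 : (0 : R) <= M).
Hypothesis hF : forall w', rnorm (w' - w) < r ->
  nc (F w') <= M /\ forall v, derivable F w' v.

(** The successive estimates hold on balls of radius r / 16, r / 32 and r / 64; [rho u] is a scale
    for which the disc of radius 4 in direction [u] has size at most [rr]. *)
Let rr := r / 64.
Let rho (u : V) := rr / (4 * (rnorm u + 1)).
Let K := 128 * M / r.

Let rr0 : (0 : R) < rr. Proof. by rewrite /rr divr_gt0. Qed.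
Let pu (u : V) : 0 < rnorm u + 1. Proof. by rewrite ltr_wpDl ?rnorm_ge0. Qed.
Let rho0 u : 0 < rho u.
Proof. by rewrite /rho divr_gt0// mulr_gt0. Qed.
Let rhoP u : 4 * rho u * rnorm u <= rr.
Proof.
have -> : 4 * rho u * rnorm u = rr * (rnorm u / (rnorm u + 1)).
  by rewrite /rho; field; rewrite gt_eqF ?pu.
by rewrite ger_pMr// ler_pdivrMr// mul1r lerDl.
Qed.
Let K0 : 0 <= K. Proof. by rewrite /K divr_ge0 ?mulr_ge0// ltW. Qed.
Let r64 : r = 64 * rr. Proof. by rewrite /rr; field. Qed.

Let dF w' u : rnorm (w' - w) < r -> derivable F w' u.
Proof. by case/hF. Qed.

(** The derivative estimate for x -> F(x + d) - F(x), which the Lipschitz bound already makes at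
    most [K] |d|. *)
Lemma derive_lipschitz u w1 w2 : rnorm (w1 - w) < r / 16 -> rnorm (w2 - w) < r / 16 ->
  rho u * nc ('D_u F w2 - 'D_u F w1) <= 16 * (K * rnorm (w2 - w1)).
Proof.
have r0' : (0 : R) < r := r0; have rr0' : (0 : R) < rr := rr0; have r64' := r64.
move=> h1 h2; set d := w2 - w1.
have E : w1 + d = w2 by rewrite /d addrC subrK.
have hd : rnorm d < r / 8.
  by rewrite /d (le_lt_trans (rnorm_tri _ _ w))// (rnormB w) ; lra.
have d1 : derivable F (w1 + d) u by rewrite E; apply: dF; lra.
have d2 : derivable F w1 u by apply: dF; lra.
have [d3 e3] := derivable_shift_derive d1.
have [d4 e4] := derivableB_derive d3 d2.
rewrite -[X in 'D_u F X - _]E -e3 -e4.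
apply: (@derive_bound _ _ (fun x => F (x + d) - F x) w1 u rr (K * rnorm d) (rho u) rr0').
- by rewrite mulr_ge0// rnorm_ge0.
- exact: rho0.
- exact: rhoP.
move=> w' hw'.
have hw : rnorm (w' - w) < r / 2 by rewrite (le_lt_trans (rnorm_tri _ _ w1))//; lra.
have hwd : rnorm (w' + d - w) < r / 2.
  have -> : w' + d - w = (w' - w1) + ((w1 - w) + d).
    by rewrite [RHS]addrA subrKA [RHS]addrAC.
  rewrite (le_lt_trans (rnormD _ _))// (@le_lt_trans _ _ (rnorm (w' - w1) +
    (rnorm (w1 - w) + rnorm d)))// ?lerD2l ?rnormD//; lra.
split.
  have := lipschitz_ball r0 M0 hF hw hwd.
  by rewrite (_ : w' + d - w' = d)// addrAC subrr add0r.
have d5 : derivable F (w' + d) u by apply: dF; lra.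
have d6 : derivable F w' u by apply: dF; lra.
have [d7 _] := derivable_shift_derive d5.
by have [] := derivableB_derive d7 d6.
Qed.

Let C1 u := 16 * K * rnorm u / rho u.
Let C10 u : 0 <= C1 u.
Proof.
apply: divr_ge0; last exact: ltW (rho0 u).
by apply: mulr_ge0; [apply: mulr_ge0|exact: rnorm_ge0].
Qed.

(** Quadratic remainder: z -> F(w0 + z u) - z D_u F(w0) has a derivative of order |z|, because D_u F
    is Lipschitz. *)
Lemma quotient_rate u w0 (s : C) : rnorm (w0 - w) < r / 32 ->
  nc s * rnorm u < r / 32 ->
  nc (F (w0 + s *: u) - F w0 - s * 'D_u F w0) <= C1 u * nc s * nc s.
Proof.
have r0' : (0 : R) < r := r0; have rr0' : (0 : R) < rr := rr0; have r64' := r64.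
move=> h0 hs.
pose k (z : C) := F (w0 + z *: u) - z * 'D_u F w0.
have := @cdiff_mvt _ k 0 s (C1 u * nc s).
rewrite /k scale0r addr0 mul0r !subr0 addrAC; apply.
move=> t /andP[t0 t1]; rewrite add0r.
have nt : nc (t%:C%C * s) <= nc s.
  by rewrite Normc.normcM normc_real ger0_norm// ler_piMl ?normc_ge0.
have hz : rnorm (w0 + (t%:C%C * s) *: u - w) < r / 16.
  rewrite addrAC (le_lt_trans (rnormD _ _))// rnormZ.
  have : nc (t%:C%C * s) * rnorm u <= nc s * rnorm u by rewrite ler_wpM2r ?rnorm_ge0.
  lra.
exists ('D_u F (w0 + (t%:C%C * s) *: u) - 1 * 'D_u F w0).
  apply: cdiffB.
    apply: derivable_cdiff_at; apply: dF; lra.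
  have -> : (fun z => z * 'D_u F w0) = (fun z => 'D_u F w0 * (0 + 1 * z)).
    by apply/funext => z; rewrite add0r mul1r mulrC.
  rewrite mul1r -[X in cdiff _ _ X]mulr1; apply: cdiffZ.
  move=> e e0; exists 1 => // z _.
  have -> : 0 + 1 * z - (0 + 1 * (t%:C%C * s)) - 1 * (z - t%:C%C * s) = 0 by ring.
  by rewrite Normc.normc0 mulr_ge0 ?normc_ge0 ?ltW.
rewrite mul1r.
have hw0 : rnorm (w0 - w) < r / 16 by lra.
have := derive_lipschitz u hw0 hz.
have -> : w0 + (t%:C%C * s) *: u - w0 = (t%:C%C * s) *: u by rewrite addrAC subrr add0r.
rewrite rnormZ => h.
rewrite -(ler_pM2l (rho0 u)) (le_trans h)//.
have -> : rho u * (C1 u * nc s) = 16 * (K * (nc s * rnorm u)).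
  by rewrite /C1; field; rewrite gt_eqF ?rho0.
by rewrite ler_wpM2l// ler_wpM2l// ler_wpM2r ?rnorm_ge0.
Qed.

Lemma derive_bound_at w' : rnorm (w' - w) < rr ->
  nc ('D_v F w') <= 16 * M / rho v.
Proof.
have r0' : (0 : R) < r := r0; have rr0' : (0 : R) < rr := rr0; have r64' := r64.
move=> hw'; rewrite ler_pdivlMr// mulrC.
apply: (@derive_bound _ _ F w' v rr M (rho v) rr0' M0 (rho0 v) (rhoP v)) => w'' hw''.
have [|? ?] := hF (w' := w''); last by split.
by rewrite (le_lt_trans (rnorm_tri _ _ w'))//; lra.
Qed.

(** The quotients (F(x + s u) - F(x)) / s are Cauchy in s at a linear rate, uniformly in x. The
    derivative estimate transfers the rate to their derivatives along [v], which are the difference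
    quotients of D_v F. *)
Lemma derive_derivable w' u : rnorm (w' - w) < rr -> derivable ('D_v F) w' u.
Proof.
have r0' : (0 : R) < r := r0; have rr0' : (0 : R) < rr := rr0; have r64' := r64.
move=> hw'.
pose Q (s : C) := ('D_v F (w' + s *: u) - 'D_v F w') * s^-1.
pose del := rr / (rnorm u + 1).
have del0 : 0 < del by rewrite divr_gt0.
have delP s : nc s < del -> nc s * rnorm u < rr.
  rewrite ltr_pdivlMr// => h; apply: le_lt_trans h.
  by rewrite ler_wpM2l ?normc_ge0// lerDl.
have small w'' : rnorm (w'' - w') < rr -> rnorm (w'' - w) < r / 32.
  by move=> h; rewrite (le_lt_trans (rnorm_tri _ _ w'))//; lra.
have step s w'' : nc s < del -> rnorm (w'' - w') < rr -> rnorm (w'' + s *: u - w) < r.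
  move=> /delP sd /small h; rewrite addrAC (le_lt_trans (rnormD _ _))// rnormZ; lra.
pose q (s : C) (x : V) := s^-1 * (F (x + s *: u) - F x).
have dq s x : nc s < del -> rnorm (x - w') < rr -> derivable (q s) x v /\
    'D_v (q s) x = s^-1 * ('D_v F (x + s *: u) - 'D_v F x).
  move=> sd xw; have d1 : derivable F (x + s *: u) v by apply: dF; exact: step.
  have d2 : derivable F x v by apply: dF; have := small _ xw; lra.
  have [d3 e3] := derivable_shift_derive d1.
  have [d4 e4] := derivableB_derive d3 d2.
  have [d5 e5] := derivableZ_derive s^-1 d4; split; first exact: d5.
  by rewrite -e3 -e4; exact: e5.
have ww : rnorm (w' - w') < rr by rewrite subrr rnorm0.
have hQ s t : s != 0 -> t != 0 -> nc s < del -> nc t < del ->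
    nc (Q s - Q t) <= 16 * C1 u / rho v * (nc s + nc t).
  move=> s0 t0 sd td.
  have [d1 e1] := dq s w' sd ww; have [d2 e2] := dq t w' td ww.
  have [d3 e3] := derivableB_derive d1 d2.
  have -> : Q s - Q t = 'D_v (fun x => q s x - q t x) w'.
    rewrite e3 e1 e2 /Q; congr (_ - _); exact: mulrC.
  rewrite -(ler_pM2l (rho0 v)).
  have -> : rho v * (16 * C1 u / rho v * (nc s + nc t)) = 16 * (C1 u * (nc s + nc t)).
    by field; rewrite gt_eqF ?rho0.
  have cst0 : 0 <= C1 u * (nc s + nc t) by rewrite mulr_ge0// addr_ge0 ?normc_ge0.
  apply: (@derive_bound _ _ (fun x => q s x - q t x) w' v rr _ _ rr0' cst0 (rho0 v) (rhoP v)).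
  move=> x hx; split; last first.
    have [f1 _] := dq s x sd hx; have [f2 _] := dq t x td hx.
    by have [] := derivableB_derive f1 f2.
  have H (z : C) : z != 0 -> nc z < del -> nc (q z x - 'D_u F x) <= C1 u * nc z.
    move=> z0 zd; have nz := normc_gt0 z0.
    have := @quotient_rate u x z (small _ hx).
    have zr : nc z * rnorm u < r / 32 by have := delP z zd; lra.
    move=> /(_ zr) h.
    have -> : q z x - 'D_u F x = (F (x + z *: u) - F x - z * 'D_u F x) * z^-1.
      by rewrite /q; field.
    by rewrite Normc.normcM Normc.normcV ler_pdivrMr.
  rewrite (le_trans (normc_triB _ _ ('D_u F x)))// mulrDr lerD ?H//.
  by rewrite normcB H.
have K1 : 0 <= 16 * C1 u / rho v by rewrite divr_ge0 ?(ltW (rho0 v))// mulr_ge0.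
have [l hl] := cauchy_rate_lim del0 K1 hQ.
have [] // := @cdiff_derivable _ _ ('D_v F) w' u l.
move=> e e0; set k := 2 * _ in hl.
have k1 : 0 < k + 1 by rewrite ltr_wpDl// mulr_ge0.
exists (Num.min del (e / (k + 1))); first by rewrite lt_min del0 divr_gt0.
move=> s; rewrite subr0 lt_min => /andP[sd]; rewrite ltr_pdivlMr// => se.
rewrite scale0r addr0.
have [->|s0] := eqVneq s 0.
  by rewrite scale0r addr0 subrr mulr0 subr0 Normc.normc0 mulr0.
have -> : 'D_v F (w' + s *: u) - 'D_v F w' - l * s = (Q s - l) * s.
  rewrite /Q; move: ('D_v F _) ('D_v F _) => a b; by field.
rewrite Normc.normcM ler_wpM2r ?normc_ge0// (le_trans (hl s s0 sd))//.
apply: le_trans (ltW se); rewrite mulrC ler_wpM2l ?normc_ge0// lerDl//.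
Qed.

End at_point.

Lemma bounded_hol_derive D F v : bounded_hol D F -> bounded_hol D ('D_v F).
Proof.
move=> hF w /hF[r r0 [M hM]].
have M0 : 0 <= M.
  have [] := hM w; first by rewrite subrr rnorm0.
  by move=> _ h _; rewrite (le_trans _ h)// normc_ge0.
have h w' : rnorm (w' - w) < r -> nc (F w') <= M /\ forall v, derivable F w' v.
  by move=> /hM[].
exists (r / 64); first by rewrite divr_gt0.
eexists => w' hw'; split.
- by have [] := hM w'; first by lra.
- exact: (derive_bound_at v r0 M0 h hw').
- by move=> u; exact: (derive_derivable r0 M0 h).
Qed.

Lemma bounded_holB D F G : bounded_hol D F -> bounded_hol D G ->
  bounded_hol D (fun x => F x - G x).
Proof.
move=> hF hG w Dw; have [r1 r10 [M1 h1]] := hF w Dw.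
have [r2 r20 [M2 h2]] := hG w Dw.
exists (Num.min r1 r2); first by rewrite lt_min r10.
exists (M1 + M2) => w'; rewrite lt_min => /andP[/h1[D1 b1 d1] /h2[D2 b2 d2]].
split; [exact: D1| |].
  by rewrite (le_trans (le_normcD _ _))// normcN lerD.
by move=> v; have [] := derivableB_derive (d1 v) (d2 v).
Qed.

(** A small disc in direction [v] around a point of [D] stays in [D], so values outside do not
    matter. *)
Lemma eq_on_derive D F G w v : bounded_hol D F -> D w ->
  (forall x, D x -> F x = G x) -> 'D_v G w = 'D_v F w.
Proof.
move=> hF Dw FG; have [r r0 [M hM]] := hF w Dw.
have [_ _ dF] := hM w (eq_ind_r (fun x => x < r) r0 (eq_trans (congr1 _ (subrr w)) (rnorm0 V))).
have dl := derivable_cdiff (dF v).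
have v1 : 0 < rnorm v + 1 by rewrite ltr_wpDl ?rnorm_ge0.
apply: (cdiff_derivable _).2.
apply: (@eq_cdiff _ (fun s => F (w + s *: v)) _ _ _ (r / (rnorm v + 1))) dl.
  by rewrite divr_gt0.
move=> s; rewrite subr0 ltr_pdivlMr// => hs; apply: FG.
have [] // := hM (w + s *: v).
rewrite addrAC subrr add0r rnormZ; apply: le_lt_trans hs.
by rewrite ler_wpM2l ?normc_ge0// lerDl.
Qed.

End derivative_closed.

(** * Complex matrices acting on real coordinates *)

Section real_action.
Context {R : realType}.
Local Notation C := R[i].
Local Notation re := (@re_mx R _ _).
Local Notation im := (@im_mx R _ _).

Definition realmat n (g : 'M[C]_n) : 'M[R]_(n + n) :=
  block_mx (re g) (- im g) (im g) (re g).

Lemma detRE n (g : 'M[C]_n) : detR g = \det (realmat g).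
Proof. by []. Qed.

Lemma re_mulmx p q r (A : 'M[C]_(p, q)) (B : 'M[C]_(q, r)) :
  re (A *m B) = re A *m re B - im A *m im B.
Proof.
apply/matrixP => i j; rewrite !mxE raddf_sum -sumrB; apply: eq_bigr => k _.
by rewrite !mxE; case: (A i k) (B k j) => ? ? [].
Qed.

Lemma im_mulmx p q r (A : 'M[C]_(p, q)) (B : 'M[C]_(q, r)) :
  im (A *m B) = re A *m im B + im A *m re B.
Proof.
apply/matrixP => i j; rewrite !mxE raddf_sum -big_split; apply: eq_bigr => k _.
by rewrite !mxE; case: (A i k) (B k j) => ? ? [].
Qed.

Lemma re_cplx p q (A B : 'M[R]_(p, q)) : re (cplx A B) = A.
Proof. by apply/matrixP => i j; rewrite !mxE. Qed.

Lemma im_cplx p q (A B : 'M[R]_(p, q)) : im (cplx A B) = B.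
Proof. by apply/matrixP => i j; rewrite !mxE. Qed.

Lemma cplx_reim p q (A : 'M[C]_(p, q)) : cplx (re A) (im A) = A.
Proof. by apply/matrixP => i j; rewrite !mxE; case: (A i j). Qed.

Lemma realmat_mul n (g h : 'M[C]_n) : realmat (g *m h) = realmat g *m realmat h.
Proof.
rewrite /realmat mulmx_block re_mulmx im_mulmx !mulNmx !mulmxN opprD.
by congr block_mx; rewrite addrC.
Qed.

Lemma realmat1 n : realmat (1%:M : 'M[C]_n) = 1%:M.
Proof.
have -> : (1%:M : 'M[R]_(n + n)) = block_mx 1%:M 0 0 1%:M by rewrite -scalar_mx_block.
rewrite /realmat; congr block_mx; apply/matrixP => i j; rewrite !mxE;
  by case: (i == j); rewrite /= ?oppr0.
Qed.

(** Multiplicativity of [realmat] turns a complex inverse into a real one. *)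
Lemma detR_neq0 n (g : 'M[C]_n) : g \in unitmx -> detR g != 0.
Proof.
move=> ug; rewrite detRE; apply/eqP => h.
have := congr1 determinant (realmat_mul g (invmx g)).
by rewrite mulmxV// realmat1 det1 det_mulmx h mul0r => /eqP; rewrite oner_eq0.
Qed.

Definition actE n (g : 'M[C]_n) (v : 'cV[R]_n * 'cV[R]_n) : 'cV[R]_n * 'cV[R]_n :=
  (re g *m v.1 + - im g *m v.2, im g *m v.1 + re g *m v.2).

Lemma cplx_actE n (g : 'M[C]_n) v :
  cplx (actE g v).1 (actE g v).2 = g *m cplx v.1 v.2.
Proof.
rewrite -[RHS]cplx_reim re_mulmx im_mulmx !re_cplx !im_cplx /actE/= mulNmx.
by rewrite [im g *m _ + _]addrC.
Qed.

Lemma measurable_actE n (g : 'M[C]_n) : measurable_fun setT (actE g).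
Proof.
apply: measurable_fun_pair; apply: measurable_cVP => i; under eq_fun do rewrite !mxE;
 apply: measurable_funD; apply: measurable_sum => j; apply: measurable_funM => //;
 apply: (measurableT_comp (measurable_coord j)) => //;
 by [exact: measurable_fst|exact: measurable_snd].
Qed.

Local Open Scope ereal_scope.

Lemma lebE_act n (g : 'M[C]_n) U : g \in unitmx -> measurable U ->
  lebE n (actE g @^-1` U) = `|detR g|^-1%:E * lebE n U.
Proof. by move=> /detR_neq0 g0 mU; exact: pair_block. Qed.

Lemma lebE_translate n (b : 'cV[R]_n * 'cV[R]_n) U : measurable U ->
  lebE n ((fun z => (z + b)%R) @^-1` U) = lebE n U.
Proof.
move=> mU.
have mt k (c : 'cV[R]_k) : measurable_fun setT (fun x : 'cV[R]_k => (x + c)%R).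
  have := @measurable_affine_cV R k 1%:M c.
  by under eq_fun do rewrite mul1mx.
have := @product_measure_shear _ _ _ _ R (@lebesgue_cV R n) (@lebesgue_cV R n)
  (fun x => x + b.1)%R (fun _ y => y + b.2)%R (NngNum (@ler01 R)) (NngNum (@ler01 R)) U
  (mt _ _) _ _ _ mU.
rewrite /= mulr1 mul1e => H.
rewrite -[RHS]H.
- by congr (_ _); apply/seteqP; split=> -[x y].
- by apply: (measurableT_comp (mt _ _)); exact: measurable_snd.
- by move=> A mA; rewrite mul1e; exact: lebesgue_cV_translate.
- by move=> _ A mA; rewrite mul1e; exact: lebesgue_cV_translate.
Qed.

Lemma measurable_translateE n (b : 'cV[R]_n * 'cV[R]_n) :
  measurable_fun setT (fun z : 'cV[R]_n * 'cV[R]_n => (z + b)%R).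
Proof.
have mt k (c : 'cV[R]_k) : measurable_fun setT (fun x : 'cV[R]_k => (x + c)%R).
  have := @measurable_affine_cV R k 1%:M c.
  by under eq_fun do rewrite mul1mx.
have -> : (fun z : 'cV[R]_n * 'cV[R]_n => (z + b)%R) = (fun z : 'cV[R]_n * 'cV[R]_n => (z.1 + b.1, z.2 + b.2)%R).
  by apply/funext => -[].
apply: measurable_fun_pair; apply: (measurableT_comp (mt _ _)).
  exact: measurable_fst.
exact: measurable_snd.
Qed.

Lemma lebP_act n m (g : 'M[C]_n) (h : 'M[C]_m) U :
  g \in unitmx -> h \in unitmx -> measurable U ->
  lebP n m ((fun z => (actE g z.1, actE h z.2)) @^-1` U) =
    (`|detR g|^-1 * `|detR h|^-1)%:E * lebP n m U.
Proof.
move=> ug uh mU.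
have g0 : (0 <= `|detR g|^-1)%R by rewrite invr_ge0.
have h0 : (0 <= `|detR h|^-1)%R by rewrite invr_ge0.
apply: (@product_measure_shear _ _ _ _ R (lebE n) (lebE m) (actE g) (fun=> actE h)
  (NngNum g0) (NngNum h0)) => //.
- exact: measurable_actE.
- by apply: (measurableT_comp (measurable_actE h)); exact: measurable_snd.
- by move=> A mA; exact: lebE_act.
- by move=> _ A mA; exact: lebE_act.
Qed.

Lemma lebP_translate n m (b : ('cV[R]_n * 'cV[R]_n) * ('cV[R]_m * 'cV[R]_m))
    (U : set (('cV[R]_n * 'cV[R]_n) * ('cV[R]_m * 'cV[R]_m))) : measurable U ->
  lebP n m ((fun z => (z + b)%R) @^-1` U) = lebP n m U.
Proof.
move=> mU.
have := @product_measure_shear _ _ _ _ R (lebE n) (lebE m)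
  (fun x => x + b.1)%R (fun _ y => y + b.2)%R (NngNum (@ler01 R)) (NngNum (@ler01 R)) U
  (measurable_translateE _) _ _ _ mU.
rewrite /= mulr1 mul1e => H.
rewrite -[RHS]H.
- by congr (_ _); apply/seteqP; split=> -[x y].
- by apply: (measurableT_comp (measurable_translateE _)); exact: measurable_snd.
- by move=> A mA; rewrite mul1e; exact: lebE_translate.
- by move=> _ A mA; rewrite mul1e; exact: lebE_translate.
Qed.

Lemma lebP_open_gt0 n m (U : set (('cV[R]_n * 'cV[R]_n) * ('cV[R]_m * 'cV[R]_m))) x : open U -> U x -> 0 < lebP n m U.
Proof.
move=> oU Ux; apply: (@product_open_gt0 R _ _ _ _ (lebE n) (lebE m) open open U x).
- by move=> V y oV Vy; split; [exact: open_measurable_E|exact: (lebesgue_E_open_gt0 oV Vy)].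
- by move=> V y oV Vy; split; [exact: open_measurable_E|exact: (lebesgue_E_open_gt0 oV Vy)].
- exact: open_measurable_P.
- exact: (open_prod_rect oU Ux).
Qed.

End real_action.

(** * Measurability of functions supported in an open set *)

Section measurable_open_support.
Context {R : realType}.

(** A preimage is that of an open subset of [U], together with the complement of [U] when the target
    set contains 0. The map [i] lets [X] have complex coordinates while [M] carries the real ones
    and the measure. *)
Lemma measurable_open_support (X : topologicalType) d (M : measurableType d)
    (i : M -> X) (g : M -> R) (U : set X) :
  (forall V : set X, open V -> measurable (i @^-1` V)) -> open U ->
  (exists2 f : X -> R, {in U, continuous f} & forall x, U (i x) -> g x = f (i x)) ->
  (forall x, ~ U (i x) -> g x = 0) ->
  measurable_fun setT (g : M -> measurableTypeR R).
Proof.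
move=> hi oU [f cf gf] g0; apply: preimage_measurable_fun => // V oV.
rewrite setTI.
have mUV : measurable (i @^-1` (U `&` f @^-1` V)).
  apply: hi; rewrite openE => x [Ux fx]; rewrite /interior.
  apply: filterI; first exact: open_nbhs_nbhs.
  by apply: cf; [rewrite inE|exact: open_nbhs_nbhs].
have mU : measurable (i @^-1` U) by exact: hi.
have [V0|V0] := pselect (V 0).
- rewrite (_ : g @^-1` V = i @^-1` (U `&` f @^-1` V) `|` ~` (i @^-1` U)).
    by apply: measurableU => //; exact: measurableC.
  apply/seteqP; split=> x /=.
    move=> Vg; have [Ux|Ux] := pselect (U (i x)); last by right.
    by left; split => //; rewrite -gf.
  by case=> [[Ux fx]|Ux]; [rewrite gf|rewrite g0].
- rewrite (_ : g @^-1` V = i @^-1` (U `&` f @^-1` V))//.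
  apply/seteqP; split=> x /=.
    move=> Vg; have [Ux|Ux] := pselect (U (i x)).
      by split => //; rewrite -gf.
    by move: Vg; rewrite g0.
  by move=> [Ux fx]; rewrite gf.
Qed.

End measurable_open_support.

(** * Norm and real coordinates of points *)

Section point_norm.
Context {R : realType}.
Local Notation C := R[i].
Local Notation nc := (@Normc.normc R).
Local Notation point n m := ('cV[C]_n * 'cV[C]_m)%type.
Local Notation P n m := (('cV[R]_n * 'cV[R]_n) * ('cV[R]_m * 'cV[R]_m))%type.

Lemma rnorm_ballE (V : normedModType C) (x : V) r : rnorm x < r <-> ball 0 r%:C%C x.
Proof. by rewrite -ball_normE/= sub0r normrN rnormE ltcR. Qed.

Lemma rnorm_cV k (x : 'cV[C]_k) r : 0 < r ->
  rnorm x < r <-> forall i, nc (x i ord0) < r.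
Proof.
move=> r0; rewrite rnorm_ballE; split=> [[_ h] i|h].
  have := h i ord0; rewrite mxE.
  by move=> /rnorm_ballE; rewrite rnorm_normc.
split=> [|i j]; first by rewrite ltcR.
by rewrite mxE ord1; apply/rnorm_ballE; rewrite rnorm_normc.
Qed.

Lemma rnorm_pair n m (x : point n m) r :
  rnorm x < r <-> rnorm x.1 < r /\ rnorm x.2 < r.
Proof.
rewrite !rnorm_ballE; split=> [[h1 h2]|[h1 h2]]; by split.
Qed.

Lemma rnorm_coord k (x : 'cV[C]_k) i : nc (x i ord0) <= rnorm x.
Proof.
rewrite leNgt; apply/negP => h.
have := rnorm_cV x (le_lt_trans (rnorm_ge0 x) h).
by move=> [/(_ h)/(_ i)]; rewrite ltxx.
Qed.

Lemma rnorm_fst n m (x : point n m) : rnorm x.1 <= rnorm x.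
Proof.
rewrite leNgt; apply/negP => h.
by have /rnorm_pair[] := h; rewrite ltxx.
Qed.

Lemma rnorm_snd n m (x : point n m) : rnorm x.2 <= rnorm x.
Proof.
rewrite leNgt; apply/negP => h.
by have /rnorm_pair[_] := h; rewrite ltxx.
Qed.

Lemma real_pointB n m (v w : P n m) : real_point (v - w) = real_point v - real_point w.
Proof.
congr pair; apply/matrixP => i j; rewrite !mxE;
  by apply/eqP; rewrite eq_complex/= !eqxx.
Qed.

Lemma real_pointD n m (v w : P n m) : real_point (v + w) = real_point v + real_point w.
Proof.
congr pair; apply/matrixP => i j; rewrite !mxE;
  by apply/eqP; rewrite eq_complex/= !eqxx.
Qed.

Lemma real_point_act n m (z : C) (v : P n m) :
  real_point (actE z%:M v.1, actE z%:M v.2) = z *: real_point v.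
Proof.
congr pair => /=; rewrite cplx_actE mul_scalar_mx; by [].
Qed.

Lemma real_point_cont n m (v : P n m) e : 0 < e ->
  exists2 d, 0 < d & forall w, ball v d w -> rnorm (real_point w - real_point v) < e.
Proof.
move=> e0; have e20 : 0 < e / 2 by rewrite divr_gt0.
exists (e / 2) => // w [[[_ h1] [_ h2]] [[_ h3] [_ h4]]].
have H k (a b c d : 'cV[R]_k) : (forall i j, ball (a i j) (e / 2) (b i j)) ->
   (forall i j, ball (c i j) (e / 2) (d i j)) -> rnorm (cplx b d - cplx a c) < e.
  move=> ab cd; apply/rnorm_cV => // i; rewrite !mxE.
  apply: (le_lt_trans (normc_le_ReIm _)) => /=; rewrite (splitr e).
  have := ab i ord0; have := cd i ord0.
  rewrite /ball/= => h1' h2'; rewrite (distrC (b i ord0)) (distrC (d i ord0)).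
  exact: ltrD.
by apply/rnorm_pair; split; apply: H.
Qed.

Lemma real_point_comp_continuous n m (F : point n m -> C) (v : P n m) :
  (forall e, 0 < e -> exists2 d, 0 < d & forall w, rnorm (w - real_point v) < d ->
    nc (F w - F (real_point v)) < e) ->
  {for v, continuous (fun v => nc (F (real_point v)))} /\
  ({for v, continuous (fun v => complex.Re (F (real_point v)))} /\
  {for v, continuous (fun v => complex.Im (F (real_point v)))}).
Proof.
move=> hF.
have H (p : C -> R) : (forall a b, `|p a - p b| <= nc (a - b)) ->
    {for v, continuous (fun v => p (F (real_point v)))}.
  move=> hp; apply/cvgrPdist_lt => e /hF[d d0 hd].
  have [d' d'0 hd'] := real_point_cont v d0.
  apply: filterS (nbhsx_ballx v d' d'0) => w /hd'/hd.
  by rewrite distrC; apply: le_lt_trans.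
split; last split; apply: H => a b.
- rewrite ler_norml lerBlDr lerNl opprB lerBlDr; apply/andP; split.
    by rewrite normcB -{1}[b](subrK a) le_normcD.
  by rewrite -{1}[a](subrK b) le_normcD.
- by rewrite -raddfB absRe_le_normc.
- by rewrite -raddfB absIm_le_normc.
Qed.

Lemma open_rnorm_ball n m r : open [set v : P n m | rnorm (real_point v) < r].
Proof.
rewrite openE => v /= vr; apply/nbhs_ballP.
have d0 : 0 < r - rnorm (real_point v) by rewrite subr_gt0.
have [d' d'0 hd'] := real_point_cont v d0.
exists d' => // w /hd' h /=.
by rewrite -(subrK (real_point v) (real_point w)) (le_lt_trans (rnormD _ _))// -ltrBrDr.
Qed.

Lemma lebP_rnorm_ball n m r :
  (lebP n m [set v : P n m | (rnorm (real_point v) < r)%R] < +oo)%E.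
Proof.
have [r0|r0] := leP r 0.
  rewrite (_ : [set _ | _] = set0) ?measure0//.
  by apply/seteqP; split=> v //= h; have := rnorm_ge0 (real_point v); lra.
pose Q k : set 'cV[R]_k := cube 0 r.
have fin k : (lebesgue_cV k (Q k) < +oo)%E by rewrite lebesgue_cube ?ltry.
have mQ k : measurable (Q k) by exact: measurable_cube.
have finE k : (lebE k (Q k `*` Q k) < +oo)%E.
  have -> : lebE k (Q k `*` Q k) = (lebesgue_cV k (Q k) * lebesgue_cV k (Q k))%E.
    exact: (product_measure1E _ _ (mQ k) (mQ k)).
  by rewrite lebesgue_cube// -EFinM ltry.
have mQQ k : measurable (Q k `*` Q k) by exact: measurableX.
apply: (@le_lt_trans _ _ (lebP n m ((Q n `*` Q n) `*` (Q m `*` Q m)))).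
  apply: le_measure; rewrite ?inE.
  - by apply: open_measurable_P; exact: open_rnorm_ball.
  - exact: measurableX.
  - move=> v /= /rnorm_pair[/rnorm_cV h1 /rnorm_cV h2].
    have Hr k (a b : 'cV[R]_k) : (forall i, nc (cplx a b i ord0) < r) ->
        Q k a /\ Q k b.
      move=> h; split=> i; rewrite mxE subr0; have := h i; rewrite mxE;
      apply: le_lt_trans; [exact: (absRe_le_normc (_ +i* _)%C)|
        exact: (absIm_le_normc (_ +i* _)%C)].
    by split; [exact: Hr (h1 r0)|exact: Hr (h2 r0)].
have -> : lebP n m ((Q n `*` Q n) `*` (Q m `*` Q m)) =
    (lebE n (Q n `*` Q n) * lebE m (Q m `*` Q m))%E.
  exact: (product_measure1E _ _ (mQQ n) (mQQ m)).
have f1 := finE n; have f2 := finE m.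
by rewrite lte_mul_pinfty// ge0_fin_numE.
Qed.

End point_norm.

(** * The mean value inequality in several variables *)

Section mean_value_points.
Context {R : realType} (n m : nat).
Local Notation C := R[i].
Local Notation nc := (@Normc.normc R).
Local Notation point := ('cV[C]_n * 'cV[C]_m)%type.
Local Notation P := (('cV[R]_n * 'cV[R]_n) * ('cV[R]_m * 'cV[R]_m))%type.
Local Notation lam := (@lebP R n m).
Local Notation B r := [set v : P | rnorm (real_point v) < r].
Local Notation I11 := (`[(-1)%R, 1%R]%classic : set (measurableTypeR R)).

Definition scalE k (z : C) (v : 'cV[R]_k * 'cV[R]_k) : 'cV[R]_k * 'cV[R]_k :=
  (complex.Re z *: v.1 - complex.Im z *: v.2, complex.Im z *: v.1 + complex.Re z *: v.2).

Definition scalP (z : C) (v : P) : P := (scalE z v.1, scalE z v.2).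

Lemma scalE_act k z v : scalE z v = actE (z%:M : 'M[C]_k) v.
Proof.
have hr : re_mx (z%:M : 'M[C]_k) = (complex.Re z)%:M.
  by apply/matrixP => i j; rewrite !mxE; case: (i == j).
have hi : im_mx (z%:M : 'M[C]_k) = (complex.Im z)%:M.
  by apply/matrixP => i j; rewrite !mxE; case: (i == j).
by rewrite /actE hr hi mulNmx !mul_scalar_mx.
Qed.

Lemma real_point_scal z v : real_point (scalP z v) = z *: real_point v.
Proof. by rewrite /scalP !scalE_act real_point_act. Qed.

Lemma measurable_scalP_fun d (T : measurableType d) (a : T -> C) (b : T -> P) :
  measurable_fun setT (fun x => complex.Re (a x) : measurableTypeR R) ->
  measurable_fun setT (fun x => complex.Im (a x) : measurableTypeR R) ->
  measurable_fun setT b ->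
  measurable_fun setT (fun x => scalP (a x) (b x)).
Proof.
move=> ma mb mc.
have H k (e : T -> 'cV[R]_k * 'cV[R]_k) : measurable_fun setT e ->
    measurable_fun setT (fun x => scalE (a x) (e x)).
  move=> me.
  have m1 i : measurable_fun setT (fun x => (e x).1 i ord0 : measurableTypeR R).
    by apply: (measurableT_comp (measurable_coord i)); exact: (measurableT_comp measurable_fst).
  have m2 i : measurable_fun setT (fun x => (e x).2 i ord0 : measurableTypeR R).
    by apply: (measurableT_comp (measurable_coord i)); exact: (measurableT_comp measurable_snd).
  apply: measurable_fun_pair; apply: measurable_cVP => i; under eq_fun do rewrite !mxE.
    by apply: measurable_funB; apply: measurable_funM => //; exact: m1 || exact: m2.
  by apply: measurable_funD; apply: measurable_funM => //; exact: m1 || exact: m2.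
apply: measurable_fun_pair; apply: H.
  exact: (measurableT_comp measurable_fst).
exact: (measurableT_comp measurable_snd).
Qed.

Lemma measurable_scalP z : measurable_fun setT (scalP z).
Proof. exact: measurable_scalP_fun. Qed.

Lemma measurable_ball_rnorm r : measurable (B r).
Proof. by apply: open_measurable_P; exact: open_rnorm_ball. Qed.

Lemma scal_unit (z : C) k : z != 0 -> (z%:M : 'M[C]_k) \in unitmx.
Proof. by move=> z0; rewrite unitmxE det_scalar unitrX// unitfE. Qed.

Lemma lam_scal z : z != 0 -> exists c : {nonneg R},
  forall U, measurable U -> lam (scalP z @^-1` U) = (c%:num%:E * lam U)%E.
Proof.
move=> z0.
have c0 : 0 <= `|detR (z%:M : 'M[C]_n)|^-1 * `|detR (z%:M : 'M[C]_m)|^-1.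
  by rewrite mulr_ge0// invr_ge0.
exists (NngNum c0) => U mU.
rewrite -(lebP_act (scal_unit n z0) (scal_unit m z0) mU).
by congr (_ _); apply/seteqP; split=> v; rewrite /scalP /= !scalE_act.
Qed.

Lemma detR_real (x : R) k : detR (x%:C%C%:M : 'M[C]_k) = x ^+ (k + k).
Proof.
have hr : re_mx (x%:C%C%:M : 'M[C]_k) = x%:M.
  by apply/matrixP => i j; rewrite !mxE; case: (i == j).
have hi : im_mx (x%:C%C%:M : 'M[C]_k) = 0.
  by apply/matrixP => i j; rewrite !mxE; case: (i == j).
by rewrite /detR hr hi oppr0 det_ublock !det_scalar exprD.
Qed.

Definition rdim := ((n + n) + (m + m))%N.

Lemma lam_scal_real (x : R) U : 0 < x -> measurable U ->
  lam (scalP x%:C%C @^-1` U) = ((x ^+ rdim)^-1%:E * lam U)%E.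
Proof.
move=> x0 mU; have xc : (x%:C%C : C) != 0 by rewrite eq_complex/= negb_and gt_eqF.
rewrite (_ : (x ^+ rdim)^-1 =
    `|detR (x%:C%C%:M : 'M[C]_n)|^-1 * `|detR (x%:C%C%:M : 'M[C]_m)|^-1).
  rewrite -(lebP_act (scal_unit n xc) (scal_unit m xc) mU).
  by congr (_ _); apply/seteqP; split=> v; rewrite /scalP /= !scalE_act.
by rewrite !detR_real !ger0_norm ?exprn_ge0 ?(ltW x0)// -invfM -exprD.
Qed.

Lemma ball_lam_gt0 r : 0 < r -> (0 < lam (B r))%E.
Proof.
move=> r0; apply: (@lebP_open_gt0 R n m (B r) 0); first exact: open_rnorm_ball.
have h0 : real_point (0 : P) = 0 by rewrite -[0 in LHS](subrr 0) real_pointB subrr.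
by change (rnorm (real_point (0 : P)) < r); rewrite h0 rnorm0.
Qed.

(** The factor can be read on the unit ball, which a dilation of modulus at least 1 pulls back into
    itself; no determinant has to be computed. *)
Lemma lam_scal_le1 z : 1 <= nc z -> exists2 c : {nonneg R}, c%:num <= 1 &
  forall U, measurable U -> lam (scalP z @^-1` U) = (c%:num%:E * lam U)%E.
Proof.
move=> z1; have z0 : z != 0.
  by apply/eqP => h; move: z1; rewrite h Normc.normc0 ler10.
have [c hc] := lam_scal z0; exists c => //.
have B0 := ball_lam_gt0 ltr01.
have Bf : (lam (B 1%R) \is a fin_num).
  by rewrite ge0_fin_numE// lebP_rnorm_ball.
rewrite -lee_fin -(@lee_pmul2r _ (lam (B 1%R)))// -hc; last exact: measurable_ball_rnorm.
rewrite mul1e; apply: le_measure; rewrite ?inE.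
- rewrite -[X in measurable X]setTI; apply: measurable_scalP => //; exact: measurable_ball_rnorm.
- exact: measurable_ball_rnorm.
- move=> v /=; rewrite real_point_scal rnormZ; apply: le_lt_trans.
  by rewrite ler_peMl ?rnorm_ge0.
Qed.

Lemma bounded_ccont (F : point -> C) w r M : 0 < r ->
  (forall w', rnorm (w' - w) < r -> nc (F w') <= M /\ forall v, derivable F w' v) ->
  forall w', rnorm (w' - w) < r -> forall e, 0 < e -> exists2 d, 0 < d &
    forall x, rnorm (x - w') < d -> nc (F x - F w') < e.
Proof.
move=> r0 hF w' hw' e e0.
have M0 : 0 <= M by have [h _] := hF _ hw'; rewrite (le_trans _ h)// normc_ge0.
pose r' := r - rnorm (w' - w).
have r'0 : (0 : R) < r' by rewrite subr_gt0.
have hF' x : rnorm (x - w') < r' -> nc (F x) <= M /\ forall v, derivable F x v.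
  by move=> hx; apply: hF; rewrite (le_lt_trans (rnorm_tri _ _ w'))// -ltrBrDr.
have L := lipschitz_ball r'0 M0 hF'.
set K := 128 * M / r' in L.
have K0 : (0 : R) <= K by rewrite /K divr_ge0 ?mulr_ge0// ltW.
have K1 : (0 : R) < K + 1 by rewrite ltr_wpDl.
exists (Num.min (r' / 2) (e / (K + 1))); first by rewrite lt_min !divr_gt0.
move=> x; rewrite lt_min => /andP[x1]; rewrite ltr_pdivlMr// => x2.
have w'w' : rnorm (w' - w') < r' / 2 by rewrite subrr rnorm0 divr_gt0.
apply: (le_lt_trans (L _ _ w'w' x1)); apply: le_lt_trans x2.
by rewrite mulrC ler_wpM2l ?rnorm_ge0// lerDl.
Qed.

(** |F| around [w] in real coordinates, extended by 0 so as to be measurable on the whole space. *)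
Definition cutoff (F : point -> C) w r (v : P) : R :=
  if rnorm (real_point v) < r then nc (F (w + real_point v)) else 0.

Lemma cutoff_ge0 F w r v : 0 <= cutoff F w r v.
Proof. by rewrite /cutoff; case: ifP => // _; exact: normc_ge0. Qed.

Lemma measurable_cutoff (F : point -> C) w r :
  (forall w', rnorm (w' - w) < r -> forall e, 0 < e -> exists2 d, 0 < d &
    forall x, rnorm (x - w') < d -> nc (F x - F w') < e) ->
  measurable_fun setT (cutoff F w r : P -> measurableTypeR R).
Proof.
move=> hF.
apply: (@measurable_open_support R P _ _ id _ (B r)).
- by move=> V; exact: open_measurable_P.
- exact: open_rnorm_ball.
- exists (fun v : P => nc (F (w + real_point v))).
    move=> v /[!inE]/= vr.
    have [] // := @real_point_comp_continuous R n m (fun x => F (w + x)) v.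
    have hv : rnorm (w + real_point v - w) < r by rewrite addrAC subrr add0r.
    move=> e e0; have [d d0 hd] := hF _ hv e e0.
    by exists d => // x xv; apply: hd; rewrite addrAC opprD addrA subrr add0r addrC.
  by move=> v /= vr; rewrite /cutoff vr.
- by move=> v /= vr; rewrite /cutoff; case: ifP.
Qed.

(** The one-variable inequality on each complex line through [w], integrated over directions in the
    unit ball. Multiplication by a point of a side maps [B 1] into [B 2] and does not enlarge
    integrals; 8 is four sides times length 2. *)
Lemma mean_value_point (F : point -> C) w M :
  (forall w', rnorm (w' - w) < 4 -> nc (F w') <= M /\ forall v, derivable F w' v) ->
  ((nc (F w))%:E * lam (B 1%R) <= 8%:E * \int[lam]_(v in B 2%R) (nc (F (w + real_point v)%R))%:E)%E.
Proof.
move=> hF; have r4 : (0 : R) < 4 by [].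
have cF := bounded_ccont r4 hF.
set g := cutoff F w 4.
have mg : measurable_fun setT (g : P -> measurableTypeR R) by exact: measurable_cutoff.
have g0 v : 0 <= g v by exact: cutoff_ge0.
pose S k (z : measurableTypeR R * P) := g (scalP (side k z.1) z.2).
have mS k : measurable_fun setT (S k : _ -> measurableTypeR R).
  apply: (measurableT_comp mg); apply: measurable_scalP_fun => //.
  - rewrite (_ : (fun x => _) = fun x : measurableTypeR R * P =>
      complex.Re ('i%C ^+ k : C) - complex.Im ('i%C ^+ k : C) * x.1).
      by apply: measurable_funB => //; apply: measurable_funM.
    apply/funext => x; rewrite /side /ray; case: ('i%C ^+ k) => a b /=.
    by rewrite mulr1.
  - rewrite (_ : (fun x => _) = fun x : measurableTypeR R * P =>
      complex.Re ('i%C ^+ k : C) * x.1 + complex.Im ('i%C ^+ k : C)).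
      by apply: measurable_funD => //; apply: measurable_funM.
    apply/funext => x; rewrite /side /ray; case: ('i%C ^+ k) => a b /=.
    by rewrite mulr1.
pose H (z : measurableTypeR R * P) : \bar R :=
  ((\sum_(k < 4) S k z) * \1_I11 z.1 * \1_(B 1%R) z.2)%:E.
have mB := measurable_ball_rnorm.
have mI : measurable I11 by exact: measurable_itv.
have mi1 : measurable_fun setT (\1_(B 1%R) : P -> R) by exact: measurable_indic.
have mi2 : measurable_fun setT (\1_I11 : measurableTypeR R -> R) by exact: measurable_indic.
have mH : measurable_fun setT H.
  apply/measurable_EFinP; apply: measurable_funM; last first.
    exact: (measurableT_comp mi1 measurable_snd).
  apply: measurable_funM; last exact: (measurableT_comp mi2 measurable_fst).
  by apply: measurable_sum => k; exact: mS.
have H0 z : (0 <= H z)%E.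
  by rewrite lee_fin mulr_ge0// mulr_ge0//; apply: sumr_ge0 => k _; exact: g0.
have side4 k y v : -1 <= y <= 1 -> rnorm (real_point v) < 1 ->
    rnorm (real_point (scalP (side k y) v)) < 2.
  move=> y1 v1; rewrite real_point_scal rnormZ.
  apply: (@le_lt_trans _ _ (2 * rnorm (real_point v))).
    by rewrite ler_wpM2r ?rnorm_ge0// side_le2.
  lra.
have step1 : ((nc (F w))%:E * lam (B 1%R) <= \int[lam]_v \int[lebesgue_measure]_y H (y, v))%E.
  rewrite -(@integral_cst _ P R lam (B 1%R) (mB 1%R) (nc (F w))%:E).
  rewrite integral_mkcond; apply: ge0_le_integral => //.
  - by move=> v _; rewrite patchE; case: ifP => // _; rewrite lee_fin normc_ge0.
  - apply: (measurable_restrictT (cst (nc (F w))%:E : P -> \bar R) (mB 1%R)).1.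
    exact: measurable_cst.
  - exact: measurable_fun_fubini_tonelli_G.
  - move=> v _; rewrite patchE; case: ifPn => [/[!inE]/= v1|_]; last first.
      by apply: integral_ge0 => y _; exact: H0.
    have := @mean_value_ineq R (fun s => F (w + s *: real_point v)).
    rewrite scale0r addr0 => /(_ _ _)/le_trans; apply.
    + move=> z _ z4; eexists; apply: derivable_cdiff_at.
      have [|//] := hF (w + z *: real_point v).
      rewrite addrAC subrr add0r rnormZ (le_lt_trans _ z4)//.
      by rewrite ler_piMr ?normc_ge0// ltW.
    + apply: (@cdiff_cont _ _ _ ('D_(real_point v) F w)); apply: derivable_cdiff.
      by have [|//] := hF w; rewrite subrr rnorm0.
    + rewrite integral_mkcond le_eqVlt; apply/orP; left; apply/eqP.
      apply: eq_integral => y _; rewrite patchE /H /=.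
      rewrite [\1_(B 1%R) v]indicE [v \in _]mem_set// mulr1.
      rewrite indicE; case: ifPn => [yI|_]; last by rewrite mulr0.
      rewrite mulr1; congr EFin; apply: eq_bigr => k _.
      have y1 : -1 <= y <= 1 by move: yI; rewrite inE/= in_itv.
      rewrite /S /g /cutoff /= ifT; first by rewrite real_point_scal.
      by apply: lt_trans (side4 k y v y1 v1) _; lra.
apply: (le_trans step1); rewrite -(@fubini_tonelli _ _ _ _ R lebesgue_measure lam H mH H0).
pose G (v : P) : \bar R := ((g v) * \1_(B 2%R) v)%:E.
have mG : measurable_fun setT G.
  by apply/measurable_EFinP; apply: measurable_funM => //; exact: measurable_indic.
have G0 v : (0 <= G v)%E by rewrite lee_fin mulr_ge0.
have GE : (\int[lam]_(v in B 2%R) (nc (F (w + real_point v)%R))%:E = \int[lam]_v G v)%E.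
  rewrite integral_mkcond; apply: eq_integral => v _; rewrite patchE /G indicE.
  case: ifPn => [/[!inE]/= v2|_]; last by rewrite mulr0.
  by rewrite mulr1 /g /cutoff ifT//; lra.
rewrite GE.
apply: (@le_trans _ _ (\int[lebesgue_measure]_(y in I11) (4%:E * \int[lam]_v G v))%E); last first.
  rewrite integral_cst//= lebesgue_measure_itv/= lte_fin ifT; last by lra.
  by rewrite -EFinB muleAC -EFinM (_ : 4 * (1 - -1) = 8 :> R)//; ring.
rewrite [leRHS]integral_mkcond; apply: ge0_le_integral => //.
- by move=> y _; apply: integral_ge0 => v _; exact: H0.
- exact: measurable_fun_fubini_tonelli_F.
- apply: (measurable_restrictT (cst (4%:E * \int[lam]_v G v)%E : measurableTypeR R -> \bar R) mI).1.
  exact: measurable_cst.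
move=> y _; rewrite patchE; case: ifPn => [yI|yI]; last first.
  rewrite (eq_integral (cst 0%E)) ?integral0// => v _.
  by rewrite /H /= indicE (negbTE yI) mulr0 mul0r.
have y1 : -1 <= y <= 1 by move: yI; rewrite inE/= in_itv.
have bnd k : (\int[lam]_v G (scalP (side k y) v) <= \int[lam]_v G v)%E.
  have [c c1 hc] := lam_scal_le1 (side_ge1 k y).
  rewrite (ge0_integral_scaled (measurable_scalP (side k y)) hc mG G0).
  rewrite -[leRHS]mul1e lee_wpmul2r ?integral_ge0//; by move=> v _; exact: G0.
apply: (@le_trans _ _ (\int[lam]_v (\sum_(k < 4) G (scalP (side k y) v)))%E).
  apply: ge0_le_integral => //.
  - exact: (measurableT_comp mH (@measurable_pair1 _ _ (measurableTypeR R) P y)).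
  - apply: emeasurable_sum => k.
    by apply: (measurableT_comp mG); exact: measurable_scalP.
  - move=> v _; rewrite /H /= sumEFin lee_fin indicE yI mulr1 mulr_suml.
    apply: ler_sum => k _; rewrite indicE /S /=.
    have [v1|v1] := boolP (v \in B 1); last by rewrite mulr0 mulr_ge0.
    rewrite mulr1 indicE mem_set ?mulr1//=; apply: side4 => //.
    by move: v1; rewrite inE.
rewrite ge0_integral_sum//; last first.
  by move=> k; apply: (measurableT_comp mG); exact: measurable_scalP.
rewrite 3!big_ord_recr big_ord1/=.
have -> : (4%:E * \int[lam]_v G v = ((\int[lam]_v G v + \int[lam]_v G v) + \int[lam]_v G v) + \int[lam]_v G v)%E.
  have : (0 <= \int[lam]_v G v)%E by apply: integral_ge0 => v _; exact: G0.
  case: (\int[lam]_v G v)%E => [x| |]//= _; last by rewrite mulry gtr0_sg// mul1e.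
  by rewrite -EFinM; congr EFin; ring.
apply: leeD; last exact: bnd.
apply: leeD; last exact: bnd.
by apply: leeD; exact: bnd.
Qed.

End mean_value_points.

Lemma ge0_integralZ_real d (T : measurableType d) (R : realType)
    (mu : {measure set T -> \bar R}) (f : T -> R) (k : R) :
  measurable_fun setT (f : T -> measurableTypeR R) -> (forall x, 0 <= f x) -> 0 <= k ->
  (\int[mu]_x (k * f x)%:E = k%:E * \int[mu]_x (f x)%:E)%E.
Proof.
move=> mf f0 k0; under eq_integral do rewrite EFinM.
apply: ge0_integralZl_EFin => //; last exact/measurable_EFinP.
by move=> x _; rewrite lee_fin.
Qed.

(** * Submean inequality for the powers of |F| *)

Section submean.
Context {R : realType} (n m : nat).
Local Notation C := R[i].
Local Notation nc := (@Normc.normc R).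
Local Notation point := ('cV[C]_n * 'cV[C]_m)%type.
Local Notation P := (('cV[R]_n * 'cV[R]_n) * ('cV[R]_m * 'cV[R]_m))%type.
Local Notation lam := (@lebP R n m).
Local Notation B r := [set v : P | rnorm (real_point v) < r].
Local Notation k := (rdim n m).

Let Lam := fine (lam (B 1)).

Let lamB r : lam (B r) = (fine (lam (B r)))%:E.
Proof. by rewrite fineK// ge0_fin_numE// lebP_rnorm_ball. Qed.

Let Lam0 : (0 : R) < Lam.
Proof. by rewrite -lte_fin -lamB ball_lam_gt0. Qed.

Lemma mean_value_cutoff (F : point -> C) w M :
  (forall w', rnorm (w' - w) < 4 -> nc (F w') <= M /\ forall v, derivable F w' v) ->
  ((nc (F w) * Lam)%:E <= 8%:E * \int[lam]_v (cutoff F w 2 v)%:E)%E.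
Proof.
move=> hF; have := mean_value_point hF; rewrite lamB -EFinM => /le_trans; apply.
rewrite (_ : \int[lam]_(v in B 2%R) _ = \int[lam]_v (cutoff F w 2 v)%:E)%E//.
rewrite integral_mkcond; apply: eq_integral => v _.
rewrite patchE /cutoff; case: ifPn; first by rewrite inE /= => ->.
by rewrite notin_setE /= => /negP/negbTE ->.
Qed.

Lemma derivable_affine (F : point -> C) (a : point) (b : C) x v :
  derivable F (a + b *: x) v -> derivable (fun x => F (a + b *: x)) x v.
Proof.
move=> /derivable_cdiff h.
have [] // := @cdiff_derivable _ _ (fun x => F (a + b *: x)) x v ('D_v F (a + b *: x) * b).
have := @cdiff_affine _ (fun s => F (a + b *: x + s *: v)) 0 b 0 ('D_v F (a + b *: x)).
rewrite mulr0 addr0 => /(_ h); congr cdiff; apply/funext => s.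
by rewrite add0r scalerDr scalerA addrA.
Qed.

Lemma cutoff_scaled (F : point -> C) w v sg : 0 < sg ->
  cutoff (fun x => F ((w - sg%:C%C *: w) + sg%:C%C *: x)) w 2 v =
  cutoff F w (2 * sg) (scalP sg%:C%C v).
Proof.
move=> s0; rewrite /cutoff.
have -> : real_point (scalP sg%:C%C v) = sg%:C%C *: real_point v by exact: real_point_scal.
have -> : rnorm (sg%:C%C *: real_point v) = rnorm (real_point v) * sg.
  by rewrite rnormZ normc_real (gtr0_norm s0) mulrC.
rewrite (ltr_pM2r s0); congr (if _ then nc (F _) else _).
by rewrite scalerDr addrA subrK.
Qed.

(** Dilation by [sg] around [w]; the change of volume is the power of [sg] by the real dimension. *)
Lemma mean_value_scaled (F : point -> C) w M sg : 0 < sg ->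
  (forall w', rnorm (w' - w) < 4 * sg -> nc (F w') <= M /\ forall v, derivable F w' v) ->
  ((nc (F w) * Lam)%:E <=
     (8 / sg ^+ k)%:E * \int[lam]_v (cutoff F w (2 * sg) v)%:E)%E.
Proof.
move=> s0 hF; have s0' : (0 : R) < sg := s0.
pose G x := F ((w - sg%:C%C *: w) + sg%:C%C *: x).
have GE x : (w - sg%:C%C *: w) + sg%:C%C *: x = w + sg%:C%C *: (x - w).
  by rewrite scalerBr addrAC -addrA.
have hin x r : rnorm (x - w) < r -> rnorm (w + sg%:C%C *: (x - w) - w) < r * sg.
  move=> xr; rewrite addrAC subrr add0r rnormZ normc_real gtr0_norm// mulrC.
  by rewrite ltr_pM2r.
have hG x : rnorm (x - w) < 4 -> nc (G x) <= M /\ forall v, derivable G x v.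
  move=> /hin/hF; rewrite -GE => -[h1 h2]; split; first exact: h1.
  by move=> v; exact: (@derivable_affine F _ _ x v (h2 v)).
have Gw : G w = F w by rewrite /G GE subrr scaler0 addr0.
have := mean_value_cutoff hG; rewrite Gw => /le_trans; apply.
have -> : (8 / sg ^+ k)%:E = (8%:E * (sg ^+ k)^-1%:E)%E by rewrite -EFinM.
rewrite -muleA.
have mc : measurable_fun setT (cutoff F w (2 * sg) : P -> measurableTypeR R).
  apply: measurable_cutoff => w' hw'.
  have h4 : (0 : R) < 4 * sg by rewrite mulr_gt0.
  by apply: (bounded_ccont h4 hF); lra.
have k0 : 0 <= (sg ^+ k)^-1 by rewrite invr_ge0 exprn_ge0// ltW.
pose f v := (cutoff F w (2 * sg) v)%:E.
have mf : measurable_fun setT f by exact/measurable_EFinP.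
have f0 v : (0 <= f v)%E by rewrite lee_fin cutoff_ge0.
have hc U : measurable U -> lam (scalP sg%:C%C @^-1` U) = ((NngNum k0)%:num%:E * lam U)%E.
  by move=> mU; exact: lam_scal_real.
have E : (\int[lam]_v (cutoff G w 2 v)%:E = (sg ^+ k)^-1%:E * \int[lam]_v f v)%E.
  transitivity (\int[lam]_v f (scalP sg%:C%C v))%E.
    by apply: eq_integral => v _; exact: (congr1 EFin (cutoff_scaled F w v s0')).
  exact: (ge0_integral_scaled (measurable_scalP sg%:C%C) hc mf f0).
by rewrite E.
Qed.

Section at_center.
Variables (q R0 : R).
Hypotheses (q0 : 0 < q) (R00 : 0 < R0).

Let A (F : point -> C) w := (\int[lam]_v ((cutoff F w R0 v) `^ q)%:E)%E.

Let A0 F w : (0 <= A F w)%E.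
Proof. by apply: integral_ge0 => v _; rewrite lee_fin powR_ge0. Qed.

Definition locally_good (F : point -> C) w M := forall w', rnorm (w' - w) < R0 ->
  nc (F w') <= M /\ forall v, derivable F w' v.

Let mcut F w M r : locally_good F w M -> r <= R0 ->
  measurable_fun setT (cutoff F w r : P -> measurableTypeR R).
Proof.
move=> hF rR; apply: measurable_cutoff => w' hw'.
by apply: (bounded_ccont R00 hF); apply: lt_le_trans rR.
Qed.

(** In place of Jensen's inequality: y <= x + x^{1-q} y^q for every x > 0, applied to y = |F| with
    [x] a fixed multiple of |F(w)|. *)
Lemma submean_ge1 : 1 <= q -> exists2 K : R, 0 < K &
  forall F w M, locally_good F w M -> ((nc (F w) `^ q)%:E <= K%:E * A F w)%E.
Proof.
move=> q1; have q0' : (0 : R) < q := q0; have R00' : (0 : R) < R0 := R00.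
have La0 := Lam0; have mvs := @mean_value_scaled.
move: La0 mvs; generalize Lam => La La0 mvs.
pose sg := R0 / 4; have sg0 : 0 < sg by rewrite divr_gt0.
pose c := 8 / sg ^+ k; have c0 : 0 < c by rewrite divr_gt0// exprn_gt0.
have [L L0 LE] : exists2 L : R, 0 < L & lam (B (2 * sg)) = L%:E.
  exists (fine (lam (B (2 * sg)))); last exact: lamB.
  by rewrite -lte_fin -lamB ball_lam_gt0// mulr_gt0.
(* Chosen so that the term in x L is exactly half of the left-hand side N La and can be absorbed. *)
pose th := La / (2 * c * L).
have th0 : 0 < th := divr_gt0 La0 (mulr_gt0 (mulr_gt0 (ltr0n R 2) c0) L0).
exists ((L * th `^ q)^-1); first by rewrite invr_gt0 mulr_gt0// powR_gt0.
move=> F w M hF; set N := nc (F w).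
have N0 : 0 <= N by exact: normc_ge0.
have [->|Nn] := eqVneq N 0.
  by rewrite powR0 ?gt_eqF// mule_ge0// lee_fin invr_ge0 mulr_ge0 ?powR_ge0// ltW.
have {}N0 : 0 < N by rewrite lt_neqAle eq_sym Nn.
have hF4 w' : rnorm (w' - w) < 4 * sg -> nc (F w') <= M /\ forall v, derivable F w' v.
  by move=> h; apply: hF; apply: lt_le_trans h _; rewrite /sg; lra.
have := mvs _ _ _ _ sg0 hF4; rewrite -/c -/N => mv.
have [Afin|] := boolP (A F w \is a fin_num); last first.
  rewrite ge0_fin_numE// -leNgt leye_eq => /eqP ->.
  by rewrite mulry gtr0_sg ?mul1e ?leey// invr_gt0 mulr_gt0// powR_gt0.
rewrite -(fineK Afin) -EFinM lee_fin; set a := fine _.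
pose x := th * N; have x0 : 0 < x by rewrite mulr_gt0.
have key : (\int[lam]_v (cutoff F w (2 * sg) v)%:E <= (x * L + x `^ (1 - q) * a)%:E)%E.
  have mB := @measurable_ball_rnorm R n m (2 * sg).
  have mc := mcut hF (lexx R0).
  have mp : measurable_fun setT (fun v : P => (cutoff F w R0 v `^ q : measurableTypeR R)).
    exact: (measurableT_comp (@measurable_powR R q) mc).
  apply: (@le_trans _ _ (\int[lam]_v ((x * \1_(B (2 * sg)) v)%:E +
      (x `^ (1 - q) * (cutoff F w R0 v `^ q))%:E))%E).
    apply: ge0_le_integral => //.
    - by move=> v _; rewrite lee_fin cutoff_ge0.
    - by apply/measurable_EFinP; apply: (mcut hF); rewrite /sg; lra.
    - apply: emeasurable_funD; apply/measurable_EFinP.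
        by apply: measurable_funM; [exact: measurable_cst|exact: (measurable_indic mB)].
      by apply: measurable_funM; [exact: measurable_cst|exact: mp].
    - move=> v _; rewrite -EFinD lee_fin {1}/cutoff indicE.
      case: ifPn => hv; last first.
        by apply: addr_ge0; apply: mulr_ge0; rewrite ?powR_ge0 ?(ltW x0).
      rewrite mem_set ?mulr1//= /cutoff ifT; last by apply: lt_le_trans hv _; rewrite /sg; lra.
      set y := nc _; have y0 : 0 <= y by exact: normc_ge0.
      have [yx|xy] := leP y x.
        by rewrite (le_trans yx)// lerDl; apply: mulr_ge0; exact: powR_ge0.
      have yp : 0 < y by exact: lt_trans xy.
      have E : y = y `^ (1 - q) * y `^ q.
        by rewrite -powRD ?subrK ?powRr1// (gt_eqF yp) implybT.
      rewrite {1}E; apply: (@le_trans _ _ (x `^ (1 - q) * y `^ q)); last first.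
        by rewrite lerDr (ltW x0).
      rewrite ler_wpM2r ?powR_ge0//.
      have e z : z `^ (1 - q) = (z `^ (q - 1))^-1 by rewrite -powRN opprB.
      rewrite !e lef_pV2 ?posrE ?powR_gt0//.
      by apply: ge0_ler_powR; rewrite ?nnegrE ?subr_ge0 ?(ltW x0) ?(ltW xy).
  rewrite ge0_integralD//; last 4 first.
  - by move=> v _; rewrite lee_fin mulr_ge0// (ltW x0).
  - by apply/measurable_EFinP; apply: measurable_funM; [exact: measurable_cst|exact: (measurable_indic mB)].
  - by move=> v _; rewrite lee_fin; apply: mulr_ge0; exact: powR_ge0.
  - by apply/measurable_EFinP; apply: measurable_funM; [exact: measurable_cst|exact: mp].
  rewrite EFinD leeD//.
    rewrite (@ge0_integralZ_real _ P R lam (\1_(B (2 * sg))) x (measurable_indic mB))//; last exact: ltW.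
    have iB : (\int[lam]_v (\1_(B (2 * sg)%R) v)%:E = L%:E)%E.
      by rewrite -LE; exact: (etrans (integral_indic lam measurableT mB) (congr1 lam (setIT _))).
    by rewrite iB -EFinM.
  rewrite (@ge0_integralZ_real _ P R lam _ (x `^ (1 - q)) mp) ?powR_ge0//; last first.
    by move=> v; exact: powR_ge0.
  by rewrite -[X in (_ * X)%E]/(A F w) -(fineK Afin).
have {mv} mv : N * La <= c * (x * L + x `^ (1 - q) * a).
  rewrite -lee_fin (le_trans mv)// [X in (_ <= X)%E]EFinM.
  by apply: lee_wpmul2l => //; rewrite lee_fin ltW.
have E1 : c * (x * L) = N * La / 2.
  by rewrite /x /th; field; rewrite !gt_eqF.
have mv2 : x * L <= x `^ (1 - q) * a.
  by rewrite -(ler_pM2l c0); lra.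
have x1q : x `^ (1 - q) = x * (x `^ q)^-1.
  by rewrite powRD ?powRr1 ?powRN// ?(ltW x0)// (gt_eqF x0) implybT.
have : L * x `^ q <= a.
  move: mv2; rewrite x1q -[x * _ * a]mulrA (ler_pM2l x0).
  by rewrite mulrC ler_pdivlMr ?powR_gt0.
rewrite /x powRM ?(ltW th0) ?(ltW N0)// mulrA => h.
by rewrite mulrC ler_pdivlMr ?mulr_gt0 ?powR_gt0// mulrC.
Qed.

(** Maximise |F(x)| dl(x)^{k/q} over the ball, [dl] being the distance to its boundary. In |F| =
    |F|^{1-q} |F|^q the first factor is bounded through the supremum [S], so the mean value
    inequality gives S <= K1 S^{1-q} a, that is S^q <= K1 a. *)
Lemma submean_lt1 : q < 1 -> exists2 K : R, 0 < K &
  forall F w M, locally_good F w M -> ((nc (F w) `^ q)%:E <= K%:E * A F w)%E.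
Proof.
move=> q1; have q0' : (0 : R) < q := q0; have R00' : (0 : R) < R0 := R00.
have La0 := Lam0; have mvs := @mean_value_scaled.
move: La0 mvs; generalize Lam => La La0 mvs.
(* With this exponent the powers of the distance [d] cancel in the estimate at each point. *)
pose kq := k%:R / q.
have kq0 : 0 <= kq by rewrite divr_ge0// ltW.
pose K1 := 8 / La * 8 ^+ k * 2 `^ (kq * (1 - q)).
have K10 : 0 < K1 by rewrite !mulr_gt0 ?invr_gt0 ?exprn_gt0 ?powR_gt0.
exists (K1 / R0 ^+ k); first by rewrite divr_gt0// exprn_gt0.
move=> F w M hF; set N := nc (F w).
have N0 : 0 <= N by exact: normc_ge0.
have [->|Nn] := eqVneq N 0.
  by rewrite powR0 ?gt_eqF// mule_ge0// lee_fin divr_ge0 ?exprn_ge0 ?ltW.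
have {}N0 : 0 < N by rewrite lt_neqAle eq_sym Nn.
have [Afin|] := boolP (A F w \is a fin_num); last first.
  rewrite ge0_fin_numE// -leNgt leye_eq => /eqP ->.
  by rewrite mulry gtr0_sg ?mul1e ?leey// divr_gt0// exprn_gt0.
rewrite -(fineK Afin) -EFinM lee_fin; set a := fine _.
have a0 : 0 <= a by rewrite fine_ge0.
pose dl x := R0 - rnorm (x - w).
pose T := [set nc (F x) * dl x `^ kq | x in [set x | rnorm (x - w) < R0]].
have M0 : 0 <= M by have [|h _] := hF w; rewrite ?subrr ?rnorm0// (le_trans _ h)// normc_ge0.
(* The bound [M] is used only to make [S] finite, so that S^{1-q} can be divided out; it leaves no
   trace in the constant. *)
have Tub : ubound T (M * R0 `^ kq).
  move=> _ [x xr <-]; have [h _] := hF x xr.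
  rewrite ler_pM ?normc_ge0 ?powR_ge0// ge0_ler_powR// ?nnegrE ?(ltW R00)//.
    by rewrite subr_ge0 ltW.
  by rewrite /dl gerBl rnorm_ge0.
have wR : rnorm (w - w) < R0 by rewrite subrr rnorm0.
have Tw : T (N * R0 `^ kq) by exists w => //; rewrite /dl subrr rnorm0 subr0.
pose S := sup T.
have TS x : T x -> x <= S by move=> Tx; apply: ub_le_sup => //; exists (M * R0 `^ kq).
have S0 : 0 < S.
  by apply: lt_le_trans (TS _ Tw); rewrite mulr_gt0// powR_gt0.
have step x : rnorm (x - w) < R0 -> nc (F x) * dl x `^ kq <= K1 * S `^ (1 - q) * a.
  move=> xR; set d := dl x; have d0 : 0 < d by rewrite subr_gt0.
  (* The ball of radius 4 [sg] around x stays inside the given one, and on the ball of radius 2 [sg]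
     the distance to the boundary is at least d / 2. *)
  pose sg := d / 8; have sg0 : 0 < sg by rewrite divr_gt0.
  have inR r y : r <= d -> rnorm (y - x) < r -> rnorm (y - w) < R0.
    move=> rd yr; apply: (le_lt_trans (rnorm_tri _ _ x)).
    by move: rd; rewrite /d /dl; lra.
  have hF4 y : rnorm (y - x) < 4 * sg -> nc (F y) <= M /\ forall v, derivable F y v.
    by move=> h; apply: hF; apply: inR h; rewrite /sg; lra.
  have mv := mvs _ _ _ _ sg0 hF4.
  pose b := (S * (d / 2) `^ (- kq)) `^ (1 - q).
  have b0 : 0 <= b by exact: powR_ge0.
  pose v1 : P := ((re_mx (x - w).1, im_mx (x - w).1), (re_mx (x - w).2, im_mx (x - w).2)).
  have v1E : real_point v1 = x - w by congr pair; rewrite /= cplx_reim.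
  have mc := mcut hF (lexx R0).
  have mp : measurable_fun setT (fun v : P => (cutoff F w R0 v `^ q : measurableTypeR R)).
    exact: (measurableT_comp (@measurable_powR R q) mc).
  have mt : measurable_fun setT (fun v : P => v + v1).
    have -> : (fun v : P => v + v1) = (fun v : P => (v.1 + v1.1, v.2 + v1.2)).
      by apply/funext => -[].
    apply: measurable_fun_pair; apply: (measurableT_comp (measurable_translateE _)).
      exact: measurable_fst.
    exact: measurable_snd.
  have key : (\int[lam]_v (cutoff F x (2 * sg) v)%:E <= (b * a)%:E)%E.
    apply: (@le_trans _ _ (\int[lam]_v (b%:E * ((cutoff F w R0 (v + v1)) `^ q)%:E))%E).
      apply: ge0_le_integral => //.
      - by move=> v _; rewrite lee_fin cutoff_ge0.
      - apply/measurable_EFinP; apply: measurable_cutoff => y hy.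
        by apply: (bounded_ccont R00 hF); apply: inR hy; rewrite /sg; lra.
      - under eq_fun do rewrite -EFinM.
        apply/measurable_EFinP; apply: measurable_funM => //.
        exact: (measurableT_comp mp mt).
      - move=> v _; rewrite -EFinM lee_fin {1}/cutoff; case: ifPn => hv; last first.
          by rewrite mulr_ge0 ?powR_ge0.
        set y := x + real_point v.
        have yE : w + real_point (v + v1) = y.
          rewrite real_pointD v1E /y addrCA [w + _]addrC subrK; exact: addrC.
        have yx : rnorm (y - x) < 2 * sg by rewrite /y addrAC subrr add0r.
        have yR : rnorm (y - w) < R0 by apply: inR yx; rewrite /sg; lra.
        rewrite /cutoff ifT; last by rewrite -yE addrAC subrr add0r in yR.
        rewrite yE; set z := nc (F y).
        have [->|zn] := eqVneq z 0; first by rewrite powR0 ?gt_eqF// mulr0.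
        have z0 : 0 < z by rewrite lt_neqAle eq_sym zn normc_ge0.
        have zE : z = z `^ (1 - q) * z `^ q.
          by rewrite -powRD ?subrK ?powRr1 ?(ltW z0)// (gt_eqF z0) implybT.
        rewrite {1}zE ler_wpM2r ?powR_ge0// ge0_ler_powR ?nnegrE ?subr_ge0 ?(ltW q1)//.
        + exact: ltW.
        + by rewrite mulr_ge0 ?powR_ge0 ?(ltW S0).
        have dy : d / 2 <= dl y.
          have : rnorm (y - w) <= rnorm (y - x) + rnorm (x - w) by exact: rnorm_tri.
          by move: yx; rewrite /sg /d /dl; lra.
        have d20 : 0 < d / 2 by rewrite divr_gt0.
        rewrite powRN ler_pdivlMr ?powR_gt0//.
        apply: (le_trans _ (TS _ (ex_intro2 _ _ y yR erefl))).
        rewrite ler_wpM2l ?(ltW z0)// ge0_ler_powR ?nnegrE ?(ltW d20)//.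
        by rewrite (le_trans _ dy)// ltW.
    rewrite ge0_integralZl_EFin//; last 2 first.
    - by move=> v _; rewrite lee_fin powR_ge0.
    - by apply/measurable_EFinP; exact: (measurableT_comp mp mt).
    have mp' : measurable_fun setT (fun v => (cutoff F w R0 v `^ q)%:E) by exact/measurable_EFinP.
    have p0 v : (0 <= (cutoff F w R0 v `^ q)%:E)%E by rewrite lee_fin powR_ge0.
    have hc U : measurable U -> lam ((fun v => v + v1) @^-1` U) = ((NngNum (@ler01 R))%:num%:E * lam U)%E.
      by move=> mU; rewrite mul1e; exact: lebP_translate.
    rewrite (@ge0_integral_scaled _ P R lam _ _ _ mt hc mp' p0) mul1e.
    by rewrite EFinM -[X in (_ * X <= _)%E]/(A F w) -(fineK Afin).
  have {}mv : nc (F x) * La <= 8 / sg ^+ k * (b * a).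
    rewrite -lee_fin (le_trans mv)// [X in (_ <= X)%E]EFinM.
    by apply: lee_wpmul2l => //; rewrite lee_fin divr_ge0// exprn_ge0// ltW.
  have {}mv : nc (F x) <= 8 / La / sg ^+ k * (b * a).
    by rewrite -(ler_pM2r La0) (le_trans mv)// le_eqVlt; apply/orP; left; apply/eqP; field;
      rewrite !gt_eqF// exprn_gt0.
  have bE : b = S `^ (1 - q) * (2 `^ (kq * (1 - q)) * d `^ (k%:R - kq)).
    rewrite /b (@powRM _ S); [congr (_ * _)|exact: ltW|exact: powR_ge0].
    rewrite -powRrM powRM ?invr_ge0 ?(ltW d0)// mulrC; congr (_ * _).
      rewrite -powR_inv1// -powRrM; congr (_ `^ _); ring.
    congr (_ `^ _); rewrite /kq; field; by rewrite gt_eqF.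
  have sgE : (sg ^+ k)^-1 = 8 ^+ k * d `^ (- k%:R).
    rewrite powRN powR_mulrn ?(ltW d0)// /sg expr_div_n invfM invrK mulrC//.
  apply: (@le_trans _ _ (8 / La / sg ^+ k * (b * a) * d `^ kq)).
    by rewrite ler_wpM2r ?powR_ge0.
  rewrite sgE bE le_eqVlt; apply/orP; left; apply/eqP.
  have dE : d `^ (- k%:R) * d `^ (k%:R - kq) * d `^ kq = 1.
    rewrite -!powRD; first by rewrite addrA addNr add0r addNr powRr0.
    - by rewrite (gt_eqF d0) implybT.
    - by rewrite (gt_eqF d0) implybT.
  transitivity (K1 * S `^ (1 - q) * a * (d `^ (- k%:R) * d `^ (k%:R - kq) * d `^ kq)).
    by rewrite /K1; ring.
  by rewrite dE mulr1.
have SK : S <= K1 * S `^ (1 - q) * a.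
  apply: ge_sup; first by exists (N * R0 `^ kq).
  by move=> _ [x xr <-]; exact: step.
have Sq : S `^ q <= K1 * a.
  have SE : S = S `^ (1 - q) * S `^ q.
    by rewrite -powRD ?subrK ?powRr1 ?(ltW S0)// (gt_eqF S0) implybT.
  have p0 : 0 < S `^ (1 - q) by rewrite powR_gt0.
  by rewrite -(ler_pM2l p0) -SE (le_trans SK)// mulrCA mulrA.
rewrite mulrAC ler_pdivlMr ?exprn_gt0//.
apply: le_trans Sq.
have -> : N `^ q * R0 ^+ k = (N * R0 `^ kq) `^ q.
  rewrite powRM ?powR_ge0 ?(ltW N0)// -powRrM /kq divfK ?gt_eqF//.
  by rewrite powR_mulrn// ltW.
by rewrite ge0_ler_powR ?nnegrE ?(ltW q0) ?(ltW S0)// ?mulr_ge0 ?powR_ge0 ?(ltW N0)// TS.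
Qed.

Lemma submean : exists2 K : R, 0 < K &
  forall F w M, locally_good F w M ->
  ((nc (F w) `^ q)%:E <=
    K%:E * \int[lam]_v ((cutoff F w R0 v) `^ q)%:E)%E.
Proof. by have [q1|q1] := leP 1 q; [exact: submean_ge1|exact: submean_lt1]. Qed.

End at_center.

End submean.

(** * Real vectors with the supremum norm *)

Section real_vectors.
Context {R : realType}.

Lemma cV_norm_lt k (x : 'cV[R]_k) (r : R) : 0 < r ->
  `|x| < r <-> forall i, `|x i ord0| < r.
Proof.
move=> r0; have E : `|x| < r <-> ball (0 : 'cV[R]_k) r x.
  by rewrite -ball_normE/= sub0r normrN.
split=> [/E[_ h] i|h].
  by have := h i ord0; rewrite mxE -ball_normE/= sub0r normrN.
apply/E; split => // i j; rewrite ord1 mxE -ball_normE/= sub0r normrN; exact: h.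
Qed.

Lemma cV_coord_le k (x : 'cV[R]_k) i : `|x i ord0| <= `|x|.
Proof.
rewrite leNgt; apply/negP => h.
have [/(_ h)/(_ i)] := cV_norm_lt x (le_lt_trans (normr_ge0 x) h).
by rewrite ltxx.
Qed.

Lemma cV_norm_le k (x : 'cV[R]_k) (r : R) : 0 <= r ->
  (forall i, `|x i ord0| <= r) -> `|x| <= r.
Proof.
move=> r0 h; apply/ler_addgt0Pr => e e0; apply: ltW.
apply/cV_norm_lt; first by rewrite ltr_wpDl.
by move=> i; rewrite ltr_pwDr.
Qed.

Lemma cV_closureP k (A : set 'cV[R]_k) x :
  closure A x <-> forall e : R, 0 < e -> exists2 y, A y & `|y - x| < e.
Proof.
split=> [h e e0|h B /nbhs_ballP[e /= e0 eB]].
  have [|y [Ay]] := h (ball x e); first exact: nbhsx_ballx.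
  by rewrite -ball_normE/= distrC => xy; exists y.
have [y Ay xy] := h e e0; exists y; split => //; apply: eB.
by rewrite -ball_normE/= distrC.
Qed.

Lemma cV_compact k (A : set 'cV[R]_k) (M : R) : closed A ->
  (forall x, A x -> `|x| <= M) -> compact A.
Proof.
move=> cA AM.
pose B := [set v : 'rV[R]_k | forall i, `[(- M)%R, M]%classic (v ord0 i)].
have cB : compact B.
  by apply: (@rV_compact _ k (fun=> `[(- M)%R, M]%classic)) => i; exact: segment_compact.
apply: (@subclosed_compact _ _ [set v^T | v in B]) => //.
  apply: continuous_compact => //; apply: continuous_subspaceT => v.
  move=> U /nbhs_ballP[e /= e0 eU]; apply/nbhs_ballP; exists e => // w [_ vw].
  by apply: eU; split => // i j; rewrite !mxE; exact: vw.
move=> x /AM xM; exists x^T; last by rewrite trmxK.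
move=> i /=; rewrite mxE in_itv/= -ler_norml.
by apply: le_trans xM; exact: cV_coord_le.
Qed.

Lemma mulmx_bound k l (t : 'M[R]_(k, l)) : exists2 C : R, 0 < C &
  forall h : 'cV[R]_l, `|t *m h| <= C * `|h|.
Proof.
pose C := \sum_i \sum_j `|t i j| + 1.
have C0 : 0 <= \sum_i \sum_j `|t i j| by do 2 (apply: sumr_ge0 => ? _).
exists C => [|h]; first by rewrite ltr_wpDl.
apply: cV_norm_le; first by rewrite mulr_ge0 // addr_ge0.
move=> i; rewrite mxE (le_trans (ler_norm_sum _ _ _))//.
apply: (@le_trans _ _ (\sum_j `|t i j| * `|h|)).
  by apply: ler_sum => j _; rewrite normrM ler_wpM2l// cV_coord_le.
rewrite -mulr_suml ler_wpM2r// /C (bigD1 i)//= -addrA lerDl addr_ge0//.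
by do 2 (apply: sumr_ge0 => ? _).
Qed.

Lemma pairingDr k (l h h' : 'cV[R]_k) : pairing l (h + h') = pairing l h + pairing l h'.
Proof. by rewrite -big_split; apply: eq_bigr => i _; rewrite mxE mulrDr. Qed.

Lemma pairingDl k (l l' h : 'cV[R]_k) : pairing (l + l') h = pairing l h + pairing l' h.
Proof. by rewrite -big_split; apply: eq_bigr => i _; rewrite mxE mulrDl. Qed.

Lemma pairingZr k (l h : 'cV[R]_k) a : pairing l (a *: h) = a * pairing l h.
Proof. by rewrite mulr_sumr; apply: eq_bigr => i _; rewrite mxE mulrCA. Qed.

Lemma pairingZl k (l h : 'cV[R]_k) a : pairing (a *: l) h = a * pairing l h.
Proof. by rewrite mulr_sumr; apply: eq_bigr => i _; rewrite mxE mulrA. Qed.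

Lemma pairingBr k (l h h' : 'cV[R]_k) : pairing l (h - h') = pairing l h - pairing l h'.
Proof. by rewrite pairingDr -scaleN1r pairingZr mulN1r. Qed.

Lemma pairing_bound k (l h : 'cV[R]_k) : `|pairing l h| <= k%:R * `|l| * `|h|.
Proof.
rewrite (le_trans (ler_norm_sum _ _ _))//.
apply: (@le_trans _ _ (\sum_(i < k) `|l| * `|h|)).
  by apply: ler_sum => i _; rewrite normrM ler_pM// cV_coord_le.
by rewrite sumr_const card_ord -[X in X <= _]mulr_natl mulrA.
Qed.

Lemma pairing_delta k (l : 'cV[R]_k) i : pairing (delta_mx i ord0) l = l i ord0.
Proof.
rewrite /pairing (bigD1 i)//= mxE !eqxx mul1r big1 ?addr0// => j ji.
by rewrite mxE (negbTE ji) mul0r.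
Qed.

End real_vectors.

(** * The cone, its dual and the group T_+ *)

Section cone_geometry.
Context {R : realType} {m r : nat} (K : homogeneous_cone R m r).
Local Notation Om := (Om K).
Local Notation e := (eOm K).
Local Notation T := (Tplus K).
Local Notation Cb := (closure (Defs.Om K)).
Local Notation V := 'cV[R]_m.
Implicit Types (h k : V) (t : 'M[R]_m).

Lemma OmZ (a : R) h : 0 < a -> Om h -> Om (a *: h).
Proof. exact: Om_cone. Qed.

Lemma OmD h k : Om h -> Om k -> Om (h + k).
Proof.
move=> Oh Ok.
have i0 : 0 <= 2^-1 :> R by rewrite invr_ge0.
have i1 : 2^-1 <= 1 :> R by rewrite invf_le1// ler1n.
have := @Om_convex _ _ _ K h k (Itv01 i0 i1) (mem_set Oh) (mem_set Ok).
move=> /set_mem H.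
suff -> : h + k = 2 *: conv (Itv01 i0 i1) (h : convex_lmodType V) (k : convex_lmodType V).
  exact: OmZ.
have -> : conv (Itv01 i0 i1) (h : convex_lmodType V) (k : convex_lmodType V) =
  2^-1 *: h + (1 - 2^-1) *: k :> V by [].
rewrite scalerDr !scalerA.
have -> : (1 - 2^-1 : R) = 2^-1 by field.
by rewrite divff ?scale1r// pnatr_eq0.
Qed.

Lemma Om_ball h : Om h -> exists2 d : R, 0 < d & forall k, `|k - h| < d -> Om k.
Proof.
move=> Oh; have /nbhs_ballP[d /= d0 dO] := open_nbhs_nbhs (conj (@Om_open _ _ _ K) Oh).
by exists d => // k hk; apply: dO; rewrite -ball_normE/= distrC.
Qed.

(** An approximant of [k] lies in the cone, and the small error is absorbed by the interior point
    [h]. *)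
Lemma OmDclosure h k : Om h -> Cb k -> Om (h + k).
Proof.
move=> Oh /cV_closureP Ck; have [d d0 hd] := Om_ball Oh.
have [k' Ok' kk'] := Ck d d0.
have -> : h + k = (h - (k' - k)) + k' by rewrite opprB addrA addrNK.
by apply: OmD => //; apply: hd; rewrite addrAC subrr add0r normrN.
Qed.

Lemma OmW h : Om h -> Cb h.
Proof. exact: subset_closure. Qed.

Lemma eOmP : Om e. Proof. exact: eOm_in. Qed.

Lemma CbD h k : Cb h -> Cb k -> Cb (h + k).
Proof.
move=> /cV_closureP Ch /cV_closureP Ck; apply/cV_closureP => d d0.
have d2 : 0 < d / 2 by rewrite divr_gt0.
have [h' Oh' hh'] := Ch _ d2; have [k' Ok' kk'] := Ck _ d2.
exists (h' + k'); first exact: OmD.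
rewrite opprD addrACA (le_lt_trans (ler_normD _ _))//; lra.
Qed.

Lemma CbZ_gt0 (a : R) h : 0 < a -> Cb h -> Cb (a *: h).
Proof.
move=> a0 /cV_closureP Ch; apply/cV_closureP => d d0.
have [h' Oh' hh'] := Ch _ (divr_gt0 d0 a0).
exists (a *: h'); first exact: OmZ.
by rewrite -scalerBr normrZ gtr0_norm// mulrC -ltr_pdivlMr.
Qed.

Lemma Cb0 : Cb 0.
Proof.
apply/cV_closureP => d d0; pose a := d / (`|e| + 1).
have e1 : 0 < `|e| + 1 by rewrite ltr_wpDl.
have a0 : 0 < a by rewrite divr_gt0.
exists (a *: e); first by apply: OmZ => //; exact: eOmP.
by rewrite subr0 normrZ gtr0_norm// /a mulrAC ltr_pdivrMr// ltr_pM2l// ltrDl.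
Qed.

Lemma CbZ (a : R) h : 0 <= a -> Cb h -> Cb (a *: h).
Proof.
rewrite le_eqVlt => /orP[/eqP <- _|]; first by rewrite scale0r; exact: Cb0.
exact: CbZ_gt0.
Qed.

(** If 0 were in the open cone, dilations would make the cone the whole space, which contains a line
    since m > 0. *)
Lemma Om_neq0 h : Om h -> h != 0.
Proof.
move=> Oh; apply/eqP => h0; move: Oh; rewrite h0 => /Om_ball[d d0 hd].
have O (v : V) : Om v.
  have v1 : 0 < `|v| + 1 by rewrite ltr_wpDl.
  have a0 : 0 < d / (`|v| + 1) by rewrite divr_gt0.
  rewrite -[v]scale1r -(divff (lt0r_neq0 a0)) mulrC -scalerA.
  apply: OmZ; first by rewrite invr_gt0.
  by apply: hd; rewrite subr0 normrZ gtr0_norm// mulrAC ltr_pdivrMr// ltr_pM2l// ltrDl.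
have m0 := cone_dim_gt0 K.
pose v : V := delta_mx (Ordinal m0) ord0.
have v0 : v != 0.
  apply/eqP => /matrixP/(_ (Ordinal m0) ord0)/eqP.
  by rewrite !mxE !eqxx oner_eq0.
by apply: (@Om_no_line _ _ _ K 0 v v0) => a; exact: O.
Qed.

Lemma Om'_gt0 l h : Om' K l -> Om h -> 0 < pairing l h.
Proof. by move=> Ol Oh; apply: Ol; [exact: OmW|exact: Om_neq0]. Qed.

Lemma Om'_ge0 l h : Om' K l -> Cb h -> 0 <= pairing l h.
Proof.
move=> Ol Ch; have [->|h0] := eqVneq h 0; last exact/ltW/Ol.
by rewrite /pairing big1// => i _; rewrite mxE mulr0.
Qed.

(** A continuous function positive on the compact set of unit vectors of the closed cone has a
    positive minimum there. *)
Lemma Om'_coercive l : Om' K l -> exists2 c : R, 0 < c &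
  forall h, Cb h -> c * `|h| <= pairing l h.
Proof.
move=> Ol; pose A := [set h : V | Cb h /\ `|h| = 1].
have cA : compact A.
  apply: (@cV_compact _ _ _ 1) => [|x [_ ->]//].
  apply: closedI; first exact: closed_closure.
  apply: (@closed_comp _ _ (fun h : V => `|h|) [set 1]) => [x _|].
    exact: norm_continuous.
  exact: closed_eq.
have [A0|A0] := eqVneq A set0.
  exists 1 => // h Ch; have [->|h0] := eqVneq h 0.
    by rewrite normr0 mulr0 Om'_ge0//; exact: Cb0.
  have : A (`|h|^-1 *: h).
    split; first by apply: CbZ => //; rewrite invr_ge0.
    by rewrite normrZ normfV normr_id mulVf ?normr_eq0.
  by rewrite A0.
have cp : {within A, continuous (pairing l)}.
  apply: continuous_subspaceT => h U /nbhs_ballP[d /= d0 dU].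
  have M0 : 0 < m%:R * `|l| + 1 by rewrite ltr_wpDl// mulr_ge0.
  apply/nbhs_ballP; exists (d / (m%:R * `|l| + 1)) => /=; first by rewrite divr_gt0.
  move=> k; rewrite -ball_normE/= => hk; apply: dU; rewrite -ball_normE/=.
  rewrite -pairingBr (le_lt_trans (pairing_bound _ _))//.
  rewrite ltr_pdivlMr// in hk; apply: le_lt_trans hk.
  by rewrite mulrC ler_wpM2l// lerDl.
have /set0P A1 := A0; have [h0] := compact_EVT_min A1 cA cp.
rewrite inE => -[Ch0 h01] hmin.
exists (pairing l h0).
  by apply: Ol => //; rewrite -normr_eq0 h01 oner_eq0.
move=> h Ch; have [->|hn] := eqVneq h 0.
  by rewrite normr0 mulr0 Om'_ge0//; exact: Cb0.
have hn0 : 0 < `|h| by rewrite normr_gt0.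
have := hmin (`|h|^-1 *: h); rewrite inE pairingZr => H.
rewrite mulrC -ler_pdivlMl//; apply: H.
split; first by apply: CbZ => //; rewrite invr_ge0.
by rewrite normrZ normfV normr_id mulVf ?normr_eq0.
Qed.

Lemma Om'_ball l : Om' K l -> exists2 d : R, 0 < d & forall l', `|l' - l| < d -> Om' K l'.
Proof.
move=> Ol; have [c c0 hc] := Om'_coercive Ol.
have m0 : (0 : R) < m%:R by rewrite ltr0n (cone_dim_gt0 K).
exists (c / m%:R) => [|l' ll' h Ch h0]; first by rewrite divr_gt0.
have hn0 : 0 < `|h| by rewrite normr_gt0.
have -> : l' = l + (l' - l) by rewrite addrC subrK.
rewrite pairingDl; have := pairing_bound (l' - l) h.
rewrite ler_norml => /andP[+ _]; have := hc _ Ch.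
have : m%:R * `|l' - l| * `|h| < c * `|h| by rewrite ltr_pM2r// mulrC -ltr_pdivlMr.
lra.
Qed.

Lemma Om'_open : open (Om' K : set V).
Proof.
rewrite openE => l /Om'_ball[d d0 hd]; apply/nbhs_ballP; exists d => // l'.
by rewrite -ball_normE/= distrC => /hd.
Qed.

(** For large [a] the vector e - h / a is a small perturbation of the interior point e. This
    converts norm bounds into bounds for the order of the cone. *)
Lemma eOm_absorb : exists2 C : R, 0 < C & forall h (a : R), C * `|h| < a -> Om (a *: e - h).
Proof.
have [d d0 hd] := Om_ball eOmP; exists d^-1 => [|h a ha]; first by rewrite invr_gt0.
have a0 : 0 < a by apply: le_lt_trans ha; rewrite mulr_ge0// invr_ge0 ltW.
rewrite -[h]scale1r -(divff (lt0r_neq0 a0)) -scalerA -scalerBr; apply: OmZ => //.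
apply: hd; rewrite addrAC subrr add0r normrN normrZ normfV gtr0_norm//.
by rewrite ltr_pdivrMl// mulrC -ltr_pdivrMl.
Qed.

Lemma Om_lower h : Om h -> exists2 a : R, 0 < a & Om (h - a *: e).
Proof.
move=> /Om_ball[d d0 hd]; pose a := d / (`|e| + 1).
have e1 : 0 < `|e| + 1 by rewrite ltr_wpDl.
have a0 : 0 < a by rewrite divr_gt0.
exists a => //; apply: hd.
by rewrite addrAC subrr add0r normrN normrZ gtr0_norm// /a mulrAC ltr_pdivrMr// ltr_pM2l// ltrDl.
Qed.

(** Order intervals are bounded because the coercive functional [eOm'] is monotone. *)
Lemma Cb_bounded (a : R) : exists2 M : R, 0 < M &
  forall h, Cb h -> Cb (a *: e - h) -> `|h| <= M.
Proof.
have [c c0 hc] := Om'_coercive (@eOm'_in _ _ _ K).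
pose M := `|pairing (eOm' K) (a *: e)| / c + 1.
have M0 : 0 <= `|pairing (eOm' K) (a *: e)| / c by rewrite divr_ge0// ltW.
exists M => [|h Ch Cah]; first by rewrite ltr_wpDl.
rewrite (@le_trans _ _ (`|pairing (eOm' K) (a *: e)| / c))// ?lerDl//.
rewrite ler_pdivlMr// mulrC (le_trans (hc _ Ch))//.
rewrite (le_trans _ (ler_norm _))// -subr_ge0 -pairingBr.
exact: (Om'_ge0 (@eOm'_in _ _ _ K)).
Qed.

Lemma T_unit t : T t -> t \in unitmx.
Proof. by case: (Tplus_group K) => h _ _ _ _; exact: h. Qed.

Lemma T1 : T 1%:M. Proof. by case: (Tplus_group K). Qed.

Lemma TM s t : T s -> T t -> T (s *m t).
Proof. by case: (Tplus_group K) => _ _ h _ _; exact: h. Qed.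

Lemma TV t : T t -> T (invmx t).
Proof. by case: (Tplus_group K) => _ _ _ h _; exact: h. Qed.

Lemma TOm t h : T t -> Om h -> Om (t *m h).
Proof. by case: (Tplus_Om K) => H _; exact: H. Qed.

Lemma TOmE t h : T t -> Om (t *m h) <-> Om h.
Proof.
move=> Tt; split=> [|]; last exact: TOm.
by move=> /(TOm (TV Tt)); rewrite mulKmx// T_unit.
Qed.

Lemma TCb t h : T t -> Cb h -> Cb (t *m h).
Proof.
move=> Tt /cV_closureP Ch; apply/cV_closureP => d d0.
have [C C0 hC] := mulmx_bound t.
have [h' Oh' hh'] := Ch _ (divr_gt0 d0 C0).
exists (t *m h'); first exact: TOm.
by rewrite -mulmxBr (le_lt_trans (hC _))// mulrC -ltr_pdivlMr.
Qed.

Lemma orbitP h : Om h -> T (orbit_elt K h) /\ orbit_elt K h *m e = h.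
Proof.
move=> Oh; have [_ /(_ e h eOmP Oh)[t [[Tt te] _]]] := Tplus_Om K.
exact: (@xgetPex _ 1%:M [set t | T t /\ t *m e = h] (ex_intro _ t (conj Tt te))).
Qed.

Lemma orbit_uniq t t' : T t -> T t' -> t *m e = t' *m e -> t = t'.
Proof.
move=> Tt Tt' tt'; have [_ /(_ e _ eOmP (TOm Tt' eOmP))[t0 [_ u]]] := Tplus_Om K.
by rewrite -(u t (conj Tt tt')) -(u t' (conj Tt' erefl)).
Qed.

Lemma orbit_mul t h : T t -> Om h -> orbit_elt K (t *m h) = t *m orbit_elt K h.
Proof.
move=> Tt Oh; have [T1 e1] := orbitP (TOm Tt Oh); have [T2 e2] := orbitP Oh.
by apply: orbit_uniq => //; [exact: TM|rewrite e1 -mulmxA e2].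
Qed.

Lemma orbit_e : orbit_elt K e = 1%:M.
Proof.
have [T1' e1] := orbitP eOmP; apply: orbit_uniq => //; first exact: T1.
by rewrite e1 mul1mx.
Qed.

Lemma linear_automorphism_T t : T t -> linear_automorphism Om t.
Proof.
move=> Tt; split; first exact: T_unit.
apply/seteqP; split=> [_ [h Oh <-]|h Oh]; first exact: TOm.
exists (invmx t *m h); first by apply: TOm => //; exact: TV.
by rewrite mulKVmx// T_unit.
Qed.

Lemma Delta_gt0 t j : T t -> 0 < Delta K t ord0 j.
Proof.
move=> Tt; have [sD _ _ _] := Delta_char K.
have : (Delta K @` T) (Delta K t) by exists t.
by rewrite sD; exact.
Qed.

Lemma DeltaM s t j : T s -> T t ->
  Delta K (s *m t) ord0 j = Delta K s ord0 j * Delta K t ord0 j.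
Proof. by move=> Ts Tt; have [_ h _ _] := Delta_char K; exact: h. Qed.

(** Logarithm of Delta^s(t): linear in [s] and additive in [t], so that identities between powers
    become identities between sums. *)
Definition lnDelta t (s : 'rV[R]_r) : R := \sum_j s ord0 j * ln (Delta K t ord0 j).

Definition lnDeltaOm h s := lnDelta (orbit_elt K h) s.

Lemma rpow_Delta t s : T t -> rpow (Delta K t) s = expR (lnDelta t s).
Proof.
move=> Tt; rewrite /rpow /lnDelta expR_sum; apply: eq_bigr => j _.
by rewrite /powR gt_eqF// Delta_gt0.
Qed.

Lemma DeltaOmE s h : Om h -> DeltaOm K s h = expR (lnDeltaOm h s).
Proof. by move=> /orbitP[Tt _]; exact: rpow_Delta. Qed.

Lemma lnDeltaM t t' s : T t -> T t' -> lnDelta (t *m t') s = lnDelta t s + lnDelta t' s.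
Proof.
move=> Tt Tt'; rewrite -big_split; apply: eq_bigr => j _.
by rewrite DeltaM// lnM ?posrE ?Delta_gt0//= mulrDr.
Qed.

Lemma lnDelta1 s : lnDelta 1%:M s = 0.
Proof.
have := lnDeltaM s T1 T1; rewrite mul1mx => /eqP.
by rewrite -[X in X == _]addr0 (inj_eq (addrI _)) eq_sym => /eqP.
Qed.

Lemma lnDeltaV t s : T t -> lnDelta (invmx t) s = - lnDelta t s.
Proof.
move=> Tt; apply/eqP; rewrite -subr_eq0 opprK -lnDeltaM//; last exact: TV.
by rewrite mulVmx ?lnDelta1// T_unit.
Qed.

Lemma lnDeltaD t s s' : lnDelta t (s + s') = lnDelta t s + lnDelta t s'.
Proof. by rewrite -big_split; apply: eq_bigr => j _; rewrite mxE mulrDl. Qed.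

Lemma lnDeltaZ t a s : lnDelta t (a *: s) = a * lnDelta t s.
Proof. by rewrite mulr_sumr; apply: eq_bigr => j _; rewrite mxE mulrA. Qed.

Lemma lnDeltaN t s : lnDelta t (- s) = - lnDelta t s.
Proof. by rewrite -scaleN1r lnDeltaZ mulN1r. Qed.

Lemma lnDeltaOmM t h s : T t -> Om h -> lnDeltaOm (t *m h) s = lnDelta t s + lnDeltaOm h s.
Proof.
move=> Tt Oh; rewrite /lnDeltaOm orbit_mul// lnDeltaM//.
by have [] := orbitP Oh.
Qed.

Lemma lnDeltaOm_e s : lnDeltaOm e s = 0.
Proof. by rewrite /lnDeltaOm orbit_e lnDelta1. Qed.

End cone_geometry.

(** * Complex vectors and compact sets of points *)

Section complex_vectors.
Context {R : realType}.
Local Notation C := R[i].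
Local Notation nc := (@Normc.normc R).

Lemma rnorm_cV_le k (x : 'cV[C]_k) (r : R) : 0 <= r ->
  (forall i, nc (x i ord0) <= r) -> rnorm x <= r.
Proof.
move=> r0 h; apply/ler_addgt0Pr => e e0; apply: ltW.
apply/rnorm_cV; first by rewrite ltr_wpDl.
by move=> i; apply: le_lt_trans (h i) _; rewrite ltrDl.
Qed.

Lemma rnorm_pair_le n m (x : 'cV[C]_n * 'cV[C]_m) (r : R) : rnorm x.1 <= r -> rnorm x.2 <= r ->
  rnorm x <= r.
Proof.
move=> h1 h2; apply/ler_addgt0Pr => e e0; apply: ltW; apply/rnorm_pair.
by split; [apply: le_lt_trans h1 _|apply: le_lt_trans h2 _]; rewrite ltrDl.
Qed.

Lemma re_mx_le k (x : 'cV[C]_k) : `|re_mx x| <= rnorm x.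
Proof.
apply: cV_norm_le => [|i]; first exact: rnorm_ge0.
by rewrite mxE (le_trans (absRe_le_normc _))// rnorm_coord.
Qed.

Lemma im_mx_le k (x : 'cV[C]_k) : `|im_mx x| <= rnorm x.
Proof.
apply: cV_norm_le => [|i]; first exact: rnorm_ge0.
by rewrite mxE (le_trans (absIm_le_normc _))// rnorm_coord.
Qed.

Lemma rnorm_le_reim k (x : 'cV[C]_k) : rnorm x <= `|re_mx x| + `|im_mx x|.
Proof.
apply: rnorm_cV_le => [|i]; first exact: addr_ge0.
rewrite (le_trans (normc_le_ReIm _))// lerD//.
  by have := cV_coord_le (re_mx x) i; rewrite mxE.
by have := cV_coord_le (im_mx x) i; rewrite mxE.
Qed.

Lemma re_mxB k l (x y : 'M[C]_(k, l)) : re_mx (x - y) = re_mx x - re_mx y.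
Proof. by apply/matrixP => i j; rewrite !mxE; case: (x i j) => ? ?; case: (y i j). Qed.

Lemma im_mxB k l (x y : 'M[C]_(k, l)) : im_mx (x - y) = im_mx x - im_mx y.
Proof. by apply/matrixP => i j; rewrite !mxE; case: (x i j) => ? ?; case: (y i j). Qed.

Lemma re_mxD k l (x y : 'M[C]_(k, l)) : re_mx (x + y) = re_mx x + re_mx y.
Proof. by apply/matrixP => i j; rewrite !mxE; case: (x i j) => ? ?; case: (y i j). Qed.

Lemma im_mxD k l (x y : 'M[C]_(k, l)) : im_mx (x + y) = im_mx x + im_mx y.
Proof. by apply/matrixP => i j; rewrite !mxE; case: (x i j) => ? ?; case: (y i j). Qed.

Lemma rnorm_conj k (x : 'cV[C]_k) : rnorm (map_mx (@conjc R) x) = rnorm x.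
Proof.
have h (y : 'cV[C]_k) : rnorm (map_mx (@conjc R) y) <= rnorm y.
  apply: rnorm_cV_le => [|i]; first exact: rnorm_ge0.
  by rewrite mxE normc_conj rnorm_coord.
apply/eqP; rewrite eq_le h -[X in rnorm X <= _](_ : map_mx (@conjc R) (map_mx (@conjc R) x) = x) ?h//.
by apply/matrixP => i j; rewrite !mxE conjcK.
Qed.

Lemma rnorm_mulmx k l (t : 'M[C]_(k, l)) : exists2 B : R, 0 < B &
  forall h : 'cV[C]_l, rnorm (t *m h) <= B * rnorm h.
Proof.
have B0 : 0 <= \sum_i \sum_j nc (t i j) by do 2 (apply: sumr_ge0 => ? _); exact: normc_ge0.
exists (\sum_i \sum_j nc (t i j) + 1) => [|h]; first by rewrite ltr_wpDl.
apply: rnorm_cV_le => [|i]; first by rewrite mulr_ge0 ?rnorm_ge0// addr_ge0.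
rewrite mxE (le_trans (normc_sum _ _ _))//.
apply: (@le_trans _ _ (\sum_j nc (t i j) * rnorm h)).
  by apply: ler_sum => j _; rewrite Normc.normcM ler_wpM2l ?normc_ge0// rnorm_coord.
rewrite -mulr_suml ler_wpM2r ?rnorm_ge0// (bigD1 i)//= -addrA lerDl addr_ge0//.
by do 2 (apply: sumr_ge0 => ? _); exact: normc_ge0.
Qed.

Lemma rnorm_continuous (V : normedModType C) (W : normedModType R) (f : V -> W) x :
  (forall e : R, 0 < e -> exists2 d : R, 0 < d & forall y, rnorm (y - x) < d -> `|f y - f x| < e) ->
  {for x, continuous f}.
Proof.
move=> h U /nbhs_ballP[e /= e0 eU]; have [d d0 hd] := h e e0.
apply/nbhs_rnormP; exists d => // y /hd xy; apply: eU.
by rewrite -ball_normE/= distrC.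
Qed.

Lemma rnorm_continuousC (V : normedModType C) (f : V -> C) x :
  (forall e : R, 0 < e -> exists2 d : R, 0 < d & forall y, rnorm (y - x) < d -> nc (f y - f x) < e) <->
  {for x, continuous f}.
Proof.
split=> [h U /(nbhs_rnormP (f x : (C : normedModType C)))[e e0 eU]|h e e0].
  have [d d0 hd] := h e e0.
  by apply/nbhs_rnormP; exists d => // y /hd xy; apply: eU; rewrite rnorm_normc.
have : nbhs (f x) [set z | nc (z - f x) < e].
  apply/(nbhs_rnormP (f x : (C : normedModType C))); exists e => // z.
by move=> /h/nbhs_rnormP[d d0 hd]; exists d.
Qed.

Lemma cVC_compact k (A : set 'cV[C]_k) (M : R) : closed A ->
  (forall x, A x -> rnorm x <= M) -> compact A.
Proof.
move=> cA AM; pose B := [set a : 'cV[R]_k | `|a| <= M].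
have cB : compact B.
  apply: (@cV_compact _ _ _ M) => //.
  apply: (@closed_comp _ _ (fun h : 'cV[R]_k => `|h|) [set x | x <= M]) => [x _|].
    exact: norm_continuous.
  exact: closed_le.
apply: (@subclosed_compact _ _ [set cplx v.1 v.2 | v in B `*` B]) => //.
  apply: continuous_compact; last exact: compact_setX.
  apply: continuous_subspaceT => v U /nbhs_rnormP[d d0 dU].
  have d2 : 0 < d / 2 by rewrite divr_gt0.
  apply/nbhs_ballP; exists (d / 2) => // w [].
  rewrite -!ball_normE/= => h1 h2; apply: dU.
  apply: (le_lt_trans (rnorm_le_reim _)).
  have -> : re_mx (cplx w.1 w.2 - cplx v.1 v.2) = w.1 - v.1 by apply/matrixP => i j; rewrite !mxE.
  have -> : im_mx (cplx w.1 w.2 - cplx v.1 v.2) = w.2 - v.2 by apply/matrixP => i j; rewrite !mxE.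
  by rewrite [`|w.1 - _|]distrC [`|w.2 - _|]distrC; lra.
move=> x /AM xM; exists (re_mx x, im_mx x); last by rewrite /= cplx_reim.
by split => /=; [exact: le_trans (re_mx_le _) xM|exact: le_trans (im_mx_le _) xM].
Qed.

Lemma closed_rnorm_le (V : normedModType C) (M : R) : closed [set x : V | rnorm x <= M].
Proof.
move=> x hx; rewrite /= leNgt; apply/negP => Mx.
have d0 : 0 < rnorm x - M by rewrite subr_gt0.
have [|y [/= yM]] := hx [set y | rnorm (y - x) < rnorm x - M].
  by apply/nbhs_rnormP; exists (rnorm x - M).
have := rnorm_tri x 0 y; rewrite !subr0 (rnormB x y); lra.
Qed.

Lemma point_compact n m (A : set ('cV[C]_n * 'cV[C]_m)) (M : R) : closed A ->
  (forall x, A x -> rnorm x <= M) -> compact A.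
Proof.
move=> cA AM.
apply: (@subclosed_compact _ _ ([set x : 'cV[C]_n | rnorm x <= M] `*` [set x : 'cV[C]_m | rnorm x <= M])) => //.
  by apply: compact_setX; apply: (@cVC_compact _ _ M) => //; exact: closed_rnorm_le.
move=> x /AM xM; split => /=.
  exact: le_trans (rnorm_fst _) xM.
exact: le_trans (rnorm_snd _) xM.
Qed.

End complex_vectors.

(** * Geometry of the domain and its exhaustion by compact sets *)

Section siegel_geometry.
Context {R : realType} {n m r : nat} (S : siegel_domain R n m r).
Local Notation C := R[i].
Local Notation nc := (@Normc.normc R).
Local Notation point := ('cV[C]_n * 'cV[C]_m)%type.
Local Notation Phi := (Phi S).
Local Notation Cb := (closure (Om S)).
Local Notation e := (eOm S).

Lemma PhiD z z' w : Phi (z + z') w = Phi z w + Phi z' w.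
Proof. by have := Phi_linear S w 1 z z'; rewrite !scale1r. Qed.

Lemma Phi0l w : Phi 0 w = 0.
Proof.
by apply: (@addrI _ (Phi 0 w)); rewrite -PhiD !addr0.
Qed.

Lemma PhiZ a z w : Phi (a *: z) w = a *: Phi z w.
Proof. by have := Phi_linear S w a z 0; rewrite Phi0l !addr0. Qed.

Lemma PhiB z z' w : Phi (z - z') w = Phi z w - Phi z' w.
Proof. by rewrite -scaleN1r PhiD PhiZ scaleN1r. Qed.

Lemma PhiBr z w w' : Phi z (w - w') = Phi z w - Phi z w'.
Proof.
rewrite (Phi_hermitian S (w - w') z) PhiB (Phi_hermitian S w z) (Phi_hermitian S w' z).
by apply/matrixP => i j; rewrite !mxE; exact: (rmorphB (@conjc R)).
Qed.

Lemma PhiN z w : Phi (- z) w = - Phi z w.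
Proof. by rewrite -scaleN1r PhiZ scaleN1r. Qed.

Lemma PhiNr z w : Phi z (- w) = - Phi z w.
Proof. by rewrite -[- w]add0r PhiBr (Phi_hermitian S 0 z) Phi0l map_mx0 sub0r. Qed.

Lemma Phi_sum z w : Phi z w = \sum_i z i ord0 *: Phi (delta_mx i ord0) w.
Proof.
have -> : z = \sum_i z i ord0 *: delta_mx i ord0.
  by rewrite {1}[z]matrix_sum_delta; apply: eq_bigr => i _; rewrite big_ord1.
rewrite (big_morph (Phi^~ w) (fun a b => PhiD a b w) (Phi0l w)).
apply: eq_bigr => i _; rewrite PhiZ summxE (bigD1 i)//= big1 ?addr0.
  by rewrite !mxE !eqxx mulr1.
by move=> j ji; rewrite !mxE eq_sym (negbTE ji) mulr0.
Qed.

Lemma rnorm_sum (V : normedModType C) (I : finType) (F : I -> V) :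
  rnorm (\sum_i F i) <= \sum_i rnorm (F i).
Proof.
elim/big_ind2 : _ => [|a b c d ab cd|//]; first by rewrite rnorm0.
by rewrite (le_trans (rnormD _ _))// lerD.
Qed.

Lemma Phi_bound : exists2 M : R, 0 < M &
  forall z w, rnorm (Phi z w) <= M * rnorm z * rnorm w.
Proof.
have h z w : rnorm (Phi z w) <= rnorm z * \sum_i rnorm (Phi (delta_mx i ord0) w).
  rewrite {1}Phi_sum (le_trans (rnorm_sum _))// mulr_sumr; apply: ler_sum => i _.
  by rewrite rnormZ ler_wpM2r ?rnorm_ge0// rnorm_coord.
pose M := \sum_i \sum_j rnorm (Phi (delta_mx j ord0) (delta_mx i ord0)).
have M0 : 0 <= M by do 2 (apply: sumr_ge0 => ? _); exact: rnorm_ge0.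
exists (M + 1) => [|z w]; first by rewrite ltr_wpDl.
rewrite (le_trans (h z w))// [_ * rnorm z]mulrC -mulrA ler_wpM2l ?rnorm_ge0//.
apply: (@le_trans _ _ (M * rnorm w)); last by rewrite ler_wpM2r ?rnorm_ge0// lerDl.
rewrite mulr_suml; apply: ler_sum => i _.
rewrite (Phi_hermitian S w) rnorm_conj mulrC; exact: h.
Qed.

Lemma Phi_diag_real z : im_mx (Phi z z) = 0.
Proof.
apply/matrixP => i j; have /matrixP/(_ i j) := Phi_hermitian S z z.
by rewrite !mxE; case: (Phi z z i j) => a b [] /eqP; rewrite -addr_eq0 -mulr2n mulrn_eq0 => /eqP.
Qed.

Lemma Phi_diag_Cb z : Cb (re_mx (Phi z z)).
Proof.
have [->|z0] := eqVneq z 0; last by have [] := @Phi_pos _ _ _ _ S z z0.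
rewrite Phi0l (_ : re_mx 0 = 0); first exact: Cb0.
by apply/matrixP => i j; rewrite !mxE.
Qed.

Definition rho (w : point) : 'cV[R]_m := im_mx w.2 - re_mx (Phi w.1 w.1).

Lemma domainE w : domain S w <-> Om S (rho w). Proof. by []. Qed.

(** [rho] is quadratic in the first variable, so the Lipschitz constant grows with the bound [c] on
    the point. *)
Lemma rho_lip : exists2 L : R, 0 < L & forall c w w', rnorm w <= c -> rnorm (w' - w) <= 1 ->
  `|rho w' - rho w| <= L * (c + 1) * rnorm (w' - w).
Proof.
have [M M0 hM] := Phi_bound; exists (2 * M + 1) => [|c w w' wc ww]; first by rewrite ltr_wpDl// mulr_ge0// ltW.
have c0 : 0 <= c := le_trans (rnorm_ge0 _) wc.
set d := rnorm (w' - w); have d0 : 0 <= d by exact: rnorm_ge0.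
have w1c : rnorm w.1 <= c := le_trans (rnorm_fst w) wc.
have d1 : rnorm (w'.1 - w.1) <= d := rnorm_fst (w' - w).
have d2 : rnorm (w'.2 - w.2) <= d := rnorm_snd (w' - w).
have w1c' : rnorm w'.1 <= c + 1.
  rewrite -[w'.1](subrK w.1) (le_trans (rnormD _ _))// addrC lerD// (le_trans d1)//.
have -> : rho w' - rho w = im_mx (w'.2 - w.2) -
    re_mx (Phi (w'.1 - w.1) w'.1 + Phi w.1 (w'.1 - w.1)).
  rewrite im_mxB PhiB PhiBr addrA subrK re_mxB /rho opprD opprK opprB.
  by rewrite addrACA [- re_mx _ + re_mx _]addrC.
rewrite (le_trans (ler_normB _ _))//.
have h1 : `|im_mx (w'.2 - w.2)| <= d by rewrite (le_trans (im_mx_le _)).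
have h2 : `|re_mx (Phi (w'.1 - w.1) w'.1 + Phi w.1 (w'.1 - w.1))| <= M * d * (c + 1) + M * c * d.
  rewrite (le_trans (re_mx_le _))// (le_trans (rnormD _ _))// lerD//.
    rewrite (le_trans (hM _ _))//; apply: ler_pM => //; rewrite ?rnorm_ge0//.
      by rewrite mulr_ge0 ?rnorm_ge0// ltW.
    by rewrite ler_wpM2l// ltW.
  rewrite (le_trans (hM _ _))//; apply: ler_pM => //; rewrite ?rnorm_ge0//.
    by rewrite mulr_ge0 ?rnorm_ge0// ltW.
  by rewrite ler_wpM2l// ltW.
rewrite (le_trans (lerD h1 h2))//.
have : 0 <= M * d by rewrite mulr_ge0// ltW.
have : 0 <= c * d by rewrite mulr_ge0.
nra.
Qed.

Lemma rho_cont w d : 0 < d -> exists2 d', 0 < d' & forall w', rnorm (w' - w) < d' -> `|rho w' - rho w| < d.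
Proof.
move=> d0; have [L L0 hL] := rho_lip.
have B0 : 0 < L * (rnorm w + 1) by rewrite mulr_gt0// ltr_wpDl// rnorm_ge0.
exists (Num.min 1 (d / (L * (rnorm w + 1)))) => [|w']; first by rewrite lt_min ltr01 divr_gt0.
rewrite lt_min => /andP[h1 h2].
rewrite (le_lt_trans (hL _ _ _ (lexx _) (ltW h1)))// mulrC -ltr_pdivlMr//.
Qed.

Lemma rho_continuous : continuous rho.
Proof. by move=> w; apply: rnorm_continuous => d d0; exact: rho_cont. Qed.

Lemma domain_nbhs w : domain S w -> exists2 d, 0 < d & forall w', rnorm (w' - w) < d -> domain S w'.
Proof.
move=> /(@Om_ball _ _ _ S)[d d0 hd]; have [d' d'0 hd'] := rho_cont w d0.
by exists d' => // w' /hd'/hd.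
Qed.

Lemma domain_open : open (domain S).
Proof. by rewrite openE => w /domain_nbhs[d d0 hd]; apply/nbhs_rnormP; exists d. Qed.

Lemma Hol_cont F w e' : Hol S F -> domain S w -> 0 < e' -> exists2 d, 0 < d &
  forall w', rnorm (w' - w) < d -> domain S w' /\ nc (F w' - F w) < e'.
Proof.
move=> [_ hF] Dw e0; have [d1 d10 h1] := domain_nbhs Dw.
have /rnorm_continuousC/(_ _ e0)[d2 d20 h2] := differentiable_continuous (hF w Dw).
exists (Num.min d1 d2) => [|w']; first by rewrite lt_min d10.
by rewrite lt_min => /andP[/h1 ? /h2].
Qed.

Lemma Hol_bounded_hol F : Hol S F -> bounded_hol (domain S) F.
Proof.
move=> hF w Dw; have [d d0 hd] := Hol_cont hF Dw ltr01.
exists d => //; exists (nc (F w) + 1) => w' /hd[Dw' h]; split => //.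
  by rewrite -[F w'](subrK (F w)) (le_trans (le_normcD _ _))// addrC lerD2l ltW.
by move=> v; apply: diff_derivable; case: hF => _; exact.
Qed.

(** The relation H = F - G is required at points of the domain only; in this form it survives each
    [dz]. *)
Definition hol_diff (H F G : point -> C) := [/\ bounded_hol (domain S) H,
  bounded_hol (domain S) F, bounded_hol (domain S) G & forall w, domain S w -> H w = F w - G w].

Lemma hol_diff_dz j H F G : hol_diff H F G -> hol_diff (dz j H) (dz j F) (dz j G).
Proof.
move=> [hH hF hG E]; split; try exact: bounded_hol_derive.
move=> w Dw; have [d0 d00 [MF hMF]] := hF w Dw; have [d1 d10 [MG hMG]] := hG w Dw.
have ww (d : R) : 0 < d -> rnorm (w - w) < d by rewrite subrr rnorm0.
have [_ _ dF] := hMF w (ww _ d00); have [_ _ dG] := hMG w (ww _ d10).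
rewrite /dz -(derivableB_derive (dF _) (dG _)).2.
by rewrite (@eq_on_derive _ _ _ _ (fun x => F x - G x) w _ hH Dw E).
Qed.

(** Additivity of an iterated derivative needs all intermediate derivatives to exist, which the
    stability of [bounded_hol] supplies. *)
Lemma RL_sub s' h1 h2 : Hol S h1 -> Hol S h2 -> forall w,
  RL S s' (fun w => h1 w - h2 w) w = RL S s' h1 w - RL S s' h2 w.
Proof.
move=> H1 H2 w; rewrite /RL; case: ifPn => [|_]; last by rewrite subrr.
rewrite inE => Dw; rewrite /diff_op -sumrB; apply: eq_bigr => al _.
rewrite -mulrBr; congr (_ * _).
have : hol_diff (fun w => h1 w - h2 w) h1 h2.
  by split; [apply: bounded_holB; exact: Hol_bounded_hol|exact: Hol_bounded_hol|exact: Hol_bounded_hol|].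
rewrite /dz_mon; suff : forall H F G, hol_diff H F G ->
    hol_diff (foldr (fun j g => iter (al j) (dz j) g) H (enum 'I_m))
      (foldr (fun j g => iter (al j) (dz j) g) F (enum 'I_m))
      (foldr (fun j g => iter (al j) (dz j) g) G (enum 'I_m)).
  by move=> /[apply] -[_ _ _]; exact.
move=> H F G hd; elim: (enum 'I_m) => //= j s IH.
by elim: (al j) => //= k; exact: hol_diff_dz.
Qed.

(** A compact exhaustion: bounded points whose [rho] dominates e / c in the order of the cone, hence
    stays away from its boundary. *)
Definition Dc (c : R) : set point := [set w | rnorm w <= c /\ Cb (rho w - c^-1 *: e)].

Lemma Dc_domain c : 0 < c -> Dc c `<=` domain S.
Proof.
move=> c0 w [_ h]; apply/domainE; rewrite -[rho w](subrK (c^-1 *: e)) addrC.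
by apply: OmDclosure => //; apply: OmZ; [rewrite invr_gt0|exact: eOmP].
Qed.

Lemma Dc_mono c c' : 0 < c -> c <= c' -> Dc c `<=` Dc c'.
Proof.
move=> c0 cc' w [wc h]; split; first exact: le_trans cc'.
have -> : rho w - c'^-1 *: e = (rho w - c^-1 *: e) + (c^-1 - c'^-1) *: e.
  by rewrite scalerBl addrA subrK.
apply: CbD; [exact: h|apply: CbZ; last exact/OmW/eOmP].
by rewrite subr_ge0 lef_pV2// posrE// (lt_le_trans c0).
Qed.

Lemma Dc_cover w : domain S w -> exists2 c, 0 < c & Dc c w.
Proof.
move=> /(@Om_lower _ _ _ S)[a a0 ha]; pose c := rnorm w + a^-1.
have a1 : 0 < a^-1 by rewrite invr_gt0.
have c0 : 0 < c by rewrite ltr_wpDl// rnorm_ge0.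
exists c => //; split; first by rewrite lerDl ltW.
have -> : rho w - c^-1 *: e = (rho w - a *: e) + (a - c^-1) *: e.
  by rewrite scalerBl addrA subrK.
apply: CbD; first exact: OmW.
apply: CbZ; last exact/OmW/eOmP.
by rewrite subr_ge0 -[leRHS]invrK lef_pV2 ?posrE// lerDr rnorm_ge0.
Qed.

Lemma Dc_closed c : closed (Dc c).
Proof.
apply: closedI; first exact: closed_rnorm_le.
apply: (@closed_comp _ _ (fun w => rho w - c^-1 *: e) Cb); last exact: closed_closure.
move=> w _; apply: continuousB; [exact: rho_continuous|exact: cst_continuous].
Qed.

Lemma Dc_compact c : compact (Dc c).
Proof. by apply: (@point_compact _ _ _ _ c); [exact: Dc_closed|move=> x []]. Qed.

(** A neighbourhood of uniform width: half of the margin e / c is spent on the variation of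
    [rho]. *)
Lemma Dc_thick c : 0 < c -> exists2 c', 0 < c' & exists2 d, 0 < d &
  forall w w', Dc c w -> rnorm (w' - w) < d -> Dc c' w'.
Proof.
move=> c0; have [L L0 hL] := rho_lip; have [B B0 hB] := @eOm_absorb _ _ _ S.
(* A displacement below 1 / k moves [rho] by less than e / (2 c) in the order of the cone. *)
pose k := 2 * c * B * (L * (c + 1)) + 1.
have c1 : 0 < c + 1 by rewrite addr_gt0.
have k0 : 0 < 2 * c * B * (L * (c + 1)) by rewrite !mulr_gt0.
have k1 : 1 <= k by rewrite lerDr ltW.
(* Large enough for the norm, which grows to at most c + 1, and above 2 c, so that 1 / c - 1 / (2 c)
   still exceeds its inverse. *)
exists (2 * c + 1); first by rewrite addr_gt0// mulr_gt0.
exists (Num.min 1 k^-1); first by rewrite lt_min ltr01 invr_gt0 (lt_le_trans ltr01).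
move=> w w' [wc hw]; rewrite lt_min => /andP[h1 h2]; split.
  rewrite -[w'](subrK w) (le_trans (rnormD _ _))//; lra.
have hr := hL _ _ _ wc (ltW h1).
have hr2 : B * `|rho w - rho w'| < (2 * c)^-1.
  rewrite distrC (le_lt_trans (ler_wpM2l (ltW B0) hr))//.
  rewrite -[ltRHS]mul1r ltr_pdivlMr ?mulr_gt0//.
  have : k * rnorm (w' - w) < 1 by rewrite -ltr_pdivlMl ?mulr1// (lt_le_trans ltr01).
  have := rnorm_ge0 (w' - w); rewrite /k; nra.
have -> : rho w' - (2 * c + 1)^-1 *: e = (rho w - c^-1 *: e) +
    ((2 * c)^-1 *: e - (rho w - rho w')) + (c^-1 - (2 * c)^-1 - (2 * c + 1)^-1) *: e.
  rewrite !scalerBl opprB !addrA.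
  by apply/matrixP => i j; rewrite !mxE; ring.
apply: CbD; last first.
  apply: CbZ; last exact/OmW/eOmP.
  have -> : c^-1 - (2 * c)^-1 - (2 * c + 1)^-1 = (2 * c * (2 * c + 1))^-1.
    by field; rewrite !gt_eqF// ?addr_gt0// ?mulr_gt0.
  by rewrite invr_ge0 mulr_ge0// ?addr_ge0// ?mulr_ge0// ltW.
by apply: CbD; [exact: hw|apply/OmW/hB].
Qed.

(** The cutoff is the supremum over x in [Dc c] of the positive part of 1 - |w - x| / d, Lipschitz
    because all these functions share the constant 1 / d. *)
Lemma Dc_cutoff c : 0 < c -> exists2 c', 0 < c' & exists chi : point -> R,
  [/\ forall w, 0 <= chi w <= 1, forall w, Dc c w -> chi w = 1,
      forall w, ~ Dc c' w -> chi w = 0 &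
      exists2 L, 0 < L & forall w w', `|chi w - chi w'| <= L * rnorm (w - w')].
Proof.
move=> c0; have [c' c'0 [d d0 hd]] := Dc_thick c0.
exists c' => //; pose A w := [set 0 : R] `|` [set 1 - rnorm (w - x) / d | x in Dc c].
have A0 w : A w !=set0 by exists 0; left.
have A1 w : ubound (A w) 1.
  by move=> _ [->//|[x _ <-]]; rewrite gerBl divr_ge0 ?rnorm_ge0// ltW.
have As w : has_sup (A w) by split; [exact: A0|exists 1; exact: A1].
exists (fun w => sup (A w)); split.
- move=> w; rewrite ge_sup ?A1// andbT.
  by apply: ub_le_sup; [exists 1; exact: A1|left].
- move=> w Dw; apply/eqP; rewrite eq_le ge_sup ?A1//=.
  apply: ub_le_sup; [by exists 1; exact: A1|right; exists w => //].
  by rewrite subrr rnorm0 mul0r subr0.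
- move=> w Dw; apply/eqP; rewrite eq_le; apply/andP; split; last first.
    by apply: ub_le_sup; [exists 1; exact: A1|left].
  apply: ge_sup => // _ [->//|[x Dx <-]].
  rewrite subr_le0 (ler_pdivlMr _ _ d0) mul1r leNgt; apply/negP => h; apply: Dw.
  exact: (hd x).
- have d1 : 0 < d^-1 by rewrite invr_gt0.
  exists d^-1 => // w w'.
  have H v v' : sup (A v) <= sup (A v') + d^-1 * rnorm (v - v').
    apply: ge_sup => // _ [->|[x Dx <-]].
      rewrite addr_ge0// ?mulr_ge0 ?rnorm_ge0// ?(ltW d1)//.
      by apply: ub_le_sup; [exists 1; exact: A1|left].
    rewrite -lerBlDr; apply: (@le_trans _ _ (1 - rnorm (v' - x) / d)).
      have := rnorm_tri v' x v; rewrite (rnormB v' v) => h.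
      have : rnorm (v' - x) / d <= d^-1 * rnorm (v - v') + rnorm (v - x) / d.
        by rewrite ![_ / d]mulrC -mulrDr ler_wpM2l// ltW.
      lra.
    by apply: ub_le_sup; [exists 1; exact: A1|right; exists x].
  have := H w w'; have := H w' w; rewrite (rnormB w' w).
  move: (sup (A w)) (sup (A w')) (d^-1 * _) => a b c1 h1 h2.
  by rewrite ler_norml; apply/andP; split; lra.
Qed.

Lemma cutoff_Cc F c chi : Hol S F -> 0 < c -> (forall w, ~ Dc c w -> chi w = 0) ->
  (exists2 L : R, 0 < L & forall w w', `|chi w - chi w'| <= L * rnorm (w - w')) ->
  Cc S (fun w => (chi w)%:C%C * F w).
Proof.
move=> hF c0 chi0 [L L0 hL]; split; last first.
  exists (Dc c); first by split; [exact: Dc_compact|exact: Dc_domain].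
  by move=> w /chi0 ->; rewrite mul0r.
move=> w; apply/rnorm_continuousC => e' e0.
have [Dw|Dw] := pselect (Dc c w); last first.
  have /nbhs_rnormP[d d0 hd] := open_nbhs_nbhs (conj (closed_openC (@Dc_closed c)) Dw).
  exists d => // w' /hd Dw'; rewrite !chi0// !mul0r subrr Normc.normc0//.
have {}Dw := Dc_domain c0 Dw.
pose B := nc (F w) + 1; have B0 : 0 < B by rewrite ltr_wpDl// normc_ge0.
have LB : 0 < L * B by rewrite mulr_gt0.
pose K := `|chi w| + 1; have K0 : 0 < K by rewrite ltr_wpDl.
have m0 : 0 < Num.min 1 (e' / 2 / K) by rewrite lt_min ltr01 !divr_gt0.
have [d d0 hd] := Hol_cont hF Dw m0.
exists (Num.min d (e' / 2 / (L * B))) => [|w']; first by rewrite lt_min d0 !divr_gt0.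
rewrite lt_min => /andP[/hd[_]]; rewrite lt_min => /andP[h1 h2] h3.
have -> : (chi w')%:C%C * F w' - (chi w)%:C%C * F w =
    (chi w' - chi w)%:C%C * F w' + (chi w)%:C%C * (F w' - F w).
  by rewrite rmorphB/=; ring.
rewrite (le_lt_trans (le_normcD _ _))// !Normc.normcM !normc_real.
have h4 : nc (F w') <= B.
  by rewrite -[F w'](subrK (F w)) (le_trans (le_normcD _ _))// addrC lerD2l ltW.
have h5 : `|chi w' - chi w| * nc (F w') <= L * rnorm (w' - w) * B.
  by apply: ler_pM => //; exact: normc_ge0.
have h6 : `|chi w| * nc (F w' - F w) <= K * nc (F w' - F w).
  by rewrite ler_wpM2r ?normc_ge0// lerDl.
rewrite ltr_pdivlMr// in h3; rewrite ltr_pdivlMr// in h2.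
have : L * rnorm (w' - w) * B = rnorm (w' - w) * (L * B) by ring.
lra.
Qed.

End siegel_geometry.

(** * Strict positivity of integrals *)

Section positive_integrals.
Context d (X : measurableType d) (R : realType) (mu : {measure set X -> \bar R}).

Lemma integral_pos (D : set X) (f : X -> R) : measurable D ->
  measurable_fun D (f : X -> measurableTypeR R) -> (forall x, D x -> 0 < f x) ->
  (0 < mu D)%E -> (0 < \int[mu]_(x in D) (f x)%:E)%E.
Proof.
move=> mD mf f0 D0; have mf' : measurable_fun D (EFin \o f) by exact/measurable_EFinP.
have i0 : (0 <= \int[mu]_(x in D) (f x)%:E)%E.
  by apply: integral_ge0 => x /f0 /ltW; rewrite lee_fin.
rewrite lt_neqAle i0 andbT eq_sym; apply/eqP => E.
have : (\int[mu]_(x in D) `|(EFin \o f) x| = 0)%E.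
  by rewrite -[RHS]E; apply: eq_integral => x; rewrite inE => /f0 fx /=; rewrite gtr0_norm.
move=> /(ae_eq_integral_abs mu mD mf')[N [mN N0 hN]].
move: D0; rewrite ltNge; apply/negP/negPn; rewrite -N0; apply: le_measure; rewrite ?inE//.
move=> x Dx; apply: hN => /= /(_ Dx)[] fx0.
by have := f0 x Dx; rewrite fx0 ltxx.
Qed.

End positive_integrals.

(** * Powers of Delta through their Laplace transforms *)

Section real_laplace.
Context {R : realType} {n m r : nat} (S : siegel_domain R n m r).
Local Notation Om := (Om S).
Local Notation e := (eOm S).
Local Notation T := (Tplus S).
Local Notation Cb := (closure (Defs.Om S)).
Local Notation V := 'cV[R]_m.
Local Notation LD := (lnDeltaOm S).
Local Notation nu := (nuOm S).
Local Notation lam := (@lebesgue_cV R m).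
Implicit Types (h k : V) (t : 'M[R]_m) (s : 'rV[R]_r).

Definition lnDeltaOm' l s := lnDelta S (orbit_elt' S l) s.

Definition cvec s : 'rV[R[i]]_r := map_mx (fun x => x%:C%C) s.

Lemma cpow_real (x s : 'rV[R]_r) :
  cpow x (cvec s) = (expR (\sum_j s ord0 j * ln (x ord0 j)))%:C%C.
Proof.
rewrite /cpow (_ : \sum_j _ = (\sum_j s ord0 j * ln (x ord0 j))%:C%C); last first.
  by rewrite rmorph_sum; apply: eq_bigr => j _; rewrite mxE rmorphM.
rewrite /cexp /= sin0 cos0; apply/eqP; rewrite eq_complex/= ?mulr1 ?mulr0 ?mul0r ?subr0 ?addr0 ?eqxx//.
Qed.

Lemma cvecN s : - cvec s = cvec (- s).
Proof. by apply/matrixP => i j; rewrite !mxE rmorphN. Qed.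

Lemma laplace_integrand_real (phi : V -> R[i]) (f : V -> R) l h : phi h = (expR (f h))%:C%C ->
  laplace_integrand phi l h = (expR (f h - pairing l h))%:C%C.
Proof. by move=> E; rewrite /laplace_integrand E -rmorphM/= -expRD addrC. Qed.

(** For a real exponent the integrand is a real exponential, so the complex formula holds with the
    real part of its constant. *)
Lemma real_laplace (mu : {measure set V -> \bar R}) A A' (L L' : V -> 'rV[R]_r -> R) cD cD' mm :
  (forall s h, cD (cvec s) h = (expR (L h s))%:C%C) ->
  (forall s h, cD' (cvec s) h = (expR (L' h s))%:C%C) -> measurable A ->
  laplace_property mu A A' cD cD' mm ->
  forall s, (forall j, (mm j)%:R / 2 < s ord0 j) -> exists c : R, forall l, A' l ->
    mu.-integrable A (fun h => (expR (L h s - pairing l h))%:E) /\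
    (\int[mu]_(h in A) (expR (L h s - pairing l h))%:E = (c * expR (L' l (- s)))%:E)%E.
Proof.
move=> cDE cDE' mA [_ H] s hs.
have hs' j : (mm j)%:R / 2 < complex.Re (cvec s ord0 j) by rewrite mxE.
have [c hc] := H (cvec s) hs'; exists (complex.Re c) => l /hc[[I1 I2] E].
have E1 h : complex.Re (laplace_integrand (cD (cvec s)) l h) = expR (L h s - pairing l h).
  by rewrite (laplace_integrand_real (f := fun h => L h s)).
have EE : (fun h => (complex.Re (laplace_integrand (cD (cvec s)) l h))%:E) =
    (fun h => (expR (L h s - pairing l h))%:E) by apply/funext => h; rewrite E1.
rewrite EE in I1; split; first exact: I1.
move: E; rewrite cvecN cDE' => /(congr1 (@complex.Re R)).
rewrite /laplace /= /Rintegral; under eq_integral do rewrite E1.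
move=> E; rewrite -(fineK (integrable_fin_num mA I1)) E.
by case: c {hc E} => a b /=; rewrite mulr0 subr0.
Qed.

Lemma measurable_Om : measurable Om.
Proof. by apply: open_measurable_cV; exact: Om_open. Qed.

Lemma measurable_Om' : measurable (Om' S).
Proof. by apply: open_measurable_cV; exact: Om'_open. Qed.

Lemma laplace_Om_real s : (forall j, (mvec S j)%:R / 2 < s ord0 j) ->
  exists c : R, forall l, Om' S l ->
    nu.-integrable Om (fun h => (expR (LD h s - pairing l h))%:E) /\
    (\int[nu]_(h in Om) (expR (LD h s - pairing l h))%:E = (c * expR (lnDeltaOm' l (- s)))%:E)%E.
Proof.
apply: (real_laplace (L := LD) (L' := lnDeltaOm') _ _ measurable_Om (laplace_Om S)).
- by move=> s' h; rewrite /cDeltaOm cpow_real.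
- by move=> s' h; rewrite /cDeltaOm' cpow_real.
Qed.

Lemma laplace_Om'_real s : (forall j, (mvec' S j)%:R / 2 < s ord0 j) ->
  exists c : R, forall h, Om h ->
    (nuOm' S).-integrable (Om' S) (fun l => (expR (lnDeltaOm' l s - pairing h l))%:E) /\
    (\int[nuOm' S]_(l in Om' S) (expR (lnDeltaOm' l s - pairing h l))%:E = (c * expR (LD h (- s)))%:E)%E.
Proof.
apply: (real_laplace (L := lnDeltaOm') (L' := LD) _ _ measurable_Om' (laplace_Om' S)).
- by move=> s' h; rewrite /cDeltaOm' cpow_real.
- by move=> s' h; rewrite /cDeltaOm cpow_real.
Qed.

(** So large that both it and its sum with [s] lie in the range of convergence of the Laplace
    transform. *)
Definition bigexp (mm : 'I_r -> nat) (s : 'rV[R]_r) : 'rV[R]_r :=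
  const_mx (\sum_j ((mm j)%:R + `|s ord0 j|) + 1).

Lemma bigexpP mm s j : (mm j)%:R / 2 < bigexp mm s ord0 j /\
  (mm j)%:R / 2 < (s + bigexp mm s) ord0 j.
Proof.
have H : (mm j)%:R + `|s ord0 j| <= \sum_j ((mm j)%:R + `|s ord0 j|).
  by rewrite (bigD1 j)//= lerDl sumr_ge0// => i _; rewrite addr_ge0.
have h1 : (0 : R) <= (mm j)%:R by [].
have h2 := normr_ge0 (s ord0 j).
have : - `|s ord0 j| <= s ord0 j by rewrite lerNl (le_trans (ler_norm _))// normrN.
rewrite /bigexp !mxE; move: H h1 h2.
set a := \sum_j _; set b := (mm j)%:R; set c := `|s ord0 j|; set d := s ord0 j.
clearbody a b c d => h1 h2 h3 h4.
by split; lra.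
Qed.

Lemma pairing_measurable l : measurable_fun setT (pairing l : V -> measurableTypeR R).
Proof.
apply: measurable_sum => i; apply: measurable_funM => //.
exact: measurable_coord.
Qed.

(** Integrability of the Laplace integrand contains its measurability, hence that of the logarithm
    of Delta^s for large [s]; every exponent is a difference of two large ones. *)
Lemma real_laplace_measurable (A : set V) l (L : V -> 'rV[R]_r -> R) mm : measurable A ->
  (forall h s s', L h (s + s') = L h s + L h s') ->
  (forall s, (forall j, (mm j)%:R / 2 < s ord0 j) ->
    measurable_fun A (fun h => (expR (L h s - pairing l h))%:E)) ->
  forall s, measurable_fun A (L^~ s : V -> measurableTypeR R).
Proof.
move=> mA LDD H s.
have H' s' : (forall j, (mm j)%:R / 2 < s' ord0 j) ->
    measurable_fun A (L^~ s' : V -> measurableTypeR R).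
  move=> /H/measurable_EFinP mf.
  have -> : L^~ s' = (fun h => ln (expR (L h s' - pairing l h)) + pairing l h).
    by apply/funext => h; rewrite expRK subrK.
  apply: measurable_funD; first exact: (measurableT_comp (@measurable_ln R) mf).
  by apply: measurable_funS (pairing_measurable l).
have -> : L^~ s = (fun h => L h (s + bigexp mm s) - L h (bigexp mm s)).
  by apply/funext => h; rewrite LDD addrK.
by apply: measurable_funB; apply: H' => j; have [] := bigexpP mm s j.
Qed.

Lemma LD_measurable s : measurable_fun Om (LD^~ s : V -> measurableTypeR R).
Proof.
apply: (@real_laplace_measurable _ (eOm' S) _ (mvec S) measurable_Om).
  by move=> h s1 s2; exact: lnDeltaD.
move=> s1 hs1; have [c hc] := laplace_Om_real hs1.
by have [/measurable_int] := hc _ (@eOm'_in _ _ _ S).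
Qed.

Lemma LD'_measurable s : measurable_fun (Om' S) (lnDeltaOm'^~ s : V -> measurableTypeR R).
Proof.
apply: (@real_laplace_measurable _ e _ (mvec' S) measurable_Om').
  by move=> h s1 s2; exact: lnDeltaD.
move=> s1 hs1; have [c hc] := laplace_Om'_real hs1.
by have [/measurable_int] := hc _ (eOmP S).
Qed.

Lemma nu_density A : measurable A -> A `<=` Om ->
  nu A = (\int[lam]_(h in A) (expR (LD h (dvec S)))%:E)%E.
Proof.
move=> mA AO; rewrite nuOmE// (_ : A `&` Om = A); last by apply/setIidPl.
by apply: eq_integral => h; rewrite inE => /AO Oh; rewrite DeltaOmE.
Qed.

Lemma measurable_expR_LD A s : A `<=` Om -> measurable A ->
  measurable_fun A ((fun h => expR (LD h s)) : V -> measurableTypeR R).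
Proof.
move=> AO mA; apply: (measurableT_comp (@measurable_expR R)).
by apply: measurable_funS (LD_measurable s) => //; exact: measurable_Om.
Qed.

Lemma nu_open_gt0 (U : set V) h : open U -> U `<=` Om -> U h -> (0 < nu U)%E.
Proof.
move=> oU UO Uh; have mU := open_measurable_cV oU.
rewrite (nu_density mU UO); apply: (integral_pos mU).
- exact: (measurable_expR_LD _ UO mU).
- by move=> k _; exact: expR_gt0.
- exact: lebesgue_cV_open_gt0 oU Uh.
Qed.

Lemma orbit'P l : Om' S l -> T (orbit_elt' S l).
Proof.
move=> Ol; have [_ /(_ (eOm' S) l (@eOm'_in _ _ _ S) Ol)[t [[Tt te] _]]] := Tplus_Om' S.
exact: (@xgetPex _ 1%:M [set t | T t /\ t^T *m eOm' S = l] (ex_intro _ t (conj Tt te))).1.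
Qed.

Lemma nu'_gt0 : (0 < nuOm' S (Om' S))%E.
Proof.
rewrite nuOm'E ?setIid//; last exact: measurable_Om'.
rewrite (eq_integral (fun l => (expR (lnDeltaOm' l (dvec S)))%:E)); last first.
  by move=> l; rewrite inE => /orbit'P Tl; rewrite /DeltaOm' rpow_Delta.
apply: integral_pos => [|||]; first exact: measurable_Om'.
- exact: (measurableT_comp (@measurable_expR R) (LD'_measurable _)).
- by move=> k _; exact: expR_gt0.
- exact: lebesgue_cV_open_gt0 (Om'_open (K := S)) (@eOm'_in _ _ _ S).
Qed.

Lemma pairingC l h : pairing l h = pairing h l :> R.
Proof. by apply: eq_bigr => i _; rewrite mulrC. Qed.

(** Delta^{-s} is a positive multiple of the Laplace transform of a measure on the dual cone, hence
    decreases along the cone. *)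
Lemma LD_mono_big s h k : (forall j, (mvec' S j)%:R / 2 < s ord0 j) ->
  Om k -> Cb (h - k) -> LD k s <= LD h s.
Proof.
move=> hs Ok hk; have Oh : Om h by rewrite -[h](subrK k) addrC; exact: OmDclosure.
have [c hc] := laplace_Om'_real hs.
have mI x : Om x -> measurable_fun (Om' S) (fun l => (expR (lnDeltaOm' l s - pairing x l))%:E).
  by move=> /hc[/measurable_int].
have c0 : 0 < c.
  have [_ E] := hc _ Oh.
  have : (0 < (c * expR (LD h (- s)))%:E)%E.
    rewrite -E; apply: integral_pos => [|||]; first exact: measurable_Om'.
    - by apply/measurable_EFinP; exact: mI.
    - by move=> l _; exact: expR_gt0.
    - exact: nu'_gt0.
  by rewrite lte_fin pmulr_lgt0// expR_gt0.
have [_ Eh] := hc _ Oh; have [_ Ek] := hc _ Ok.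
have : ((c * expR (LD h (- s)))%:E <= (c * expR (LD k (- s)))%:E)%E.
  rewrite -Eh -Ek; apply: ge0_le_integral.
  - exact: measurable_Om'.
  - by move=> l _; rewrite lee_fin expR_ge0.
  - exact: mI.
  - exact: mI.
  - move=> l Ol; rewrite lee_fin ler_expR lerD2l lerN2 pairingC [leRHS]pairingC.
    by rewrite -subr_ge0 -pairingBr; exact: Om'_ge0 Ol hk.
by rewrite lee_fin ler_pM2l// ler_expR /lnDeltaOm !lnDeltaN lerN2.
Qed.

(** Passage to all nonnegative exponents: s1 + N s is large for every N, and the inequality for it,
    divided by N, gives the one for [s] in the limit. *)
Lemma LD_mono s h k : (forall j, 0 <= s ord0 j) ->
  Om k -> Cb (h - k) -> LD k s <= LD h s.
Proof.
move=> s0 Ok hk; rewrite leNgt; apply/negP => lt.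
pose s1 := bigexp (mvec' S) 0.
have hN (N : nat) : LD k s1 + N%:R * LD k s <= LD h s1 + N%:R * LD h s.
  have := @LD_mono_big (s1 + N%:R *: s) h k _ Ok hk.
  rewrite /lnDeltaOm !lnDeltaD !lnDeltaZ; apply => j; rewrite mxE.
  have [h1 _] := bigexpP (mvec' S) 0 j; rewrite (lt_le_trans h1)// lerDl mxE mulr_ge0//.
have d0 : 0 < LD k s - LD h s by rewrite subr_gt0.
pose q := `|LD h s1 - LD k s1| / (LD k s - LD h s).
have q0 : 0 <= q by rewrite divr_ge0// ltW.
have := archi_boundP q0; rewrite ltr_pdivrMr// => H.
have := hN (Num.bound q); have := ler_norm (LD h s1 - LD k s1).
by move: H; rewrite mulrBr; lra.
Qed.

(** The order interval between h / 2 and h. Its measure for nu does not depend on [h], so it serves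
    as a ball for averages. *)
Definition shell h : set V := [set k | Om (k - 2^-1 *: h) /\ Om (h - k)].

Lemma shell_open h : open (shell h).
Proof.
rewrite openE => k [/(@Om_ball _ _ _ S)[d d0 hd] /(@Om_ball _ _ _ S)[d' d'0 hd']].
apply/nbhs_ballP; exists (Num.min d d') => /=; first by rewrite lt_min d0.
move=> k'; rewrite -ball_normE/= lt_min => /andP[h1 h2]; split; [apply: hd|apply: hd'].
  by rewrite opprB addrA subrK distrC.
by rewrite opprB addrC addrA subrK.
Qed.

Lemma half_Om h : Om h -> Om (2^-1 *: h).
Proof. by apply: OmZ; rewrite invr_gt0. Qed.

Lemma shell_Om h : Om h -> shell h `<=` Om.
Proof.
move=> Oh k [h1 _]; rewrite -[k](subrK (2^-1 *: h)); apply: OmD => //.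
exact: half_Om.
Qed.

Lemma shell_mem h : Om h -> shell h ((3 / 4) *: h).
Proof.
move=> Oh; split.
  by rewrite -scalerBl; apply: OmZ => //; lra.
rewrite -{1}[h]scale1r -scalerBl; apply: OmZ => //; lra.
Qed.

Lemma nu_shell h : Om h -> nu (shell h) = nu (shell e).
Proof.
move=> Oh; have [Tt te] := orbitP Oh; set t := orbit_elt S h in Tt te.
have mS : measurable (shell h) by apply: open_measurable_cV; exact: shell_open.
rewrite -(nuOm_invariant (linear_automorphism_T Tt) mS); congr (nu _).
apply/seteqP; split=> k /=; rewrite /shell/= -{1 2}te scalemxAr -!mulmxBr !TOmE//.
Qed.

Lemma nu_shell_gt0 : (0 < nu (shell e))%E.
Proof.
apply: nu_open_gt0 (shell_mem (eOmP S)); first exact: shell_open.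
exact: shell_Om (eOmP S).
Qed.

Lemma LD_half h s : Om h -> LD (2^-1 *: h) s = LD h s + LD (2^-1 *: e) s.
Proof.
move=> Oh; have [Tt te] := orbitP Oh; set t := orbit_elt S h in Tt te.
by rewrite -{1}te scalemxAr lnDeltaOmM//; exact: half_Om (eOmP S).
Qed.

(** On the shell Delta^s is at least its value at h / 2 and the exponential at least its value at h,
    so the integral dominates a value at a single point. *)
Lemma shell_integral l s h A : Om' S l -> (forall j, 0 <= s ord0 j) -> Om h -> measurable A ->
  shell h `<=` A -> A `<=` Om ->
  ((expR (LD h s + LD (2^-1 *: e) s - pairing l h))%:E * nu (shell e) <=
    \int[nu]_(k in A) (expR (LD k s - pairing l k))%:E)%E.
Proof.
move=> Ol s0 Oh mA hA AO; rewrite -(nu_shell Oh).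
have mS : measurable (shell h) by apply: open_measurable_cV; exact: shell_open.
have mf : measurable_fun A (fun k => (expR (LD k s - pairing l k))%:E).
  apply/measurable_EFinP; apply: (measurableT_comp (@measurable_expR R)).
  apply: measurable_funB; last exact: measurable_funS (pairing_measurable l).
  by apply: measurable_funS (LD_measurable s) => //; exact: measurable_Om.
apply: le_trans (ge0_subset_integral nu mS mA mf _ hA); last first.
  by move=> k _; rewrite lee_fin expR_ge0.
rewrite -integral_cst//; apply: ge0_le_integral => //.
- by move=> k _; rewrite lee_fin expR_ge0.
- exact: measurable_funS mf.
- move=> k [h1 h2]; have Ok : Om k by exact: (shell_Om Oh).
  rewrite lee_fin ler_expR lerB//.
    by rewrite -LD_half//; apply: LD_mono => //; [exact: half_Om|exact: OmW].
  by rewrite -subr_ge0 -pairingBr; apply: Om'_ge0 Ol _; exact: OmW.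
Qed.

Lemma Om'Z l (a : R) : 0 < a -> Om' S l -> Om' S (a *: l).
Proof. by move=> a0 Ol h Ch h0; rewrite pairingZl mulr_gt0//; exact: Ol. Qed.

Lemma integrable_LD l s : Om' S l -> (forall j, (mvec S j)%:R / 2 < s ord0 j) ->
  nu.-integrable Om (fun h => (expR (LD h s - pairing l h))%:E).
Proof. by move=> Ol /laplace_Om_real[c /(_ _ Ol)[]]. Qed.

Lemma nu_shell_fin : (nu (shell e) < +oo)%E.
Proof.
have hs j : (mvec S j)%:R / 2 < bigexp (mvec S) 0 ord0 j by have [] := bigexpP (mvec S) 0 j.
have s0 j : 0 <= bigexp (mvec S) 0 ord0 j by rewrite (le_trans _ (ltW (hs j)))// divr_ge0.
have I := integrable_LD (@eOm'_in _ _ _ S) hs.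
have F := integrable_fin_num measurable_Om I.
have := shell_integral (@eOm'_in _ _ _ S) s0 (eOmP S) measurable_Om (shell_Om (eOmP S)) (@subset_refl _ Om).
rewrite -(fineK F); case: (nu (shell e)) => [x||]//; first by rewrite ltry.
by rewrite mulry gtr0_sg ?expR_gt0// mul1e.
Qed.

(** A finite integral bounds the integrand pointwise, by averaging over shells of constant positive
    measure. *)
Lemma LD_upper_big l s : Om' S l -> (forall j, (mvec S j)%:R / 2 < s ord0 j) ->
  exists B : R, forall h, Om h -> LD h s - pairing l h <= B.
Proof.
move=> Ol hs; have s0 j : 0 <= s ord0 j by rewrite (le_trans _ (ltW (hs j)))// divr_ge0.
have I := integrable_LD Ol hs; have F := integrable_fin_num measurable_Om I.
have v0 := nu_shell_gt0; have vf := nu_shell_fin.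
have vE : nu (shell e) = (fine (nu (shell e)))%:E by rewrite fineK// ge0_fin_numE.
pose v := fine (nu (shell e)); have vp : 0 < v by rewrite -lte_fin -vE.
pose J' := fine (\int[nu]_(k in Om) (expR (LD k s - pairing l k))%:E).
exists (J' / v - 1 - LD (2^-1 *: e) s) => h Oh.
have := shell_integral Ol s0 Oh measurable_Om (shell_Om Oh) (@subset_refl _ Om).
rewrite -(fineK F) vE -EFinM lee_fin -ler_pdivlMr// => H.
have := le_trans (expR_ge1Dx _) H; rewrite /J' /v; lra.
Qed.

(** Translation by e reduces nonnegative exponents to large ones: the added power satisfies
    Delta^{s1}(h + e) >= 1. *)
Lemma LD_upper l s : Om' S l -> (forall j, 0 <= s ord0 j) ->
  exists B : R, forall h, Om h -> LD h s - pairing l h <= B.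
Proof.
move=> Ol s0; pose s1 := bigexp (mvec S) s.
have [|B hB] := @LD_upper_big l (s + s1) Ol.
  by move=> j; have [] := bigexpP (mvec S) s j.
exists (B + pairing l e) => h Oh.
have Ohe : Om (h + e) by apply: OmD => //; exact: eOmP.
have h1 : LD h s <= LD (h + e) s.
  by apply: (LD_mono s0 Oh); rewrite [h + e]addrC addrK; exact/OmW/eOmP.
have h2 : 0 <= LD (h + e) s1.
  rewrite -(lnDeltaOm_e S s1); apply: LD_mono; last by rewrite addrK; exact: OmW.
  - move=> j; have [hb _] := bigexpP (mvec S) s j; rewrite (le_trans _ (ltW hb))// divr_ge0//.
  - exact: eOmP.
have := hB _ Ohe; rewrite {1}/lnDeltaOm lnDeltaD pairingDr -!/(LD _ _); lra.
Qed.

(** By dominated convergence the Laplace integral over points that do not dominate a e tends to 0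
    with a. That region contains the shell of each of its points, so the integrand is small on
    it. *)
Lemma LD_decay_big l s del : Om' S l -> (forall j, (mvec S j)%:R / 2 < s ord0 j) ->
  exists2 a : R, 0 < a & forall h, Om h -> del <= LD h s - pairing l h -> Cb (h - a *: e).
Proof.
move=> Ol hs; have s0 j : 0 <= s ord0 j by rewrite (le_trans _ (ltW (hs j)))// divr_ge0.
pose A (k : nat) := [set h | Om h /\ ~ Cb (h - k.+1%:R^-1 *: e)].
pose f h := (expR (LD h s - pairing l h))%:E.
have I : nu.-integrable Om f := integrable_LD Ol hs.
have mA (k : nat) : measurable (A k).
  apply: measurableI; first exact: measurable_Om.
  apply: open_measurable_cV; apply: closed_openC.
  apply: (@closed_comp _ _ (fun h : V => h - k.+1%:R^-1 *: e) Cb); last exact: closed_closure.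
  move=> h _ U /nbhs_ballP[d /= d0 dU]; apply/nbhs_ballP; exists d => // h'.
  rewrite -ball_normE/= => hh; apply: dU; rewrite -ball_normE/=.
  by rewrite opprB addrA subrK.
have mf := measurable_int nu I.
pose F (k : nat) h := (f h * (\1_(A k) h)%:E)%E.
have := @dominated_cvg _ _ _ nu Om measurable_Om F (cst 0%E) f.
have -> : (\int[nu]_(h in Om) cst 0%E h)%E = 0%E by rewrite integral0.
have FE (k : nat) : (\int[nu]_(h in Om) F k h = \int[nu]_(h in A k) f h)%E.
  rewrite (_ : A k = Om `&` A k); last by rewrite (setIidr (_ : A k `<=` Om))// => h [].
  rewrite integral_mkcondr; apply: eq_integral => h _.
  by rewrite /F patchE indicE; case: (h \in A k); rewrite ?mule1 ?mule0.
under eq_fun do rewrite FE.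
move=> H; have {H}cv : (\int[nu]_(h in A k) f h)%E @[k --> \oo] --> 0%E.
  apply: H => //.
  - move=> k; apply: emeasurable_funM => //.
    by apply/measurable_EFinP; exact: measurable_indic.
  - move=> h Oh; have [a a0 ha] := Om_lower Oh.
    apply: cvg_near_cst; near=> k; rewrite /F indicE memNset ?mule0// => -[_]; apply.
    have -> : h - k.+1%:R^-1 *: e = (h - a *: e) + (a - k.+1%:R^-1) *: e.
      by rewrite scalerBl addrA subrK.
    apply: CbD; first exact: OmW.
    apply: CbZ; last exact/OmW/eOmP.
    by rewrite subr_ge0; apply: ltW; near: k; exact: (near_infty_natSinv_lt (PosNum a0)).
  - move=> k h Oh; rewrite /F gee0_abs ?mule_ge0 ?lee_fin ?expR_ge0//.
    by rewrite indicE; case: (_ \in _); rewrite ?mulr1 ?mulr0 ?expR_ge0.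
have [v vE] : exists v : R, nu (shell e) = v%:E.
  by exists (fine (nu (shell e))); rewrite fineK// ge0_fin_numE// nu_shell_fin.
pose c := expR (del + LD (2^-1 *: e) s) * v.
have cE : ((expR (del + LD (2^-1 *: e) s))%:E * nu (shell e) = c%:E)%E.
  by rewrite vE -EFinM.
have c0 : 0 < c.
  by rewrite -lte_fin -cE mule_gt0 ?lte_fin ?expR_gt0// nu_shell_gt0.
have [k hk] : exists k : nat, (\int[nu]_(h in A k) f h < c%:E)%E.
  have : \forall k \near \oo, (\int[nu]_(h in A k) f h < c%:E)%E.
    apply: (cv [set y | (y < c%:E)%E]).
    change (nbhs (0 : R) (fun x : R => (x%:E < c%:E)%E)).
    apply/nbhs_ballP; exists c => // x; rewrite -ball_normE/= sub0r normrN lte_fin.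
    by apply: le_lt_trans; exact: ler_norm.
  by move=> [k _ hk]; exists k; apply: hk => /=.
exists k.+1%:R^-1; first by rewrite invr_gt0.
move=> h Oh hdel; apply: contrapT => nC.
move: hk; apply/negP; rewrite -leNgt -cE.
have sA : shell h `<=` A k.
  move=> k' hk'; split; first exact: shell_Om hk'.
  move=> Ck'; apply: nC; have [_ h2] := hk'.
  have -> : h - k.+1%:R^-1 *: e = (h - k') + (k' - k.+1%:R^-1 *: e) by rewrite addrA subrK.
  by apply: CbD => //; exact: OmW.
apply: le_trans (shell_integral Ol s0 Oh (mA k) sA _); last by move=> ? [].
by rewrite lee_wpmul2r// lee_fin ler_expR; lra.
Unshelve. all: by end_near.
Qed.

(** Multiplying [s], [l] and [del] by a large N brings the exponent into the Laplace range. For the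
    norm, half of [l] bounds the power of Delta and the other half, being coercive, bounds [h]. *)
Lemma LD_decay l s del : Om' S l -> (forall j, 0 < s ord0 j) ->
  exists2 a : R, 0 < a & forall h, Om h -> del <= LD h s - pairing l h ->
    Cb (h - a *: e) /\ `|h| <= a^-1.
Proof.
move=> Ol s0.
have [N hN] : exists N : nat, (0 < N)%N /\ forall j, (mvec S j)%:R / 2 < N%:R * s ord0 j.
  pose q := \sum_j (mvec S j)%:R / s ord0 j.
  have q0 : 0 <= q by apply: sumr_ge0 => j _; rewrite divr_ge0// ltW.
  exists (Num.bound q).+1; split => // j.
  have : (mvec S j)%:R / s ord0 j <= q.
    by rewrite /q (bigD1 j)//= lerDl sumr_ge0// => i _; rewrite divr_ge0// ltW.
  have := archi_boundP q0; rewrite -ltr_pdivrMr// => h1 h2.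
  have : (mvec S j)%:R / 2 / s ord0 j <= (mvec S j)%:R / s ord0 j.
    by rewrite ler_pM2r ?invr_gt0// ler_pdivrMr// ler_peMr// ler1n.
  have : (Num.bound q).+1%:R = (Num.bound q)%:R + 1 :> R by rewrite -natr1.
  lra.
have [N0 hN'] := hN; have N0' : (0 : R) < N%:R by rewrite ltr0n.
have [|a a0 ha] := @LD_decay_big (N%:R *: l) (N%:R *: s) (N%:R * del) (Om'Z N0' Ol).
  by move=> j; rewrite mxE.
have Ol2 : Om' S (2^-1 *: l) by apply: Om'Z => //; rewrite invr_gt0.
have [B hB] := LD_upper Ol2 (fun j => ltW (s0 j)).
have [c c0 hc] := Om'_coercive Ol2.
pose M := `|B - del| / c + 1.
have M0 : 0 <= `|B - del| / c by rewrite divr_ge0// ltW.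
have M1 : 0 < M by rewrite ltr_wpDl.
exists (Num.min a M^-1) => [|h Oh hdel]; first by rewrite lt_min a0 invr_gt0.
have m0 : 0 < Num.min a M^-1 by rewrite lt_min a0 invr_gt0.
split.
  have h1 : Cb (h - a *: e).
    apply: ha => //; rewrite {1}/lnDeltaOm lnDeltaZ pairingZl -mulrBr.
    by rewrite ler_pM2l.
  have -> : h - Num.min a M^-1 *: e = (h - a *: e) + (a - Num.min a M^-1) *: e.
    by rewrite scalerBl addrA subrK.
  apply: CbD; first exact: h1.
  by apply: CbZ; [rewrite subr_ge0 ge_min lexx|exact/OmW/eOmP].
apply: (@le_trans _ _ M); last first.
  by rewrite -[X in X <= _]invrK lef_pV2 ?posrE ?invr_gt0// ge_min lexx orbT.
rewrite (@le_trans _ _ (`|B - del| / c))// ?lerDl// ler_pdivlMr// mulrC.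
rewrite (le_trans (hc _ (OmW Oh)))// (le_trans _ (ler_norm _))//.
by have := hB _ Oh; move: hdel; rewrite pairingZl; lra.
Qed.

(** The measure of a shell computed twice: by invariance of nu, and by its density with respect to
    Lebesgue measure, which the determinant rescales. *)
Lemma det_T t : T t -> `|\det t| = expR (- lnDelta S t (dvec S)).
Proof.
move=> Tt; have Ote := TOm Tt (eOmP S).
have mS : measurable (shell (t *m e)) by apply: open_measurable_cV; exact: shell_open.
have mSe : measurable (shell e) by apply: open_measurable_cV; exact: shell_open.
have E := nu_shell Ote; rewrite nu_density// in E; last exact: shell_Om.
pose D h := expR (LD h (dvec S)).
pose f h := ((D h) * \1_(shell (t *m e)) h)%:E.
have mf : measurable_fun setT f.
  apply/measurable_EFinP; rewrite (_ : (fun h => _) = (D \_ (shell (t *m e)))).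
    by apply/(measurable_restrictT _ mS); apply: measurable_expR_LD => //; exact: shell_Om.
  apply/funext => h; rewrite patchE indicE; case: ifP; by rewrite ?mulr1 ?mulr0.
have f0 h : (0 <= f h)%E by rewrite lee_fin mulr_ge0// expR_ge0.
have iD A (g : V -> R) : measurable A -> (\int[lam]_h (g h * \1_A h)%:E = \int[lam]_(h in A) (g h)%:E)%E.
  move=> mA'; rewrite [RHS]integral_mkcond; apply: eq_integral => h _.
  by rewrite patchE indicE; case: ifP; rewrite ?mulr1 ?mulr0.
have dt0 : \det t != 0 by rewrite -unitfE -unitmxE; exact: (T_unit Tt).
have dp : 0 <= `|\det t|^-1 by rewrite invr_ge0.
have mt : measurable_fun setT (fun x : V => t *m x).
  by have := @measurable_affine_cV R m t 0; under eq_fun do rewrite addr0.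
have H := @ge0_integral_scaled _ V R lam _ (NngNum dp) f mt _ mf f0.
have {}H : (\int[lam]_h f (t *m h) = `|\det t|^-1%:E * \int[lam]_h f h)%E.
  by apply: H => B mB; exact: (lebesgue_cV_linear (T_unit Tt) mB).
have Ef : (\int[lam]_h f h = nu (shell e))%E by rewrite iD.
move: H; rewrite Ef.
have -> : (\int[lam]_h f (t *m h) = \int[lam]_h (expR (lnDelta S t (dvec S)) * (D h * \1_(shell e) h))%:E)%E.
  apply: eq_integral => h _; rewrite /f !indicE.
  have -> : (t *m h \in shell (t *m e)) = (h \in shell e).
    apply/idP/idP; rewrite !inE /shell/= scalemxAr -!mulmxBr !TOmE//.
  case: (boolP (h \in shell e)); last by rewrite !mulr0.
  rewrite inE !mulr1 => /(shell_Om (eOmP S)) Oh; congr EFin.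
  by rewrite /D lnDeltaOmM// expRD.
under eq_integral do rewrite EFinM.
rewrite ge0_integralZl_EFin//; last 2 first.
- by move=> h _; rewrite lee_fin mulr_ge0// expR_ge0.
- apply/measurable_EFinP; rewrite (_ : (fun h => _) = (D \_ (shell e))).
    apply/(measurable_restrictT _ mSe); apply: measurable_expR_LD => //.
    exact: shell_Om (eOmP S).
  apply/funext => h; rewrite patchE indicE; case: ifP; by rewrite ?mulr1 ?mulr0.
rewrite iD// -nu_density//; last exact: shell_Om (eOmP S).
have vE : nu (shell e) = (fine (nu (shell e)))%:E.
  by rewrite fineK// ge0_fin_numE// nu_shell_fin.
have v0 : 0 < fine (nu (shell e)) by rewrite -lte_fin -vE nu_shell_gt0.
rewrite vE -!EFinM => -[] /(mulIf (lt0r_neq0 v0)) H.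
by rewrite expRN H invrK.
Qed.

(** T_+ carries e to [h0], so the bound is uniform in [h0]; at e each unit exponent is monotone for
    the order of the cone. *)
Lemma LD_interval (a b : R) s : 0 < a -> 0 < b -> exists2 B : R, 0 < B &
  forall h0 h, Om h0 -> Cb (h - a *: h0) -> Cb (b *: h0 - h) -> `|LD h s - LD h0 s| <= B.
Proof.
move=> a0 b0; have Oa := OmZ a0 (eOmP S); have Ob := OmZ b0 (eOmP S).
pose u : 'I_r -> 'rV[R]_r := fun j => delta_mx ord0 j.
have u0 j i : 0 <= u j ord0 i by rewrite mxE; case: (_ && _).
have LDs h s' : LD h s' = \sum_j s' ord0 j * LD h (u j).
  apply: eq_bigr => j _; congr (_ * _).
  rewrite /lnDeltaOm /lnDelta (bigD1 j)//= mxE !eqxx mul1r big1 ?addr0// => i ij.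
  by rewrite mxE eqxx /= eq_sym (eq_sym j i) (negbTE ij) mul0r.
pose Bj j := `|LD (a *: e) (u j)| + `|LD (b *: e) (u j)|.
have Bp : 0 <= \sum_j `|s ord0 j| * Bj j by apply: sumr_ge0 => j _; rewrite mulr_ge0// addr_ge0.
exists (\sum_j `|s ord0 j| * Bj j + 1); first by rewrite ltr_wpDl.
move=> h0 h Oh0 h1 h2; have [Tt te] := orbitP Oh0; set t := orbit_elt S h0 in Tt te.
have hE : h = t *m (invmx t *m h) by rewrite mulKVmx// (T_unit Tt).
set k := invmx t *m h in hE.
have k1 : Cb (k - a *: e).
  have -> : k - a *: e = invmx t *m (h - a *: h0).
    by rewrite mulmxBr -scalemxAr -te mulKmx// (T_unit Tt).
  by apply: TCb => //; exact: TV.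
have k2 : Cb (b *: e - k).
  have -> : b *: e - k = invmx t *m (b *: h0 - h).
    by rewrite mulmxBr -scalemxAr -te mulKmx// (T_unit Tt).
  by apply: TCb => //; exact: TV.
have Ok : Om k by rewrite -[k](subrK (a *: e)) addrC; exact: OmDclosure.
have -> : LD h s - LD h0 s = LD k s.
  by rewrite {1}hE (lnDeltaOmM _ Tt Ok) [LD h0 s]/lnDeltaOm -/t addrAC subrr add0r.
rewrite LDs (le_trans (ler_norm_sum _ _ _))// (@le_trans _ _ (\sum_j `|s ord0 j| * Bj j)) ?lerDl//.
apply: ler_sum => j _; rewrite normrM ler_wpM2l//.
have l1 := LD_mono (u0 j) Oa k1; have l2 := LD_mono (u0 j) Ok k2.
rewrite /Bj ler_norml; have := ler_norm (LD (b *: e) (u j)).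
have := ler_norm (- LD (a *: e) (u j)); rewrite normrN.
have := normr_ge0 (LD (b *: e) (u j)); have := normr_ge0 (LD (a *: e) (u j)).
by move=> ? ? ? ?; apply/andP; split; lra.
Qed.

End real_laplace.

(** * Measurability from sublevel sets *)

Section measurability_criterion.
Context d (X : measurableType d) (R : realType).

Lemma measurable_fun_c_infty_le (D : set X) (f : X -> \bar R) : measurable D ->
  (forall a : \bar R, measurable (D `&` [set x | (f x <= a)%E])) -> measurable_fun D f.
Proof.
move=> mD H; apply: (measurability _ (ErealGenOInfty.measurableE R)) => // _ [_ [x ->] <-].
rewrite (_ : _ `&` _ = D `\` (D `&` [set y | (f y <= x%:E)%E])); first exact: measurableD.
apply/seteqP; split=> y [Dy /=]; rewrite in_itv/= andbT => h; split => //.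
  by move=> [_]; apply/negP; rewrite -ltNge.
by rewrite ltNge; apply/negP => hy; apply: h.
Qed.

End measurability_criterion.

(** * Quasi-norms of L^p for 0 < p <= oo *)

Section Lnorm_facts.
Context d (X : measurableType d) (R : realType) (mu : {measure set X -> \bar R}).
Implicit Types (f g : X -> \bar R) (p : \bar R).
Local Open Scope ereal_scope.

(* Monotonicity without measurability: the integral of a nonnegative function is
   a supremum over the simple functions below it. *)
Lemma le_integral_ge0 f g : (forall x, 0 <= f x) -> (forall x, f x <= g x) ->
  \int[mu]_x f x <= \int[mu]_x g x.
Proof.
move=> f0 fg; rewrite !ge0_integralTE//; last by move=> x; exact: le_trans (fg x).
by apply: ge_ereal_sup => _ [h hf <-]; apply: ereal_sup_ubound; exists h => // x; exact: le_trans (fg x).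
Qed.

Lemma le_poweR (x y : \bar R) (r : R) : (0 <= r)%R -> 0 <= x -> x <= y -> x `^ r <= y `^ r.
Proof.
move=> r0 x0 xy; apply: gt0_ler_poweR => //; rewrite in_itv/= leey andbT//.
exact: le_trans xy.
Qed.

Lemma Lnorm_le p f g : 0 < p -> (forall x, `|f x| <= `|g x|) ->
  Lnorm mu p f <= Lnorm mu p g.
Proof.
move=> p0 fg; rewrite unlock; case: p p0 => [p| |//] p0.
  rewrite lte_fin in p0; apply: le_poweR; first by rewrite invr_ge0 ltW.
    by apply: integral_ge0 => x _; exact: poweR_ge0.
  by apply: le_integral_ge0 => x; [exact: poweR_ge0|apply: le_poweR => //; exact: ltW].
case: ifP => // _; apply: le_ess_sup; apply: aeW => x; exact: fg.
Qed.

Lemma Lnorm_ge0' p f : 0 < p -> 0 <= Lnorm mu p f.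
Proof.
move=> p0; rewrite unlock; case: p p0 => [p| |//] p0; first exact: poweR_ge0.
case: ifPn => // mu0; apply: ess_sup_gee => //; apply: aeW => x; exact: abse_ge0.
Qed.

Lemma measurable_abse_poweR f (q : R) : measurable_fun setT f ->
  measurable_fun setT (fun x => `|f x| `^ q).
Proof.
move=> mf; apply: (measurableT_comp (measurable_poweR q)).
exact: measurableT_comp.
Qed.

Lemma LnormZ_ge0 p (k : R) f : 0 < p -> (0 <= k)%R -> measurable_fun setT f ->
  Lnorm mu p (fun x => k%:E * f x) = k%:E * Lnorm mu p f.
Proof.
move=> p0 k0 mf; rewrite unlock; case: p p0 => [p| |//] p0.
  rewrite lte_fin in p0.
  have E x : `|k%:E * f x| `^ p = (k `^ p)%:E * `|f x| `^ p.
    by rewrite abseM poweRM// gee0_abs// lee_fin.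
  under eq_integral do rewrite E.
  rewrite ge0_integralZl_EFin//; last 3 first.
  - by move=> x _; exact: poweR_ge0.
  - exact: measurable_abse_poweR.
  - exact: powR_ge0.
  rewrite poweRM; [|by rewrite lee_fin powR_ge0|by apply: integral_ge0 => x _; exact: poweR_ge0].
  by rewrite -poweR_EFin -poweRrM mulfV ?gt_eqF// poweRe1.
case: ifP => mu0; last by rewrite mule0.
have -> : abse \o (fun x => k%:E * f x) = cst k%:E \* (abse \o f).
  by apply/funext => x /=; rewrite abseM gee0_abs// lee_fin.
by rewrite ess_supZl.
Qed.

(** For finite p a change of variable. For p = oo the factor is 1, since [phi] pulls null sets back
    to null sets. *)
Lemma Lnorm_scaled p (phi : X -> X) (c : R) f : 0 < p -> (0 <= c)%R ->
  measurable_fun setT phi -> (forall A, measurable A -> mu (phi @^-1` A) = c%:E * mu A) ->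
  measurable_fun setT f ->
  Lnorm mu p (fun x => f (phi x)) <= (c `^ fine p^-1)%:E * Lnorm mu p f.
Proof.
move=> p0 c0 mphi hphi mf; rewrite unlock; case: p p0 => [p| |//] p0.
  rewrite lte_fin in p0.
  have mg : measurable_fun setT (fun x => `|f x| `^ p).
    exact: measurable_abse_poweR.
  have g0 x : 0 <= `|f x| `^ p by exact: poweR_ge0.
  rewrite (@ge0_integral_scaled _ _ _ mu phi (NngNum c0) _ mphi hphi mg g0)/=.
  by rewrite poweRM ?lee_fin ?integral_ge0// inver gt_eqF.
rewrite invey/= powRr0 mul1e; case: ifP => // _.
apply/ess_supP; have [N [mN N0 hN]] := ess_sup_ge mu (abse \o f).
exists (phi @^-1` N); split.
- by rewrite -[X in measurable X]setTI; exact: mphi.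
- by rewrite hphi// N0 mule0.
- by move=> x hx; apply: hN.
Qed.

Lemma Lnorm_fin_bound p f : 0 < p ->
  match p with
  | r%:E => is_true (\int[mu]_x `|f x| `^ r < +oo)
  | _ => exists B : R, forall x, `|f x| <= B%:E
  end -> Lnorm mu p f < +oo.
Proof.
move=> p0 H; rewrite unlock; case: p p0 H => [p| |//] p0; first exact: poweR_lty.
move=> [B hB]; case: ifP => // _.
apply: (@le_lt_trans _ _ B%:E); last exact: ltry.
by apply/ess_supP; apply: aeW => x; exact: hB.
Qed.

End Lnorm_facts.

(** * Slices of a function and their measurability *)

Section slices.
Context {R : realType} {n m r : nat} (S : siegel_domain R n m r).
Local Notation C := R[i].
Local Notation nc := (@Normc.normc R).
Local Notation point := ('cV[C]_n * 'cV[C]_m)%type.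
Local Notation Nt := ('cV[R]_n * 'cV[R]_n * 'cV[R]_m)%type.
Local Notation Om := (Om S).
Local Notation e := (eOm S).
Local Notation T := (Tplus S).
Local Notation Phi := (Phi S).
Local Notation LD := (lnDeltaOm S).
Local Notation nu := (nuOm S).

(** Coordinates of the domain in N x Omega, in which [rho] is the second projection. *)
Definition slice_pt (x : Nt * 'cV[R]_m) : point :=
  (cplx x.1.1.1 x.1.1.2,
   cplx x.1.2 (re_mx (Phi (cplx x.1.1.1 x.1.1.2) (cplx x.1.1.1 x.1.1.2)) + x.2)).

Lemma re_cplx' k l (a b : 'M[R]_(k, l)) : re_mx (cplx a b) = a.
Proof. by apply/matrixP => i j; rewrite !mxE. Qed.

Lemma im_cplx' k l (a b : 'M[R]_(k, l)) : im_mx (cplx a b) = b.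
Proof. by apply/matrixP => i j; rewrite !mxE. Qed.

Lemma slice_pt_rho x : rho S (slice_pt x) = x.2.
Proof. by rewrite /rho /= im_cplx' addrAC subrr add0r. Qed.

Definition slice_coord (w : point) : Nt * 'cV[R]_m :=
  ((re_mx w.1, im_mx w.1, re_mx w.2), rho S w).

Lemma slice_coordK w : slice_pt (slice_coord w) = w.
Proof.
case: w => a b; rewrite /slice_pt /slice_coord /rho /= cplx_reim.
by rewrite [_ + (_ - _)]addrCA subrr addr0 cplx_reim.
Qed.

Lemma slice_pt_cont x d : 0 < d -> exists2 d', 0 < d' & forall y, ball x d' y ->
  rnorm (slice_pt y - slice_pt x) < d.
Proof.
move=> d0; have [M M0 hM] := Phi_bound S.
pose z := cplx x.1.1.1 x.1.1.2.
pose K := 4 + M * (2 * rnorm z + 2) * 2.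
have K0 : 0 < K by rewrite ltr_wpDr// ?mulr_ge0 ?addr_ge0 ?mulr_ge0 ?rnorm_ge0// ltW.
exists (Num.min 1 (d / K)); first by rewrite lt_min ltr01 divr_gt0.
move=> y [[[]]]; rewrite -!ball_normE/= => h1 h2 h3 h4.
set d1 := Num.min 1 (d / K) in h1 h2 h3 h4; have d1_1 : d1 <= 1 by rewrite ge_min lexx.
have d1K : d1 * K <= d by rewrite -ler_pdivlMr// ge_min lexx orbT.
pose w := cplx y.1.1.1 y.1.1.2.
have cB k (a b a' b' : 'cV[R]_k) : rnorm (cplx a b - cplx a' b') <= `|a - a'| + `|b - b'|.
  apply: le_trans (rnorm_le_reim _) _.
  by rewrite re_mxB im_mxB !re_cplx' !im_cplx'.
have wz : rnorm (w - z) < 2 * d1.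
  by apply: le_lt_trans (cB _ _ _ _ _) _; rewrite [`|y.1.1.1 - _|]distrC [`|y.1.1.2 - _|]distrC; lra.
have PB : `|re_mx (Phi w w) - re_mx (Phi z z)| <= M * (2 * rnorm z + 2) * (2 * d1).
  rewrite -re_mxB (le_trans (re_mx_le _))//.
  have -> : Phi w w - Phi z z = Phi (w - z) w + Phi z (w - z) by rewrite PhiB PhiBr addrA subrK.
  rewrite (le_trans (rnormD _ _))//.
  have wn : rnorm w <= rnorm z + 2.
    rewrite -[w](subrK z) (le_trans (rnormD _ _))//; have := rnorm_ge0 z; lra.
  have a1 := hM (w - z) w; have a2 := hM z (w - z).
  have m1 : M * rnorm (w - z) * rnorm w <= M * (2 * d1) * (rnorm z + 2).
    apply: ler_pM; rewrite ?rnorm_ge0// ?mulr_ge0 ?rnorm_ge0 ?(ltW M0)//.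
    by rewrite ler_wpM2l ?(ltW M0)// ltW.
  have m2 : M * rnorm z * rnorm (w - z) <= M * rnorm z * (2 * d1).
    by apply: ler_wpM2l; [rewrite mulr_ge0 ?rnorm_ge0 ?(ltW M0)|exact: ltW].
  have -> : M * (2 * rnorm z + 2) * (2 * d1) = M * (2 * d1) * (rnorm z + 2) + M * rnorm z * (2 * d1) by ring.
  lra.
have d1p : 0 <= d1 by rewrite (le_trans _ (ltW h1)).
have half : rnorm (slice_pt y - slice_pt x) <= M * (2 * rnorm z + 2) * (2 * d1) + (`|y.1.2 - x.1.2| + `|y.2 - x.2|) + 2 * d1.
  have P0 : 0 <= M * (2 * rnorm z + 2) * (2 * d1).
    by rewrite (le_trans _ PB).
  have n1 := normr_ge0 (y.1.2 - x.1.2); have n2 := normr_ge0 (y.2 - x.2).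
  apply: rnorm_pair_le => /=.
    by rewrite (le_trans (ltW wz))//; lra.
  apply: le_trans (cB _ _ _ _ _) _; rewrite -/w -/z opprD addrACA.
  have := ler_normD (re_mx (Phi w w) - re_mx (Phi z z)) (y.2 - x.2); lra.
apply: le_lt_trans half _; rewrite [`|y.1.2 - _|]distrC [`|y.2 - _|]distrC.
have : M * (2 * rnorm z + 2) * (2 * d1) = d1 * (M * (2 * rnorm z + 2) * 2) by ring.
move: d1K; rewrite /K mulrDr; lra.
Qed.

Lemma measurable_slice_pt (U : set point) : open U -> measurable (slice_pt @^-1` U).
Proof.
move=> oU; apply: open_measurable_NV; rewrite openE => x Ux.
have /nbhs_rnormP[d d0 hd] := open_nbhs_nbhs (conj oU Ux).
have [d' d'0 hd'] := slice_pt_cont x d0.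
by apply/nbhs_ballP; exists d' => // y /hd'/hd.
Qed.

Lemma nc_continuous_in F : (forall w, domain S w -> {for w, continuous F}) ->
  {in domain S, continuous (fun w => nc (F w))}.
Proof.
move=> cF w; rewrite inE => /cF/rnorm_continuousC h.
apply: rnorm_continuous => d /h[d' d'0 hd']; exists d' => // y /hd' yd.
apply: le_lt_trans yd.
have := normc_triB (F y) 0 (F w); have := normc_triB (F w) 0 (F y).
rewrite !subr0 (normcB (F w)).
move: (nc (F y)) (nc (F w)) (nc (F y - F w)) => a b c h1 h2.
by rewrite ler_norml; apply/andP; split; lra.
Qed.

Lemma measurable_slice2 F : on_domain S F -> (forall w, domain S w -> {for w, continuous F}) ->
  measurable_fun setT ((fun x => nc (F (slice_pt x))) : _ -> measurableTypeR R).
Proof.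
move=> oF cF.
apply: (@measurable_open_support R _ _ _ slice_pt _ (domain S) measurable_slice_pt (@domain_open _ _ _ _ S)).
  by exists (fun w => nc (F w)) => //; exact: nc_continuous_in.
by move=> x Dx; rewrite oF// Normc.normc0.
Qed.

Lemma sliceE F h v : slice S F h v = F (slice_pt (v, h)). Proof. by []. Qed.

Lemma measurable_slice F h : on_domain S F -> (forall w, domain S w -> {for w, continuous F}) ->
  measurable_fun setT (fun v => (nc (slice S F h v))%:E).
Proof.
move=> oF cF; apply/measurable_EFinP.
exact: (measurableT_comp (measurable_slice2 oF cF) (@measurable_pair2 _ _ Nt 'cV[R]_m h)).
Qed.

Lemma measurable_on_domainP F : (forall w, domain S w -> {for w, continuous F}) ->
  measurable_on_domain S F.
Proof.
move=> cF.
have mD : measurable (@real_point R n m @^-1` domain S).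
  apply: open_measurable_P; rewrite openE => x Dx.
  have [d d0 hd] := domain_nbhs Dx; have [d' d'0 hd'] := real_point_cont x d0.
  by apply/nbhs_ballP; exists d' => // y /hd'/hd.
have H (f : point -> R) : {in domain S, continuous f} ->
    measurable_fun (real_point @^-1` domain S) ((fun v => f (real_point v)) : _ -> measurableTypeR R).
  move=> cf; pose g v := if pselect (domain S (real_point v)) then f (real_point v) else 0.
  have mg : measurable_fun setT (g : _ -> measurableTypeR R).
    apply: (@measurable_open_support R _ _ _ (@real_point R n m) _ (domain S) _ (@domain_open _ _ _ _ S)).
    - move=> V oV; apply: open_measurable_P; rewrite openE => x Vx.
      have /nbhs_rnormP[d d0 hd] := open_nbhs_nbhs (conj oV Vx).
      have [d' d'0 hd'] := real_point_cont x d0.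
      by apply/nbhs_ballP; exists d' => // y /hd'/hd.
    - by exists f => // x Dx; rewrite /g; case: pselect.
    - by move=> x Dx; rewrite /g; case: pselect.
  apply: (eq_measurable_fun g) => [v|]; last exact: measurable_funS mg.
  by rewrite inE => Dv; rewrite /g; case: pselect.
split.
  apply: (H (fun w => complex.Re (F w))) => w; rewrite inE => /cF/rnorm_continuousC h.
  apply: rnorm_continuous => d /h[d' d'0 hd']; exists d' => // y /hd'; apply: le_lt_trans.
  by have := absRe_le_normc (F y - F w); case: (F y) (F w) => ? ? [? ?].
apply: (H (fun w => complex.Im (F w))) => w; rewrite inE => /cF/rnorm_continuousC h.
apply: rnorm_continuous => d /h[d' d'0 hd']; exists d' => // y /hd'; apply: le_lt_trans.
by have := absIm_le_normc (F y - F w); case: (F y) (F w) => ? ? [? ?].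
Qed.

Lemma slice_out F h v : on_domain S F -> ~ Om h -> slice S F h v = 0.
Proof. by move=> oF Oh; apply: oF => /domainE; rewrite -/(slice_pt (v, h)) slice_pt_rho. Qed.

Lemma Lnorm0 d (X : measurableType d) (mu : {measure set X -> \bar R}) p : (0 < p)%E ->
  Lnorm mu p (fun=> 0%E) = 0%E.
Proof.
move=> p0; have -> : (fun=> 0%E) = (fun x : X => 0%:E * (fun=> 0%E) x)%E :> (X -> \bar R).
  by apply/funext => x; rewrite mul0e.
by rewrite LnormZ_ge0// mul0e.
Qed.

Lemma sliceN_out p F h : (0 < p)%E -> on_domain S F -> ~ Om h -> sliceN S p F h = 0%E.
Proof.
move=> p0 oF Oh; rewrite /sliceN (_ : (fun v => _) = fun=> 0%E); first exact: Lnorm0.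
by apply/funext => v; rewrite slice_out// Normc.normc0.
Qed.

Lemma haarN_open_gt0 (U : set Nt) x : open U -> U x -> (0 < haarN (R := R) (n := n) (m := m) U)%E.
Proof. exact: lebesgue_N_open_gt0. Qed.

Lemma haarNT_gt0 : (0 < haarN (R := R) (n := n) (m := m) setT)%E.
Proof. by apply: (@haarN_open_gt0 _ 0) => //; exact: openT. Qed.

(** For a function continuous on the domain the essential supremum over a slice is a supremum,
    because nonempty open subsets of N have positive measure. *)
Lemma sliceN_infty F h (a : \bar R) : (forall w, domain S w -> {for w, continuous F}) -> Om h ->
  (sliceN S +oo F h <= a)%E <-> forall v, ((nc (slice S F h v))%:E <= a)%E.
Proof.
move=> cF Oh; rewrite /sliceN unlock haarNT_gt0; split=> [/ess_supP[N [mN N0 hN]] v|H]; last first.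
  by apply/ess_supP; apply: aeW => v /=; rewrite ger0_norm ?normc_ge0.
rewrite leNgt; apply/negP => av.
case: a av hN => [a av hN| |av hN]; last first.
- suff : (0 < haarN (R := R) (n := n) (m := m) N)%E by rewrite N0 ltxx.
  rewrite (_ : N = setT) ?haarNT_gt0//; apply/seteqP; split => // x _; apply: hN => /=.
  by rewrite leeNy_eq.
- by rewrite ltNge leey.
have Dv : domain S (slice_pt (v, h)) by apply/domainE; rewrite slice_pt_rho.
have /rnorm_continuousC H := cF _ Dv.
rewrite lte_fin in av; have d0 : 0 < nc (slice S F h v) - a by rewrite subr_gt0.
have [d1 d10 h1] := H _ d0; have [d2 d20 h2] := slice_pt_cont (v, h) d10.
have sub : ball v d2 `<=` N.
  move=> y vy; apply: hN => /=; apply/negP; rewrite -ltNge lte_fin ger0_norm ?normc_ge0//.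
  have /h1 : rnorm (slice_pt (y, h) - slice_pt (v, h)) < d1.
    by apply: h2; split => //=; exact: ballxx.
  have := normc_triB (F (slice_pt (v, h))) 0 (F (slice_pt (y, h))).
  rewrite !subr0 (normcB (F (slice_pt (v, h)))) !sliceE; lra.
have oB : open (interior (ball v d2)) := open_interior _.
have : (0 < haarN (R := R) (n := n) (m := m) (interior (ball v d2)))%E.
  by apply: (@haarN_open_gt0 _ v) => //; exact: nbhsx_ballx.
rewrite ltNge => /negP; apply; rewrite -N0; apply: le_measure; rewrite ?inE//.
  exact: open_measurable_N.
by move=> y /interior_subset/sub.
Qed.

(** A supremum of continuous functions is lower semicontinuous, so the superlevel sets are open in
    the cone. *)
Lemma sliceN_infty_measurable F : (forall w, domain S w -> {for w, continuous F}) ->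
  measurable_fun Om (sliceN S +oo F).
Proof.
move=> cF; have mO : measurable (Defs.Om S) := measurable_Om S.
apply: (measurable_fun_c_infty_le mO) => a.
have -> : Defs.Om S `&` [set h | (sliceN S +oo F h <= a)%E] =
    Defs.Om S `\` [set h | Om h /\ exists v, (a < (nc (slice S F h v))%:E)%E].
  apply/seteqP; split=> h [Oh H]; split => //.
    by move=> [_ [v]]; apply/negP; rewrite -leNgt; apply: (sliceN_infty _ cF Oh).1.
  apply/(sliceN_infty _ cF Oh) => v; rewrite leNgt; apply/negP => hv; apply: H.
  by split => //; exists v.
apply: measurableD => //; apply: open_measurable_cV; rewrite openE => h [Oh [v av]].
have Dv : domain S (slice_pt (v, h)) by apply/domainE; rewrite slice_pt_rho.
have [b ab bF] : exists2 b : R, (a <= b%:E)%E & b < nc (slice S F h v).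
  case: a av => [a av| |]; first by exists a.
    by rewrite ltNge leey.
  by move=> _; exists (nc (slice S F h v) - 1); [exact: leNye|rewrite ltrBlDr ltrDl].
have /rnorm_continuousC H := cF _ Dv.
have d0 : 0 < nc (slice S F h v) - b by rewrite subr_gt0.
have [d1 d10 h1] := H _ d0; have [d2 d20 h2] := slice_pt_cont (v, h) d10.
have [d3 d30 h3] := @Om_ball _ _ _ S _ Oh.
apply/nbhs_ballP; exists (Num.min d2 d3) => /=; first by rewrite lt_min d20.
move=> k; rewrite -ball_normE/= lt_min => /andP[hk2 hk3].
split; first by apply: h3; rewrite distrC.
exists v; apply: (le_lt_trans ab); rewrite lte_fin.
have /h1 : rnorm (slice_pt (v, k) - slice_pt (v, h)) < d1.
  by apply: h2; split => //=; [exact: ballxx|rewrite -ball_normE].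
have := normc_triB (F (slice_pt (v, h))) 0 (F (slice_pt (v, k))).
by rewrite !subr0 (normcB (F (slice_pt (v, h)))) !sliceE; lra.
Qed.

Lemma weighted_slices_measurable p s F : (0 < p)%E -> on_domain S F ->
  (forall w, domain S w -> {for w, continuous F}) ->
  measurable_fun Om (weighted_slices S p s F).
Proof.
move=> p0 oF cF; apply: emeasurable_funM.
  apply/measurable_EFinP; apply: (eq_measurable_fun (fun h => expR (LD h s))).
    by move=> h; rewrite inE => Oh; rewrite DeltaOmE.
  by apply: (measurable_expR_LD s) => //; exact: measurable_Om.
case: p p0 => [p| |//] p0; last exact: sliceN_infty_measurable.
apply: measurable_funTS; rewrite /sliceN unlock.
apply: (measurableT_comp (measurable_poweR _)).
have := @measurable_fun_fubini_tonelli_G _ _ Nt 'cV[R]_m R (lebN n m)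
  (fun x => (nc (F (slice_pt x)) `^ p)%:E) _ _.
move=> H; apply: (eq_measurable_fun (fubini_G (lebN n m) (fun x => (nc (F (slice_pt x)) `^ p)%:E))).
  move=> h _; rewrite /fubini_G; apply: eq_integral => v _.
  by rewrite poweR_EFin ger0_norm ?normc_ge0.
apply: H => [|x]; last by rewrite lee_fin powR_ge0.
apply/measurable_EFinP; exact: (measurableT_comp (@measurable_powR R p) (measurable_slice2 oF cF)).
Qed.

End slices.

(** * Bounded linear maps *)

Section linear_maps.
Context {R : realType}.
Local Notation C := R[i].

Lemma bounded_linear_differentiable (V W : normedModType C) (f : V -> W) (B : R) x :
  linear f -> 0 < B -> (forall v, rnorm (f v) <= B * rnorm v) -> differentiable f x.
Proof.
move=> lf B0 hB.
pose L : {linear V -> W} := HB.pack f (GRing.isLinear.Build _ _ _ _ f lf).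
have LB v w : f v - f w = f (v - w).
  have := raddfB L v w; by [].
apply: (@linear_differentiable _ _ _ L) => y U /nbhs_rnormP[d d0 dU].
apply/nbhs_rnormP; exists (d / B) => [|z zy]; first by rewrite divr_gt0.
apply: dU; rewrite LB (le_lt_trans (hB _))// mulrC -ltr_pdivlMr//.
Qed.

End linear_maps.

(** * Affine automorphisms of the domain and their Jacobians *)

Section affine_maps.
Context {R : realType} {n m r : nat} (S : siegel_domain R n m r).
Local Notation C := R[i].
Local Notation nc := (@Normc.normc R).
Local Notation point := ('cV[C]_n * 'cV[C]_m)%type.
Local Notation Nt := ('cV[R]_n * 'cV[R]_n * 'cV[R]_m)%type.
Local Notation Om := (Om S).
Local Notation e := (eOm S).
Local Notation T := (Tplus S).
Local Notation Phi := (Phi S).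
Local Notation LD := (lnDeltaOm S).
Local Notation lnD := (lnDelta S).
Local Notation nu := (nuOm S).

Definition affl t (g : 'M[C]_n) z0 (w : point) : point :=
  (g *m w.1, cplx t 0 *m w.2 + (2 * 'i%C) *: Phi (g *m w.1) z0).

(** The map (zeta, z) -> (g zeta, t z) followed by the action of the element (z0, x0) of N; the
    terms in Phi are those for which this action preserves [rho]. *)
Definition aff t (g : 'M[C]_n) z0 (x0 : 'cV[R]_m) (w : point) : point :=
  affl t g z0 w + (z0, cplx x0 0 + 'i%C *: Phi z0 z0).

Definition base : point := (0, cplx 0 e).

Lemma rho_base : rho S base = e.
Proof. by rewrite /rho /base/= im_cplx' Phi0l; apply/matrixP => i j; rewrite !mxE subr0. Qed.

Lemma domain_base : domain S base.
Proof. by apply/domainE; rewrite rho_base; exact: eOmP. Qed.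

Lemma affl_linear t g z0 : linear (affl t g z0).
Proof.
move=> a u v; congr pair => /=; first by rewrite mulmxDr -scalemxAr.
by rewrite !mulmxDr -!scalemxAr PhiD PhiZ !scalerDr !scalerA addrACA [2 * 'i%C * a]mulrC.
Qed.

Lemma affl_bound t g z0 : exists2 B : R, 0 < B & forall w, rnorm (affl t g z0 w) <= B * rnorm w.
Proof.
have [B1 B10 h1] := rnorm_mulmx g; have [B2 B20 h2] := rnorm_mulmx (cplx t 0).
have [M M0 hM] := Phi_bound S.
pose K := nc (2 * 'i%C : C) * (M * B1 * rnorm z0).
have K0 : 0 <= K by rewrite !mulr_ge0 ?normc_ge0 ?rnorm_ge0// ltW.
exists (B1 + (B2 + K)) => [|w]; first by rewrite ltr_wpDr// addr_ge0// ltW.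
have w1 := rnorm_fst w; have w2 := rnorm_snd w; have w0 := rnorm_ge0 w.
have g1 : rnorm (g *m w.1) <= B1 * rnorm w by rewrite (le_trans (h1 _))// ler_wpM2l// ltW.
apply: rnorm_pair_le => /=.
  by rewrite (le_trans g1)// ler_wpM2r// lerDl addr_ge0// ltW.
rewrite (le_trans (rnormD _ _))// rnormZ [leRHS]mulrDl -[X in X <= _]add0r lerD//.
  by rewrite mulr_ge0// ltW.
rewrite [leRHS]mulrDl lerD//.
  by rewrite (le_trans (h2 _))// ler_wpM2l// ltW.
have h3 := hM (g *m w.1) z0.
have h4 : M * rnorm (g *m w.1) * rnorm z0 <= M * (B1 * rnorm w) * rnorm z0.
  by rewrite ler_wpM2r ?rnorm_ge0// ler_wpM2l// ltW.
have -> : K * rnorm w = nc (2 * 'i%C : C) * (M * (B1 * rnorm w) * rnorm z0) by rewrite /K; ring.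
by apply: ler_wpM2l; [exact: normc_ge0|exact: le_trans h3 h4].
Qed.

Lemma aff_differentiable t g z0 x0 w : differentiable (aff t g z0 x0) w.
Proof.
have [B B0 hB] := affl_bound t g z0.
have -> : aff t g z0 x0 = affl t g z0 + cst (z0, cplx x0 0 + 'i%C *: Phi z0 z0) by [].
apply: differentiableD; last exact: differentiable_cst.
exact: (bounded_linear_differentiable _ (affl_linear t g z0) B0 hB).
Qed.

Section intertwined.
Variables (t : 'M[R]_m) (g : 'M[C]_n) (z0 : 'cV[C]_n) (x0 : 'cV[R]_m).
Hypotheses (Tt : T t) (ug : g \in unitmx) (tg : intertwines Phi t g).

Lemma re_cplx_mul (x : 'cV[C]_m) : re_mx (cplx t 0 *m x) = t *m re_mx x.
Proof. by rewrite re_mulmx re_cplx' im_cplx' mul0mx subr0. Qed.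

Lemma im_cplx_mul (x : 'cV[C]_m) : im_mx (cplx t 0 *m x) = t *m im_mx x.
Proof. by rewrite im_mulmx re_cplx' im_cplx' mul0mx addr0. Qed.

Lemma im_i (x : 'cV[C]_m) : im_mx ('i%C *: x) = re_mx x.
Proof. by apply/matrixP => i j; rewrite !mxE; case: (x i j) => a b /=; rewrite mul0r mul1r add0r. Qed.

Lemma im_2i (x : 'cV[C]_m) : im_mx ((2 * 'i%C) *: x) = re_mx x + re_mx x.
Proof.
have -> : (2 * 'i%C) *: x = 'i%C *: x + 'i%C *: x by rewrite -scalerDl -mulr2n mulr_natl.
by rewrite im_mxD im_i.
Qed.

Lemma re_Phi_sym z w : re_mx (Phi z w) = re_mx (Phi w z).
Proof. by rewrite (Phi_hermitian S w z); apply/matrixP => i j; rewrite !mxE; case: (Phi w z i j). Qed.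

Lemma PhiDr z w w' : Phi z (w + w') = Phi z w + Phi z w'.
Proof.
rewrite (Phi_hermitian S (w + w') z) PhiD (Phi_hermitian S w z) (Phi_hermitian S w' z).
by apply/matrixP => i j; rewrite !mxE; exact: (rmorphD (@conjc R)).
Qed.

(** The cross terms of Phi(g zeta + z0) cancel against the twist 2 i Phi(g zeta, z0), and the
    intertwining relation turns the diagonal term into t Phi(zeta). *)
Lemma rho_aff w : rho S (aff t g z0 x0 w) = t *m rho S w.
Proof.
rewrite /rho /aff /affl/= !im_mxD im_cplx_mul im_2i im_i im_cplx' add0r.
rewrite PhiD !PhiDr.
rewrite !re_mxD (re_Phi_sym z0 (g *m w.1)) -tg re_cplx_mul mulmxBr.
by apply/matrixP => i j; rewrite !mxE; ring.
Qed.

Lemma domain_aff w : domain S (aff t g z0 x0 w) <-> domain S w.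
Proof. by rewrite !domainE rho_aff; exact: TOmE. Qed.

Lemma Hol_aff F : Hol S F -> Hol S (fun w => F (aff t g z0 x0 w)).
Proof.
move=> [oF hF]; split=> [w Dw|w Dw]; first by apply: oF => /domain_aff.
apply: differentiable_comp; first exact: aff_differentiable.
by apply: hF; apply/domain_aff.
Qed.

(** The action on the horizontal coordinates. It does not depend on the height, so slices are
    carried to slices. *)
Definition affN (v : Nt) : Nt :=
  let z := actE g v.1 in
  (z + (re_mx z0, im_mx z0),
   t *m v.2 + (x0 + re_mx ((2 * 'i%C) *: Phi (cplx z.1 z.2) z0 + 'i%C *: Phi z0 z0))).

Lemma aff_slice_pt v h : aff t g z0 x0 (slice_pt S (v, h)) = slice_pt S (affN v, t *m h).
Proof.
rewrite -[LHS](slice_coordK S); congr (slice_pt S _).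
rewrite /slice_coord rho_aff slice_pt_rho /affN /=; congr (_, _).
have zE : g *m cplx v.1.1 v.1.2 = cplx (actE g v.1).1 (actE g v.1).2 by rewrite cplx_actE.
rewrite !re_mxD !im_mxD zE re_cplx_mul !re_cplx' im_cplx'; congr (_, _).
by rewrite -!addrA; congr (_ + _); exact: addrCA.
Qed.

Lemma measurable_affN : measurable_fun setT affN.
Proof.
apply: measurable_fun_pair.
  exact: (measurableT_comp (measurable_translateE _) (measurableT_comp (measurable_actE g) measurable_fst)).
apply: measurable_cVP => i; under eq_fun do rewrite !mxE.
apply: measurable_funD.
  apply: measurable_sum => j; apply: measurable_funM; first exact: measurable_cst.
  exact: (measurableT_comp (measurable_coord j) measurable_snd).
apply: measurable_funD; first exact: measurable_cst.
pose f (v : Nt) := complex.Re (((2 * 'i%C) *: Phi (g *m cplx v.1.1 v.1.2) z0 + 'i%C *: Phi z0 z0) i ord0).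
rewrite (_ : (fun v => _) = f); last first.
  by apply/funext => v; rewrite /f -cplx_actE !mxE.
apply: (measurableT_comp (f := fun x : 'cV[R]_n * 'cV[R]_n =>
  complex.Re (((2 * 'i%C) *: Phi (g *m cplx x.1 x.2) z0 + 'i%C *: Phi z0 z0) i ord0))); last exact: measurable_fst.
pose a j : C := ((2 * 'i%C) *: Phi (g *m delta_mx j ord0) z0) i ord0.
pose c : C := ('i%C *: Phi z0 z0) i ord0.
rewrite (_ : (fun x => _) = (fun x : 'cV[R]_n * 'cV[R]_n =>
  \sum_j (complex.Re (a j) * x.1 j ord0 - complex.Im (a j) * x.2 j ord0) + complex.Re c)).
  apply: measurable_funD; last exact: measurable_cst.
  apply: measurable_sum => j; apply: measurable_funB; apply: measurable_funM; try exact: measurable_cst.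
    exact: (measurableT_comp (measurable_coord j) measurable_fst).
  exact: (measurableT_comp (measurable_coord j) measurable_snd).
apply/funext => x; rewrite mxE -/c raddfD; congr (_ + _).
have -> : ((2 * 'i%C) *: Phi (g *m cplx x.1 x.2) z0) i ord0 = \sum_j a j * cplx x.1 x.2 j ord0.
  rewrite {1}(_ : cplx x.1 x.2 = \sum_j cplx x.1 x.2 j ord0 *: delta_mx j ord0); last first.
    by rewrite {1}[cplx x.1 x.2]matrix_sum_delta; apply: eq_bigr => j _; rewrite big_ord1.
  rewrite mulmx_sumr (big_morph (Phi^~ z0) (fun a b => PhiD S a b z0) (Phi0l S z0)).
  rewrite scaler_sumr summxE; apply: eq_bigr => j _.
  by rewrite -scalemxAr PhiZ scalerA [_ * cplx _ _ _ _]mulrC -scalerA mxE mulrC.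
rewrite raddf_sum; apply: eq_bigr => j _; rewrite !mxE.
by case: (a j) => ? ? /=.
Qed.

(** The Jacobians of [g] on E and of [t] on F are Delta^{-b}(t) and Delta^{-d}(t) in absolute value;
    taking preimages inverts them. *)
Lemma haarN_affN A : measurable A ->
  haarN (affN @^-1` A) = ((expR (lnD t (bvec S + dvec S)))%:E * haarN A)%E.
Proof.
move=> mA.
have d1 : 0 <= `|detR g|^-1 by rewrite invr_ge0.
have d2 : 0 <= `|\det t|^-1 by rewrite invr_ge0.
pose phi (v : 'cV[R]_n * 'cV[R]_n) := actE g v + (re_mx z0, im_mx z0).
pose psi (v : 'cV[R]_n * 'cV[R]_n) (x : 'cV[R]_m) := t *m x +
  (x0 + re_mx ((2 * 'i%C) *: Phi (cplx (actE g v).1 (actE g v).2) z0 + 'i%C *: Phi z0 z0)).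
have E : affN = (fun z => (phi z.1, psi z.1 z.2)) by [].
have mphi : measurable_fun setT phi.
  exact: (measurableT_comp (measurable_translateE _) (measurable_actE g)).
have mpsi : measurable_fun setT (fun z : Nt => psi z.1 z.2).
  exact: (measurableT_comp measurable_snd measurable_affN).
have h1 B : measurable B -> lebE n (phi @^-1` B) = ((NngNum d1)%:num%:E * lebE n B)%E.
  move=> mB; rewrite /phi -(lebE_translate (re_mx z0, im_mx z0) mB).
  rewrite -(lebE_act ug)//.
  by rewrite -[X in measurable X]setTI; apply: measurable_translateE.
have h2 x B : measurable B -> lebesgue_cV m (psi x @^-1` B) = ((NngNum d2)%:num%:E * lebesgue_cV m B)%E.
  move=> mB; pose c := x0 + re_mx ((2 * 'i%C) *: Phi (cplx (actE g x).1 (actE g x).2) z0 + 'i%C *: Phi z0 z0).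
  have mB' : measurable ((fun y : 'cV[R]_m => y + c) @^-1` B).
    rewrite -[X in measurable X]setTI.
    have := @measurable_affine_cV R m 1%:M c; under eq_fun do rewrite mul1mx.
    by move=> H; apply: H.
  rewrite -[lebesgue_cV m B](lebesgue_cV_translate c mB).
  exact: (lebesgue_cV_linear (T_unit Tt) mB').
have := product_measure_shear mphi mpsi h1 h2 mA.
rewrite -E => H; apply: etrans H _; congr (_%:E * _)%E => /=.
rewrite (det_T Tt) -(Delta_bvec Tt ug tg) rpow_Delta// lnDeltaN.
by rewrite gtr0_norm ?expR_gt0// !expRN !invrK -expRD lnDeltaD.
Qed.

End intertwined.

Lemma aff_exists w : domain S w -> exists t g, [/\ T t, g \in unitmx, intertwines Phi t g,
  aff t g w.1 (re_mx w.2) base = w & forall s, lnD t s = LD (rho S w) s].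
Proof.
move=> Dw; have [Tt te] := orbitP ((domainE S w).1 Dw).
have [g ug tg] := @Phi_homogeneous _ _ _ _ S _ Tt; exists (orbit_elt S (rho S w)), g; split => //.
rewrite /aff /affl /base /= !mulmx0 Phi0l scaler0 addr0 addrC.
case: w Dw Tt te tg => a b Dw Tt te tg /=; congr pair; first by rewrite /= addr0.
rewrite /= -[RHS](cplx_reim b) -[LHS](cplx_reim _) !re_mxD !im_mxD re_cplx_mul im_cplx_mul im_i !re_cplx' !im_cplx'.
congr cplx.
  rewrite mulmx0 addr0; have -> : re_mx ('i%C *: Phi a a) = 0; last by rewrite addr0.
  apply/matrixP => i j; have /matrixP/(_ i j) := Phi_diag_real S a.
  by rewrite !mxE; case: (Phi a a i j) => x y /= ->; rewrite mul0r mul1r subr0.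
by rewrite te /rho/= add0r addrC subrK.
Qed.

(** Here [t] is the inverse of the orbit element of rho(w), and the translation part is the opposite
    of the linear image of [w]. *)
Lemma aff_to_base w : domain S w -> exists t g, [/\ T t, g \in unitmx, intertwines Phi t g,
  aff t g (- (g *m w.1)) (- (t *m re_mx w.2)) w = base & forall s, lnD t s = - LD (rho S w) s].
Proof.
move=> Dw; have [Tt te] := orbitP ((domainE S w).1 Dw).
have Tv := TV Tt; have [g ug tg] := @Phi_homogeneous _ _ _ _ S _ Tv.
exists (invmx (orbit_elt S (rho S w))), g; split => //; last by move=> s; rewrite lnDeltaV.
set t := invmx _ in Tv tg *.
have te' : t *m rho S w = e by rewrite -te mulKmx// (T_unit Tt).
have hr : rho S (aff t g (- (g *m w.1)) (- (t *m re_mx w.2)) w) = t *m rho S w by apply: rho_aff.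
rewrite te' in hr; rewrite -[LHS](slice_coordK S) -[RHS](slice_coordK S).
congr (slice_pt S _); rewrite /slice_coord hr rho_base; congr (_, _, _, _).
- by rewrite /= subrr.
- by rewrite /= subrr.
rewrite /= !re_mxD re_cplx_mul !re_cplx' PhiNr scalerN PhiN PhiNr opprK.
have h : re_mx ('i%C *: Phi (g *m w.1) (g *m w.1)) = 0.
  apply/matrixP => i j; have /matrixP/(_ i j) := Phi_diag_real S (g *m w.1).
  by rewrite !mxE; case: (Phi _ _ i j) => x y /= ->; rewrite mul0r mul1r subr0.
have -> : (2 * 'i%C) *: Phi (g *m w.1) (g *m w.1) = 'i%C *: Phi (g *m w.1) (g *m w.1) + 'i%C *: Phi (g *m w.1) (g *m w.1).
  by rewrite -scalerDl -mulr2n mulr_natl.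
have hN (x : 'cV[C]_m) : re_mx (- x) = - re_mx x.
  by apply/matrixP => i j; rewrite !mxE; case: (x i j).
by rewrite hN re_mxD h !addr0 oppr0 addr0 subrr.
Qed.

End affine_maps.

(** * Norms under automorphisms and bounds for point evaluation *)

Section norm_bounds.
Context {R : realType} {n m r : nat} (S : siegel_domain R n m r).
Local Notation C := R[i].
Local Notation nc := (@Normc.normc R).
Local Notation point := ('cV[C]_n * 'cV[C]_m)%type.
Local Notation Nt := ('cV[R]_n * 'cV[R]_n * 'cV[R]_m)%type.
Local Notation Om := (Om S).
Local Notation e := (eOm S).
Local Notation T := (Tplus S).
Local Notation Phi := (Phi S).
Local Notation LD := (lnDeltaOm S).
Local Notation lnD := (lnDelta S).
Local Notation nu := (nuOm S).
Local Notation hN := (haarN (R := R) (n := n) (m := m)).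

Lemma expR_powR (x q : R) : expR x `^ q = expR (q * x).
Proof. by rewrite /powR gt_eqF ?expR_gt0// expRK. Qed.

Lemma nu_T t A : T t -> measurable A -> nu ((fun h => t *m h) @^-1` A) = (1%:E * nu A)%E.
Proof. by move=> Tt mA; rewrite mul1e; exact: (nuOm_invariant (linear_automorphism_T Tt) mA). Qed.

Lemma measurable_mulT (t : 'M[R]_m) : measurable_fun setT (fun h : 'cV[R]_m => t *m h).
Proof. by have := @measurable_affine_cV R m t 0; under eq_fun do rewrite addr0. Qed.

Definition decayOm s l : 'cV[R]_m -> \bar R := (fun h => (expR (LD h s - pairing l h))%:E) \_ Om.

Lemma measurable_decayOm s l : measurable_fun setT (decayOm s l).
Proof.
apply/(measurable_restrictT _ (measurable_Om S)); apply/measurable_EFinP.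
apply: (measurableT_comp (@measurable_expR R)); apply: measurable_funB; first exact: LD_measurable.
apply: measurable_funTS; exact: pairing_measurable.
Qed.

Lemma decayOm_in s l h : Om h -> decayOm s l h = (expR (LD h s - pairing l h))%:E.
Proof. by move=> Oh; rewrite /decayOm patchE mem_set. Qed.

Lemma decayOm_ge0 s l h : (0 <= decayOm s l h)%E.
Proof. by rewrite /decayOm patchE; case: ifP => // _; rewrite lee_fin expR_ge0. Qed.

(** Under this condition Delta^s e^{-<l, .>} is in L^q(nu) for [l] in the dual cone: q s lies in the
    Laplace range for finite q, and the function is bounded for q = oo. *)
Definition qcond (q : \bar R) (s : 'rV[R]_r) :=
  ((q < +oo)%E -> forall j, fine q^-1%E / 2 * (mvec S j)%:R < s ord0 j) /\
  (q = +oo%E -> forall j, 0 <= s ord0 j).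

Lemma decayOm_norm q s l : (0 < q)%E -> Om' S l -> qcond q s ->
  (Lnorm nu q (decayOm s l) < +oo)%E.
Proof.
move=> q0 Ol [h1 h2]; apply: Lnorm_fin_bound => //.
case: q q0 h1 h2 => [q| |//] q0 h1 h2; last first.
  have [B hB] := LD_upper Ol (h2 erefl).
  exists (expR B) => h; rewrite /decayOm patchE; case: ifPn => [|_].
    by rewrite inE => Oh; rewrite gee0_abs ?lee_fin ?expR_ge0// ler_expR; exact: hB.
  by rewrite abse0 lee_fin expR_ge0.
rewrite lte_fin in q0; have q00 : 0 < q by [].
have hs j : (mvec S j)%:R / 2 < (q *: s) ord0 j.
  have := h1 (ltry _) j; rewrite fine_invr mxE -(ltr_pM2l q00).
  by rewrite mulrA mulrA mulfV ?gt_eqF// mul1r [2^-1 * _]mulrC.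
have I := integrable_LD (Om'Z q00 Ol) hs.
have F := integrable_fin_num (measurable_Om S) I.
rewrite (eq_integral ((fun h => (expR (LD h (q *: s) - pairing (q *: l) h))%:E) \_ Om)); last first.
  move=> h _; rewrite /decayOm !patchE; case: ifP => _.
    rewrite gee0_abs ?lee_fin ?expR_ge0// poweR_EFin expR_powR.
    by rewrite [LD h (q *: s)]lnDeltaZ pairingZl mulrBr.
  have e0 : (`|0 : \bar R| `^ q = 0)%E by rewrite abse0 poweR_EFin powR0 ?gt_eqF.
  exact: e0.
by rewrite -integral_mkcond -(fineK F) ltry.
Qed.

(** A function dominated by the transport of a product, Delta^tau e^{-l} in the height times [Y] in
    the horizontal variable. The Haar measure of N contributes Delta^{(b + d) / p}(t), the weight
    Delta^{-s}(t). *)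
Lemma norm_upper p q s l tau (Y : Nt -> R) : (0 < p)%E -> (0 < q)%E -> Om' S l ->
  measurable_fun setT (Y : Nt -> measurableTypeR R) -> (forall v, 0 <= Y v) ->
  (Lnorm hN p (fun v => (Y v)%:E) < +oo)%E -> qcond q (s + tau) ->
  exists2 K : R, 0 < K & forall t g z0 x0 (a : R) f, T t -> g \in unitmx ->
    intertwines Phi t g -> 0 <= a -> on_domain S f ->
    (forall h v, Om h -> nc (slice S f h v) <=
      a * expR (LD (t *m h) tau - pairing l (t *m h)) * Y (affN S t g z0 x0 v)) ->
    (Lpq_norm S p q s f <= (K * a * expR (fine p^-1 * lnD t (bvec S + dvec S) - lnD t s))%:E)%E.
Proof.
move=> p0 q0 Ol mY Y0 NYf qc; have NGf := decayOm_norm q0 Ol qc.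
have [NY NYE] : exists NY : R, Lnorm hN p (fun v => (Y v)%:E) = NY%:E.
  by exists (fine (Lnorm hN p (fun v => (Y v)%:E))); rewrite fineK// ge0_fin_numE// Lnorm_ge0'.
have [NG NGE] : exists NG : R, Lnorm nu q (decayOm (s + tau) l) = NG%:E.
  by exists (fine (Lnorm nu q (decayOm (s + tau) l))); rewrite fineK// ge0_fin_numE// Lnorm_ge0'.
have NY0 : 0 <= NY by rewrite -lee_fin -NYE Lnorm_ge0'.
have NG0 : 0 <= NG by rewrite -lee_fin -NGE Lnorm_ge0'.
exists (NY * NG + 1); first by rewrite ltr_wpDl// mulr_ge0.
move=> t g z0 x0 a f Tt ug tg a0 of_ hf.
pose c := expR (lnD t (bvec S + dvec S)).
have mYE : measurable_fun setT (fun v => (Y v)%:E) by exact/measurable_EFinP.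
have maff := measurable_affN S t g z0 x0.
pose A h := a * expR (LD (t *m h) tau - pairing l (t *m h)).
have A0 h : 0 <= A h by rewrite mulr_ge0// expR_ge0.
pose cp := c `^ fine p^-1; have cp0 : 0 <= cp by exact: powR_ge0.
have hsl h : Om h -> (sliceN S p f h <= (A h * (cp * NY))%:E)%E.
  move=> Oh; rewrite /sliceN.
  apply: (@le_trans _ _ (Lnorm hN p (fun v => (A h)%:E * (Y (affN S t g z0 x0 v))%:E)%E)).
    apply: Lnorm_le => // v; rewrite -EFinM !gee0_abs ?lee_fin ?normc_ge0 ?mulr_ge0//.
    exact: hf.
  rewrite LnormZ_ge0//; last exact: measurableT_comp mYE maff.
  rewrite [X in (_ <= X)%E]EFinM; apply: lee_wpmul2l; first by rewrite lee_fin.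
  have := @Lnorm_scaled _ _ _ hN p (affN S t g z0 x0) c (fun v => (Y v)%:E) p0 (expR_ge0 _) maff
    (haarN_affN z0 x0 Tt ug tg) mYE.
  by rewrite NYE -EFinM.
pose k0 := a * cp * NY * expR (- lnD t s).
have k00 : 0 <= k0 by rewrite !mulr_ge0// expR_ge0.
apply: (@le_trans _ _ (Lnorm nu q (fun h => k0%:E * decayOm (s + tau) l (t *m h))%E)).
  apply: Lnorm_le => // h; rewrite [X in (_ <= X)%E]gee0_abs; last first.
    by rewrite mule_ge0 ?decayOm_ge0 ?lee_fin.
  have [Oh|Oh] := pselect (Om h); last first.
    by rewrite /weighted_slices sliceN_out// mule0 abse0 mule_ge0 ?decayOm_ge0 ?lee_fin.
  rewrite decayOm_in; last exact: TOm.
  rewrite gee0_abs; last by rewrite /weighted_slices mule_ge0 ?lee_fin ?DeltaOmE ?expR_ge0 ?Lnorm_ge0'.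
  rewrite /weighted_slices DeltaOmE//.
  apply: (le_trans (lee_wpmul2l _ (hsl h Oh))); first by rewrite lee_fin expR_ge0.
  rewrite -!EFinM lee_fin /A /k0 le_eqVlt; apply/orP; left; apply/eqP.
  have -> : LD (t *m h) (s + tau) - pairing l (t *m h) =
      LD h s + lnD t s + (LD (t *m h) tau - pairing l (t *m h)).
    by rewrite [LD (t *m h) (s + tau)]lnDeltaD -![lnD (orbit_elt S _) _]/(LD _ _) [LD (t *m h) s]lnDeltaOmM//; ring.
  rewrite !expRD [expR (- lnD t s)]expRN.
  have := expR_gt0 (lnD t s) => e0; field.
  by rewrite gt_eqF.
rewrite LnormZ_ge0//; last exact: measurableT_comp (measurable_decayOm _ _) (measurable_mulT t).
have := @Lnorm_scaled _ _ _ nu q (fun h => t *m h) 1 (decayOm (s + tau) l) q0 ler01 (measurable_mulT t)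
  (fun A mA => nu_T Tt mA) (measurable_decayOm _ _).
rewrite powR1 mul1e NGE => H.
apply: (le_trans (lee_wpmul2l _ H)); first by rewrite lee_fin.
rewrite -EFinM lee_fin /k0 /cp /c expR_powR.
have -> : expR (fine p^-1 * lnD t (bvec S + dvec S) - lnD t s) =
  expR (fine p^-1 * lnD t (bvec S + dvec S)) * expR (- lnD t s) by rewrite expRD.
have := expR_gt0 (fine p^-1 * lnD t (bvec S + dvec S)); have := expR_gt0 (- lnD t s).
move: (expR _) (expR _) => u v u0 v0.
have -> : a * u * NY * v * NG = (NY * NG) * (a * u * v) by ring.
have -> : (NY * NG + 1) * a * (u * v) = (NY * NG + 1) * (a * u * v) by ring.
by rewrite ler_wpM2r ?lerDl// !mulr_ge0// ltW.
Qed.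

Lemma bounded_on_Dc F c : 0 < c -> Hol S F -> exists M : R, forall w, Dc S c w -> nc (F w) <= M.
Proof.
move=> c0 hF; have [D0|D0] := eqVneq (Dc S c) set0.
  by exists 0 => w; rewrite D0.
have /set0P D1 := D0.
have cf : {within Dc S c, continuous (fun w => - nc (F w))}.
  apply: continuous_in_subspaceT => w; rewrite inE => Dw; apply: cvgN.
  apply: (nc_continuous_in (S := S)).
    by move=> x Dx; apply: differentiable_continuous; case: hF => _; exact.
  by rewrite inE; exact: Dc_domain Dw.
have [w0 _ hw0] := compact_EVT_min D1 (Dc_compact (S := S) (c := c)) cf.
exists (nc (F w0)) => w Dw; have := hw0 w; rewrite inE => /(_ Dw).
by rewrite lerN2.
Qed.

Lemma Hol_continuous F w : Hol S F -> domain S w -> {for w, continuous F}.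
Proof. by move=> [_ hF] Dw; exact: differentiable_continuous (hF w Dw). Qed.

(** A neighbourhood of e on which every power of Delta is bounded above and below, so that nu is
    comparable to Lebesgue measure. *)
Definition near_e : set 'cV[R]_m := [set h | Om (h - 2^-1 *: e) /\ Om (2 *: e - h)].

Lemma near_e_open : open near_e.
Proof.
rewrite openE => k [/(@Om_ball _ _ _ S)[d d0 hd] /(@Om_ball _ _ _ S)[d' d'0 hd']].
apply/nbhs_ballP; exists (Num.min d d') => /=; first by rewrite lt_min d0.
move=> k'; rewrite -ball_normE/= lt_min => /andP[h1 h2]; split; [apply: hd|apply: hd'].
  by rewrite opprB addrA subrK distrC.
by rewrite opprB addrC addrA subrK.
Qed.

Lemma near_e_e : near_e e.
Proof.
have h2 : (0 : R) < 2^-1 by rewrite invr_gt0.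
split; [have -> : e - 2^-1 *: e = 2^-1 *: e|have -> : 2 *: e - e = e].
- by rewrite -{1}[e]scale1r -scalerBl; congr (_ *: _); field.
- exact: OmZ h2 (eOmP S).
- by rewrite -{2}[e]scale1r -scalerBl (_ : 2 - 1 = 1 :> R) ?scale1r//; ring.
- exact: eOmP.
Qed.

Lemma near_e_Om h : near_e h -> Om h.
Proof.
move=> [h1 _]; rewrite -[h](subrK (2^-1 *: e)); apply: OmD => //.
by apply: OmZ (eOmP S); rewrite invr_gt0.
Qed.

Lemma near_e_LD s : exists2 B : R, 0 < B & forall h, near_e h -> `|LD h s| <= B.
Proof.
have h2 : (0 : R) < 2^-1 by rewrite invr_gt0.
have [B B0 hB] := @LD_interval _ _ _ _ S _ 2 s h2 (ltr0n R 2).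
exists B => // h [h1 h3]; have := hB e h (eOmP S) (OmW h1) (OmW h3).
by rewrite lnDeltaOm_e subr0.
Qed.

Lemma nu_ge_lebesgue : exists2 k : R, 0 < k & forall A, measurable A -> A `<=` near_e ->
  (lebesgue_cV m A <= k%:E * nu A)%E.
Proof.
have [B B0 hB] := near_e_LD (dvec S); exists (expR B); first exact: expR_gt0.
move=> A mA Ae; have AO : A `<=` Om by move=> h /Ae/near_e_Om.
rewrite nu_density// -ge0_integralZl_EFin//; last first.
  by apply/measurable_EFinP; exact: measurable_expR_LD.
rewrite -[leLHS]mul1e -(integral_cst _ mA); apply: ge0_le_integral => //.
- apply: measurable_funeM; apply/measurable_EFinP; exact: measurable_expR_LD.
- move=> h /Ae/hB; rewrite -EFinM lee_fin -expRD ler_norml => /andP[h1 _].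
  by rewrite -expR0 ler_expR; lra.
Qed.

Lemma integral_lebesgue_nu (f : 'cV[R]_m -> \bar R) (k : R) : 0 < k ->
  (forall A, measurable A -> A `<=` near_e -> (lebesgue_cV m A <= k%:E * nu A)%E) ->
  measurable_fun setT f -> (forall h, 0 <= f h)%E ->
  (\int[lebesgue_cV m]_(h in near_e) f h <= k%:E * \int[nu]_(h in near_e) f h)%E.
Proof.
move=> k0 hk mf f0; have k00 := ltW k0.
have mE : measurable near_e by apply: open_measurable_cV; exact: near_e_open.
have := @ge0_integral_mscale _ _ R nu near_e mE (NngNum k00) f (measurable_funTS mf) (fun h _ => f0 h).
move=> /= <-.
have -> : (\int[lebesgue_cV m]_(h in near_e) f h = \int[mrestr (lebesgue_cV m) mE]_(h in near_e) f h)%E.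
  apply: eq_measure_integral => A mA AE.
  exact: (congr1 (lebesgue_cV m) (esym (setIidl AE))).
apply: ge0_le_measure_integral => // A mA.
have mAE : measurable (A `&` near_e) by exact: measurableI.
apply: (le_trans (hk _ mAE (@subIsetr _ _ _))); rewrite /mscale/=.
apply: lee_wpmul2l; first by rewrite lee_fin.
by apply: le_measure; rewrite ?inE//; exact: subIsetl.
Qed.

Lemma base_ball : exists2 R0 : R, 0 < R0 & exists2 c : R, 0 < c &
  forall w, rnorm (w - base S) < R0 -> near_e (rho S w) /\ Dc S c w.
Proof.
have [d d0 hd] : exists2 d : R, 0 < d & forall h, `|h - e| < d -> near_e h.
  have /nbhs_ballP[d /= d0 hd] := open_nbhs_nbhs (conj near_e_open near_e_e).
  by exists d => // h he; apply: hd; rewrite -ball_normE/= distrC.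
have [d1 d10 hd1] := rho_cont S (base S) d0.
have [c0 c00 bc] := Dc_cover (domain_base S).
have [c c_0 [d2 d20 hd2]] := Dc_thick S c00.
exists (Num.min d1 d2); first by rewrite lt_min d10.
exists c => // w; rewrite lt_min => /andP[/hd1 h1 /(hd2 _ _ bc) h2]; split => //.
by apply: hd; rewrite -(rho_base S).
Qed.

(** Tonelli in all variables: translating Im z by Phi(zeta) - e turns Euclidean coordinates around
    [base] into slice coordinates. *)
Lemma slice_integral_le F (R0 q : R) : 0 < q -> 0 < R0 -> Hol S F ->
  (forall w, rnorm (w - base S) < R0 -> near_e (rho S w)) ->
  (exists M : R, forall w, rnorm (w - base S) < R0 -> nc (F w) <= M) ->
  (\int[lebP n m]_v (cutoff F (base S) R0 v `^ q)%:E <=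
   \int[lebesgue_cV m]_(h in near_e) \int[hN]_v (nc (slice S F h v) `^ q)%:E)%E.
Proof.
move=> q0 R00 hF hR [M hM].
pose Pt := (('cV[R]_n * 'cV[R]_n) * ('cV[R]_m * 'cV[R]_m))%type.
pose u (v : Pt) := (cutoff F (base S) R0 v `^ q)%:E.
have good w : rnorm (w - base S) < R0 -> nc (F w) <= M /\ forall v, derivable F w v.
  move=> hw; split; first exact: hM.
  by move=> v; apply: diff_derivable; case: hF => _; apply; apply/domainE/near_e_Om/hR.
have mc : measurable_fun setT (cutoff F (base S) R0 : Pt -> measurableTypeR R).
  by apply: measurable_cutoff => w hw; apply: (bounded_ccont R00 good).
have mu : measurable_fun setT u.
  by apply/measurable_EFinP; exact: (measurableT_comp (@measurable_powR R q) mc).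
have u0 v : (0 <= u v)%E by rewrite lee_fin powR_ge0.
pose G (x : Nt * 'cV[R]_m) := (nc (F (slice_pt S x)) `^ q * \1_near_e x.2)%:E.
have mE : measurable near_e by apply: open_measurable_cV; exact: near_e_open.
have mS : measurable_fun setT (fun x => (nc (F (slice_pt S x)) `^ q : measurableTypeR R)).
  apply: (measurableT_comp (@measurable_powR R q)); apply: measurable_slice2.
    by case: hF.
  by move=> w; exact: Hol_continuous.
have mG : measurable_fun setT G.
  apply/measurable_EFinP; apply: measurable_funM => //.
  exact: (measurableT_comp (measurable_indic mE) measurable_snd).
have G0 x : (0 <= G x)%E by rewrite lee_fin mulr_ge0// powR_ge0.
have A1 : (\int[lebP n m]_v u v = \int[lebE n]_z \int[lebE m]_y u (z, y))%E by exact: (fubini_tonelli1 u mu u0).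
have A2 z : (\int[lebE m]_y u (z, y) = \int[lebesgue_cV m]_x \int[lebesgue_cV m]_y u (z, (x, y)))%E.
  apply: (fubini_tonelli1 (fun y => u (z, y)) _ (fun y => u0 (z, y))).
  exact: (measurableT_comp mu (measurable_pair1 z)).
pose b (z : 'cV[R]_n * 'cV[R]_n) := re_mx (Phi (cplx z.1 z.2) (cplx z.1 z.2)) - e.
have A3 z x : (\int[lebesgue_cV m]_y u (z, (x, y)) = \int[lebesgue_cV m]_h u (z, (x, (h + b z)%R)))%E.
  have mt : measurable_fun setT (fun h : 'cV[R]_m => h + b z).
    by have := @measurable_affine_cV R m 1%:M (b z); under eq_fun do rewrite mul1mx.
  have mux : measurable_fun setT (fun y => u (z, (x, y))).
    exact: (measurableT_comp mu (measurableT_comp (measurable_pair1 z) (measurable_pair1 x))).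
  have hb A : measurable A -> lebesgue_cV m ((fun h => h + b z) @^-1` A) =
      ((NngNum (@ler01 R))%:num%:E * lebesgue_cV m A)%E.
    by move=> mA; rewrite mul1e; exact: lebesgue_cV_translate.
  by rewrite (@ge0_integral_scaled _ _ _ (lebesgue_cV m) _ _ _ mt hb mux (fun y => u0 _)) mul1e.
have A4 z x h : (u (z, (x, (h + b z)%R)) <= G ((z, x), h))%E.
  rewrite /u /G /cutoff lee_fin.
  have bE : base S + real_point (z, (x, h + b z)) = slice_pt S ((z, x), h).
    rewrite /base /real_point /slice_pt /b /=; congr pair; first by rewrite add0r.
    by apply/matrixP => i j; rewrite !mxE; apply/eqP; rewrite eq_complex/= add0r eqxx/=; apply/eqP; ring.
  case: ifPn => hR0; last by rewrite powR0 ?gt_eqF// mulr_ge0// powR_ge0.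
  rewrite bE indicE mem_set ?mulr1//=.
  have := hR (slice_pt S ((z, x), h)); rewrite slice_pt_rho; apply.
  by rewrite -bE addrAC subrr add0r.
rewrite -[leLHS]/(\int[lebP n m]_v u v)%E A1.
apply: (@le_trans _ _ (\int[lebE n]_z \int[lebesgue_cV m]_x \int[lebesgue_cV m]_h G ((z, x), h))%E).
  apply: le_integral_ge0 => z; first by apply: integral_ge0.
  rewrite A2; apply: le_integral_ge0 => x; first by apply: integral_ge0.
  by rewrite A3; apply: le_integral_ge0 => h.
have -> : (\int[lebE n]_z \int[lebesgue_cV m]_x \int[lebesgue_cV m]_h G ((z, x), h) =
    \int[lebN n m]_v \int[lebesgue_cV m]_h G (v, h))%E.
  symmetry; apply: (fubini_tonelli1 (fun v => \int[lebesgue_cV m]_h G (v, h))%E).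
    exact: (measurable_fun_fubini_tonelli_F G mG G0).
  by move=> v; apply: integral_ge0.
have -> : (\int[lebN n m]_v \int[lebesgue_cV m]_h G (v, h) = \int[lebesgue_cV m]_h \int[lebN n m]_v G (v, h))%E.
  exact: (fubini_tonelli G mG G0).
rewrite [leRHS]integral_mkcond; apply: le_integral_ge0 => h; first by apply: integral_ge0.
rewrite patchE; case: ifPn => hE; last first.
  rewrite (eq_integral (cst 0%E)) ?integral0// => v _.
  by rewrite /G indicE (negbTE hE) mulr0.
apply: le_integral_ge0 => v //; by rewrite /G indicE hE mulr1.
Qed.

Lemma ler_powR_inv (x y q : R) : 0 < q -> 0 <= x -> 0 <= y -> x `^ q <= y `^ q -> x <= y.
Proof.
move=> q0 x0 y0; apply: contraTT; rewrite -!ltNge => yx.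
by apply: gt0_ltr_powR; rewrite ?nnegrE.
Qed.

Lemma powR_invK (x q : R) : 0 < q -> 0 <= x -> (x `^ q^-1) `^ q = x.
Proof. by move=> q0 x0; rewrite -powRrM mulVf ?gt_eqF// powRr1. Qed.

(** The automorphism moves the point to [base], where the submean inequality and Tonelli bound |F|^q
    by slice integrals over heights near e. The invariance of nu under [t] compares these with the
    norm and brings in the powers of Delta(t). *)
Lemma pointwise_fin (q : R) s : 0 < q -> exists2 K : R, 0 < K & forall t g z0 x0 F (M : R),
  T t -> g \in unitmx -> intertwines Phi t g -> Hol S F -> (Lpq_norm S q%:E q%:E s F <= M%:E)%E ->
  nc (F (aff S t g z0 x0 (base S))) <= K * expR (q^-1 * lnD t (bvec S + dvec S) - lnD t s) * M.
Proof.
move=> q0; have [R0 R00 [c c0 hR]] := base_ball.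
have [K1 K10 hK1] := @submean R n m q R0 q0 R00.
have [k k0 hk] := nu_ge_lebesgue; have [B B0 hB] := near_e_LD s.
exists ((K1 * k) `^ q^-1 * expR B); first by rewrite mulr_gt0 ?expR_gt0// powR_gt0// mulr_gt0.
move=> t g z0 x0 F M Tt ug tg hF hM.
have qe0 : (0 < q%:E)%E by rewrite lte_fin.
have M0 : 0 <= M by rewrite -lee_fin (le_trans _ hM)// Lnorm_ge0'.
pose F' w := F (aff S t g z0 x0 w).
have hF' : Hol S F' by exact: Hol_aff.
have [M' hM'] := bounded_on_Dc c0 hF'.
have good : locally_good R0 F' (base S) M'.
  move=> w /hR[h1 h2]; split; first exact: hM'.
  by move=> v; apply: diff_derivable; case: hF' => _; apply; apply/domainE/near_e_Om.
have := hK1 _ _ _ good => H1.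
have H2 := slice_integral_le q0 R00 hF' (fun w hw => (hR w hw).1) (ex_intro _ M' (fun w hw => (good w hw).1)).
have oF : on_domain S F by case: hF.
have cF w : domain S w -> {for w, continuous F} by exact: Hol_continuous.
pose Sq F h := (\int[hN]_v (nc (slice S F h v) `^ q)%:E)%E.
have mSq H : Hol S H -> measurable_fun setT (Sq H).
  move=> hH; have := @measurable_fun_fubini_tonelli_G _ _ Nt 'cV[R]_m R (lebN n m)
    (fun x => (nc (H (slice_pt S x)) `^ q)%:E) _ _; apply.
    apply/measurable_EFinP; apply: (measurableT_comp (@measurable_powR R q)).
    by apply: measurable_slice2; [case: hH|move=> w; exact: Hol_continuous].
  by move=> x; rewrite lee_fin powR_ge0.
have Sq0 H h : (0 <= Sq H h)%E by apply: integral_ge0 => v _; rewrite lee_fin powR_ge0.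
have H3 := integral_lebesgue_nu k0 hk (mSq _ hF') (Sq0 F').
pose cc := expR (lnD t (bvec S + dvec S)).
have cc0 : 0 <= cc by exact: expR_ge0.
have E1 h : Sq F' h = (cc%:E * Sq F (t *m h))%E.
  rewrite -(@ge0_integral_scaled _ _ _ hN (affN S t g z0 x0) (NngNum cc0)
    (fun v => (nc (slice S F (t *m h) v) `^ q)%:E)).
  - by apply: eq_integral => v _; rewrite !sliceE /F' aff_slice_pt.
  - exact: measurable_affN.
  - by move=> A mA; exact: haarN_affN.
  - apply/measurable_EFinP; apply: (measurableT_comp (@measurable_powR R q)).
    by have /measurable_EFinP := measurable_slice (t *m h) oF cF.
  - by move=> v; rewrite lee_fin powR_ge0.
pose W h := (`|weighted_slices S q%:E s F h| `^ q)%E.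
have W0 h : (0 <= W h)%E by exact: poweR_ge0.
have WE h : Om h -> W h = ((expR (q * LD h s))%:E * Sq F h)%E.
  move=> Oh; rewrite /W /weighted_slices gee0_abs; last first.
    by rewrite mule_ge0 ?lee_fin ?DeltaOmE ?expR_ge0 ?Lnorm_ge0'.
  rewrite poweRM ?lee_fin ?DeltaOmE ?expR_ge0 ?Lnorm_ge0'// poweR_EFin expR_powR; congr (_ * _)%E.
  rewrite /sliceN unlock -poweRrM mulVf ?gt_eqF// poweRe1; last first.
    by apply: integral_ge0 => v _; exact: poweR_ge0.
  by apply: eq_integral => v _; rewrite gee0_abs ?lee_fin ?normc_ge0// poweR_EFin.
have mW : measurable_fun setT W.
  apply: measurable_abse_poweR.
  rewrite (_ : weighted_slices S q%:E s F = weighted_slices S q%:E s F \_ Om); last first.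
    apply/funext => h; rewrite patchE; case: ifPn => //; rewrite notin_setE => Oh.
    by rewrite /weighted_slices sliceN_out// mule0.
  apply/(measurable_restrictT _ (measurable_Om S)); exact: weighted_slices_measurable.
have IW : (\int[nu]_h W h <= (M `^ q)%:E)%E.
  move: hM; rewrite /Lpq_norm unlock -/W => hM.
  have -> : (\int[nu]_h W h = ((\int[nu]_h W h) `^ q^-1) `^ q)%E.
    by rewrite -poweRrM mulVf ?gt_eqF// poweRe1//; apply: integral_ge0.
  rewrite -poweR_EFin; apply: le_poweR => //; [exact: ltW|exact: poweR_ge0].
have WT : (\int[nu]_h W (t *m h) = \int[nu]_h W h)%E.
  have := @ge0_integral_scaled _ _ _ nu (fun h => t *m h) (NngNum (@ler01 R)) W (measurable_mulT t)
    (fun A mA => nu_T Tt mA) mW W0.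
  by rewrite /= mul1e.
(* [cc] is the Jacobian on N; the exponential removes the weight at t h, uniformly for h near e. *)
pose k1 := cc * expR (q * (B - lnD t s)).
have k10 : 0 <= k1 by rewrite mulr_ge0 ?expR_ge0.
have H4 : (\int[nu]_(h in near_e) Sq F' h <= k1%:E * (M `^ q)%:E)%E.
  apply: le_trans (lee_wpmul2l _ IW); last by rewrite lee_fin.
  rewrite -WT -(@ge0_integralZl_EFin _ _ _ nu setT measurableT (fun h => W (t *m h)) (fun h _ => W0 _) (measurableT_comp mW (measurable_mulT t)) k1 k10).
  rewrite [leLHS]integral_mkcond; apply: le_integral_ge0 => h.
    by rewrite patchE; case: ifP => // _; exact: Sq0.
  rewrite patchE; case: ifPn; last by rewrite mule_ge0 ?lee_fin.
  rewrite inE => hE; have Oh := near_e_Om hE.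
  rewrite E1 WE; last exact: TOm.
  rewrite muleA -EFinM; apply: lee_wpmul2r; first exact: Sq0.
  rewrite lee_fin /k1 -mulrA; apply: ler_peMr; first exact: expR_ge0.
  rewrite -expRD.
  have := hB _ hE; rewrite ler_norml => /andP[h1 _].
  have LDM := lnDeltaOmM s Tt Oh.
  apply: le_trans (expR_ge1Dx _); rewrite lerDl [X in _ + q * X]LDM.
  have -> : q * (B - lnD t s) + q * (lnD t s + LD h s) = q * (B + LD h s) by ring.
  by apply: mulr_ge0; [exact: ltW q0|rewrite -lerBlDl sub0r].
have H5 : nc (F' (base S)) `^ q <= K1 * k * (k1 * M `^ q).
  have -> : K1 * k * (k1 * M `^ q) = K1 * (k * (k1 * M `^ q)) by rewrite -mulrA.
  rewrite -lee_fin; apply: (le_trans H1).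
  rewrite [X in (_ <= X)%E](_ : _ = K1%:E * (k%:E * (k1%:E * (M `^ q)%:E)))%E; last by rewrite -!EFinM.
  apply: lee_wpmul2l; first by rewrite lee_fin ltW.
  apply: (le_trans H2); apply: (le_trans H3).
  by apply: lee_wpmul2l; first by rewrite lee_fin ltW.
set Z := q^-1 * _ - _.
have a1 : 0 <= (K1 * k) `^ q^-1 by exact: powR_ge0.
have a2 : 0 <= (K1 * k) `^ q^-1 * expR B by apply: mulr_ge0 => //; exact: expR_ge0.
have a3 : 0 <= (K1 * k) `^ q^-1 * expR B * expR Z by apply: mulr_ge0 => //; exact: expR_ge0.
apply: (ler_powR_inv q0 (normc_ge0 _) (mulr_ge0 a3 M0)).
apply: (le_trans H5); rewrite le_eqVlt; apply/orP; left; apply/eqP.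
rewrite (@powRM _ _ M _ a3 M0) (@powRM _ _ (expR Z) _ a2 (expR_ge0 _)) (@powRM _ _ (expR B) _ a1 (expR_ge0 _)).
have Kk : 0 <= K1 * k by apply: mulr_ge0; exact: ltW.
rewrite (powR_invK q0 Kk) (expR_powR B q) (expR_powR Z q).
have -> : k1 = expR (q * B) * expR (q * Z).
  have qn : q != 0 by rewrite gt_eqF.
  rewrite /k1 /cc /Z -!expRD; congr expR; field; exact: qn.
clearbody k1 Z; ring.
Qed.

(** If the bound failed at [w], continuity of F and the comparison of weights on an order interval
    would make it fail on an open set of heights, which is not null. *)
Lemma pointwise_infty s : exists2 K : R, 0 < K & forall F w (M : R), Hol S F -> domain S w ->
  (Lpq_norm S +oo%E +oo%E s F <= M%:E)%E -> nc (F w) * expR (LD (rho S w) s) <= K * M.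
Proof.
have h2 : (0 : R) < 2^-1 by rewrite invr_gt0.
have [B B0 hB] := @LD_interval _ _ _ _ S _ 2 s h2 (ltr0n R 2).
exists (expR B) => [|F w M hF Dw]; first exact: expR_gt0.
have nuT : (0 < nu setT)%E.
  apply: (@lt_le_trans _ _ (nu near_e)).
    by apply: (nu_open_gt0 near_e_open _ near_e_e) => h; exact: near_e_Om.
  apply: le_measure; rewrite ?inE//; apply: open_measurable_cV; exact: near_e_open.
rewrite /Lpq_norm unlock nuT => /ess_supP[N [mN N0 hN']].
rewrite leNgt; apply/negP => lt.
(* Some height near e lies off the null set, because such heights have positive measure. *)
have M0 : 0 <= M.
  have [h [Oh nNh]] : exists h, Om h /\ ~ N h.
    apply: contrapT => H; have : (0 < nu N)%E; last by rewrite N0 ltxx.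
    apply: (@lt_le_trans _ _ (nu near_e)).
      by apply: (nu_open_gt0 near_e_open _ near_e_e) => h; exact: near_e_Om.
    apply: le_measure; rewrite ?inE//; first by apply: open_measurable_cV; exact: near_e_open.
    by move=> h hE; apply: contrapT => nN; apply: H; exists h; split => //; exact: near_e_Om.
  rewrite -lee_fin; apply: le_trans (abse_ge0 (weighted_slices S +oo%E s F h)) _.
  apply: contrapT => hh; apply: nNh; apply: hN' => /= H; exact: hh H.
pose a := expR B * M * expR (- LD (rho S w) s).
have aF : a < nc (F w).
  by rewrite /a expRN -(ltr_pM2r (expR_gt0 (LD (rho S w) s))) divfK// gt_eqF ?expR_gt0.
have d0 : 0 < nc (F w) - a by rewrite subr_gt0.
have [d1 d10 hd1] := Hol_cont hF Dw d0.
set x := slice_coord S w; have xw : slice_pt S x = w by exact: slice_coordK.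
have [d2 d20 hd2] := slice_pt_cont S x d10.
have Or : Om (rho S w) := Dw.
have hO1 : Om (rho S w - 2^-1 *: rho S w).
  by rewrite -{1}[rho S w]scale1r -scalerBl; apply: OmZ => //; lra.
have hO2 : Om (2 *: rho S w - rho S w).
  by rewrite -{2}[rho S w]scale1r -scalerBl; apply: OmZ => //; lra.
have [d3 d30 hd3] := @Om_ball _ _ _ S _ Or.
have [d4 d40 hd4] := @Om_ball _ _ _ S _ hO1.
have [d5 d50 hd5] := @Om_ball _ _ _ S _ hO2.
pose d := Num.min (Num.min d2 d3) (Num.min d4 d5).
have dp : 0 < d by rewrite !lt_min d20 d30 d40 d50.
pose U := interior (ball (rho S w) d).
have UO : U `<=` Om.
  move=> h /interior_subset; rewrite -ball_normE/= !lt_min => /andP[/andP[_ h3] _].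
  by apply: hd3; rewrite distrC.
have nuU : (0 < nu U)%E.
  by apply: (@nu_open_gt0 _ _ _ _ S U (rho S w)) => //; [exact: open_interior|exact: nbhsx_ballx].
move: nuU; rewrite ltNge => /negP; apply; rewrite -N0; apply: le_measure; rewrite ?inE//.
  by apply: open_measurable_cV; exact: open_interior.
move=> h Uh; have Oh := UO _ Uh; apply: hN' => /= H.
have := interior_subset Uh; rewrite -ball_normE/= !lt_min => /andP[/andP[h2' _] /andP[h4 h5]].
have LDh : `|LD h s - LD (rho S w) s| <= B.
  apply: hB => //; apply: OmW; [apply: hd4|apply: hd5].
    by rewrite opprB addrA subrK distrC.
  by rewrite opprB addrC addrA subrK.
have /hd1[_] : rnorm (slice_pt S (x.1, h) - w) < d1.
  rewrite -[X in _ - X]xw; apply: hd2.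
  by split; [exact: ballxx|rewrite /= -ball_normE/=].
move: H; rewrite /weighted_slices DeltaOmE// gee0_abs; last by rewrite mule_ge0 ?lee_fin ?expR_ge0 ?Lnorm_ge0'.
move=> H; have {}H : (sliceN S +oo F h <= (M * expR (- LD h s))%:E)%E.
  rewrite leNgt; apply/negP => hh; move: H; apply/negP; rewrite -ltNge.
  have -> : M%:E = ((expR (LD h s))%:E * (M * expR (- LD h s))%:E)%E.
    by rewrite -EFinM mulrCA -expRD subrr expR0 mulr1.
  by rewrite lte_pmul2l ?lte_fin ?expR_gt0.
have := (sliceN_infty _ (fun w' Dw' => Hol_continuous hF Dw') Oh).1 H x.1.
rewrite lee_fin sliceE => h6 h7.
have h8 : M * expR (- LD h s) <= a.
  rewrite /a -mulrA mulrCA ler_wpM2l// -expRD ler_expR.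
  by move: LDh; rewrite ler_norml => /andP[? ?]; lra.
have := normc_triB (F w) 0 (F (slice_pt S (x.1, h))).
rewrite !subr0 (normcB (F w)); lra.
Qed.

End norm_bounds.

(** * Properness of the action on the domain *)

Section proper.
Context {R : realType} {n m r : nat} (S : siegel_domain R n m r).
Local Notation C := R[i].
Local Notation nc := (@Normc.normc R).
Local Notation point := ('cV[C]_n * 'cV[C]_m)%type.
Local Notation Om := (Om S).
Local Notation Cb := (closure (Defs.Om S)).
Local Notation e := (eOm S).
Local Notation T := (Tplus S).
Local Notation Phi := (Phi S).
Local Notation LD := (lnDeltaOm S).
Local Notation lnD := (lnDelta S).

Lemma Phi_diag_bound : exists2 M0 : R, 0 < M0 & forall M z, 0 <= M -> rnorm z <= M ->
  rnorm (Phi z z) <= M0 * M * M.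
Proof.
have [M0 M00 hM] := Phi_bound S; exists M0 => // M z M1 zM.
apply: (le_trans (hM _ _)); apply: ler_pM => //; last by apply: ler_wpM2l => //; exact: ltW.
  by apply: mulr_ge0; [exact: ltW|exact: rnorm_ge0].
exact: rnorm_ge0.
Qed.

Lemma rho_bounded M : exists2 B : R, 0 < B & forall w, rnorm w <= M -> `|rho S w| <= B.
Proof.
have [M0 M00 hM] := Phi_diag_bound.
exists (`|M| + M0 * `|M| * `|M| + 1); first by rewrite ltr_wpDl// addr_ge0// !mulr_ge0// ltW.
move=> w wM; have wM' : rnorm w <= `|M| by apply: le_trans (ler_norm _).
have h1 := le_trans (rnorm_fst w) wM'; have h2 := le_trans (rnorm_snd w) wM'.
have h3 := hM _ _ (normr_ge0 M) h1.
apply: (le_trans (ler_normB _ _)).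
have := le_trans (im_mx_le w.2) h2; have := le_trans (re_mx_le (Phi w.1 w.1)) h3.
by lra.
Qed.

(** A membership test in slice coordinates: Im z is recovered as rho + Phi(zeta). *)
Lemma Dc_of M a : 0 < a -> exists2 c : R, 0 < c & forall w, rnorm w.1 <= M ->
  `|re_mx w.2| <= M -> `|rho S w| <= M -> Cb (rho S w - a *: e) -> Dc S c w.
Proof.
move=> a0; have [M0 M00 hM] := Phi_diag_bound.
pose c := a^-1 + (`|M| + `|M| + M0 * `|M| * `|M|).
have p0 : 0 <= M0 * `|M| * `|M| by rewrite !mulr_ge0// ltW.
have ai : 0 < a^-1 by rewrite invr_gt0.
have c0 : 0 < c by rewrite ltr_pwDl// !addr_ge0.
exists c; first exact: c0.
move=> w; have MM := ler_norm M.
move=> /le_trans/(_ MM) h1 /le_trans/(_ MM) h2 /le_trans/(_ MM) h3 h4; split.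
  have h5 := hM _ _ (normr_ge0 M) h1.
  have h6 : `|im_mx w.2| <= `|M| + M0 * `|M| * `|M|.
    have -> : im_mx w.2 = rho S w + re_mx (Phi w.1 w.1) by rewrite /rho subrK.
    apply: (le_trans (ler_normD _ _)).
    by have := le_trans (re_mx_le (Phi w.1 w.1)) h5; lra.
  apply: rnorm_pair_le.
    by rewrite /c; move: h1 p0 ai (normr_ge0 M); lra.
  apply: (le_trans (rnorm_le_reim _)); rewrite /c; lra.
have -> : rho S w - c^-1 *: e = (rho S w - a *: e) + (a - c^-1) *: e.
  by rewrite scalerBl addrA subrK.
apply: (CbD h4); apply: CbZ; last exact/OmW/eOmP.
rewrite subr_ge0 -[a]invrK lef_pV2 ?posrE//.
by rewrite /c lerDl !addr_ge0.
Qed.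

Lemma Phi_diagZ (a : R) z : Phi (a%:C%C *: z) (a%:C%C *: z) = (a ^+ 2)%:C%C *: Phi z z.
Proof.
have -> : Phi (a%:C%C *: z) (a%:C%C *: z) = a%:C%C *: (a%:C%C *: Phi z z).
  rewrite PhiZ; congr (_ *: _); rewrite Phi_hermitian PhiZ [Phi z z in RHS]Phi_hermitian.
  apply/matrixP => i j; rewrite !mxE; case: (Phi z z i j) => p q.
  by rewrite /conjc /=; apply/eqP; rewrite eq_complex /= !mul0r; apply/andP; split; apply/eqP; ring.
by rewrite scalerA -rmorphM expr2.
Qed.

Lemma re_mxZ (a : R) k (x : 'cV[C]_k) : re_mx (a%:C%C *: x) = a *: re_mx x.
Proof. by apply/matrixP => i j; rewrite !mxE Re_mul_real. Qed.

Lemma re_mxN k (x : 'cV[C]_k) : re_mx (- x) = - re_mx x.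
Proof. by apply/matrixP => i j; rewrite !mxE; case: (x i j). Qed.

(** Homogeneity of degree 2 and compactness of the unit sphere, on which Phi(zeta) does not
    vanish. *)
Lemma Phi_coercive : exists2 k : R, 0 < k & forall z, k * rnorm z ^+ 2 <= `|re_mx (Phi z z)|.
Proof.
pose A := [set z : 'cV[C]_n | rnorm z = 1].
have key z : z != 0 -> A ((rnorm z)^-1%:C%C *: z).
  move=> z0; have nz : 0 < rnorm z by have := normr_gt0 z; rewrite z0 rnormE ltcR.
  by rewrite /A /= rnormZ normc_real ger0_norm ?invr_ge0 ?rnorm_ge0// mulVf// gt_eqF.
have rc (x : 'cV[C]_n) : {for x, continuous (fun z : 'cV[C]_n => rnorm z : R)}.
  apply: rnorm_continuous => e' e0; exists e' => // y; apply: le_lt_trans.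
  rewrite ler_norml; have := rnorm_tri y 0 x; have := rnorm_tri x 0 y.
  by rewrite !subr0 (rnormB x y) => ? ?; apply/andP; split; lra.
have cA : compact A.
  apply: (@cVC_compact _ _ _ 1) => [|x ->//].
  have -> : A = (fun z : 'cV[C]_n => rnorm z) @^-1` [set 1 : R] by [].
  by apply: preimage_closed => [x _|]; [exact: rc|exact: closed_eq].
have fc : continuous (fun z => `|re_mx (Phi z z)|).
  move=> x; apply: rnorm_continuous => e' e0.
  (* At z = 0 the map [rho] is -Phi, whose continuity is thus already known. *)
  have [d d0 hd] := rho_cont S (x, 0) e0; exists d => // y yx.
  have := hd (y, 0); rewrite /rho /= => h.
  apply: le_lt_trans (h _); last by apply/rnorm_pair; rewrite /= subrr rnorm0.
  by apply: (le_trans (ler_dist_dist _ _)); rewrite -normrN (_ : - (_ - _) = (im_mx (0 : 'cV[C]_m) - re_mx (Phi y y)) - (im_mx 0 - re_mx (Phi x x)))//; apply/matrixP => i j; rewrite !mxE; ring.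
have [A0|/set0P A1] := eqVneq A set0.
  exists 1 => // z; have [->|/key] := eqVneq z 0; last by rewrite A0.
  by rewrite rnorm0 expr0n mulr0.
have [z0 Az0 hz0] := compact_EVT_min A1 cA (continuous_subspaceT fc).
rewrite inE in Az0.
have z00 : z0 != 0 by apply: contraPneq Az0 => ->; rewrite /A /= rnorm0 => /eqP; rewrite eq_sym oner_eq0.
exists `|re_mx (Phi z0 z0)|.
  rewrite normr_gt0; apply/negP => /eqP re0; case/negP: (@Phi_pos _ _ _ _ S _ z00).2; apply/eqP/matrixP => i j.
  have /matrixP/(_ i j) := re0; have /matrixP/(_ i j) := Phi_diag_real S z0.
  by rewrite !mxE; case: (Phi z0 z0 i j) => a b /= -> ->.
move=> z; have [->|zn] := eqVneq z 0; first by rewrite rnorm0 expr0n mulr0.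
have nz : 0 < rnorm z by have := normr_gt0 z; rewrite zn rnormE ltcR.
have := hz0 _ (mem_set (key z zn)); rewrite Phi_diagZ re_mxZ normrZ ger0_norm ?exprn_ge0 ?invr_ge0 ?rnorm_ge0//.
by rewrite exprVn mulrC ler_pdivlMr// exprn_gt0.
Qed.

Lemma Cb_pm_bounded (a : R) : exists2 M : R, 0 < M &
  forall k : 'cV[R]_m, Cb (a *: e + k) -> Cb (a *: e - k) -> `|k| <= M.
Proof.
have [M M0 hM] := @Cb_bounded _ _ _ S (a + a).
exists (M + `|a| * `|e|); first by rewrite ltr_pwDl// mulr_ge0.
move=> k h1 h2; have := hM (a *: e + k) h1; rewrite scalerDl opprD addrA addrK => /(_ h2) h.
rewrite -(addKr (a *: e) k) addrC (le_trans (ler_normB _ _))// normrZ.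
by rewrite lerD2r.
Qed.

Lemma invc_gt0 (x : R) : 0 < x -> 0 < x^-1.
Proof. by rewrite invr_gt0. Qed.

Lemma aff_fst t g z0 x0 w : (aff S t g z0 x0 w).1 = g *m w.1 + z0. Proof. by []. Qed.

Lemma aff_re t g z0 x0 w : re_mx (aff S t g z0 x0 w).2 =
  t *m re_mx w.2 + re_mx ((2 * 'i%C) *: Phi (g *m w.1) z0) + (x0 + re_mx ('i%C *: Phi z0 z0)).
Proof. by rewrite /aff /affl /= !re_mxD re_cplx_mul re_cplx'. Qed.

(** Inverting the automorphism bounds each coordinate of [w] by those of its image, and t^{-1} e
    dominates a positive multiple of e. *)
Lemma Dc_aff t g z0 x0 c : T t -> g \in unitmx -> intertwines Phi t g -> 0 < c ->
  exists2 c' : R, 0 < c' & forall w, Dc S c (aff S t g z0 x0 w) -> Dc S c' w.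
Proof.
move=> Tt ug tg c0.
have [B1 B10 h1] := rnorm_mulmx (invmx g).
have [B1' B1'0 h1'] := rnorm_mulmx g.
have [B2 B20 h2] := mulmx_bound (invmx t).
have [B3 B30 h3] := rho_bounded c.
have [M0 M00 hM] := Phi_bound S.
have [a a0 ha] : exists2 a : R, 0 < a & Om (invmx t *m e - a *: e).
  by apply: Om_lower; apply: TOm; [exact: TV|exact: eOmP].
pose M1 := B1 * (c + rnorm z0).
pose X := `|x0 + re_mx ('i%C *: Phi z0 z0)|.
pose M2 := B2 * (c + 2 * (M0 * (B1' * M1) * rnorm z0) + X).
pose M3 := B2 * B3.
have M10 : 0 <= M1 by rewrite mulr_ge0 ?addr_ge0 ?rnorm_ge0 ?ltW.
have M20 : 0 <= M2.
  apply: mulr_ge0; first exact: ltW.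
  apply: addr_ge0; last exact: normr_ge0.
  apply: addr_ge0; first exact: ltW.
  apply: mulr_ge0 => //; apply: mulr_ge0; last exact: rnorm_ge0.
  apply: mulr_ge0; first exact: ltW.
  by apply: mulr_ge0 => //; exact: ltW.
have M30 : 0 <= M3 by rewrite mulr_ge0 ?ltW.
have [c' c'0 hc'] := @Dc_of (M1 + M2 + M3) (c^-1 * a) (mulr_gt0 (invc_gt0 c0) a0).
exists c'; first exact: c'0.
move=> w [wc wC].
have w1 : rnorm w.1 <= M1.
  rewrite -[w.1](mulKmx ug) (le_trans (h1 _))// ler_wpM2l ?(ltW B10)//.
  have -> : g *m w.1 = (aff S t g z0 x0 w).1 - z0 by rewrite aff_fst addrK.
  by rewrite (le_trans (rnormD _ _))// rnormN lerD2r (le_trans (rnorm_fst _)).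
have rw : rho S w = invmx t *m rho S (aff S t g z0 x0 w).
  by rewrite rho_aff// mulKmx//; exact: T_unit Tt.
have w3 : `|rho S w| <= M3.
  by rewrite rw (le_trans (h2 _))// ler_wpM2l ?(ltW B20)// h3.
apply: hc'.
- by move: w1; lra.
- suff : `|re_mx w.2| <= M2 by lra.
  rewrite -[re_mx w.2](mulKmx (T_unit Tt)) (le_trans (h2 _))// ler_wpM2l ?(ltW B20)//.
  have -> : t *m re_mx w.2 = re_mx (aff S t g z0 x0 w).2 - re_mx ((2 * 'i%C) *: Phi (g *m w.1) z0)
      - (x0 + re_mx ('i%C *: Phi z0 z0)).
    by rewrite aff_re addrAC addrK addrK.
  apply: (le_trans (ler_normB _ _)); rewrite lerD2r.
  apply: (le_trans (ler_normB _ _)); apply: lerD.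
    by rewrite (le_trans (re_mx_le _))// (le_trans (rnorm_snd _)).
  rewrite (le_trans (re_mx_le _))// rnormZ Normc.normcM normcI mulr1.
  have -> : nc 2 = 2 by rewrite -[2 : C](rmorph_nat (real_complex R)) normc_real ger0_norm.
  rewrite ler_wpM2l// (le_trans (hM _ _))// ler_wpM2r ?rnorm_ge0// ler_wpM2l ?(ltW M00)//.
  by rewrite (le_trans (h1' _))// ler_wpM2l ?(ltW B1'0).
- by move: w3; lra.
have -> : rho S w - (c^-1 * a) *: e = invmx t *m (rho S (aff S t g z0 x0 w) - c^-1 *: e)
    + c^-1 *: (invmx t *m e - a *: e).
  by rewrite mulmxBr -rw -scalemxAr scalerBr scalerA addrA subrK.
apply: CbD; first exact: TCb (TV Tt) wC.
by apply: CbZ; [rewrite invr_ge0 ltW|exact: OmW].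
Qed.

(** Let u be the image of a fixed [w] under the automorphism that takes [w0] to [base]. Applying
    t^{-1} to rho(u) >= e / c gives rho(w0) <= c rho(w), an upper bound; applying it to rho(u) <= Y
    e gives rho(w0) >= rho(w) / Y, which keeps [w0] off the boundary. The other coordinates follow
    from these. *)
Lemma Dc_normalize c w : 0 < c -> domain S w -> exists2 c' : R, 0 < c' &
  forall w0 t g, T t -> g \in unitmx -> intertwines Phi t g -> t *m rho S w0 = e ->
  Dc S c (aff S t g (- (g *m w0.1)) (- (t *m re_mx w0.2)) w) -> Dc S c' w0.
Proof.
move=> c0 Dw.
have [B3 B30 h3] := rho_bounded c.
have [M0 M00 hM] := Phi_bound S.
have [A A0 hA] := @eOm_absorb _ _ _ S.
have [k k0 hk] := Phi_coercive.
have [a a0 ha] := @Om_lower _ _ _ S _ Dw.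
pose Y1 := B3 + c + M0 * c * c.
have cY1 : c <= Y1.
  by rewrite /Y1; have := mulr_gt0 (mulr_gt0 M00 c0) c0; move: (M0 * c * c) => x; lra.
have BY1 : B3 <= Y1.
  by rewrite /Y1; have := mulr_gt0 (mulr_gt0 M00 c0) c0; move: (M0 * c * c) => x; lra.
have Y10 : 0 < Y1 by rewrite !addr_gt0 ?mulr_gt0.
pose Y := A * Y1 + 1; have Y0 : 0 < Y by rewrite addr_gt0 ?mulr_gt0.
pose L := A * `|rho S w| + 1; have L0 : 0 < L by rewrite ltr_wpDl ?mulr_ge0 ?(ltW A0).
have [M1 M10 hM1] := @Cb_pm_bounded (Y * (c * L)).
have [M2 M20 hM2] := @Cb_pm_bounded (c * L).
pose Z := rnorm w.1 + (M1 / k + 1).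
pose X := `|re_mx w.2| + 2 * (M0 * rnorm w.1 * Z) + M1.
have Z0 : 0 <= Z.
  by rewrite !addr_ge0 ?rnorm_ge0// divr_ge0// ltW.
have X0 : 0 <= X by rewrite !addr_ge0 ?(ltW M10)// !mulr_ge0// ?rnorm_ge0// ltW.
have [c' c'0 hc'] := @Dc_of (Z + X + M2) (Y^-1 * a) (mulr_gt0 (invc_gt0 Y0) a0).
exists c'; first exact: c'0.
move=> w0 t g Tt ug tg te; set z0 := - _; set x0 := - _; move=> [uc uC].
set u := aff S t g z0 x0 w in uc uC.
have ut := T_unit Tt.
have r0 : rho S w0 = invmx t *m e by rewrite -te mulKmx.
have ru : rho S u = t *m rho S w by rewrite rho_aff.
have rw : rho S w = invmx t *m rho S u by rewrite ru mulKmx//.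
have up : Cb (c *: rho S w - rho S w0).
  have -> : c *: rho S w - rho S w0 = c *: (invmx t *m (rho S u - c^-1 *: e)).
    have e1 : invmx t *m (c^-1 *: e) = c^-1 *: rho S w0 by rewrite r0 -scalemxAr.
    rewrite [invmx t *m (_ - _)]mulmxBr -rw e1 (scalerBr c (rho S w) (c^-1 *: rho S w0)).
    by rewrite scalerA mulfV ?gt_eqF// scale1r.
  by apply: CbZ; [exact: ltW|exact: TCb (TV Tt) uC].
have upe : Cb ((c * L) *: e - rho S w0).
  have -> : (c * L) *: e - rho S w0 = c *: (L *: e - rho S w) + (c *: rho S w - rho S w0).
    by rewrite scalerBr scalerA addrA subrK.
  apply: CbD up; apply: CbZ; first exact: ltW.
  by apply/OmW/hA; rewrite ltrDl.
have O0 : Cb (rho S w0) by rewrite r0; exact/TCb/OmW/eOmP/(TV Tt).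
(* A vector bounded by [Y1] lies between -Y e and Y e, so its image under t^{-1} lies between -Y
   rho(w0) and Y rho(w0), an interval already bounded. *)
have bd (h : 'cV[R]_m) : `|h| <= Y1 -> `|invmx t *m h| <= M1.
  move=> hY.
  have half (h' : 'cV[R]_m) : `|h'| <= Y1 -> Cb ((Y * (c * L)) *: e + invmx t *m h').
    move=> h'Y.
    have -> : (Y * (c * L)) *: e + invmx t *m h' = Y *: ((c * L) *: e - rho S w0)
        + invmx t *m (Y *: e - (- h')).
      rewrite opprK mulmxDr -scalemxAr -r0.
      by rewrite (scalerBr Y ((c * L) *: e) (rho S w0)) scalerA addrA subrK.
    apply: CbD; first by apply: CbZ => //; exact: ltW.
    apply: TCb (TV Tt) _; apply/OmW/hA; rewrite normrN.
    by rewrite (@le_lt_trans _ _ (A * Y1)) ?ltrDl// ler_wpM2l ?(ltW A0).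
  apply: hM1; first exact: half.
  by rewrite -mulmxN; apply: half; rewrite normrN.
have u1 : u.1 = g *m (w.1 - w0.1) by rewrite /u aff_fst mulmxBr.
have u1c : rnorm u.1 <= c by rewrite (le_trans (rnorm_fst _)).
have tgV z : re_mx (Phi z z) = invmx t *m re_mx (Phi (g *m z) (g *m z)).
  by rewrite -tg re_cplx_mul mulKmx//.
(* From x^2 <= y follows x <= y + 1, which spares a square root. *)
have z1 : rnorm (w.1 - w0.1) <= M1 / k + 1.
  have h : k * rnorm (w.1 - w0.1) ^+ 2 <= M1.
    apply: (le_trans (hk _)); rewrite tgV -u1; apply: bd.
    rewrite (le_trans (re_mx_le _))// (le_trans (hM _ _))//.
    apply: (@le_trans _ _ (M0 * c * c)); last by rewrite /Y1 lerDr ltW ?addr_gt0.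
    by apply: ler_pM; rewrite ?mulr_ge0 ?rnorm_ge0 ?(ltW M00)// ler_wpM2l ?(ltW M00).
  have {}h : rnorm (w.1 - w0.1) ^+ 2 <= M1 / k by rewrite ler_pdivlMr// mulrC.
  have := rnorm_ge0 (w.1 - w0.1); move: h; move: (rnorm _) (M1 / k) => x y; nra.
have w01 : rnorm w0.1 <= Z.
  have -> : w0.1 = w.1 - (w.1 - w0.1) by rewrite opprB addrC subrK.
  by rewrite (le_trans (rnormD _ _))// rnormN lerD2l.
have w03 : `|rho S w0| <= M2.
  apply: hM2; last exact: upe.
  apply: CbD O0; apply: CbZ; last exact/OmW/eOmP.
  by rewrite mulr_ge0 ?ltW.
apply: hc'.
- by move: w01; lra.
- suff : `|re_mx w0.2| <= X by lra.
  have -> : re_mx w0.2 = re_mx w.2 - re_mx ((2 * 'i%C) *: Phi w.1 w0.1) - invmx t *m re_mx u.2.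
    rewrite /u aff_re /z0 /x0 PhiNr -tg PhiN PhiNr opprK -tg.
    rewrite scalerN.
    have -> : re_mx (- ((2 * 'i%C) *: (cplx t 0 *m Phi w.1 w0.1))) = - (t *m re_mx ((2 * 'i%C) *: Phi w.1 w0.1)).
      by rewrite -re_cplx_mul -scalemxAr re_mxN.
    rewrite (scalemxAr 'i%C) re_cplx_mul.
    have -> : re_mx ('i%C *: Phi w0.1 w0.1) = 0.
      have /matrixP im0 := Phi_diag_real S w0.1.
      apply/matrixP => i j; have := im0 i j; rewrite !mxE.
      by case: (Phi w0.1 w0.1 i j) => p q /= ->; rewrite mul0r mul1r subr0.
    rewrite mulmx0 addr0 !mulmxDr !mulmxN !mulKmx//.
    by rewrite subKr.
  apply: (le_trans (ler_normB _ _)); apply: lerD; last first.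
    apply: bd; rewrite (le_trans (re_mx_le _))// (le_trans (rnorm_snd _))// (le_trans uc)//.
  apply: (le_trans (ler_normB _ _)); rewrite lerD2l.
  rewrite (le_trans (re_mx_le _))// rnormZ Normc.normcM normcI mulr1.
  have -> : nc 2 = 2 by rewrite -[2 : C](rmorph_nat (real_complex R)) normc_real ger0_norm.
  rewrite ler_wpM2l// (le_trans (hM _ _))// ler_wpM2l ?mulr_ge0 ?rnorm_ge0 ?(ltW M00)//.
- by move: w03; lra.
have -> : rho S w0 - (Y^-1 * a) *: e = Y^-1 *: (invmx t *m (Y *: e - rho S u)) + Y^-1 *: (rho S w - a *: e).
  rewrite mulmxBr -rw -scalemxAr -r0 -scalerDr addrA subrK scalerBr !scalerA mulVf ?gt_eqF//.
  by rewrite scale1r.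
have Yi : 0 <= Y^-1 by rewrite invr_ge0 ltW.
apply: CbD; (apply: CbZ; first exact: Yi); last exact: OmW ha.
apply: TCb (TV Tt) _; apply/OmW/hA.
apply: (@le_lt_trans _ _ (A * Y1)); last by rewrite /Y ltrDl.
by apply: ler_wpM2l; [exact: ltW|exact: le_trans (h3 _ uc) BY1].
Qed.

Lemma pointwise (q : \bar R) s : (0 < q)%E -> exists2 K : R, 0 < K & forall F w (M : R),
  Hol S F -> domain S w -> (Lpq_norm S q q s F <= M%:E)%E ->
  nc (F w) * expR (LD (rho S w) s - fine q^-1 * LD (rho S w) (bvec S + dvec S)) <= K * M.
Proof.
case: q => [q| |//] q0.
  rewrite lte_fin in q0; have [K K0 hK] := @pointwise_fin _ _ _ _ S q s q0.
  exists K => // F w M hF Dw hM; have [t [g [Tt ug tg wE tD]]] := aff_exists Dw.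
  have := hK t g w.1 (re_mx w.2) F M Tt ug tg hF hM; rewrite wE !tD fine_invr.
  rewrite -(ler_pM2r (expR_gt0 (LD (rho S w) s - q^-1 * LD (rho S w) (bvec S + dvec S)))).
  move/le_trans; apply.
  set x := lnDeltaOm _ _ (_ + _); set y := lnDeltaOm _ _ _.
  have -> : K * expR (q^-1 * x - y) * M * expR (y - q^-1 * x) = K * M * (expR (q^-1 * x - y) * expR (y - q^-1 * x)).
    by ring.
  have -> : expR (q^-1 * x - y) * expR (y - q^-1 * x) = 1.
    by rewrite -expRD -[RHS]expR0; congr expR; ring.
  by rewrite mulr1.
have [K K0 hK] := @pointwise_infty _ _ _ _ S s.
exists K => // F w M hF Dw hM.
have -> : fine (+oo^-1 : \bar R)%E = 0 by [].
by rewrite mul0r subr0; exact: hK.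
Qed.

End proper.

(** * The complex exponential *)

Section complex_exponential.
Context {R : realType}.
Local Notation C := R[i].
Local Notation nc := (@Normc.normc R).

Lemma is_derive_eps (f : R -> R) x l : is_derive x (1 : R) f l ->
  forall e, 0 < e -> exists2 d, 0 < d & forall h, `|h| < d -> `|f (h + x) - f x - l * h| <= e * `|h|.
Proof.
move=> [df <-] e e0.
have : (fun h => h^-1 *: ((f \o shift x) (h *: (1 : R)) - f x)) @ 0^' --> 'D_1 f x := df.
move=> /cvgrPdist_le/(_ _ e0)/nbhs_ballP[d /= d0 hd]; exists d => // h hh.
have [->|h0] := eqVneq h 0; first by rewrite add0r subrr mulr0 subrr !normr0 mulr0.
have := hd h; rewrite -ball_normE /= sub0r normrN => /(_ hh h0).
rewrite /shift /= [h *: 1]mulr1 => H.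
have hp : 0 < `|h| by rewrite normr_gt0.
rewrite -(ler_pM2r hp) -normrM in H.
move: H; congr (_ <= _); rewrite -normrN; congr `|_|.
rewrite mulrBl opprB; congr (_ - _).
by rewrite [h^-1 *: _]/(h^-1 * _) mulrC mulrA mulfV// mul1r.
Qed.

Lemma cexpD (z w : C) : cexp (z + w) = cexp z * cexp w.
Proof.
case: z w => [a b] [c d]; rewrite /cexp /= expRD cosD sinD.
by apply/eqP; rewrite eq_complex /= !mul0r; apply/andP; split; apply/eqP; ring.
Qed.

Lemma normc_cexp (z : C) : nc (cexp z) = expR (complex.Re z).
Proof.
rewrite /cexp Normc.normcM normc_real ger0_norm ?expR_ge0//.
by rewrite /Normc.normc cos2Dsin2 sqrtr1 mulr1.
Qed.

Lemma cexp_neq0 (z : C) : cexp z != 0.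
Proof.
apply/eqP => z0; have := expR_gt0 (complex.Re z).
by rewrite -normc_cexp z0 Normc.normc0 ltxx.
Qed.

(** The first order expansions of exp, cos and sin at 0, multiplied out; the errors add up to at
    most 9 sixteenths of e |w|. Additivity then carries the derivative from 0 to every point. *)
Lemma cexp_first_order (e : R) : 0 < e -> exists2 d, 0 < d & forall w : C, nc w < d ->
  nc (cexp w - 1 - w) <= e * nc w.
Proof.
move=> e0; pose e1 := Num.min 1 (e / 16).
have e10 : 0 < e1 by rewrite lt_min ltr01 divr_gt0.
have e11 : e1 <= 1 by rewrite ge_min lexx.
have e16 : e1 <= e / 16 by rewrite ge_min lexx orbT.
move: e10 e11 e16; move: (e1) => {}e1 e10 e11 e16.
have [d1 d10 h1] := is_derive_eps (is_derive_expR (0 : R)) e10.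
have [d2 d20 h2] := is_derive_eps (is_derive_cos (0 : R)) e10.
have [d3 d30 h3] := is_derive_eps (is_derive_sin (0 : R)) e10.
exists (Num.min (Num.min d1 d2) (Num.min d3 e1)); first by rewrite !lt_min d10 d20 d30 e10.
move=> w; rewrite !lt_min => /andP[/andP[w1 w2] /andP[w3 we]].
have xw := absRe_le_normc w; have yw := absIm_le_normc w.
have := h1 _ (le_lt_trans xw w1); have := h2 _ (le_lt_trans yw w2).
have := h3 _ (le_lt_trans yw w3).
rewrite !addr0 expR0 cos0 sin0 subr0 mul1r oppr0 mul0r subr0 mul1r.
have : complex.Im (cexp w - 1 - w) = expR (complex.Re w) * sin (complex.Im w) - complex.Im w.
  by rewrite /cexp; case: (w) => a b /=; ring.
have : complex.Re (cexp w - 1 - w) = expR (complex.Re w) * cos (complex.Im w) - 1 - complex.Re w.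
  by rewrite /cexp; case: (w) => a b /=; ring.
set x := complex.Re w in xw *; set y := complex.Im w in yw *; set N := nc w in we xw yw *.
move=> ReE ImE hs hc he.
have N0 : 0 <= N by exact: normc_ge0.
apply: (le_trans (normc_le_ReIm _)); rewrite ReE ImE.
set E := expR x in he *; set c := cos y in hc *; set s := sin y in hs *.
have xe : `|x| <= 1 by rewrite (le_trans xw)// (le_trans (ltW we)).
have E3 : `|E| <= 3.
  have -> : E = (E - 1 - x) + (1 + x) by ring.
  apply: (le_trans (ler_normD _ _)); have := ler_normD 1 x; rewrite normr1.
  have : e1 * `|x| <= 1 * 1 by apply: ler_pM => //; exact: ltW.
  by move: he xe; lra.
have E1 : `|E - 1| <= 2 * `|x|.
  have -> : E - 1 = (E - 1 - x) + x by ring.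
  apply: (le_trans (ler_normD _ _)).
  have : e1 * `|x| <= 1 * `|x| by apply: ler_wpM2r.
  by move: he; lra.
have eN (u : R) : `|u| <= N -> e1 * `|u| <= e / 16 * N.
  by move=> uN; apply: ler_pM => //; exact: ltW.
have P1 : `|E * c - 1 - x| <= 4 * (e / 16 * N).
  have -> : E * c - 1 - x = (E - 1 - x) + E * (c - 1) by ring.
  apply: (le_trans (ler_normD _ _)); rewrite normrM.
  have : `|E| * `|c - 1| <= 3 * (e / 16 * N).
    by apply: ler_pM => //; exact: le_trans hc (eN _ yw).
  by have := le_trans he (eN _ xw); lra.
have P2 : `|E * s - y| <= 5 * (e / 16 * N).
  have -> : E * s - y = E * (s - y) + (E - 1) * y by ring.
  apply: (le_trans (ler_normD _ _)); rewrite !normrM.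
  have : `|E| * `|s - y| <= 3 * (e / 16 * N).
    by apply: ler_pM => //; exact: le_trans hs (eN _ yw).
  have : `|E - 1| * `|y| <= (2 * (e / 16)) * N.
    apply: ler_pM => //; apply: (le_trans E1); rewrite ler_pM2l//.
    by rewrite (le_trans xw)// (le_trans (ltW we)).
  lra.
have : 0 <= e * N by rewrite mulr_ge0// ltW.
by move: P1 P2; lra.
Qed.

Lemma cdiff_cexp (z : C) : cdiff (@cexp R) z (cexp z).
Proof.
move=> e e0; have p := expR_gt0 (complex.Re z).
have [d d0 hd] := cexp_first_order (divr_gt0 e0 p).
exists d => // w wz.
have -> : cexp w - cexp z - cexp z * (w - z) = cexp z * (cexp (w - z) - 1 - (w - z)).
  by rewrite -{1}(subrK z w) addrC cexpD; ring.
rewrite Normc.normcM normc_cexp mulrC -ler_pdivlMr// (le_trans (hd _ wz))//.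
by rewrite mulrAC.
Qed.

Lemma differentiable_cexp (z : C) : differentiable (@cexp R : C -> C) z.
Proof.
apply/derivable1_diffP; apply: (@cdiff_derivable R C _ z 1 (cexp z * 1) _).1.
apply: (@eq_cdiff R (fun s => cexp (z + 1 * s)) _ _ _ 1) => // [w _|].
  by rewrite mul1r [w *: 1]mulr1.
by apply: cdiff_affine; rewrite mulr0 addr0; exact: cdiff_cexp.
Qed.

End complex_exponential.

(** * Differentiability of products and quotients *)

Section differentiability.
Context {R : realType}.
Local Notation C := R[i].
Variable V : normedModType C.
Implicit Types F G : V -> C.

(** Functions that agree near [w] have the same expansion there; this handles functions extended by
    0 outside the domain. *)
Lemma eq_differentiable F G w (d : R) : 0 < d -> (forall v, rnorm (v - w) < d -> F v = G v) ->
  differentiable F w -> differentiable G w.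
Proof.
move=> d0 FG dF; have [cd H] := (diff_locallyP _ _).1 dF.
have E : G \o shift w = cst (G w) + 'd F w +o_ (0 : V) id.
  apply/eqaddoP => eps eps0; have := (eqaddoP _ _ _ _).1 H eps eps0.
  have Fw : F w = G w by apply: FG; rewrite subrr rnorm0.
  have nF : \forall h \near (0 : V), F (h + w) = G (h + w).
    apply/nbhs_rnormP; exists d => // h; rewrite subr0 => hd; apply: FG.
    by rewrite addrK.
  apply: filterS2 nF => h hF; rewrite /= !fctE /= hF Fw.
  by [].
have dG := diff_unique cd E.
by apply: (diff_locallyP _ _).2; split; rewrite dG; [exact: cd|exact: E].
Qed.

Lemma differentiable_bigprod (I : Type) (s : seq I) (F : I -> V -> C) w :
  (forall i, differentiable (F i) w) -> differentiable (fun v => \prod_(i <- s) F i v) w.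
Proof.
move=> dF; elim: s => [|i s IH].
  have -> : (fun v => \prod_(i <- [::]) F i v) = cst 1 by apply/funext => v; rewrite big_nil.
  exact: differentiable_cst.
have -> : (fun v => \prod_(j <- i :: s) F j v) = F i * (fun v => \prod_(j <- s) F j v).
  by apply/funext => v; rewrite big_cons.
by apply: differentiableM.
Qed.

Lemma differentiable_mul F G w : differentiable F w -> differentiable G w ->
  differentiable (fun v => F v * G v) w.
Proof. by move=> dF dG; exact: (differentiableM dF dG). Qed.

Lemma differentiable_inv F w : differentiable F w -> F w != 0 ->
  differentiable (fun v => (F v)^-1) w.
Proof. exact: differentiableV. Qed.

Lemma differentiable_exp F w k : differentiable F w -> differentiable (fun v => F v ^+ k) w.
Proof.
move=> dF; have := @differentiable_bigprod _ (iota 0 k) (fun=> F) w (fun=> dF).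
by under eq_fun do rewrite big_const_seq count_predT size_iota iter_mulr_1.
Qed.

End differentiability.

(** * An integrable weight on N *)

Section integrable_weight.
Context {R : realType}.
Local Notation lam := (lebesgue_cV (R := R)).
Local Notation Nt n m := ('cV[R]_n * 'cV[R]_n * 'cV[R]_m)%type.

(** A product of unnormalised Cauchy densities: at most 1, integrable, and small as soon as one
    coordinate is large. *)
Definition Jw k (x : 'cV[R]_k) : R := \prod_(i < k) (1 + x i ord0 ^+ 2)^-1.

Lemma onesq_ge1 (x : R) : 1 <= 1 + x ^+ 2. Proof. by rewrite lerDl sqr_ge0. Qed.

Lemma onesq_gt0 (x : R) : 0 < 1 + x ^+ 2.
Proof. exact: lt_le_trans ltr01 (onesq_ge1 x). Qed.

Lemma Jw_gt0 k (x : 'cV[R]_k) : 0 < Jw x.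
Proof. by apply: prodr_gt0 => i _; rewrite invr_gt0 onesq_gt0. Qed.

Lemma Jw_le1 k (x : 'cV[R]_k) : Jw x <= 1.
Proof.
apply: prodr_ile1 => i _; rewrite invr_ge0 ltW ?onesq_gt0//=.
by rewrite invf_le1 ?onesq_ge1// onesq_gt0.
Qed.

Lemma Jw_coord k (x : 'cV[R]_k) i : Jw x <= (1 + x i ord0 ^+ 2)^-1.
Proof.
rewrite /Jw (bigD1 i)//= ler_piMr ?invr_ge0 ?(ltW (onesq_gt0 _))//.
apply: prodr_ile1 => j _; rewrite invr_ge0 ltW ?onesq_gt0//=.
by rewrite invf_le1 ?onesq_ge1// onesq_gt0.
Qed.

Lemma Jw_norm k (x : 'cV[R]_k) (eta : R) : 0 < eta -> eta <= Jw x -> `|x| <= eta^-1.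
Proof.
move=> e0 ex; apply: cV_norm_le => [|i]; first by rewrite invr_ge0 ltW.
have := le_trans ex (Jw_coord x i); rewrite -[leLHS]invrK lef_pV2 ?posrE ?invr_gt0 ?onesq_gt0//.
have := sqr_ge0 (`|x i ord0| - 1); rewrite sqrrB1 real_normK ?num_real//.
have := normr_ge0 (x i ord0); have := sqr_ge0 (x i ord0); lra.
Qed.

(** A common bound on the factors 1 + x_i^2 multiplies to a bound of 1 / Jw by the k-th power of q /
    c. *)
Lemma Jw_lower k (x : 'cV[R]_k) (c q : R) : 0 <= c -> (forall i, c * (1 + x i ord0 ^+ 2) <= q) ->
  c ^+ k <= q ^+ k * Jw x.
Proof.
move=> c0 h; have -> : c ^+ k = \prod_(i < k) c by rewrite prodr_const card_ord.
have -> : q ^+ k = \prod_(i < k) q by rewrite prodr_const card_ord.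
rewrite /Jw -big_split /=; apply: ler_prod => i _; rewrite c0 /=.
by rewrite ler_pdivlMr ?onesq_gt0.
Qed.

Lemma measurable_onesq : measurable_fun setT (fun x : R => (1 + x ^+ 2)^-1).
Proof.
apply: continuous_measurable_fun => x.
apply: cvgV; first by rewrite gt_eqF// onesq_gt0.
by apply: cvgD; [exact: cvg_cst|exact: exprn_continuous].
Qed.

Lemma measurable_Jw k : measurable_fun setT (@Jw k : 'cV[R]_k -> measurableTypeR R).
Proof.
rewrite /Jw; elim: (index_enum _) => [|i s IH].
  have -> : (fun x : 'cV[R]_k => \prod_(i <- [::]) (1 + x i ord0 ^+ 2)^-1) = cst 1.
    by apply/funext => y; rewrite big_nil.
  exact: measurable_cst.
have -> : (fun x : 'cV[R]_k => \prod_(j <- i :: s) (1 + x j ord0 ^+ 2)^-1) =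
    (fun x => (1 + x i ord0 ^+ 2)^-1 * \prod_(j <- s) (1 + x j ord0 ^+ 2)^-1).
  by apply/funext => y; rewrite big_cons.
apply: measurable_funM IH.
exact: (measurableT_comp measurable_onesq (measurable_coord (R := R) (k := k) i)).
Qed.

Lemma integral_onesq : (\int[@lebesgue_measure R]_x ((1 + x ^+ 2)^-1)%:E < +oo)%E.
Proof.
rewrite (@ge0_symfun_integralT R (fun x => (1 + x ^+ 2)^-1)); last 3 first.
- by move=> x; rewrite invr_ge0 ltW// onesq_gt0.
- move=> x; apply: cvgV; first by rewrite gt_eqF// onesq_gt0.
  by apply: cvgD; [exact: cvg_cst|exact: exprn_continuous].
- by move=> x /=; rewrite sqrrN.
have -> : [set x : R | 0 <= x] = `[0, +oo[%classic.
  by apply/seteqP; split => x /=; rewrite in_itv /= andbT.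
by have := @integral0y_oneDsqr R; rewrite /oneDsqr => ->; rewrite -EFinM ltry.
Qed.

Lemma integral_prod d1 d2 (X : measurableType d1) (Y : measurableType d2)
    (m1 : {sigma_finite_measure set X -> \bar R}) (m2 : {sigma_finite_measure set Y -> \bar R})
    (f : X -> R) (g : Y -> R) :
  measurable_fun setT (f : X -> measurableTypeR R) -> measurable_fun setT (g : Y -> measurableTypeR R) ->
  (forall x, 0 <= f x) -> (forall y, 0 <= g y) ->
  (\int[m1]_x (f x)%:E < +oo)%E -> (\int[m2]_y (g y)%:E < +oo)%E ->
  (\int[m1 \x m2]_z (f z.1 * g z.2)%:E < +oo)%E.
Proof.
move=> mf mg f0 g0 If Ig.
have mfg : measurable_fun setT (fun z : X * Y => (f z.1 * g z.2)%:E).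
  apply/measurable_EFinP; apply: measurable_funM.
    exact: measurableT_comp mf measurable_fst.
  exact: measurableT_comp mg measurable_snd.
rewrite (fubini_tonelli1 _ mfg) => [|z]; last by rewrite lee_fin mulr_ge0.
rewrite /fubini_F.
have [I IE] : exists I : R, (\int[m2]_x (g x)%:E)%E = I%:E.
  exists (fine (\int[m2]_x (g x)%:E)%E); rewrite fineK// ge0_fin_numE//.
  by apply: integral_ge0 => x _; rewrite lee_fin.
have I0 : 0 <= I by rewrite -lee_fin -IE; apply: integral_ge0 => x _; rewrite lee_fin.
have inner x : (\int[m2]_y (f x * g y)%:E = I%:E * (f x)%:E)%E.
  under eq_integral do rewrite EFinM.
  rewrite (@ge0_integralZl_EFin _ _ _ m2 setT measurableT (fun y => (g y)%:E)).
  - by rewrite IE muleC.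
  - by move=> y _; rewrite lee_fin.
  - exact/measurable_EFinP.
  - exact: f0.
rewrite (eq_integral (fun x => I%:E * (f x)%:E)%E) => [|x _]; last exact: inner.
rewrite (@ge0_integralZl_EFin _ _ _ m1 setT measurableT (fun x => (f x)%:E) _ _ I I0).
- by apply: lte_mul_pinfty => //; rewrite lee_fin.
- by move=> x _; rewrite lee_fin.
- exact/measurable_EFinP.
Qed.

Lemma integral_Jw k : (\int[lam k]_x (Jw x)%:E < +oo)%E.
Proof.
elim: k => [|k IH].
  rewrite (eq_integral (cst 1%E)); last by move=> x _; rewrite /Jw big_ord0.
  apply: (@le_lt_trans _ _ (1 * lam 0 setT)%E); last by rewrite mul1e lebesgue_cV0T ltry.
  by rewrite -(integral_cst _ measurableT).
have mJ := @measurable_Jw k; have mJ1 := @measurable_Jw k.+1.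
have -> : (\int[lam k.+1]_x (Jw x)%:E =
    \int[pushforward (@lebesgue_measure R \x lam k) (@consv R k)]_x (Jw x)%:E)%E.
  apply: eq_measure_integral; [exact: measurable_consv|move=> ? A mA _].
  by first [exact: (@lebesgue_cVS R k A mA)|exact: esym (@lebesgue_cVS R k A mA)].
rewrite (@ge0_integral_pushforward _ _ _ _ R (@consv R k) (@measurable_consv R k)
  (@lebesgue_measure R \x lam k)%E setT (fun x => (Jw x)%:E)) //; last 2 first.
- exact/measurable_EFinP.
- by move=> x _; rewrite lee_fin ltW// Jw_gt0.
rewrite preimage_setT.
pose f (z : measurableTypeR R * 'cV[R]_k) := (((1 + z.1 ^+ 2)^-1)%:E * (Jw z.2)%:E)%E.
have fE z : ((fun x => (Jw x)%:E) \o @consv R k) z = f z.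
  rewrite /f /= -EFinM /Jw big_ord_recl consvE0; congr (_ * _)%:E.
  by apply: eq_bigr => i _; rewrite consvES.
rewrite (eq_integral f) => [|z _]; last exact: fE.
apply: (@integral_prod _ _ _ _ (@lebesgue_measure R) (lam k) (fun x => (1 + x ^+ 2)^-1) (@Jw k)) => //.
- exact: measurable_onesq.
- by move=> x; rewrite invr_ge0 ltW// onesq_gt0.
- by move=> x; rewrite ltW// Jw_gt0.
- exact: integral_onesq.
Qed.

Definition Jn n m (v : Nt n m) : R := Jw v.1.1 * Jw v.1.2 * Jw v.2.

Lemma Jn_gt0 n m (v : Nt n m) : 0 < Jn v. Proof. by rewrite !mulr_gt0 ?Jw_gt0. Qed.

Lemma Jn_le n m (v : Nt n m) : Jn v <= Jw v.1.1 /\ (Jn v <= Jw v.1.2 /\ Jn v <= Jw v.2).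
Proof.
rewrite /Jn; have := Jw_gt0 v.1.1; have := Jw_gt0 v.1.2; have := Jw_gt0 v.2.
have := Jw_le1 v.1.1; have := Jw_le1 v.1.2; have := Jw_le1 v.2.
move: (Jw v.1.1) (Jw v.1.2) (Jw v.2) => a b c c1 b1 a1 c0 b0 a0.
have ab1 : a * b <= 1 by rewrite -[1]mulr1 ler_pM// ltW.
split; last split.
- by rewrite -mulrA ler_piMr ?(ltW a0)// -[1]mulr1 ler_pM// ltW.
- by rewrite mulrAC ler_piMl ?(ltW b0)// -[1]mulr1 ler_pM// ltW.
- by rewrite ler_piMl ?(ltW c0).
Qed.

Lemma Jn_le1 n m (v : Nt n m) : Jn v <= 1.
Proof. exact: le_trans (Jn_le v).1 (Jw_le1 _). Qed.

Lemma measurable_Jn n m : measurable_fun setT (@Jn n m : _ -> measurableTypeR R).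
Proof.
apply: measurable_funM; first apply: measurable_funM.
- exact: measurableT_comp (@measurable_Jw n) (measurableT_comp measurable_fst measurable_fst).
- exact: measurableT_comp (@measurable_Jw n) (measurableT_comp measurable_snd measurable_fst).
- exact: measurableT_comp (@measurable_Jw m) measurable_snd.
Qed.

Lemma integral_Jn n m : (\int[lebN n m]_v (Jn v)%:E < +oo)%E.
Proof.
apply: (@integral_prod _ _ _ _ (lebE n) (lam m) (fun z => Jw z.1 * Jw z.2) (@Jw m)).
- apply: measurable_funM.
    exact: measurableT_comp (@measurable_Jw n) measurable_fst.
  exact: measurableT_comp (@measurable_Jw n) measurable_snd.
- exact: measurable_Jw.
- by move=> z; rewrite mulr_ge0// ltW// Jw_gt0.
- by move=> z; rewrite ltW// Jw_gt0.
- apply: (@integral_prod _ _ _ _ (lam n) (lam n) (@Jw n) (@Jw n)); try exact: measurable_Jw.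
  + by move=> x; rewrite ltW// Jw_gt0.
  + by move=> x; rewrite ltW// Jw_gt0.
  + exact: integral_Jw.
  + exact: integral_Jw.
- exact: integral_Jw.
Qed.

(** Since Jn <= 1, its power of exponent K p >= 1 is at most [Jn], which is integrable. *)
Lemma Jn_norm n m (p : \bar R) (c : R) K : (0 < p)%E -> 0 <= c -> 1 <= K%:R * fine p \/ p = +oo%E ->
  (Lnorm (haarN (R := R) (n := n) (m := m)) p (fun v => (c * Jn v ^+ K)%:E) < +oo)%E.
Proof.
move=> p0 c0 pK; apply: Lnorm_fin_bound => //.
have J0 (v : Nt n m) : 0 <= c * Jn v ^+ K :> R by rewrite mulr_ge0// exprn_ge0// ltW// Jn_gt0.
case: p p0 pK => [p| |//] p0 pK; last first.
  exists c => v; rewrite abse_EFin (ger0_norm (J0 v)) lee_fin; apply: ler_piMr => //.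
  by apply: exprn_ile1; [exact/ltW/Jn_gt0|exact: Jn_le1].
case: pK => [/= pK|//]; rewrite lte_fin in p0.
apply: (@le_lt_trans _ _ (\int[lebN n m]_v ((c `^ p)%:E * (Jn v)%:E))%E).
  apply: le_integral_ge0 => v; first by rewrite lee_fin powR_ge0.
  have lJ : ln (Jn v) <= 0 by rewrite -ln1 ler_ln ?posrE ?Jn_le1// Jn_gt0.
  rewrite (ger0_norm (J0 v)) -EFinM lee_fin powRM ?exprn_ge0 ?(ltW (Jn_gt0 _))//.
  apply: ler_wpM2l; first exact: powR_ge0.
  rewrite -powR_mulrn ?(ltW (Jn_gt0 _))// -powRrM -[leRHS]powRr1 ?(ltW (Jn_gt0 _))//.
  have pw z : Jn v `^ z = expR (z * ln (Jn v)) by rewrite /powR gt_eqF ?Jn_gt0.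
  have pK' : 1 <= K%:R * p := pK.
  rewrite !pw ler_expR -subr_ge0 -mulrBl -mulrNN.
  by apply: mulr_ge0; rewrite oppr_ge0// subr_le0.
rewrite (@ge0_integralZl_EFin _ _ _ (lebN n m) setT measurableT (fun v => (Jn v)%:E)).
- by apply: lte_mul_pinfty; rewrite ?lee_fin ?powR_ge0//; exact: integral_Jn.
- by move=> v _; rewrite lee_fin ltW// Jn_gt0.
- by apply/measurable_EFinP; exact: (@measurable_Jn n m).
- exact: powR_ge0.
Qed.

End integrable_weight.

(** * A holomorphic function without zeros and with decay *)

Section test_function.
Context {R : realType} {n m r : nat} (S : siegel_domain R n m r).
Local Notation C := R[i].
Local Notation nc := (@Normc.normc R).
Local Notation point := ('cV[C]_n * 'cV[C]_m)%type.
Local Notation Nt := ('cV[R]_n * 'cV[R]_n * 'cV[R]_m)%type.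
Local Notation Om := (Om S).
Local Notation Cb := (closure (Defs.Om S)).
Local Notation e := (eOm S).
Local Notation e' := (eOm' S).
Local Notation Phi := (Phi S).
Local Notation LD := (lnDeltaOm S).

Definition cpair (l : 'cV[R]_m) (z : 'cV[C]_m) : C := \sum_i (l i ord0)%:C%C * z i ord0.

Lemma cpair_re l z : complex.Re (cpair l z) = pairing l (re_mx z).
Proof.
rewrite /cpair (big_morph (@complex.Re R) (id1 := 0) (op1 := +%R)) => [|[a b] [c d]//|//].
by apply: eq_bigr => i _; rewrite Re_mul_real mxE.
Qed.

Lemma cpair_im l z : complex.Im (cpair l z) = pairing l (im_mx z).
Proof.
rewrite /cpair (big_morph (@complex.Im R) (id1 := 0) (op1 := +%R)) => [|[a b] [c d]//|//].
by apply: eq_bigr => i _; rewrite mxE; case: (z i ord0) => a b /=; rewrite mul0r addr0.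
Qed.

Lemma cpair_linear l : linear (fun w : point => cpair l w.2 : C).
Proof.
move=> a u v; rewrite /cpair scaler_sumr -big_split /=; apply: eq_bigr => i _.
by rewrite !mxE mulrDr; congr (_ + _); rewrite mulrCA.
Qed.

Lemma cpair_differentiable l w : differentiable (fun w : point => cpair l w.2 : C) w.
Proof.
pose B := \sum_i `|l i ord0| + 1.
have B0 : 0 < B by rewrite ltr_wpDl// sumr_ge0.
apply: (bounded_linear_differentiable _ (@cpair_linear l) B0) => v.
rewrite rnorm_normc; apply: (le_trans (normc_sum _ _ _)).
apply: (@le_trans _ _ (\sum_i `|l i ord0| * rnorm v)); last first.
  by rewrite -mulr_suml ler_wpM2r ?rnorm_ge0// lerDl.
apply: ler_sum => i _; rewrite Normc.normcM normc_real ler_wpM2l//.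
by rewrite (le_trans (rnorm_coord _ _))// rnorm_snd.
Qed.

(** For [l] in the dual cone Im <l, z> is positive on the domain, so the shift by i keeps the factor
    of modulus at least 1. *)
Definition fac l (w : point) : C := cpair l w.2 + 'i%C.

Lemma fac_differentiable l w : differentiable (fac l) w.
Proof.
have := differentiableD (@cpair_differentiable l w) (differentiable_cst ('i%C : C) w).
exact.
Qed.

Lemma sqr_normc (z : C) : nc z ^+ 2 = complex.Re z ^+ 2 + complex.Im z ^+ 2.
Proof. by case: z => a b; rewrite /Normc.normc sqr_sqrtr// addr_ge0 ?sqr_ge0. Qed.

Lemma fac_sqr l w : nc (fac l w) ^+ 2 = pairing l (re_mx w.2) ^+ 2 +
  (1 + pairing l (re_mx (Phi w.1 w.1)) + pairing l (rho S w)) ^+ 2.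
Proof.
rewrite sqr_normc /fac -cpair_re; congr (_ ^+ 2 + _ ^+ 2).
  by case: (cpair l w.2) => a b /=; rewrite addr0.
rewrite -addrA -pairingDr /rho [X in pairing l X]addrC subrK -cpair_im.
by case: (cpair l w.2) => a b /=; rewrite addrC.
Qed.

Lemma fac_lower l w : Om' S l -> domain S w ->
  1 + pairing l (re_mx w.2) ^+ 2 <= nc (fac l w) ^+ 2 /\
  1 + pairing l (re_mx (Phi w.1 w.1)) <= nc (fac l w) ^+ 2.
Proof.
move=> Ol Dw; rewrite fac_sqr; have := Om'_gt0 Ol Dw.
have := Om'_ge0 Ol (@Phi_diag_Cb _ _ _ _ S w.1).
rewrite -/(rho S w); move: (pairing _ _) (pairing _ _) (pairing _ _) => x y z y0 z0.
by split; nra.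
Qed.

Lemma fac_ge1 l w : Om' S l -> domain S w -> 1 <= nc (fac l w).
Proof.
move=> Ol Dw; have [h _] := fac_lower Ol Dw.
have := sqr_ge0 (pairing l (re_mx w.2)); have := normc_ge0 (fac l w).
by move: h; move: (nc _) (_ ^+ 2) => x y; nra.
Qed.

Lemma prod_ge1 (I : Type) (s : seq I) (P : pred I) (F : I -> R) :
  (forall i, 1 <= F i) -> 1 <= \prod_(i <- s | P i) F i.
Proof.
move=> F1; elim/big_ind : _ => // x y x1 y1.
by rewrite -[1]mulr1 ler_pM.
Qed.

(** The dual cone is open, so small multiples of the basis vectors can be added to its base point;
    the differences with [e'] then recover every coordinate. *)
Lemma dual_frame : exists2 d : R, 0 < d & forall i : 'I_m, Om' S (e' + d *: delta_mx i ord0).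
Proof.
have [d d0 hd] := @Om'_ball _ _ _ S _ (@eOm'_in _ _ _ S).
exists (d / 2); first by rewrite divr_gt0.
move=> i; apply: hd; rewrite addrC addKr; apply/cV_norm_lt => // j; rewrite mxE normrM.
have -> : `|d / 2| = d / 2 by rewrite ger0_norm// divr_ge0// ltW.
apply: (@le_lt_trans _ _ (d / 2)); last by rewrite ltr_pdivrMr// ltr_pMr// ltr1n.
by rewrite ler_piMr ?divr_ge0 ?(ltW d0)// mxE; case: (_ && _); rewrite ?normr1 ?normr0.
Qed.

Definition frame_prod (d : R) (w : point) : C :=
  fac e' w * \prod_(i < m) fac (e' + d *: delta_mx i ord0) w.

Lemma frame_prod_differentiable d w : differentiable (frame_prod d) w.
Proof.
apply: differentiable_mul; first exact: fac_differentiable.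
by apply: differentiable_bigprod => i; exact: fac_differentiable.
Qed.

Section frame.
Variable d : R.
Hypotheses (d0 : 0 < d) (hd : forall i : 'I_m, Om' S (e' + d *: delta_mx i ord0)).

Lemma frame_prod_ge1 w : domain S w -> 1 <= nc (frame_prod d w).
Proof.
move=> Dw; rewrite Normc.normcM normc_prod; apply: mulr_ege1.
  exact: fac_ge1 (@eOm'_in _ _ _ S) Dw.
by apply: prod_ge1 => i; exact: fac_ge1 (hd i) Dw.
Qed.

Lemma frame_prod_fac w : domain S w -> nc (fac e' w) ^+ 2 <= nc (frame_prod d w) ^+ 2.
Proof.
move=> Dw; rewrite ler_sqr ?nnegrE ?normc_ge0// Normc.normcM normc_prod.
rewrite ler_peMr ?normc_ge0//; apply: prod_ge1 => i; exact: fac_ge1 (hd i) Dw.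
Qed.

Lemma frame_prod_fac2 i w : domain S w ->
  nc (fac e' w) ^+ 2 * nc (fac (e' + d *: delta_mx i ord0) w) ^+ 2 <= nc (frame_prod d w) ^+ 2.
Proof.
move=> Dw; rewrite -exprMn ler_sqr ?nnegrE ?mulr_ge0 ?normc_ge0// Normc.normcM normc_prod.
rewrite ler_wpM2l ?normc_ge0// (bigD1 i)//= ler_peMr ?normc_ge0//.
by apply: prod_ge1 => j; exact: fac_ge1 (hd j) Dw.
Qed.

(** The factor of [e'] controls zeta, by coercivity of Phi, as well as <e', x>; with the factor of
    e' + d delta_i it controls x_i. Spending one squared product on each real coordinate yields the
    weight [Jn]. *)
Lemma frame_prod_lower : exists2 c : R, 0 < c & forall v h, Om h ->
  c ^+ (n + n + m) <= (nc (frame_prod d (slice_pt S (v, h))) ^+ 2) ^+ (n + n + m) * Jn v.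
Proof.
have [k k0 hk] := @Phi_coercive _ _ _ _ S.
have [k' k'0 hk'] := Om'_coercive (@eOm'_in _ _ _ S).
pose b := k' * k; have b0 : 0 < b by rewrite mulr_gt0.
(* With Y = X + d x one has d^2 (1 + x^2) = d^2 + (Y - X)^2, which is at most (d^2 + 2) (1 + X^2) (1
   + Y^2). *)
pose c1 := d ^+ 2 / (d ^+ 2 + 2); have d2 : 0 < d ^+ 2 by rewrite exprn_gt0.
have d22 : 0 < d ^+ 2 + 2 by rewrite addr_gt0.
pose c := Num.min c1 (Num.min 1 b).
have c0 : 0 < c by rewrite !lt_min ltr01 b0 divr_gt0.
have cc1 : c <= c1 by rewrite ge_min lexx.
have c11 : c <= 1 by rewrite !ge_min lexx !orbT.
have cb : c <= b by rewrite !ge_min lexx !orbT.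
move: (c) c0 cc1 c11 cb => {}c c0 cc1 c11 cb.
exists c => // v h Oh; set w := slice_pt S (v, h).
have Dw : domain S w by apply/domainE; rewrite slice_pt_rho.
set q := nc _ ^+ 2.
have zeta (a : R) : `|a| <= rnorm w.1 -> c * (1 + a ^+ 2) <= q.
  move=> aw; have [_ H] := fac_lower (@eOm'_in _ _ _ S) Dw.
  apply: (@le_trans _ _ (1 + pairing e' (re_mx (Phi w.1 w.1)))); last first.
    exact: le_trans H (frame_prod_fac Dw).
  have h1 : b * rnorm w.1 ^+ 2 <= pairing e' (re_mx (Phi w.1 w.1)).
    apply: le_trans (hk' _ (@Phi_diag_Cb _ _ _ _ S w.1)).
    by rewrite /b -mulrA ler_wpM2l ?(ltW k'0).
  have h2 : a ^+ 2 <= rnorm w.1 ^+ 2.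
    by rewrite -(real_normK (num_real a)) ler_sqr ?nnegrE ?rnorm_ge0.
  have h3 : c * a ^+ 2 <= b * rnorm w.1 ^+ 2 by apply: ler_pM; rewrite ?sqr_ge0// ltW.
  by rewrite mulrDr mulr1; lra.
have H1 := @Jw_lower R n v.1.1 c q (ltW c0) _; have H2 := @Jw_lower R n v.1.2 c q (ltW c0) _.
have H3 := @Jw_lower R m v.2 c q (ltW c0) _.
have {}H1 : c ^+ n <= q ^+ n * Jw v.1.1.
  apply: H1 => i; apply: zeta; apply: le_trans (cV_coord_le _ _) _.
  by have := re_mx_le w.1; rewrite /w /slice_pt /= re_cplx'.
have {}H2 : c ^+ n <= q ^+ n * Jw v.1.2.
  apply: H2 => i; apply: zeta; apply: le_trans (cV_coord_le _ _) _.
  by have := im_mx_le w.1; rewrite /w /slice_pt /= im_cplx'.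
have {}H3 : c ^+ m <= q ^+ m * Jw v.2.
  apply: H3 => i.
  have [X1 _] := fac_lower (@eOm'_in _ _ _ S) Dw; have [Y1 _] := fac_lower (hd i) Dw.
  have re2 : re_mx w.2 = v.2 by rewrite /w /slice_pt /= re_cplx'.
  rewrite re2 in X1 Y1; rewrite pairingDl pairingZl pairing_delta in Y1.
  apply: le_trans (frame_prod_fac2 i Dw).
  apply: (@le_trans _ _ ((1 + pairing e' v.2 ^+ 2) * (1 + (pairing e' v.2 + d * v.2 i ord0) ^+ 2))); last first.
    by apply: ler_pM => //; rewrite addr_ge0// sqr_ge0.
  move: (pairing e' v.2) (v.2 i ord0) => X x.
  apply: (@le_trans _ _ (c1 * (1 + x ^+ 2))).
    by rewrite ler_wpM2r// addr_ge0// sqr_ge0.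
  rewrite /c1 mulrAC ler_pdivrMr//.
  set Y := X + d * x; have dx : d * x = Y - X by rewrite /Y addrC addKr.
  have -> : d ^+ 2 * (1 + x ^+ 2) = d ^+ 2 + (Y - X) ^+ 2 by rewrite -dx; ring.
  have := sqr_ge0 (X + Y); have := mulr_ge0 (sqr_ge0 X) (sqr_ge0 Y).
  have := mulr_ge0 (ltW d2) (sqr_ge0 X); have := mulr_ge0 (ltW d2) (sqr_ge0 Y).
  have := mulr_ge0 (ltW d2) (mulr_ge0 (sqr_ge0 X) (sqr_ge0 Y)); nra.
have q0 : 0 <= q by exact: sqr_ge0.
rewrite !exprD.
have -> : q ^+ n * q ^+ n * q ^+ m * Jn v =
  (q ^+ n * Jw v.1.1) * (q ^+ n * Jw v.1.2) * (q ^+ m * Jw v.2) by rewrite /Jn; ring.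
have p k1 : 0 <= c ^+ k1 by rewrite exprn_ge0 ?ltW.
by apply: ler_pM => //; [rewrite mulr_ge0|apply: ler_pM].
Qed.

End frame.

(* [e^{i <e', z>}] decays in the cone direction, the negative power of the
   linear factors in the others. *)
Lemma test_function K : exists2 f0 : point -> C,
  Hol S f0 /\ (forall w, domain S w -> f0 w != 0) &
  exists2 C0 : R, 0 < C0 & forall v h, Om h ->
    nc (slice S f0 h v) <= C0 * expR (- pairing e' h) * Jn v ^+ (2 * K).
Proof.
have [d d0 hd] := dual_frame; have [c c0 hc] := frame_prod_lower d0 hd.
(* One power of [Jn] costs 2 D powers of the product, and 2 K powers of [Jn] are wanted: K for the
   norm and K for smallness at infinity. *)
pose D := (n + n + m)%N; pose N := (2 * D * (2 * K))%N.
pose E (w : point) : C := cexp ('i%C * cpair e' w.2) * ((frame_prod d w)^-1) ^+ N.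
pose f0 w := if w \in domain S then E w else 0.
have Q1 w : domain S w -> frame_prod d w != 0.
  move=> Dw; apply/eqP => Q0; have := frame_prod_ge1 hd Dw.
  by rewrite Q0 Normc.normc0 ler10.
have f0E w : domain S w -> f0 w = E w by move=> Dw; rewrite /f0 mem_set.
exists f0; [split|].
- split=> [w nDw|w Dw]; first by rewrite /f0 memNset.
  have [r0 r00 hr] := domain_nbhs Dw.
  apply: (@eq_differentiable _ _ E _ _ r0 r00) => [v vw|]; first by rewrite f0E//; exact: hr.
  apply: differentiable_mul.
    apply: (@differentiable_comp _ _ _ _ (fun w : point => 'i%C * cpair e' w.2 : C) (@cexp R)).
      by apply: differentiable_mul; [exact: differentiable_cst|exact: cpair_differentiable].
    exact: differentiable_cexp.
  apply: differentiable_exp; apply: differentiable_inv; last exact: Q1.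
  exact: frame_prod_differentiable.
- move=> w Dw; rewrite f0E// mulf_neq0 ?cexp_neq0// expf_neq0// invr_neq0//.
  exact: Q1.
exists ((c ^- D) ^+ (2 * K)); first by rewrite exprn_gt0// invr_gt0 exprn_gt0.
move=> v h Oh; rewrite sliceE; set w := slice_pt S (v, h).
have Dw : domain S w by apply/domainE; rewrite slice_pt_rho.
rewrite f0E// Normc.normcM normc_cexp normcX mulrAC mulrC.
apply: ler_pM; rewrite ?exprn_ge0 ?normc_ge0 ?expR_ge0//; last first.
  rewrite ler_expR.
  have -> : complex.Re ('i%C * cpair e' w.2) = - complex.Im (cpair e' w.2).
    by case: (cpair e' w.2) => a b /=; rewrite mul0r mul1r sub0r.
  rewrite cpair_im lerN2.
  have -> : im_mx w.2 = re_mx (Phi w.1 w.1) + h by rewrite /w /slice_pt /= im_cplx'.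
  by rewrite pairingDr lerDr; exact: Om'_ge0 (@eOm'_in _ _ _ S) (@Phi_diag_Cb _ _ _ _ S w.1).
rewrite /N exprM -exprMn.
have q1 := frame_prod_ge1 hd Dw; have q0 : 0 < nc (frame_prod d w) by exact: lt_le_trans ltr01 q1.
have -> : nc (frame_prod d w)^-1 = (nc (frame_prod d w))^-1.
  have qn : nc (frame_prod d w) != 0 by rewrite gt_eqF.
  apply: (mulfI qn).
  by rewrite -Normc.normcM mulfV ?Q1// Normc.normc1 mulfV ?gt_eqF.
apply: lerXn2r; rewrite ?nnegrE ?exprn_ge0 ?invr_ge0 ?(ltW q0)//.
  by rewrite mulr_ge0 ?invr_ge0 ?exprn_ge0 ?(ltW c0)// ltW// Jn_gt0.
have := hc v h Oh; rewrite -/w -/D exprVn exprM.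
set A := (_ ^+ 2) ^+ D => H; have A0 : 0 < A by rewrite !exprn_gt0.
have cD : 0 < c ^+ D by rewrite exprn_gt0.
by rewrite ler_pdivlMl// ler_pdivrMr// mulrC.
Qed.

(** Half of the exponential and half of the powers of [Jn] stay on the right. Where the inequality
    fails the other half exceeds del / C0, which confines the height through [LD_decay] and the
    horizontal variable through [Jw_norm]. *)
Lemma decay_out (f0 : point -> C) (C0 : R) K (sig : 'rV[R]_r) : (0 < K)%N -> 0 < C0 ->
  (forall j, 0 < sig ord0 j) ->
  (forall v h, Om h -> nc (slice S f0 h v) <= C0 * expR (- pairing e' h) * Jn v ^+ (2 * K)) ->
  forall del : R, 0 < del -> exists2 c : R, 0 < c & forall v h, Om h -> ~ Dc S c (slice_pt S (v, h)) ->
    nc (slice S f0 h v) <= del * (expR (- LD h sig - pairing (2^-1 *: e') h) * Jn v ^+ K).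
Proof.
move=> K0 C00 sig0 hf del del0.
have h2 : (0 : R) < 2^-1 by rewrite invr_gt0.
pose l := 2^-1 *: e'; have Ol : Om' S l by apply: Om'Z => //; exact: eOm'_in.
have [B hB] := LD_upper Ol (fun j => ltW (sig0 j)).
pose d1 := del / C0; have d10 : 0 < d1 by rewrite divr_gt0.
have [a a0 ha] := LD_decay (ln d1) Ol sig0.
pose eta := d1 * expR (- B); have eta0 : 0 < eta by rewrite mulr_gt0 ?expR_gt0.
have [c c0 hc] := @Dc_of _ _ _ _ S (eta^-1 + eta^-1 + a^-1) a a0.
exists c => // v h Oh nD; rewrite leNgt; apply/negP => lt; apply: nD.
have J0 := Jn_gt0 v; have J1 := Jn_le1 v.
have JK0 : 0 < Jn v ^+ K by rewrite exprn_gt0.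
have JK1 : Jn v ^+ K <= 1 by rewrite exprn_ile1// ltW.
have key : d1 < expR (LD h sig - pairing l h) * Jn v ^+ K.
  have := lt_le_trans lt (hf v h Oh); rewrite mul2n -addnn exprD.
  have -> : pairing e' h = pairing l h + pairing l h by rewrite -pairingDl -scalerDl (_ : 2^-1 + 2^-1 = 1 :> R) ?scale1r//; field.
  rewrite opprD !expRD !expRN -/l.
  have := expR_gt0 (LD h sig); have := expR_gt0 (pairing l h).
  move: (expR _) (expR _) => y x x0 y0; rewrite /d1 ltr_pdivrMr//.
  have xi : 0 < x^-1 by rewrite invr_gt0.
  have -> : del * (y^-1 * x^-1 * Jn v ^+ K) = (x^-1 * Jn v ^+ K) * y^-1 * del by ring.
  have -> : C0 * (x^-1 * x^-1) * (Jn v ^+ K * Jn v ^+ K) =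
    (x^-1 * Jn v ^+ K) * y^-1 * (y * x^-1 * Jn v ^+ K * C0).
    by field; rewrite !gt_eqF.
  by rewrite ltr_pM2l// !mulr_gt0// invr_gt0.
have key1 : ln d1 <= LD h sig - pairing l h.
  rewrite -ler_expR lnK ?posrE//; apply: ltW; apply: (lt_le_trans key).
  by rewrite ler_piMr ?expR_ge0.
have [h1 h3] := ha h Oh key1.
have key2 : eta <= Jn v.
  apply: (@le_trans _ _ (Jn v ^+ K)).
    rewrite /eta expRN ler_pdivrMr ?expR_gt0// (le_trans (ltW key))// mulrC ler_wpM2l ?(ltW JK0)//.
    by rewrite ler_expR; exact: hB.
  by rewrite -[leRHS]expr1 ler_wiXn2l// ltW.
have [j1 [j2 j3]] := Jn_le v.
have n1 := Jw_norm eta0 (le_trans key2 j1); have n2 := Jw_norm eta0 (le_trans key2 j2).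
have n3 := Jw_norm eta0 (le_trans key2 j3).
have ei : 0 < eta^-1 by rewrite invr_gt0.
have ai : 0 < a^-1 by rewrite invr_gt0.
apply: hc.
- apply: (le_trans (rnorm_le_reim _)); rewrite /slice_pt /= re_cplx' im_cplx'.
  by move: n1 n2 ai; lra.
- by rewrite /slice_pt /= re_cplx'; move: n3 ai ei; lra.
- by rewrite slice_pt_rho; move: h3 ei; lra.
- by rewrite slice_pt_rho.
Qed.

End test_function.

(** * Membership in the spaces with supremum norm *)

Section target_norm.
Context {R : realType} {n m r : nat} (S : siegel_domain R n m r).
Local Notation C := R[i].
Local Notation nc := (@Normc.normc R).
Local Notation point := ('cV[C]_n * 'cV[C]_m)%type.
Local Notation Om := (Om S).
Local Notation e := (eOm S).
Local Notation LD := (lnDeltaOm S).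

Lemma sup_norm_le F sig (c : R) : on_domain S F ->
  (forall w, domain S w -> {for w, continuous F}) -> 0 <= c ->
  (forall w, domain S w -> nc (F w) * expR (LD (rho S w) sig) <= c) ->
  (Lpq_norm S +oo%E +oo%E sig F <= c%:E)%E.
Proof.
move=> oF cF c0 hF; rewrite /Lpq_norm unlock; case: ifPn => [_|_]; last by rewrite lee_fin.
apply/ess_supP; apply: aeW => h /=.
have [Oh|Oh] := pselect (Om h); last by rewrite /weighted_slices sliceN_out// mule0 abse0 lee_fin.
rewrite /weighted_slices DeltaOmE// gee0_abs; last by rewrite mule_ge0 ?lee_fin ?expR_ge0 ?Lnorm_ge0'.
have ex := expR_gt0 (LD h sig).
have -> : c%:E = ((expR (LD h sig))%:E * (c / expR (LD h sig))%:E)%E.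
  by rewrite -EFinM mulrC divfK// gt_eqF.
apply: lee_wpmul2l; first by rewrite lee_fin ltW.
apply/(sliceN_infty _ cF Oh) => v; rewrite lee_fin ler_pdivlMr// sliceE.
have := hF (slice_pt S (v, h)); rewrite slice_pt_rho; apply.
by apply/domainE; rewrite slice_pt_rho.
Qed.

Lemma Apq_infty G sig (c : R) : Hol S G ->
  (forall w, domain S w -> nc (G w) * expR (LD (rho S w) sig) <= c) ->
  Apq S +oo%E +oo%E sig G.
Proof.
move=> hG hc; have cG w (Dw : domain S w) := Hol_continuous hG Dw.
have oG : on_domain S G by case: hG.
have c0 : 0 <= c.
  by apply: le_trans (hc _ (@domain_base _ _ _ _ S)); rewrite mulr_ge0 ?normc_ge0 ?expR_ge0.
split=> //; split=> //; first exact: measurable_on_domainP.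
  exact: weighted_slices_measurable.
by apply: le_lt_trans (sup_norm_le oG cG c0 hc) _; rewrite ltry.
Qed.

Lemma LD_Dc c sig : 0 < c -> exists B : R, forall w, Dc S c w -> LD (rho S w) sig <= B.
Proof.
move=> c0; have [B1 B10 h1] := @rho_bounded _ _ _ _ S c.
have [A A0 hA] := @eOm_absorb _ _ _ S.
have ci : 0 < c^-1 by rewrite invr_gt0.
have b0 : 0 < A * B1 + 1 by rewrite addr_gt0 ?mulr_gt0.
have [B B0 hB] := @LD_interval _ _ _ _ S _ _ sig ci b0.
exists B => w [wc wC].
have := hB e (rho S w) (@eOmP _ _ _ S) wC; rewrite lnDeltaOm_e subr0.
move=> H; apply: le_trans (ler_norm _) (H _); apply/OmW/hA.
apply: (@le_lt_trans _ _ (A * B1)); last by rewrite ltrDl.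
by apply: ler_wpM2l; [exact: ltW|exact: h1].
Qed.

(** The approximation in C_c is the product with a cutoff equal to 1 on a compact set outside which
    the weighted modulus is at most eps / 2. *)
Lemma Apq0_infty G sig : Hol S G ->
  (forall eps : R, 0 < eps -> exists2 c : R, 0 < c & forall w, domain S w -> ~ Dc S c w ->
     nc (G w) * expR (LD (rho S w) sig) <= eps) ->
  Apq0 S +oo%E +oo%E sig G.
Proof.
move=> hG small; split=> //; split.
  have [c c0 hc] := small 1 ltr01.
  have [M hM] := bounded_on_Dc c0 hG; have [B hB] := LD_Dc sig c0.
  have bd w : domain S w -> nc (G w) * expR (LD (rho S w) sig) <= Num.max 1 (`|M| * expR B); last first.
    by have [] := Apq_infty hG bd.
  move=> Dw; rewrite le_max; have [Dcw|nD] := pselect (Dc S c w); last by rewrite hc.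
  apply/orP; right; apply: ler_pM; rewrite ?normc_ge0 ?expR_ge0//.
    exact: le_trans (hM _ Dcw) (ler_norm _).
  by rewrite ler_expR; exact: hB.
move=> eps eps0; have eps2 : 0 < eps / 2 by rewrite divr_gt0.
have [c c0 hc] := small _ eps2.
have [c' c'0 [chi [chi01 chi1 chi0 chiL]]] := @Dc_cutoff _ _ _ _ S _ c0.
have Cphi := cutoff_Cc hG c'0 chi0 chiL.
exists (fun w => (chi w)%:C%C * G w) => //.
apply: (@le_lt_trans _ _ (eps / 2)%:E); last by rewrite lte_fin ltr_pdivrMr// ltr_pMr// ltr1n.
apply: sup_norm_le.
- by move=> w nD; have [oG _] := hG; rewrite oG// mulr0 subrr.
- move=> w Dw; apply: (@cvgB _ _ _ _ _ G (fun w => (chi w)%:C%C * G w)).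
    exact: (Hol_continuous hG Dw).
  by case: Cphi => + _; apply.
- exact: ltW.
move=> w Dw; have -> : G w - (chi w)%:C%C * G w = (1 - chi w)%:C%C * G w.
  by rewrite rmorphB rmorph1 mulrBl mul1r.
have /andP[x0 x1] := chi01 w.
rewrite Normc.normcM normc_real ger0_norm ?subr_ge0//.
have [Dcw|nD] := pselect (Dc S c w); first by rewrite chi1// subrr !mul0r ltW.
apply: le_trans (hc w Dw nD); rewrite ler_wpM2r ?expR_ge0// ler_piMl ?normc_ge0//.
by rewrite gerBl.
Qed.

End target_norm.

(** * Test functions and their transports *)

Section test_family.
Context {R : realType} {n m r : nat} (S : siegel_domain R n m r).
Local Notation C := R[i].
Local Notation nc := (@Normc.normc R).
Local Notation point := ('cV[C]_n * 'cV[C]_m)%type.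
Local Notation Om := (Om S).
Local Notation e' := (eOm' S).
Local Notation T := (Tplus S).
Local Notation Phi := (Phi S).
Local Notation LD := (lnDeltaOm S).
Local Notation lnD := (lnDelta S).

Variables (p q : \bar R) (s : 'rV[R]_r).
Hypotheses (p0 : (0 < p)%E) (q0 : (0 < q)%E).

Definition orbit_fn (f0 : point -> C) t g z0 x0 (a : R) (w : point) : C :=
  a%:C%C * f0 (aff S t g z0 x0 w).

(* The norm of [orbit_fn f0 t g z0 x0 1] is at most a constant times this. *)
Definition orbit_scale t : R := expR (fine p^-1 * lnD t (bvec S + dvec S) - lnD t s).

(** The norm bound is stated for every function dominated by a transport of [f0], so that it also
    covers differences of two transports as they occur in distances. *)
Definition test_fn (X : set (point -> C)) (f0 : point -> C) := [/\ Hol S f0,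
  (forall w, domain S w -> f0 w != 0),
  (forall t g z0 x0 a, T t -> g \in unitmx -> intertwines Phi t g -> 0 <= a ->
     X (orbit_fn f0 t g z0 x0 a)) &
  exists2 K : R, 0 < K & forall t g z0 x0 a f, T t -> g \in unitmx -> intertwines Phi t g ->
     0 <= a -> on_domain S f ->
     (forall w, domain S w -> nc (f w) <= a * nc (f0 (aff S t g z0 x0 w))) ->
     (Lpq_norm S p q s f <= (K * a * orbit_scale t)%:E)%E].

(** That is, f0 = o(Delta^{-tau}) as the point leaves every compact subset of the domain. *)
Definition decaying (tau : 'rV[R]_r) (f0 : point -> C) := forall del : R, 0 < del ->
  exists2 c : R, 0 < c & forall w, domain S w -> ~ Dc S c w ->
    nc (f0 w) <= del * expR (- LD (rho S w) tau).

Lemma half_dual : Om' S (2^-1 *: e').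
Proof. by apply: Om'Z; [rewrite invr_gt0|exact: eOm'_in]. Qed.

Lemma pairing_half h : pairing e' h = pairing (2^-1 *: e') h + pairing (2^-1 *: e') h.
Proof. by rewrite -pairingDl -scalerDl (_ : 2^-1 + 2^-1 = 1 :> R) ?scale1r//; field. Qed.

Lemma LD0 h : LD h 0 = 0.
Proof. by rewrite /lnDeltaOm /lnDelta big1// => j _; rewrite mxE mul0r. Qed.

Lemma Hol_orbit f0 t g z0 x0 a : T t -> g \in unitmx -> intertwines Phi t g -> Hol S f0 ->
  Hol S (orbit_fn f0 t g z0 x0 a).
Proof.
move=> Tt ug tg hf; have [of_ df] := Hol_aff z0 x0 Tt tg hf.
split=> [w nD|w Dw]; first by rewrite /orbit_fn of_// mulr0.
by apply: differentiable_mul; [exact: differentiable_cst|exact: df].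
Qed.

Lemma slice_point w : exists v, slice_pt S (v, rho S w) = w.
Proof. by exists (slice_coord S w).1; have := slice_coordK S w. Qed.

(** The transports lie in the closure of C_c when [s] is strictly above the threshold: a slightly
    smaller exponent still gives finite norms, and the difference, spent on decay, makes the part
    outside a compact set small in norm. *)
Lemma test_fn_exists (tau : 'rV[R]_r) : qcond S q s -> (forall j, 0 < tau ord0 j) -> exists2 f0 : point -> C,
  test_fn (Apq S p q s) f0 /\
  ((forall j, fine q^-1%E / 2 * (mvec S j)%:R < s ord0 j) -> test_fn (Apq0 S p q s) f0) &
  decaying tau f0.
Proof.
move=> qs tau0.
(* Ensures K p >= 1 for finite p, so that the K-th power of [Jn] is in L^p; the successor keeps K
   positive in all cases. *)
pose K := (Num.bound (fine p)^-1).+1.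
have pK : 1 <= K%:R * fine p \/ p = +oo%E.
  have [->|pn] := eqVneq p +oo%E; [by right|left].
  have fp : 0 < fine p by rewrite fine_gt0// p0 ltey.
  have xi : 0 <= (fine p)^-1 by rewrite invr_ge0 ltW.
  rewrite -(ler_pdivrMr _ _ fp) div1r; apply: (le_trans (ltW (archi_boundP xi))).
  by rewrite ler_nat leqnSn.
have [f0 [hf f0n] [C0 C00 hC]] := @test_function _ _ _ _ S K.
have J0 (v : 'cV[R]_n * 'cV[R]_n * 'cV[R]_m) : 0 <= Jn v ^+ K by rewrite exprn_ge0// ltW// Jn_gt0.
have mJ (c : R) : measurable_fun setT ((fun v : 'cV[R]_n * 'cV[R]_n * 'cV[R]_m => c * Jn v ^+ K) : _ -> measurableTypeR R).
  by apply: measurable_funM => //; apply: measurable_funX; exact: measurable_Jn.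
have qs0 : qcond S q (s + 0) by rewrite addr0.
have [K1 K10 hK1] := norm_upper p0 q0 half_dual (mJ C0) (fun v => mulr_ge0 (ltW C00) (J0 v))
  (Jn_norm n m p0 (ltW C00) pK) qs0.
have half_le v h : Om h -> nc (slice S f0 h v) <= expR (LD h 0 - pairing (2^-1 *: e') h) * (C0 * Jn v ^+ K).
  move=> Oh; apply: (le_trans (hC v h Oh)); rewrite LD0 sub0r -mulrA mulrCA.
  have Jv := Jn_gt0 v; apply: ler_pM; first exact: expR_ge0.
  - by apply: mulr_ge0; [exact: ltW|exact/exprn_ge0/ltW].
  - by rewrite ler_expR pairing_half lerN2 lerDl; exact: ltW (Om'_gt0 half_dual Oh).
  rewrite ler_wpM2l ?(ltW C00)// mul2n -addnn exprD ler_piMl// exprn_ile1 ?Jn_le1//.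
  exact: ltW.
have norm_le t g z0 x0 a f : T t -> g \in unitmx -> intertwines Phi t g ->
    0 <= a -> on_domain S f ->
    (forall w, domain S w -> nc (f w) <= a * nc (f0 (aff S t g z0 x0 w))) ->
    (Lpq_norm S p q s f <= (K1 * a * orbit_scale t)%:E)%E.
  move=> Tt ug tg a0 of_ hfa; apply: (hK1 t g z0 x0 a f Tt ug tg a0 of_) => h v Oh.
  have Dv : domain S (slice_pt S (v, h)) by apply/domainE; rewrite slice_pt_rho.
  rewrite sliceE; apply: (le_trans (hfa _ Dv)); rewrite -mulrA ler_wpM2l//.
  by rewrite aff_slice_pt// -sliceE; apply: half_le; exact: TOm.
have orbit_nc t g z0 x0 a w : 0 <= a -> nc (orbit_fn f0 t g z0 x0 a w) = a * nc (f0 (aff S t g z0 x0 w)).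
  by move=> a0; rewrite /orbit_fn Normc.normcM normc_real ger0_norm.
have inA t g z0 x0 a : T t -> g \in unitmx -> intertwines Phi t g -> 0 <= a ->
    Apq S p q s (orbit_fn f0 t g z0 x0 a).
  move=> Tt ug tg a0; have ho := Hol_orbit z0 x0 a Tt ug tg hf.
  have co w (Dw : domain S w) := Hol_continuous ho Dw.
  have oo : on_domain S (orbit_fn f0 t g z0 x0 a) by case: ho.
  split=> //; split=> //; first exact: measurable_on_domainP.
    exact: weighted_slices_measurable.
  apply: (@le_lt_trans _ _ (K1 * a * orbit_scale t)%:E); last exact: ltry.
  by apply: (norm_le t g z0 x0) => // w _; rewrite orbit_nc.
exists f0; last first.
  move=> del del0; have [c c0 hc] := decay_out (ltn0Sn _) C00 tau0 hC del0.
  exists c => // w Dw nD; have [v vw] := slice_point w.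
  rewrite -vw in nD *; rewrite slice_pt_rho -sliceE.
  apply: (le_trans (hc v (rho S w) Dw nD)); rewrite ler_pM2l//.
  rewrite expRD -mulrA ler_piMr ?expR_ge0//.
  have := J0 v; have : Jn v ^+ K <= 1 by rewrite exprn_ile1 ?Jn_le1// ltW// Jn_gt0.
  have : expR (- pairing (2^-1 *: e') (rho S w)) <= 1.
    have pos := @Om'_gt0 _ _ _ S _ (rho S w) half_dual Dw.
    by rewrite -[leRHS]expR0 ler_expR oppr_le0; exact: ltW.
  have := expR_ge0 (- pairing (2^-1 *: e') (rho S w)).
  by move: (expR _) (_ ^+ _) => x y x0 x1 y1 y0; rewrite -[1]mulr1 ler_pM.
split; first by split=> //; exists K1.
move=> strict; split=> //; last by exists K1.
move=> t g z0 x0 a Tt ug tg a0; have [L H] := inA t g z0 x0 a Tt ug tg a0.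
split=> //; split=> // eps eps0.
(* Half of the gap between [s] and the threshold, so that s - sig still satisfies [qcond]. *)
pose sig : 'rV[R]_r := \row_j ((s ord0 j - fine q^-1%E / 2 * (mvec S j)%:R) / 2).
have sig0 j : 0 < sig ord0 j by rewrite mxE divr_gt0// subr_gt0.
have qsig : qcond S q (s + - sig).
  split=> [qoo j|qoo j].
    by have := strict j; rewrite !mxE; move: (_ * _) => x; lra.
  have := strict j; have := ler0n R (mvec S j); rewrite !mxE qoo.
  have -> : fine (+oo^-1 : \bar R)%E = 0 by [].
  by rewrite !mul0r subr0; lra.
have mJ1 := mJ 1.
have [K2 K20 hK2] := norm_upper p0 q0 half_dual mJ1 (fun v => mulr_ge0 ler01 (J0 v))
  (Jn_norm n m p0 ler01 pK) qsig.
pose x := K2 * a * orbit_scale t.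
have x_ge0 : 0 <= x by rewrite !mulr_ge0 ?expR_ge0// ltW.
have x1 : 0 < x + 1 by rewrite ltr_wpDl.
pose del := eps / (x + 1); have del0 : 0 < del by rewrite divr_gt0.
have [c c0 hc] := decay_out (ltn0Sn _) C00 sig0 hC del0.
have [c1 c10 hc1] := Dc_aff z0 x0 Tt ug tg c0.
have [c2 c20 [chi [chi01 chi1 chi0 chiL]]] := @Dc_cutoff _ _ _ _ S _ c10.
have Cphi := cutoff_Cc H c20 chi0 chiL.
exists (fun w => (chi w)%:C%C * orbit_fn f0 t g z0 x0 a w) => //.
have oo : on_domain S (orbit_fn f0 t g z0 x0 a) by case: H.
have ad0 : 0 <= a * del by rewrite mulr_ge0// ltW.
apply: (@le_lt_trans _ _ (K2 * (a * del) * orbit_scale t)%:E).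
  apply: (hK2 t g z0 x0 (a * del)) => // [w nD|h v Oh]; first by rewrite oo// mulr0 subrr.
  rewrite sliceE; set w := slice_pt S (v, h).
  have -> : orbit_fn f0 t g z0 x0 a w - (chi w)%:C%C * orbit_fn f0 t g z0 x0 a w =
      (1 - chi w)%:C%C * orbit_fn f0 t g z0 x0 a w by rewrite rmorphB rmorph1 mulrBl mul1r.
  have /andP[y0 y1] := chi01 w.
  rewrite Normc.normcM normc_real ger0_norm ?subr_ge0// orbit_nc//.
  have [Dw|nDw] := pselect (Dc S c1 w).
    rewrite chi1// subrr mul0r; apply: mulr_ge0; last exact: mulr_ge0 ler01 (J0 _).
    by apply: mulr_ge0; [exact: ad0|exact: expR_ge0].
  have nDa : ~ Dc S c (aff S t g z0 x0 w) by move=> /hc1.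
  rewrite /w aff_slice_pt// in nDa *; rewrite -sliceE.
  have := hc (affN S t g z0 x0 v) (t *m h) (TOm Tt Oh) nDa.
  have -> : LD (t *m h) (- sig) = - LD (t *m h) sig by rewrite [LHS]lnDeltaN.
  rewrite mul1r; move: (expR _) (Jn _ ^+ K) (nc _) (normc_ge0 (slice S f0 (t *m h) (affN S t g z0 x0 v))).
  move=> E J N N0 h1.
  apply: (@le_trans _ _ (a * N)).
    by rewrite ler_piMl ?mulr_ge0// gerBl.
  have -> : a * del * E * J = a * (del * (E * J)) by ring.
  exact: ler_wpM2l a0 _ _ h1.
rewrite lte_fin.
have -> : K2 * (a * del) * orbit_scale t = x * del by rewrite /x; ring.
by rewrite /del mulrCA -subr_gt0 -{1}[eps]mulr1 -mulrBr mulr_gt0// subr_gt0 ltr_pdivrMr// mul1r ltrDl.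
Qed.

End test_family.

(** * Continuity and compactness of the Cesaro operator *)

Section cesaro_operator.
Context {R : realType} {n m r : nat} (S : siegel_domain R n m r).
Local Notation C := R[i].
Local Notation nc := (@Normc.normc R).
Local Notation point := ('cV[C]_n * 'cV[C]_m)%type.
Local Notation e := (eOm S).
Local Notation LD := (lnDeltaOm S).
Local Notation lnD := (lnDelta S).

Variables (p1 q1 q2 : \bar R) (s1 s2 s' : 'rV[R]_r) (g : point -> C).
Variables (X1 X2 : set (point -> C)).
Hypotheses (q20 : (0 < q2)%E) (X1_Hol : X1 `<=` Hol S) (X2_Hol : X2 `<=` Hol S).
Local Notation N1 := (Lpq_norm S p1 q1 s1).
Local Notation N2 := (Lpq_norm S q2 q2 (s2 + s')).
Local Notation G := (RL S s' g).
Local Notation tgt := (tgt_space S s' X2 N2).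
Local Notation src := (src_space X1 N1).

Let s3 := s2 - s1 + (fine p1^-1%E - fine q2^-1%E) *: (bvec S + dvec S).
Let tau := s1 - fine p1^-1%E *: (bvec S + dvec S).

(** The inverse of the bound for point evaluation at [w] on the target space. *)
Definition tgt_weight w :=
  expR (LD (rho S w) (s2 + s') - fine q2^-1%E * LD (rho S w) (bvec S + dvec S)).

Lemma tgt_weight_gt0 w : 0 < tgt_weight w. Proof. exact: expR_gt0. Qed.

(** For an automorphism taking [w] to [base], the target weight is the weight of the conclusion
    times the source normalisation. This identity of exponents is what determines [s3]. *)
Lemma weight_scale t w : (forall s, lnD t s = - LD (rho S w) s) ->
  tgt_weight w = expR (LD (rho S w) (s3 + s')) * orbit_scale S p1 s1 t.
Proof.
move=> tw; rewrite /tgt_weight /orbit_scale !tw -expRD; congr expR.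
by rewrite /s3 /lnDeltaOm !(lnDeltaD, lnDeltaN, lnDeltaZ); ring.
Qed.

Lemma Hol_sub F H : Hol S F -> Hol S H -> Hol S (fun w => F w - H w).
Proof.
move=> [oF dF] [oH dH]; split=> [w nD|w Dw]; first by rewrite oF// oH// subr0.
exact: (differentiableB (dF w Dw) (dH w Dw)).
Qed.

Lemma tgt_classP (y : tgt) : exists f, [/\ Hol S f, X2 (RL S s' f) &
  forall h, tgt_val y h <-> Hol S h /\ RL S s' h = RL S s' f].
Proof.
case: y => c cb; case: (cb) => f [hf Xf] cE; exists f; split=> // h.
by rewrite /tgt_val /= cE.
Qed.

(** The margin eta < th leaves room to move, which makes the set open; the bound is uniform over the
    domain, so that it can be read at a point varying with the class. *)
Definition tgt_near (H : point -> C) (th : R) : set tgt := [set y : tgt | exists2 eta : R, eta < th &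
  forall h, tgt_val y h -> forall w, domain S w -> nc (RL S s' h w - H w) * tgt_weight w <= eta].

(* The pointwise bound makes evaluation, weighted uniformly over the domain,
   continuous on the target space. *)
Lemma tgt_near_open H th : open (tgt_near H th).
Proof.
suff : qopen (tgt_near H th) by [].
move=> y [eta et hy]; have [K K0 hK] := @pointwise _ _ _ _ S q2 (s2 + s') q20.
have d0 : 0 < (th - eta) / (2 * K) by rewrite divr_gt0 ?subr_gt0 ?mulr_gt0.
exists ((th - eta) / (2 * K)) => // y' /ereal_inf_lt[N [h1 [h2 [yh1 yh2 NE]]] Nlt].
exists ((eta + th) / 2); first by lra.
move=> h yh w Dw.
have [f [hf Xf fE]] := tgt_classP y; have [f' [hf' Xf' fE']] := tgt_classP y'.
have [hh1 R1] := (fE _).1 yh1; have [hh2 R2] := (fE' _).1 yh2; have [hh Rh] := (fE' _).1 yh.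
have sE : RL S s' (fun w => h1 w - h2 w) = (fun w => RL S s' h1 w - RL S s' h2 w).
  by apply/funext => x; rewrite RL_sub.
have hd : Hol S (RL S s' (fun w => h1 w - h2 w)).
  by rewrite sE; apply: Hol_sub; apply: X2_Hol; rewrite ?R1 ?R2.
have := hK _ w ((th - eta) / (2 * K)) hd Dw; rewrite -NE => /(_ (ltW Nlt)).
rewrite sE => /= H1.
have {}H1 : nc (RL S s' h1 w - RL S s' h2 w) * tgt_weight w <= (th - eta) / 2.
  apply: (le_trans H1); rewrite le_eqVlt; apply/orP; left; apply/eqP.
  by field; rewrite gt_eqF.
have H2 := hy h1 yh1 w Dw.
rewrite Rh -R2.
have := normc_triB (RL S s' h2 w) (H w) (RL S s' h1 w); rewrite (normcB (RL S s' h2 w) (RL S s' h1 w)).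
move/(ler_wpM2r (ltW (tgt_weight_gt0 w))) => /le_trans; apply.
by rewrite mulrDl; lra.
Qed.

Section induced.
Variable T : src -> tgt.
Hypothesis indT : induced_by g T.

Lemma induced_mem (x : src) : X2 (fun w => src_val x w * G w).
Proof.
have [Tx _] := indT; have [f [hf Xf fE]] := tgt_classP (T x).
have : tgt_val (T x) f by apply/fE.
by rewrite Tx => -[_ <-].
Qed.

Lemma induced_RL (x : src) h : tgt_val (T x) h -> RL S s' h = (fun w => src_val x w * G w).
Proof. by have [Tx _] := indT; rewrite Tx => -[]. Qed.

Lemma induced_ex (x : src) : exists h, tgt_val (T x) h.
Proof. by have [f [hf Xf fE]] := tgt_classP (T x); exists f; apply/fE. Qed.

Variable f0 : point -> C.
Hypothesis tf : test_fn S p1 q1 s1 X1 f0.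

(** The product of [G] with a transport of [f0] lies in [X2], hence is holomorphic, and the
    transport has no zeros to divide by. *)
Lemma RL_Hol : Hol S G.
Proof.
have [hf f0n inX _] := tf.
have [t [h [Tt ut th _ _]]] := aff_to_base (@domain_base _ _ _ _ S).
pose f := orbit_fn S f0 t h 0 0 1.
have Xf : X1 f by exact: inX.
have hfG := X2_Hol (induced_mem (exist _ f Xf : {f | X1 f})).
have hf1 := X1_Hol Xf.
have fn w : domain S w -> f w != 0.
  by move=> Dw; rewrite /f /orbit_fn mul1r; apply: f0n; apply/domain_aff.
split=> [w nD|w Dw]; first by rewrite /RL memNset.
have [d d0 hd] := domain_nbhs Dw.
apply: (@eq_differentiable _ _ (fun v => (f v * G v) * (f v)^-1) _ _ d d0).
  by move=> v vw; rewrite mulrAC mulfV ?mul1r//; exact/fn/hd.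
apply: differentiable_mul; first by case: hfG => _; apply.
by apply: differentiable_inv; [case: hf1 => _; apply|exact: fn].
Qed.

(** Continuity at 0 against the open set where the weighted modulus stays below 1: every transport
    of norm less than a fixed eps is sent there, and evaluation at the point taken to [base] bounds
    [G]. *)
Lemma continuous_bound : continuous T -> exists c : R, forall w, domain S w ->
  nc (G w) * expR (LD (rho S w) (s3 + s')) <= c.
Proof.
move=> cT; have [hf f0n inX [K K0 hK]] := tf.
have [t0 [h0 [Tt0 ut0 th0 _ _]]] := aff_to_base (@domain_base _ _ _ _ S).
(* The zero function, presented as a transport with a = 0 so that its membership in [X1] is part of
   [test_fn]. *)
pose x0 : src := (exist _ _ (inX t0 h0 0 0 0 Tt0 ut0 th0 (lexx 0)) : {f | X1 f}).
have x0E w : src_val x0 w = 0 by rewrite /src_val /= /orbit_fn mul0r.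
have W0 : tgt_near (fun=> 0) 1 (T x0).
  exists 0; first exact: ltr01.
  by move=> h /induced_RL -> w Dw; rewrite x0E mul0r subr0 Normc.normc0 mul0r.
have := cT x0 _ (open_nbhs_nbhs (conj (@tgt_near_open (fun=> 0) 1) W0)).
rewrite nbhsE => -[U [oU Ux0] UW].
have [eps eps0 hU] := (oU : qopen U) x0 Ux0.
have f0b : 0 < nc (f0 (base S)) by apply: normc_gt0; exact: f0n (@domain_base _ _ _ _ S).
exists (2 * K / (eps * nc (f0 (base S)))) => w Dw.
have [t [h [Tt ut th tb tD]]] := aff_to_base Dw.
set z0 := - (h *m w.1) in tb; set y0 := - (t *m re_mx w.2) in tb.
have k0 : 0 < orbit_scale S p1 s1 t by exact: expR_gt0.
(* Makes the norm bound K a orbit_scale(t) equal to eps / 2. *)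
pose a := eps / (2 * K * orbit_scale S p1 s1 t).
have a0 : 0 < a by rewrite divr_gt0 ?mulr_gt0.
pose x : src := (exist _ _ (inX t h z0 y0 a Tt ut th (ltW a0)) : {f | X1 f}).
have ho : Hol S (src_val x) by exact: X1_Hol (inX t h z0 y0 a Tt ut th (ltW a0)).
have Ux : U x.
  apply: hU; rewrite /src_dist.
  apply: (@le_lt_trans _ _ (K * a * orbit_scale S p1 s1 t)%:E).
    apply: (hK t h z0 y0 a) => //; first exact: ltW.
      by move=> v nD; rewrite /= /orbit_fn mul0r sub0r; have [oh _] := ho; have := oh v nD; rewrite /src_val /= /orbit_fn => ->; rewrite oppr0.
    move=> v Dv; rewrite /= /orbit_fn mul0r normcB subr0 Normc.normcM normc_real ger0_norm//.
    exact: ltW.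
  rewrite lte_fin.
  have -> : K * a * orbit_scale S p1 s1 t = eps / 2 by rewrite /a; field; rewrite !gt_eqF.
  by rewrite ltr_pdivrMr// ltr_pMr// ltr1n.
have [eta eta1 heta] := UW _ Ux.
have [hh Thh] := induced_ex x.
have := heta hh Thh w Dw; rewrite (induced_RL Thh) subr0.
have -> : src_val x w = a%:C%C * f0 (base S) by rewrite -tb.
rewrite (weight_scale tD) !Normc.normcM normc_real (ger0_norm (ltW a0)) => H.
rewrite ler_pdivlMr ?mulr_gt0//.
move: H; set N := nc (G w); set E := expR _; set b := nc (f0 _); set k := orbit_scale _ _ _ _ => H.
have : a * b * N * (E * k) <= 1 by apply: (le_trans H); exact: ltW.
have -> : a * b * N * (E * k) = (N * E * (eps * b)) / (2 * K).
  by rewrite /a -/k; field; rewrite !gt_eqF.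
by rewrite ler_pdivrMr ?mulr_gt0// mul1r.
Qed.

Hypothesis dec : decaying S tau f0.

(** If the conclusion fails, points w_k leaving every compact set give normalised transports bounded
    in norm. A cluster point of their images has derivative 0 by pointwise convergence, yet images
    close to it, evaluated at w_k itself, contradict the lower bound eps. *)
Lemma compact_vanishing : compact_operator T -> forall eps : R, 0 < eps ->
  exists2 c : R, 0 < c & forall w, domain S w -> ~ Dc S c w ->
    nc (G w) * expR (LD (rho S w) (s3 + s')) <= eps.
Proof.
move=> kT eps eps0; have [hf f0n inX [K K0 hK]] := tf.
apply: contrapT => H.
pose good k (z : point * ('M[R]_m * 'M[C]_n)) := [/\ domain S z.1, ~ Dc S k.+1%:R z.1,
  eps < nc (G z.1) * expR (LD (rho S z.1) (s3 + s')) &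
  [/\ Tplus S z.2.1, z.2.2 \in unitmx, intertwines (Phi S) z.2.1 z.2.2,
    aff S z.2.1 z.2.2 (- (z.2.2 *m z.1.1)) (- (z.2.1 *m re_mx z.1.2)) z.1 = base S &
    forall s, lnD z.2.1 s = - LD (rho S z.1) s]].
have /choice[Z hZ] : forall k, exists z, good k z.
  move=> k; apply: contrapT => nk; apply: H.
  exists k.+1%:R => // w Dw nD; rewrite leNgt; apply/negP => lt; apply: nk.
  have [t [h [Tt ut th tb tD]]] := aff_to_base Dw.
  by exists (w, (t, h)).
pose w_ k := (Z k).1; pose t_ k := (Z k).2.1; pose h_ k := (Z k).2.2.
pose z_ k := - (h_ k *m (w_ k).1); pose y_ k := - (t_ k *m re_mx (w_ k).2).
pose a_ k := (orbit_scale S p1 s1 (t_ k))^-1.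
have a0 k : 0 < a_ k by rewrite invr_gt0 expR_gt0.
have mem k : X1 (orbit_fn S f0 (t_ k) (h_ k) (z_ k) (y_ k) (a_ k)).
  by have [_ _ _ [Tt ut th _ _]] := hZ k; exact: inX _ _ _ _ _ Tt ut th (ltW (a0 k)).
pose x k : src := (exist _ _ (mem k) : {f | X1 f}).
pose B : set src := [set x k | k in [set: nat]].
have bB : bounded_in B.
  exists K => _ [k _ <-]; have [_ _ _ [Tt ut th _ _]] := hZ k.
  have ho := X1_Hol (mem k).
  apply: le_trans (hK (t_ k) (h_ k) (z_ k) (y_ k) (a_ k) _ Tt ut th (ltW (a0 k)) _ _) _.
  - by case: ho.
  - by move=> v Dv; rewrite /src_val /= /orbit_fn Normc.normcM normc_real ger0_norm// ltW.
  - by rewrite lee_fin /a_ -mulrA mulVf ?mulr1// gt_eqF// expR_gt0.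
have [A BA [cA clA]] := kT B bB.
pose u k := T (x k).
have Au : (u @ \oo) A by exists 0%N => // k _; apply: BA; exists (x k) => //; exists k.
have [y [_ yc]] := cA (u @ \oo) _ Au.
have freq (Q : set tgt) (N : nat) : open Q -> Q y -> exists2 k, (N <= k)%N & Q (u k).
  move=> oQ Qy.
  have PN : (u @ \oo) [set v | exists2 k, (N <= k)%N & v = u k].
    by exists N => // k /= Nk; exists k.
  have [v [[k Nk ->] Qk]] := yc _ _ PN (open_nbhs_nbhs (conj oQ Qy)).
  by exists k.
have [f [hfy Xfy fE]] := tgt_classP y.
have near_y th : 0 < th -> tgt_near (RL S s' f) th y.
  move=> th0; exists 0 => // h /fE[_ ->] w _.
  by rewrite subrr Normc.normc0 mul0r.
(* For fixed w the images of w leave every compact set, by [Dc_normalize], so the transports tend to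
   0 at w. An image within kap / 2 of the cluster point and a product below kap / 4 are incompatible
   with the value kap. *)
have H0 w : domain S w -> RL S s' f w = 0.
  move=> Dw; apply/eqP; apply: contrapT => /negP fn0.
  have wt := tgt_weight_gt0 w.
  pose kap := nc (RL S s' f w) * tgt_weight w.
  have kap0 : 0 < kap by rewrite mulr_gt0// normc_gt0.
  pose V := expR (- LD (rho S w) tau) * nc (G w) * tgt_weight w.
  have V0 : 0 <= V by rewrite !mulr_ge0 ?normc_ge0 ?expR_ge0.
  have V1 : 0 < V + 1 by rewrite ltr_wpDl.
  pose del := kap / 4 / (V + 1); have del0 : 0 < del by rewrite !divr_gt0.
  have [c c0 hc] := dec del0; have [c' c'0 hc'] := Dc_normalize c0 Dw.
  have kap2 : 0 < kap / 2 by rewrite divr_gt0.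
  have [k Nk [eta eta1 heta]] := freq _ (Num.bound c') (@tgt_near_open (RL S s' f) (kap / 2)) (near_y _ kap2).
  have [hh Thh] := induced_ex (x k).
  have := heta hh Thh w Dw; rewrite (induced_RL Thh) => h1.
  have [Dk nDk _ [Tt ut th tb tD]] := hZ k.
  have nDa : ~ Dc S c (aff S (t_ k) (h_ k) (z_ k) (y_ k) w).
    move=> Da; apply: nDk; apply: (@Dc_mono _ _ _ _ S c' _ c'0).
      apply: (le_trans (ltW (archi_boundP (ltW c'0)))); rewrite ler_nat.
      exact: leq_trans Nk (leqnSn _).
    apply: (hc' _ (t_ k) (h_ k) Tt ut th _ Da).
    have -> : t_ k *m rho S (w_ k) = rho S (aff S (t_ k) (h_ k) (z_ k) (y_ k) (w_ k)) by rewrite rho_aff.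
    have -> : aff S (t_ k) (h_ k) (z_ k) (y_ k) (w_ k) = base S := tb.
    exact: rho_base.
  have fk : nc (src_val (x k) w) <= del * expR (- LD (rho S w) tau).
    rewrite /src_val /= /orbit_fn Normc.normcM normc_real ger0_norm ?(ltW (a0 k))//.
    have Da : domain S (aff S (t_ k) (h_ k) (z_ k) (y_ k) w) by apply/domain_aff.
    apply: (le_trans (ler_wpM2l (ltW (a0 k)) (hc _ Da nDa))).
    (* The choice of [tau] makes the power of Delta(t) cancel against the normalisation, leaving a
       quantity independent of k. *)
    rewrite rho_aff// [X in expR (- X)]lnDeltaOmM// opprD expRD /a_ /orbit_scale -expRN.
    set ex := expR (- LD _ _); rewrite mulrCA ler_wpM2l ?(ltW del0)// mulrA -expRD.
    rewrite [X in expR X](_ : _ = 0) ?expR0 ?mul1r//.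
    by rewrite /tau !(lnDeltaD, lnDeltaN, lnDeltaZ); ring.
  have h2 : nc (src_val (x k) w * G w) * tgt_weight w <= kap / 4.
    rewrite Normc.normcM; apply: (@le_trans _ _ (del * V)).
      rewrite /V !mulrA ler_wpM2r ?(ltW wt)// ler_wpM2r ?normc_ge0//.
    by rewrite /del mulrAC ler_pdivrMr// ler_wpM2l ?lerDl// divr_ge0// ltW.
  have := normc_triB (RL S s' f w) 0 (src_val (x k) w * G w).
  rewrite !subr0 (normcB (RL S s' f w)) => /(ler_wpM2r (ltW wt)).
  rewrite mulrDl -/kap; lra.
have f0b : 0 < nc (f0 (base S)) by apply: normc_gt0; exact: f0n (@domain_base _ _ _ _ S).
(* At w_k the transport equals f0(base) divided by the normalisation, so an image within this
   distance of 0 forces the weighted modulus of [G] at w_k below eps. *)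
have th0 : 0 < eps * nc (f0 (base S)) by rewrite mulr_gt0.
have [k _ [eta eta1 heta]] := freq _ 0%N (@tgt_near_open (RL S s' f) _) (near_y _ th0).
have [hh Thh] := induced_ex (x k).
have [Dk _ ltk [Tt ut th tb tD]] := hZ k.
have := heta hh Thh (w_ k) Dk; rewrite (induced_RL Thh) (H0 _ Dk) subr0.
have -> : src_val (x k) (w_ k) = (a_ k)%:C%C * f0 (base S) by rewrite -tb.
rewrite (weight_scale tD) !Normc.normcM normc_real (ger0_norm (ltW (a0 k))) /a_.
have := expR_gt0 (fine p1^-1 * lnD (t_ k) (bvec S + dvec S) - lnD (t_ k) s1).
rewrite -/(orbit_scale S p1 s1 (t_ k)) -/(t_ k) -/(w_ k) in ltk *.
move: (orbit_scale _ _ _ _) (nc (f0 _)) f0b th0 eta1 => k' b b0 _ eta1 k'0.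
move: ltk; move: (nc _) (expR _) => N E ltk.
have -> : k'^-1 * b * N * (E * k') = N * E * b by field; rewrite gt_eqF.
move=> H1; have : N * E * b < eps * b by exact: le_lt_trans H1 eta1.
by rewrite ltr_pM2r// ltNge (ltW ltk).
Qed.

End induced.
End cesaro_operator.

Theorem proposition5p3 (R : realType) (n m r : nat) (S : siegel_domain R n m r)
    (p1 q1 q2 : \bar R) (s1 s2 s' : 'rV[R]_r)
    (g : 'cV[R[i]]_n * 'cV[R[i]]_m -> R[i]) :
  (0 < p1)%E -> (0 < q1)%E -> (0 < q2)%E ->
  NOm' S s' -> Hol S g ->
  let s3 := s2 - s1 + (fine p1^-1%E - fine q2^-1%E) *: (bvec S + dvec S) in
  ((forall j, fine q1^-1%E / 2 * (mvec S j)%:R < s1 ord0 j) ->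
    (induces_continuous S (Apq0 S p1 q1 s1) (Lpq_norm S p1 q1 s1)
       s' (Apq0 S q2 q2 (s2 + s')) (Lpq_norm S q2 q2 (s2 + s')) g ->
     breve S s' (Apq S +oo%E +oo%E (s3 + s')) g) /\
    ((p1 = +oo%E -> q1 = +oo%E -> forall j, 0 < s1 ord0 j) ->
     induces_compact S (Apq0 S p1 q1 s1) (Lpq_norm S p1 q1 s1)
       s' (Apq0 S q2 q2 (s2 + s')) (Lpq_norm S q2 q2 (s2 + s')) g ->
     breve S s' (Apq0 S +oo%E +oo%E (s3 + s')) g)) /\
  (((q1 < +oo)%E -> forall j, fine q1^-1%E / 2 * (mvec S j)%:R < s1 ord0 j) ->
   (q1 = +oo%E -> forall j, 0 <= s1 ord0 j) ->
    (induces_continuous S (Apq S p1 q1 s1) (Lpq_norm S p1 q1 s1)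
       s' (Apq S q2 q2 (s2 + s')) (Lpq_norm S q2 q2 (s2 + s')) g ->
     breve S s' (Apq S +oo%E +oo%E (s3 + s')) g) /\
    ((p1 = +oo%E -> q1 = +oo%E -> forall j, 0 < s1 ord0 j) ->
     induces_compact S (Apq S p1 q1 s1) (Lpq_norm S p1 q1 s1)
       s' (Apq S q2 q2 (s2 + s')) (Lpq_norm S q2 q2 (s2 + s')) g ->
     breve S s' (Apq0 S +oo%E +oo%E (s3 + s')) g)).
Proof.
move=> p10 q10 q20 _ hg s3.
have fine_ge0_inv (q : \bar R) : (0 < q)%E -> 0 <= fine q^-1%E.
  by case: q => [x| |] //; rewrite lte_fin => x0; rewrite fine_invr invr_ge0 ltW.
have fine_gt0_inv (q : \bar R) : (0 < q)%E -> q != +oo%E -> 0 < fine q^-1%E.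
  by case: q => [x| |] //; rewrite lte_fin => x0 _; rewrite fine_invr invr_gt0.
pose tau := s1 - fine p1^-1%E *: (bvec S + dvec S).
(* For finite p1 the term -(b + d) / p1 is positive and s1 is nonnegative. For p1 = oo positivity
   comes from s1 alone: from the Laplace threshold when q1 is finite, from the extra assumption when
   q1 = oo. *)
have tau_gt0 : qcond S q1 s1 -> (p1 = +oo%E -> q1 = +oo%E -> forall j, 0 < s1 ord0 j) ->
    forall j, 0 < tau ord0 j.
  move=> [q1f q1i] pq j; have b0 := bvec_le0 S j; have d0 := dvec_lt0 S j; rewrite !mxE.
  have s10 : 0 <= s1 ord0 j.
    have [qoo|qn] := eqVneq q1 +oo%E; first exact: q1i.
    apply: ltW; apply: le_lt_trans (q1f _ j); last by rewrite ltey.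
    by rewrite mulr_ge0// divr_ge0// fine_ge0_inv.
  have [poo|pn] := eqVneq p1 +oo%E.
    rewrite poo; have -> : fine (+oo^-1 : \bar R)%E = 0 by [].
    rewrite mul0r subr0; have [qoo|qn] := eqVneq q1 +oo%E; first exact: pq.
    apply: le_lt_trans (q1f _ j); last by rewrite ltey.
    by rewrite mulr_ge0// divr_ge0// fine_ge0_inv.
  have := fine_gt0_inv p1 p10 pn; move: (fine _) => x x0; have : 0 < x * - (bvec S ord0 j + dvec S ord0 j).
    by rewrite mulr_gt0//; lra.
  by rewrite mulrN; lra.
(* Takes the place of [tau] in the boundedness assertions, which rest on the norms of the test
   functions. *)
have one_gt0 : forall j, 0 < (const_mx 1 : 'rV[R]_r) ord0 j by move=> j; rewrite mxE ltr01.
have Apq_Hol p q s : Apq S p q s `<=` Hol S by move=> f [].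
have Apq0_Hol p q s : Apq0 S p q s `<=` Hol S by move=> f [].
have qstrict : (forall j, fine q1^-1%E / 2 * (mvec S j)%:R < s1 ord0 j) -> qcond S q1 s1.
  move=> h; split=> [//|_ j]; apply: ltW; apply: le_lt_trans (h j).
  by rewrite mulr_ge0// divr_ge0// fine_ge0_inv.
split=> [strict|q1f q1i].
  have qc := qstrict strict; split.
    move=> [T iT cT]; have [f0 [_ tf] _] := test_fn_exists p10 q10 qc one_gt0.
    have hG := RL_Hol (@Apq0_Hol _ _ _) (@Apq0_Hol _ _ _) iT (tf strict).
    have [c hc] := continuous_bound q20 (@Apq0_Hol _ _ _) (@Apq0_Hol _ _ _) iT (tf strict) cT.
    by split=> //; exact: Apq_infty hG hc.
  move=> pq [T iT kT]; have [f0 [_ tf] dec] := test_fn_exists p10 q10 qc (tau_gt0 qc pq).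
  have hG := RL_Hol (@Apq0_Hol _ _ _) (@Apq0_Hol _ _ _) iT (tf strict).
  have hc := compact_vanishing q20 (@Apq0_Hol _ _ _) (@Apq0_Hol _ _ _) iT (tf strict) dec kT.
  by split=> //; exact: Apq0_infty hG hc.
have qc : qcond S q1 s1 by [].
split.
  move=> [T iT cT]; have [f0 [tf _] _] := test_fn_exists p10 q10 qc one_gt0.
  have hG := RL_Hol (@Apq_Hol _ _ _) (@Apq_Hol _ _ _) iT tf.
  have [c hc] := continuous_bound q20 (@Apq_Hol _ _ _) (@Apq_Hol _ _ _) iT tf cT.
  by split=> //; exact: Apq_infty hG hc.
move=> pq [T iT kT]; have [f0 [tf _] dec] := test_fn_exists p10 q10 qc (tau_gt0 qc pq).
have hG := RL_Hol (@Apq_Hol _ _ _) (@Apq_Hol _ _ _) iT tf.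
have hc := compact_vanishing q20 (@Apq_Hol _ _ _) (@Apq_Hol _ _ _) iT tf dec kT.
by split=> //; exact: Apq0_infty hG hc.
Qed.
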